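(* Let $(\mathcal{E},\theta_1)\in\mathcal{M}_{\operatorname{Dol}}$ with $\det\theta_1=\frac{(dz)^{\otimes3}}{z^2(z-1)^2}$, and let $X_{R,\varphi},Y_{R,\varphi},Z_{R,\varphi}$ be the trace coordinates of the flat connection associated with $(\mathcal{E},R^{1/3}e^{i\varphi/3}\theta_1)$. Fix $\varphi\in[0,2\pi]$ that is not an integer multiple of $\pi/2$, so that $$x=e^{i\varphi/3}(\pi_0-\pi_1)=a+b\sqrt{-1}$$ belongs to one of the open sectors $S_j=\{x\in\mathbb{C}:\ \frac{\pi(j-1)}6<\arg x<\frac{\pi j}6\}$, $j=1,\dots,12$. Then, as $R\to\infty$: 1. $|X_{R,\varphi}|\approx\exp(R^{1/3}\operatorname{Re}(x))=\exp(R^{1/3}a)$ if $x\in S_{11},S_{12},S_1,S_2$; $|X_{R,\varphi}|\approx\exp(R^{1/3}\operatorname{Re}(\varepsilon^2x))=\exp(R^{1/3}(-\frac12a+\frac{\sqrt3}2b))$ if $x\in S_3,S_4,S_5,S_6$; $|X_{R,\varphi}|\approx\exp(R^{1/3}\operatorname{Re}(\varepsilon x))=\exp(R^{1/3}(-\frac12a-\frac{\sqrt3}2b))$ if $x\in S_7,S_8,S_9,S_{10}$. 2. $|Y_{R,\varphi}|\approx\exp(R^{1/3}\operatorname{Re}(-\varepsilon x))=\exp(R^{1/3}(\frac12a+\frac{\sqrt3}2b))$ if $x\in S_1,S_2,S_3,S_4$; $|Y_{R,\varphi}|\approx\exp(R^{1/3}\operatorname{Re}(-x))=\exp(-R^{1/3}a)$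 if $x\in S_5,S_6,S_7,S_8$; $|Y_{R,\varphi}|\approx\exp(R^{1/3}\operatorname{Re}(-\varepsilon^2x))=\exp(R^{1/3}(\frac12a-\frac{\sqrt3}2b))$ if $x\in S_9,S_{10},S_{11},S_{12}$. 3. $|Z_{R,\varphi}|\approx\exp(R^{1/3}\operatorname{Re}((1-\varepsilon)x))=\exp(R^{1/3}(\frac32a+\frac{\sqrt3}2b))$ if $x\in S_{12},S_1,S_2,S_3$; $|Z_{R,\varphi}|\approx\exp(R^{1/3}\operatorname{Re}((1-\varepsilon)\varepsilon^2x))=\exp(R^{1/3}(-\frac32a+\frac{\sqrt3}2b))$ if $x\in S_4,S_5,S_6,S_7$; $|Z_{R,\varphi}|\approx\exp(R^{1/3}\operatorname{Re}((1-\varepsilon)\varepsilon x))=\exp(-R^{1/3}\sqrt3\,b)$ if $x\in S_8,S_9,S_{10},S_{11}$.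
   Context: $\varepsilon=e^{2\pi i/3}$, $D=0+1+\infty$ on $\mathbb{C}P^1$. For scalar functions of $R$, $F\approx G$ means $F/G=1+O(e^{-\epsilon R^{1/3}})$ for some $\epsilon>0$. $\mathcal{M}_{\operatorname{Dol}}$: stable rank $3$, degree $0$ strongly parabolic logarithmic $\operatorname{SL}(3,\mathbb{C})$-Higgs bundles $(\mathcal{E},\theta)$ on $(\mathbb{C}P^1,D)$: $\mathcal{E}$ has trivial determinant and full flags $\mathcal{E}|_P=l_P^0\supset l_P^1\supset l_P^2\supset0$ at each $P\in D$, $\theta\colon\mathcal{E}\to\mathcal{E}\otimes K(D)$ is traceless with $\operatorname{res}_P\theta(l_P^i)\subset l_P^{i+1}$, and the parabolic weights of $l_P^{0}/l_P^1,l_P^1/l_P^2,l_P^2$ are $-\frac13,0,\frac13$ (stability with respect to parabolic slope). For $\tau\in\mathbb{C}^\times$ let $h_\tau$ be the Hermitian metric on $\mathbb{C}P^1\setminus D$, adapted to the parabolic structure, with fixed determinant, solving $F_{h_\tau}+|\tau|^2[\theta_1,\theta_1^{\dagger_{h_\tau}}]=0$, and $\nabla_\tau=\nabla_{h_\tau}^++\tau\theta_1+(\tau\theta_1)^{\dagger_{h_\tau}}$ the associated flat connection, with $\nabla^+_{h_\tau}$ the Chern connection. Here $\tau=R^{1/3}e^{i\varphi/3}$. Trace coordinates. Base point $z_0=\frac12$. For $P\in\{0,1\}$ and small $r>0$, $\eta_0,\eta_1$ are the straight segments from $z_0$ to $r$ and to $1-r$, and $\gamma_P$ is the positively oriented circle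 of radius $r$ around $P$ based at the endpoint of $\eta_P$. $A_{R,\varphi}$ and $B_{R,\varphi}$ are the monodromies of $\nabla_\tau$ along $\eta_0*\gamma_0*\eta_0^{-1}$ and $\eta_1*\gamma_1*\eta_1^{-1}$; the sign convention is that transport along a path is obtained by exponentiating the integral of the connection form along the path (i.e. $A_{R,\varphi},B_{R,\varphi}$ are the inverses of the parallel transports of flat sections along these loops). Then $X_{R,\varphi}=\operatorname{tr}(A_{R,\varphi}B_{R,\varphi}^{-1})$, $Y_{R,\varphi}=\operatorname{tr}(A_{R,\varphi}^{-1}B_{R,\varphi})$, $Z_{R,\varphi}=\operatorname{tr}(A_{R,\varphi}B_{R,\varphi}A_{R,\varphi}^{-1}B_{R,\varphi}^{-1})$. Periods. $\pi_0=2(\varepsilon-1)\int_0^{z_0}\frac{dz}{z^{2/3}(z-1)^{2/3}}$ and $\pi_1=2(\varepsilon-1)\int_1^{z_0}\frac{dz}{z^{2/3}(z-1)^{2/3}}$ along the real segments, with the branch for which the integrand is positive on $(0,1)$; thus $\arg(\pi_0-\pi_1)=\frac{5\pi}6$ and $\arg x=\frac\varphi3+\frac{5\pi}6$. *)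

(* Defs.v *)
(* MathComp / MathComp-Analysis; the complex numbers are R[i] for R : realType *)
From HB Require Import structures.
From mathcomp Require Import all_boot all_order all_algebra.
From mathcomp Require Import complex.
From mathcomp Require Import all_classical all_reals all_analysis.

Set Implicit Arguments.
Unset Strict Implicit.
Unset Printing Implicit Defensive.

Import Order.TTheory GRing.Theory Num.Theory.
Import numFieldNormedType.Exports.

Local Open Scope classical_set_scope.
Local Open Scope ring_scope.
Local Open Scope complex_scope.
Local Open Scope sesquilinear_scope.

Section ComplexCalculus.
Variable R : realType.
Local Notation C := R[i].

(* the norm of R[i] in MathComp is R[i]-valued; cmod is the R-valued modulus *)
Definition cmod (z : C) : R := complex.Re `|z|.

Definition cis (t : R) : C := cos t +i* sin t.

Definition holo_at (f : C -> C) (z : C) : Prop :=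
  \forall w \near (z : C^o), derivable (f : C^o -> C^o) w 1.

Definition entire (f : C -> C) : Prop := forall z, holo_at f z.

Definition holo_Cstar (f : C -> C) : Prop := forall z, z != 0 -> holo_at f z.

Definition mx_entire m n (V : C -> 'M[C]_(m, n)) : Prop :=
  forall i j, entire (fun z => V z i j).

Definition mx_holo_Cstar m n (V : C -> 'M[C]_(m, n)) : Prop :=
  forall i j, holo_Cstar (fun z => V z i j).

Definition curve_derivable (f : R -> C) (t : R) : Prop :=
  derivable (fun s => complex.Re (f s)) t 1 /\
  derivable (fun s => complex.Im (f s)) t 1.

Definition curve_derive (f : R -> C) (t : R) : C :=
  derive1 (fun s => complex.Re (f s)) t +i* derive1 (fun s => complex.Im (f s)) t.

(* real partial derivatives with respect to z = x + iy *)
Definition along_x (f : C -> C) (z : C) (s : R) : C := f (z + (s +i* 0)).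
Definition along_y (f : C -> C) (z : C) (s : R) : C := f (z + (0 +i* s)).
Definition dx (f : C -> C) (z : C) : C := curve_derive (along_x f z) 0.
Definition dy (f : C -> C) (z : C) : C := curve_derive (along_y f z) 0.

Fixpoint Cn_on (n : nat) (U : set C) (f : C -> C) : Prop :=
  match n with
  | 0 => forall z, U z -> {for z, continuous (f : C^o -> C^o)}
  | m.+1 =>
      [/\ forall z, U z -> curve_derivable (along_x f z) 0 /\
                           curve_derivable (along_y f z) 0,
          Cn_on m U (dx f) & Cn_on m U (dy f)]
  end.

Definition smooth_on (U : set C) (f : C -> C) : Prop := forall n, Cn_on n U f.

(* Wirtinger derivatives *)
Definition d_z (f : C -> C) (z : C) : C := (dx f z - (0 +i* 1) * dy f z) / 2.
Definition d_zbar (f : C -> C) (z : C) : C := (dx f z + (0 +i* 1) * dy f z) / 2.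

Definition mx_d_z m n (M : C -> 'M[C]_(m, n)) (z : C) : 'M[C]_(m, n) :=
  \matrix_(i, j) d_z (fun w => M w i j) z.
Definition mx_d_zbar m n (M : C -> 'M[C]_(m, n)) (z : C) : 'M[C]_(m, n) :=
  \matrix_(i, j) d_zbar (fun w => M w i j) z.

Definition colspan m n (V : 'M[C]_(m, n)) : {vspace 'cV[C]_m} :=
  limg (linfun (mulmx V : 'cV[C]_n -> 'cV[C]_m)).

Definition mx_stable n (A : 'M[C]_n) (U W : {vspace 'cV[C]_n}) : Prop :=
  (linfun (mulmx A : 'cV[C]_n -> 'cV[C]_n) @: U <= W)%VS.

End ComplexCalculus.

Inductive marked := Pzero | Pone | Pinfty.

(* Holomorphic bundles on CP^1 are given by their transition function between
   frames over the charts C (coordinate z) and CP^1 \ {0} (coordinate w = 1/z):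
   coordinate vectors s_0, s_oo of a section satisfy s_oo = g(z) s_0.  Every
   holomorphic bundle on C is trivial, so this loses no generality.
   A Higgs field with at most simple poles on D is recorded through the
   entire matrices hol0 = z(z-1) Theta_0 and holoo = w(w-1) Theta_oo, where
   theta = Theta_0 dz = Theta_oo dw in the two frames. *)
Record higgs (R : realType) := Higgs {
  trans : R[i] -> 'M[R[i]]_3;
  hol0 : R[i] -> 'M[R[i]]_3;
  holoo : R[i] -> 'M[R[i]]_3;
  flag : marked -> nat -> {vspace 'cV[R[i]]_3}
}.

Section Higgs.
Variable R : realType.
Local Notation C := R[i].
Variable E : higgs R.

Definition Theta0 (z : C) : 'M[C]_3 := (z * (z - 1))^-1 *: hol0 E z.
Definition Thetaoo (w : C) : 'M[C]_3 := (w * (w - 1))^-1 *: holoo E w.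

Definition res (P : marked) : 'M[C]_3 :=
  match P with
  | Pzero => - hol0 E 0
  | Pone => hol0 E 1
  | Pinfty => - holoo E 0
  end.

Definition full_flag (l : nat -> {vspace 'cV[C]_3}) : Prop :=
  (forall i, (i <= 3)%N -> \dim (l i) = (3 - i)%N) /\
  (forall i, (i < 3)%N -> (l i.+1 <= l i)%VS).

(* weights of l^0/l^1, l^1/l^2, l^2 : -1/3, 0, 1/3 *)
Definition weight (i : nat) : R := (i%:R - 1) / 3.

Definition strongly_parabolic : Prop :=
  [/\ mx_holo_Cstar (trans E)
        /\ (forall z, z != 0 -> \det (trans E z) = 1),
      mx_entire (hol0 E) /\ mx_entire (holoo E),
      (* - z^-2 dz = dw *)
      forall z, z != 0 -> z != 1 ->
        trans E z *m Theta0 z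
        = (- z ^- 2) *: (Thetaoo z^-1 *m trans E z),
      forall z, \tr (hol0 E z) = 0
    & forall P, full_flag (flag E P) /\
        forall i, (i < 3)%N -> mx_stable (res P) (flag E P i) (flag E P i.+1)].

(* The subbundle of rank r framed by the columns of V0, resp. Voo, over the two
   charts.  Its transition function is k, and det k defines a line bundle
   isomorphic to O(d), whose transition function is z^-d. *)
Definition is_subbundle (r : nat) (V0 Voo : C -> 'M[C]_(3, r)) (d : int)
    : Prop :=
  [/\ mx_entire V0 /\ mx_entire Voo,
      forall z, \rank (V0 z) = r /\ \rank (Voo z) = r
    & exists k : C -> 'M[C]_r,
      [/\ mx_holo_Cstar k,
          forall z, z != 0 -> trans E z *m V0 z = Voo z^-1 *m k z
        & exists u0 uoo : C -> C,
          [/\ entire u0 /\ entire uoo,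
              forall z, u0 z != 0 /\ uoo z != 0
            & forall z, z != 0 -> \det (k z) = uoo z^-1 * z ^ (- d) * u0 z]]].

Definition higgs_invariant (r : nat) (V0 Voo : C -> 'M[C]_(3, r)) : Prop :=
  forall z, mx_stable (hol0 E z) (colspan (V0 z)) (colspan (V0 z)) /\
            mx_stable (holoo E z) (colspan (Voo z)) (colspan (Voo z)).

Definition fiber (r : nat) (V0 Voo : C -> 'M[C]_(3, r)) (P : marked)
    : {vspace 'cV[C]_3} :=
  match P with
  | Pzero => colspan (V0 0)
  | Pone => colspan (V0 1)
  | Pinfty => colspan (Voo 0)
  end.

(* parabolic degree of a subbundle of degree d with fibers F P over D *)
Definition pardeg (d : int) (F : marked -> {vspace 'cV[C]_3}) : R :=
  d%:~R + \sum_(P <- [:: Pzero; Pone; Pinfty]) \sum_(i < 3)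
    weight i * ((\dim (F P :&: flag E P i))%:R
                - (\dim (F P :&: flag E P i.+1))%:R).

(* deg E = 0 since det E is trivial *)
Definition parabolic_stable : Prop :=
  forall (r : nat) (V0 Voo : C -> 'M[C]_(3, r)) (d : int),
    (0 < r < 3)%N -> is_subbundle V0 Voo d -> higgs_invariant V0 Voo ->
    pardeg d (fiber V0 Voo) / r%:R < pardeg 0 (fun=> fullv) / 3.

(* CP^1 \ D, inside the chart with coordinate z *)
Definition punctured : set C := [set z | z != 0 /\ z != 1].

(* A Hermitian metric is given in the frame over C by h(u, v) = v^* H u. *)
Definition hnorm (H : C -> 'M[C]_3) (z : C) (v : 'cV[C]_3) : R :=
  Num.sqrt (complex.Re ((v ^t* *m H z *m v) 0 0)).

(* The local coordinate at P in D is zeta = z, z - 1, 1/z respectively. *)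
Definition loc_pt (P : marked) (zeta : C) : C :=
  match P with
  | Pzero => zeta
  | Pone => 1 + zeta
  | Pinfty => zeta^-1
  end.

(* v in the frame of the chart used at P, rewritten in the frame over C *)
Definition loc_vec (P : marked) (zeta : C) (v : 'cV[C]_3) : 'cV[C]_3 :=
  match P with
  | Pinfty => invmx (trans E zeta^-1) *m v
  | _ => v
  end.

(* |s|_h = O(|zeta|^(alpha - delta)) for all delta > 0 *)
Definition growth (H : C -> 'M[C]_3) (P : marked) (s : C -> 'cV[C]_3)
    (alpha : R) : Prop :=
  forall delta : R, 0 < delta -> exists K eta : R, 0 < eta /\
    forall zeta : C, 0 < cmod zeta < eta ->
      hnorm H (loc_pt P zeta) (loc_vec P zeta (s zeta))
      <= K * cmod zeta `^ (alpha - delta).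

(* The growth filtration of h on germs of holomorphic sections at each P is the
   flag with its weights; i = 3 says that sections vanishing at P have weight
   2/3 = -1/3 + 1. *)
Definition adapted (H : C -> 'M[C]_3) : Prop :=
  forall (P : marked) (i : nat) (s : C -> 'cV[C]_3),
    (i <= 3)%N -> (forall j, holo_at (fun z => s z j 0) 0) ->
    (s 0 \in flag E P i <-> growth H P s (weight i)).

(* theta^dagger = Theta_dag d(zbar), and the Chern connection is
   d + chern_form dz, with curvature - d_zbar chern_form dz /\ d(zbar) *)
Definition Theta_dag (H : C -> 'M[C]_3) (z : C) : 'M[C]_3 :=
  invmx (H z) *m (Theta0 z) ^t* *m H z.

Definition chern_form (H : C -> 'M[C]_3) (z : C) : 'M[C]_3 :=
  invmx (H z) *m mx_d_z H z.

Definition harmonic_metric (tau : C) (H : C -> 'M[C]_3) : Prop :=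
  [/\ forall z, punctured z -> (H z) ^t* = H z /\
        forall v : 'cV[C]_3, v != 0 -> 0 < (v ^t* *m H z *m v) 0 0,
      forall i j, smooth_on punctured (fun z => H z i j),
      forall z, punctured z -> \det (H z) = 1,
      adapted H
    & forall z, punctured z ->
        - mx_d_zbar (chern_form H) z
        + `|tau| ^+ 2 *: (Theta0 z *m Theta_dag H z - Theta_dag H z *m Theta0 z)
        = 0].

(* connection form of the flat connection, at z, on the tangent vector v *)
Definition conn_form (tau : C) (H : C -> 'M[C]_3) (z v : C) : 'M[C]_3 :=
  v *: (chern_form H z + tau *: Theta0 z) + (v^* * tau^*) *: Theta_dag H z.

End Higgs.

Section Monodromy.
Variable R : realType.
Local Notation C := R[i].

(* T is the parallel transport of flat sections of d + omega along p, where p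
   is parametrized by [0, 1] *)
Definition is_transport (omega : C -> C -> 'M[C]_3) (p : R -> C)
    (T : 'M[C]_3) : Prop :=
  exists S : R -> 'M[C]_3,
    [/\ S 0 = 1%:M, S 1 = T,
        forall i j,
          {within `[0, 1]%classic, continuous (fun t => complex.Re (S t i j))} /\
          {within `[0, 1]%classic, continuous (fun t => complex.Im (S t i j))}
      & forall t i j, 0 < t < 1 ->
          curve_derivable (fun s => S s i j) t /\
          curve_derive (fun s => S s i j) t
          = - (omega (p t) (curve_derive p t) *m S t) i j].

(* transport along the concatenation of a list of paths, first path first *)
Fixpoint is_transport_seq (omega : C -> C -> 'M[C]_3) (ps : seq (R -> C))
    (T : 'M[C]_3) : Prop :=
  match ps with
  | [::] => T = 1%:M
  | p :: qs => exists T1 T2 : 'M[C]_3,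
      [/\ is_transport omega p T1, is_transport_seq omega qs T2
        & T = T2 *m T1]
  end.

Definition segment (u v : C) (t : R) : C := u + t%:C * (v - u).

(* positively oriented circle around c starting and ending at e *)
Definition circle (c e : C) (t : R) : C := c + (e - c) * cis (2 * pi * t).

Definition z0 : C := 2^-1.

Definition loop (c e : C) : seq (R -> C) :=
  [:: segment z0 e; circle c e; segment e z0].

Definition is_monodromy (omega : C -> C -> 'M[C]_3) (ps : seq (R -> C))
    (A : 'M[C]_3) : Prop :=
  exists2 T, is_transport_seq omega ps T & A = invmx T.

Definition trace_coordinates (omega : C -> C -> 'M[C]_3) (r : R)
    (X Y Z : C) : Prop :=
  exists A B : 'M[C]_3,
    [/\ is_monodromy omega (loop 0 r%:C) A,
        is_monodromy omega (loop 1 (1 - r%:C)) B,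
        X = \tr (A *m invmx B),
        Y = \tr (invmx A *m B)
      & Z = \tr (A *m B *m invmx A *m invmx B)].

End Monodromy.

Section Asymptotics.
Variable R : realType.
Local Notation C := R[i].

Definition eps : C := cis (2 * pi / 3).

(* z^(-2/3) (z-1)^(-2/3) on (0, 1), for the branch that is positive there *)
Definition integrand (t : R) : R := (t `^ (2 / 3) * (1 - t) `^ (2 / 3))^-1.

Definition period0 : C :=
  2 * (eps - 1) *
  (\int[@lebesgue_measure R]_(t in `[0, (1 / 2)%R]) integrand t)%R%:C.

(* the integral runs from 1 down to 1/2 *)
Definition period1 : C :=
  2 * (eps - 1) *
  (- \int[@lebesgue_measure R]_(t in `[(1 / 2)%R, 1]) integrand t)%R%:C.

Definition sector (j : nat) : set C :=
  [set x | exists rho theta : R,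
     [/\ 0 < rho, pi * (j%:R - 1) / 6 < theta < pi * j%:R / 6
       & x = rho%:C * cis theta]].

Definition in_sectors (js : seq nat) (x : C) : Prop :=
  exists2 j, j \in js & sector j x.

Definition tau_of (phi t : R) : C := (t `^ (1 / 3))%:C * cis (phi / 3).

Definition exp_approx (F G : R -> R) : Prop :=
  exists e K : R, 0 < e /\
    \forall t \near +oo, `|F t / G t - 1| <= K * expR (- e * t `^ (1 / 3)).

(* |F(t)| ~ exp(t^(1/3) Re y), where moreover Re y = c *)
Definition mod_asymp (F : R -> C) (y : C) (c : R) : Prop :=
  exp_approx (fun t => cmod (F t)) (fun t => expR (t `^ (1 / 3) * complex.Re y)) /\
  complex.Re y = c.

End Asymptotics.
Arguments eps {R}.
Arguments period0 {R}.
Arguments period1 {R}.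

(* Main.v *)
Require Import Defs.
From mathcomp Require Import all_boot all_order all_algebra.
From mathcomp Require Import complex.
From mathcomp Require Import all_classical all_reals all_analysis.
From mathcomp Require Import measurable_realfun.
From mathcomp Require Import ring lra.
Import Order.TTheory GRing.Theory Num.Theory.
Import numFieldNormedType.Exports.
Set Implicit Arguments.
Unset Strict Implicit.
Unset Printing Implicit Defensive.
Local Open Scope classical_set_scope.
Local Open Scope ring_scope.
Local Open Scope complex_scope.
Local Open Scope sesquilinear_scope.

(** The harmonic metric is known exactly, and so are the moduli of the terms of the
    three traces; only the comparison of these terms is asymptotic.

    Write [theta = T dz], [q = (z (z - 1))^-2] for the determinant and [D] for the
    adjoint of [T] in the harmonic metric.  Since the residues are nilpotent, the
    quadratic differential [tr theta^2] has at most simple poles at three points of the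
    sphere, hence vanishes ([trace_square_eq0]).  The eigenvalues of [T] are thus the
    three cube roots of [q], and [|T|^2 >= 3 |q|^(2/3)], with an excess controlled by the
    commutator of [T] and [D] ([cyclic_pointwise]).  The Bochner formula expresses the
    Laplacian of [|T|^2] through that commutator ([bochner]), and the parabolic weights
    make [|T|^2 / |q|^(2/3)] grow more slowly than any power at the punctures
    ([higgs_growth]), so that the maximum principle applies after multiplication by a
    weak gauge.  It forces [|T|^2 = 3 |q|^(2/3)], that is, [T] is normal and the equation
    decouples: [T D = |q|^(2/3)] and [T^3 = q] ([decoupled]).

    Differentiating these two identities shows that [T] is covariantly constant up to the
    factor [q' / (3 q)] ([higgs_covariant]).  Hence its eigenlines are parallel for the
    flat connection, and along a path the squared norm of a vector in the eigenline of a
    branch [lam] of the cube root of [q] is multiplied by [exp (-4 Re (tau Int lam dz))]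
    ([transport_eigenline]).  In the coordinate [zeta] with [z = zeta^3], or
    [1 - z = zeta^3], the branch and its primitive are single-valued, and a turn around
    the branch point multiplies [lam] by [eps] ([transport_loop]).

    In an eigenbasis at the base point both monodromies therefore permute the eigenlines
    cyclically.  The moduli of their entries involve the unknown norms of the basis, but
    these drop out of the traces: [X], [Y] and [Z] are sums of three terms of moduli
    [exp (Re (tau eps^k p))], [exp (- Re (tau eps^k p))] and
    [exp (Re (tau (1 - eps) eps^k p))], where [p = period0 - period1]
    ([trace_coordinates_sums]).  In each sector one term grows faster than the other two
    ([order_X], [order_Y], [order_Z]) and the sum has its size ([dominant_asymp]). *)

(** * Complex numbers with a real modulus *)

Section Modulus.
Variable R : realType.
Local Notation C := R[i].
Implicit Types (z w : C).

Lemma cReD z w : complex.Re (z + w) = complex.Re z + complex.Re w.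
Proof. by case: z; case: w. Qed.

Lemma cImD z w : complex.Im (z + w) = complex.Im z + complex.Im w.
Proof. by case: z; case: w. Qed.

Lemma cReB z w : complex.Re (z - w) = complex.Re z - complex.Re w.
Proof. by case: z; case: w. Qed.

Lemma cImB z w : complex.Im (z - w) = complex.Im z - complex.Im w.
Proof. by case: z; case: w. Qed.

Lemma cReM z w : complex.Re (z * w) =
  complex.Re z * complex.Re w - complex.Im z * complex.Im w.
Proof. by case: z; case: w. Qed.

Lemma cImM z w : complex.Im (z * w) =
  complex.Re z * complex.Im w + complex.Im z * complex.Re w.
Proof. by case: z; case: w. Qed.

Lemma cReN z : complex.Re (- z) = - complex.Re z.
Proof. by case: z. Qed.

Lemma cImN z : complex.Im (- z) = - complex.Im z.
Proof. by case: z. Qed.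

Lemma cReJ z : complex.Re z^*%C = complex.Re z.
Proof. by case: z. Qed.

Lemma cImJ z : complex.Im z^*%C = - complex.Im z.
Proof. by case: z. Qed.

Lemma cReMr (x : R) z : complex.Re (x%:C * z) = x * complex.Re z.
Proof. by rewrite cReM /= mul0r subr0. Qed.

Lemma cImMr (x : R) z : complex.Im (x%:C * z) = x * complex.Im z.
Proof. by rewrite cImM /= mul0r addr0. Qed.

Lemma cJM z w : (z * w)^*%C = z^*%C * w^*%C.
Proof. exact: rmorphM. Qed.

Lemma cJD z w : (z + w)^*%C = z^*%C + w^*%C.
Proof. exact: rmorphD. Qed.

Lemma cJB z w : (z - w)^*%C = z^*%C - w^*%C.
Proof. exact: rmorphB. Qed.

Lemma complex_eqP z w :
  complex.Re z = complex.Re w -> complex.Im z = complex.Im w -> z = w.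
Proof. by case: z => a b; case: w => c d /= -> ->. Qed.

Lemma normE z : `|z| = (cmod z)%:C.
Proof. by rewrite /cmod normc_def. Qed.

Lemma cmodE z : cmod z = Num.sqrt ((complex.Re z) ^+ 2 + (complex.Im z) ^+ 2).
Proof. by rewrite /cmod normc_def. Qed.

Lemma cmod_ge0 z : 0 <= cmod z.
Proof. by rewrite -ler0c -normE. Qed.

Lemma cmodM z w : cmod (z * w) = cmod z * cmod w.
Proof. by apply: complexI; rewrite -normE normrM !normE rmorphM. Qed.

Lemma cmodD z w : cmod (z + w) <= cmod z + cmod w.
Proof. by rewrite -lecR rmorphD /= -!normE ler_normD. Qed.

Lemma cmodN z : cmod (- z) = cmod z.
Proof. by rewrite /cmod normrN. Qed.

Lemma cmodB z w : cmod (z - w) = cmod (w - z).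
Proof. by rewrite -opprB cmodN. Qed.

Lemma cmod_eq0 z : (cmod z == 0) = (z == 0).
Proof. by rewrite -(inj_eq (@complexI R)) -normE normr_eq0. Qed.

Lemma cmod0 : cmod (0 : C) = 0.
Proof. by apply/eqP; rewrite cmod_eq0. Qed.

Lemma cmod1 : cmod (1 : C) = 1.
Proof. by rewrite /cmod normr1. Qed.

Lemma cmod_gt0 z : (0 < cmod z) = (z != 0).
Proof. by rewrite lt_neqAle cmod_ge0 andbT eq_sym cmod_eq0. Qed.

Lemma cmodV z : cmod z^-1 = (cmod z)^-1.
Proof. by apply: complexI; rewrite -normE normfV normE fmorphV. Qed.

Lemma cmodX z n : cmod (z ^+ n) = cmod z ^+ n.
Proof. by apply: complexI; rewrite -normE normrX normE rmorphXn. Qed.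

Lemma cmodJ z : cmod z^*%C = cmod z.
Proof. by rewrite /cmod normcJ. Qed.

Lemma cmodR (x : R) : cmod x%:C = `|x|.
Proof. by rewrite cmodE /= expr0n addr0 sqrtr_sqr. Qed.

Lemma cmod_sqr z : z * z^*%C = (cmod z ^+ 2)%:C.
Proof. by rewrite -sqr_normc normE rmorphXn. Qed.

Lemma cmod_Re z : `|complex.Re z| <= cmod z.
Proof. by rewrite -lecR -normE; apply: normc_ge_Re. Qed.

Lemma cmod_Im z : `|complex.Im z| <= cmod z.
Proof.
rewrite cmodE -sqrtr_sqr ler_sqrt ?addr_ge0 ?sqr_ge0 //.
by rewrite lerDr sqr_ge0.
Qed.

Lemma cmod_le z : cmod z <= `|complex.Re z| + `|complex.Im z|.
Proof.
rewrite cmodE -[leRHS]ger0_norm ?addr_ge0 // -sqrtr_sqr ler_sqrt ?sqr_ge0 //.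
rewrite sqrrD !real_normK ?num_real // lerD2r lerDl.
by rewrite mulrn_wge0 // mulr_ge0.
Qed.

Lemma conjCE z : Num.conj z = z^*%C.
Proof.
rewrite [z in LHS]Crect conjC_rect ?Creal_Re ?Creal_Im //.
rewrite -complexRe -complexIm -complexiE.
case: z => a b; simpc; reflexivity.
Qed.

(** Convergence measured by the real modulus, so that estimates are real
    inequalities; [ccvgP] compares it with the filter limit. *)
Definition clim T (F : set_system T) (f : T -> C) (l : C) :=
  forall e : R, 0 < e -> \forall x \near F, cmod (f x - l) < e.

Lemma ccvgP T (F : set_system T) (FF : Filter F) (f : T -> C) (l : C) :
  (f : T -> C^o) @ F --> (l : C^o) <-> clim F f l.
Proof.
split=> [/cvgrPdist_lt h e e0|h].
  have := h e%:C; rewrite ltcR => /(_ e0).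
  apply: filterS => x /=; rewrite normE ltcR cmodB //.
apply/cvgrPdist_lt => e e0.
have ee : e = (complex.Re e)%:C.
  by case: e e0 => a b; rewrite ltcE => /andP[/= /eqP -> _].
have := h (complex.Re e); rewrite -ltcR -ee => /(_ e0).
by apply: filterS => x /= hx; rewrite normE ee ltcR cmodB.
Qed.

Section Limits.
Variables (T : Type) (F : set_system T).
Context {FF : Filter F}.
Implicit Types (f g : T -> C) (k l : C).

Lemma clim_cst k : clim F (fun=> k) k.
Proof.
by move=> e e0; apply: filterE => x; rewrite subrr cmod0.
Qed.

Lemma climD f g k l : clim F f k -> clim F g l ->
  clim F (fun x => f x + g x) (k + l).
Proof.
move=> hf hg e e0; have e2 : 0 < e / 2 by rewrite divr_gt0.
move: (hf _ e2) (hg _ e2); apply: filterS2 => x h1 h2.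
rewrite opprD addrACA; apply: le_lt_trans (cmodD _ _) _.
by rewrite [ltRHS](splitr e) ltrD.
Qed.

Lemma climN f k : clim F f k -> clim F (fun x => - f x) (- k).
Proof.
by move=> hf e /hf; apply: filterS => x; rewrite -opprD cmodN.
Qed.

Lemma climB f g k l : clim F f k -> clim F g l ->
  clim F (fun x => f x - g x) (k - l).
Proof. by move=> hf /climN; apply: climD. Qed.

Lemma climJ f k : clim F f k -> clim F (fun x => (f x)^*%C) k^*%C.
Proof.
by move=> hf e /hf; apply: filterS => x; rewrite -rmorphB cmodJ.
Qed.

Lemma climM f g k l : clim F f k -> clim F g l ->
  clim F (fun x => f x * g x) (k * l).
Proof.
move=> /ccvgP hf /ccvgP hg; apply/ccvgP; exact: (cvgM hf hg).
Qed.

Lemma climV f k : clim F f k -> k != 0 -> clim F (fun x => (f x)^-1) k^-1.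
Proof.
move=> /ccvgP hf k0; apply/ccvgP; exact: (cvgV k0 hf).
Qed.

Lemma clim_neq0 f k : clim F f k -> k != 0 -> \forall x \near F, f x != 0.
Proof.
move=> h k0; have := h (cmod k); rewrite cmod_gt0 => /(_ k0).
apply: filterS => x; apply: contraTneq => ->.
by rewrite sub0r cmodN ltxx.
Qed.

Lemma clim_cmod f k : clim F f k -> (fun x => cmod (f x)) @ F --> cmod k.
Proof.
move=> h; apply/cvgrPdist_lt => e /h; apply: filterS => x.
apply: le_lt_trans; rewrite ler_norml; apply/andP; split.
  rewrite lerNl opprB lerBlDr; apply: le_trans (cmodD _ _); by rewrite subrK.
rewrite lerBlDr cmodB; apply: le_trans (cmodD _ _); by rewrite subrK.
Qed.

Lemma climP f k : clim F f k <->
  complex.Re (f x) @[x --> F] --> complex.Re k /\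
  complex.Im (f x) @[x --> F] --> complex.Im k.
Proof.
split=> [h|[/cvgrPdist_lt hr /cvgrPdist_lt hi]].
  split; apply/cvgrPdist_lt => e /h; apply: filterS => x /= /(le_lt_trans _);
    apply; rewrite distrC.
  - by rewrite -cReB; apply: cmod_Re.
  - by rewrite -cImB; apply: cmod_Im.
move=> e e0; have e2 : 0 < e / 2 by rewrite divr_gt0.
move: (hr _ e2) (hi _ e2); apply: filterS2 => x /= h1 h2.
apply: le_lt_trans (cmod_le _) _; rewrite [ltRHS](splitr e) cReB cImB.
by rewrite ltrD // distrC.
Qed.

Lemma clim_real (f : T -> R) (k : R) : f @ F --> k ->
  clim F (fun x => (f x)%:C) k%:C.
Proof.
move=> /cvgrPdist_lt h e /h; apply: filterS => x.
by rewrite -rmorphB cmodR distrC.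
Qed.

Lemma clim_near f k (P : C -> Prop) : clim F f k ->
  (\forall w \near (k : C^o), P w) -> \forall x \near F, P (f x).
Proof. by move=> /ccvgP h /h. Qed.

Lemma clim_comp f k (g : C -> C) l : clim F f k ->
  clim (nbhs (k : C^o)) g l -> clim F (g \o f) l.
Proof. by move=> hf hg e /hg; apply: clim_near. Qed.

Lemma clim_eq f g k : (\forall x \near F, f x = g x) -> clim F f k -> clim F g k.
Proof. by move=> h hf e /hf; move: h; apply: filterS2 => x ->. Qed.

End Limits.

Lemma clim_id z : clim (nbhs (z : C^o)) id z.
Proof. by apply/ccvgP; exact: cvg_id. Qed.

Lemma clim_singleton (U : topologicalType) (x : U) (f : U -> C) l :
  clim (nbhs x) f l -> f x = l.
Proof.
move=> h; apply/eqP; rewrite -subr_eq0 -cmod_eq0; apply/negPn/negP => n0.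
have := h (cmod (f x - l)); rewrite lt_neqAle eq_sym n0 cmod_ge0 => /(_ isT).
by move=> /nbhs_singleton; rewrite ltxx.
Qed.

Lemma near_cmodP z (P : C -> Prop) : (\forall w \near (z : C^o), P w) <->
  exists2 e : R, 0 < e & forall w, cmod (w - z) < e -> P w.
Proof.
split=> [|[e e0 h]].
  move=> /nbhs_ballP[e /= e0 h].
  have ee : e = (complex.Re e)%:C.
    by case: e e0 {h} => a b; rewrite ltcE => /andP[/= /eqP -> _].
  exists (complex.Re e); first by rewrite -ltcR -ee.
  by move=> w hw; apply: h; rewrite /ball /= normE ee ltcR cmodB.
by have := @clim_id z _ e0; apply: filterS => w /h.
Qed.

End Modulus.

(** * Wirtinger calculus *)

Section Calculus.
Variable R : realType.
Local Notation C := R[i].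
Implicit Types (z w : C) (f g : C -> C) (c : R -> C).

(** Real differentiability in Caratheodory's form, with [a] and [b] the two
    Wirtinger derivatives: since the difference quotients are functions, every
    rule of calculus is an identity plus limits of sums and products. *)
Definition wder f z (a b : C) := exists u v : C -> C,
  [/\ clim (nbhs (z : C^o)) u a, clim (nbhs (z : C^o)) v b
    & \forall w \near (z : C^o), f w - f z = (w - z) * u w + (w - z)^*%C * v w].

Definition cder c (t : R) (d : C) := exists u : R -> C,
  clim (nbhs t) u d /\ \forall s \near t, c s - c t = (s - t)%:C * u s.

Lemma clim_shift z : clim (nbhs (z : C^o)) (fun w => w - z) 0.
Proof. by rewrite -(subrr z); apply: climB; [exact: clim_id|exact: clim_cst]. Qed.

Lemma wder_clim f z a b : wder f z a b -> clim (nbhs (z : C^o)) f (f z).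
Proof.
move=> [u [v [hu hv h]]].
have h0 : clim (nbhs (z : C^o))
    (fun w => f z + ((w - z) * u w + (w - z)^*%C * v w))
    (f z + (0 * a + 0^*%C * b)).
  apply: climD; first exact: clim_cst.
  by apply: climD; apply: climM => //; [|apply: climJ]; exact: clim_shift.
rewrite conjc0 !mul0r !addr0 in h0; apply: clim_eq h0.
by apply: filterS h => w <-; rewrite addrC subrK.
Qed.

Lemma cder_clim c t d : cder c t d -> clim (nbhs t) c (c t).
Proof.
move=> [u [hu h]].
have h0 : clim (nbhs t) (fun s => c t + (s - t)%:C * u s)
    (c t + (t - t)%:C * d).
  apply: climD; first exact: clim_cst.
  apply: climM => //; apply: clim_real.
  by apply: cvgB; [exact: cvg_id|exact: cvg_cst].
rewrite subrr mul0r addr0 in h0; apply: clim_eq h0.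
by apply: filterS h => w <-; rewrite addrC subrK.
Qed.

Lemma wder_cst (k : C) z : wder (fun=> k) z 0 0.
Proof.
exists (fun=> 0), (fun=> 0); split; try exact: clim_cst.
by near=> w; rewrite subrr !mulr0 addr0.
Unshelve. all: by end_near. Qed.

Lemma wder_id z : wder id z 1 0.
Proof.
exists (fun=> 1), (fun=> 0); split; try exact: clim_cst.
by near=> w; rewrite mulr1 mulr0 addr0.
Unshelve. all: by end_near. Qed.

Lemma wder_near f g z a b : (\forall w \near (z : C^o), f w = g w) ->
  wder f z a b -> wder g z a b.
Proof.
move=> e [u [v [hu hv h]]]; exists u, v; split=> //.
have ez : f z = g z := nbhs_singleton e.
by move: e h; apply: filterS2 => w e1; rewrite e1 ez.
Qed.

Lemma wder_conj f z a b : wder f z a b -> wder (fun w => (f w)^*%C) z b^*%C a^*%C.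
Proof.
move=> [u [v [hu hv h]]].
exists (fun w => (v w)^*%C), (fun w => (u w)^*%C); split; try exact: climJ.
apply: filterS h => w h; rewrite -rmorphB h rmorphD !rmorphM /=.
by rewrite conjcK addrC.
Qed.

Lemma wderD f g z a b a' b' : wder f z a b -> wder g z a' b' ->
  wder (fun w => f w + g w) z (a + a') (b + b').
Proof.
move=> [u [v [hu hv h]]] [u' [v' [hu' hv' h']]].
exists (fun w => u w + u' w), (fun w => v w + v' w); split; try exact: climD.
move: h h'; apply: filterS2 => w h h'.
by rewrite opprD addrACA h h' !mulrDr addrACA.
Qed.

Lemma wderM f g z a b a' b' : wder f z a b -> wder g z a' b' ->
  wder (fun w => f w * g w) z (a * g z + f z * a') (b * g z + f z * b').
Proof.
move=> hf hg; have cg := wder_clim hg.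
move: hf hg => [u [v [hu hv h]]] [u' [v' [hu' hv' h']]].
exists (fun w => u w * g w + f z * u' w), (fun w => v w * g w + f z * v' w).
split.
- apply: climD; first exact: climM.
  by apply: climM hu'; exact: clim_cst.
- apply: climD; first exact: climM.
  by apply: climM hv'; exact: clim_cst.
move: h h'; apply: filterS2 => w h h'.
have -> : f w * g w - f z * g z = (f w - f z) * g w + f z * (g w - g z) by ring.
by rewrite h h'; ring.
Qed.

Lemma wderN f z a b : wder f z a b -> wder (fun w => - f w) z (- a) (- b).
Proof.
move=> [u [v [hu hv h]]].
exists (fun w => - u w), (fun w => - v w); split; try exact: climN.
by apply: filterS h => w h; rewrite -opprD h; ring.
Qed.

Lemma wderB f g z a b a' b' : wder f z a b -> wder g z a' b' ->
  wder (fun w => f w - g w) z (a - a') (b - b').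
Proof. by move=> h h'; apply: wderD => //; apply: wderN. Qed.

Lemma wderV f z a b : wder f z a b -> f z != 0 ->
  wder (fun w => (f w)^-1) z (- a / f z ^+ 2) (- b / f z ^+ 2).
Proof.
move=> hf f0; have cf := wder_clim hf; have n0 : \forall w \near (z : C^o), f w != 0 by exact: clim_neq0 cf f0.
move: hf => [u [v [hu hv h]]].
exists (fun w => - u w * ((f w)^-1 * (f z)^-1)),
       (fun w => - v w * ((f w)^-1 * (f z)^-1)); split.
- rewrite expr2 invfM; apply: climM; first exact: climN.
  by apply: climM; [exact: climV|exact: clim_cst].
- rewrite expr2 invfM; apply: climM; first exact: climN.
  by apply: climM; [exact: climV|exact: clim_cst].
apply: filterS2 h n0 => w h fw0.
have -> : (f w)^-1 - (f z)^-1 = - (f w - f z) * ((f w)^-1 * (f z)^-1).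
  by field; rewrite f0.
by rewrite h; ring.
Qed.

Lemma wder_sum (I : Type) (r : seq I) (F : I -> C -> C) z (a b : I -> C) :
  (forall i, wder (F i) z (a i) (b i)) ->
  wder (fun w => \sum_(i <- r) F i w) z (\sum_(i <- r) a i) (\sum_(i <- r) b i).
Proof.
move=> h; elim: r => [|i r ih].
  by rewrite !big_nil; under eq_fun do rewrite big_nil; exact: wder_cst.
by rewrite !big_cons; under eq_fun do rewrite big_cons; exact: wderD.
Qed.

Lemma wder_comp_curve f c t a b d : wder f (c t) a b -> cder c t d ->
  cder (f \o c) t (a * d + b * d^*%C).
Proof.
move=> [u [v [hu hv h]]] hc; have cc := cder_clim hc; case: hc => x [hx h'].
exists (fun s => u (c s) * x s + v (c s) * (x s)^*%C); split.
  apply: climD; apply: climM => //; last exact: climJ.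
    exact: (clim_comp cc hu).
  exact: (clim_comp cc hv).
have h2 : \forall s \near t, f (c s) - f (c t) =
    (c s - c t) * u (c s) + (c s - c t)^*%C * v (c s) by exact: clim_near cc h.
apply: filterS2 h2 h' => s /= e1 e2.
rewrite e1 e2 cJM conjc_real; ring.
Qed.

Lemma cder_cst (k : C) t : cder (fun=> k) t 0.
Proof.
exists (fun=> 0); split; first exact: clim_cst.
by near=> w; rewrite subrr !mulr0.
Unshelve. all: by end_near. Qed.

Lemma cderD c c' t d d' : cder c t d -> cder c' t d' ->
  cder (fun s => c s + c' s) t (d + d').
Proof.
move=> [u [hu h]] [u' [hu' h']].
exists (fun s => u s + u' s); split; first exact: climD.
move: h h'; apply: filterS2 => s h h'.
by rewrite opprD addrACA h h' mulrDr.
Qed.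

Lemma cderM c c' t d d' : cder c t d -> cder c' t d' ->
  cder (fun s => c s * c' s) t (d * c' t + c t * d').
Proof.
move=> hf hg; have cg := cder_clim hg.
move: hf hg => [u [hu h]] [u' [hu' h']].
exists (fun s => u s * c' s + c t * u' s); split.
  apply: climD; first exact: climM.
  by apply: climM hu'; exact: clim_cst.
move: h h'; apply: filterS2 => w h h'.
have -> : c w * c' w - c t * c' t = (c w - c t) * c' w + c t * (c' w - c' t).
  by ring.
by rewrite h h'; ring.
Qed.

Lemma cder_conj c t d : cder c t d -> cder (fun s => (c s)^*%C) t d^*%C.
Proof.
move=> [u [hu h]]; exists (fun s => (u s)^*%C); split; first exact: climJ.
by apply: filterS h => s h; rewrite -cJB h cJM conjc_real.
Qed.

Lemma cder_near c c' t d : (\forall s \near t, c s = c' s) ->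
  cder c t d -> cder c' t d.
Proof.
move=> e [u [hu h]]; exists u; split=> //.
have ez := nbhs_singleton e.
by move: e h; apply: filterS2 => w e1; rewrite e1 ez.
Qed.

Lemma cder_sum (I : Type) (r : seq I) (F : I -> R -> C) t (d : I -> C) :
  (forall i, cder (F i) t (d i)) ->
  cder (fun s => \sum_(i <- r) F i s) t (\sum_(i <- r) d i).
Proof.
move=> h; elim: r => [|i r ih].
  by rewrite !big_nil; under eq_fun do rewrite big_nil; exact: cder_cst.
by rewrite !big_cons; under eq_fun do rewrite big_cons; exact: cderD.
Qed.

(** Carries the calculus of real functions over to curves in [C]. *)
Lemma cderP c (t : R) d : cder c t d <->
  is_derive t 1 (fun s => complex.Re (c s)) (complex.Re d) /\
  is_derive t 1 (fun s => complex.Im (c s)) (complex.Im d).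
Proof.
split.
  move=> [u [hu h]]; have [hr hi] := (climP _ _).1 hu.
  have aux (P : C -> R) (hP : forall (x : R) z, P (x%:C * z) = x * P z)
      (hB : forall z w, P (z - w) = P z - P w) :
      P (u x) @[x --> t] --> P d ->
      is_derive t 1 (fun s => P (c s)) (P d).
    move=> hp; apply/is_derive1_caratheodory.
    exists (fun s => if s == t then P d else (P (c s) - P (c t)) / (s - t)).
    split=> [s| |]; last by rewrite eqxx.
      have [->|st] := eqVneq s t; first by rewrite !subrr mulr0.
      by rewrite mulfVK // subr_eq0.
    rewrite /prop_for /continuous_at eqxx; apply: cvg_trans hp.
    apply: near_eq_cvg; near=> s; have [->|st] := eqVneq s t.
      by rewrite (clim_singleton hu).
    rewrite -hB; have -> : c s - c t = (s - t)%:C * u s by near: s.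
    by rewrite hP mulrAC mulfV ?mul1r // subr_eq0.
  split; apply: aux => //.
  by move=> x z; rewrite cReMr.
  exact: cReB.
  by move=> x z; rewrite cImMr.
  exact: cImB.
move=> [/is_derive1_caratheodory[g [hg cg eg]]].
move=> /is_derive1_caratheodory[k [hk ck ek]].
exists (fun s => g s +i* k s); split.
  by apply/climP; rewrite -eg -ek.
near=> s; apply: complex_eqP.
  by rewrite cReMr cReB hg mulrC.
by rewrite cImMr cImB hk mulrC.
Unshelve. all: by end_near. Qed.

Lemma cder_curve c t d : cder c t d -> curve_derivable c t /\ curve_derive c t = d.
Proof.
move=> /cderP[h1 h2]; split; first by split; apply: ex_derive.
by rewrite /curve_derive !derive1E !derive_val; case: d {h1 h2}.
Qed.

Lemma curve_cder c t : curve_derivable c t -> cder c t (curve_derive c t).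
Proof.
move=> [h1 h2]; apply/cderP; rewrite /curve_derive /= !derive1E.
by split; apply: DeriveDef.
Qed.

Lemma cder_real (f : R -> R) (t d : R) : is_derive t 1 f d ->
  cder (fun s => (f s)%:C) t d%:C.
Proof. by move=> h; apply/cderP; split=> //=; apply: is_derive_cst. Qed.

Lemma cder_id t : cder (fun s : R => s%:C) t 1.
Proof. by apply: cder_real; apply: is_derive_id. Qed.

Lemma along_x_cder f z a b : wder f z a b -> cder (along_x f z) 0 (a + b).
Proof.
move=> h; have -> : a + b = a * 1 + b * 1^*%C by rewrite conjc1 !mulr1.
have -> : along_x f z = f \o (fun s : R => z + s%:C) by [].
apply: wder_comp_curve; first by rewrite addr0.
by rewrite -[X in cder _ _ X]add0r; apply: cderD; [exact: cder_cst|exact: cder_id].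
Qed.

Lemma along_y_cder f z a b : wder f z a b ->
  cder (along_y f z) 0 ('i * (a - b)).
Proof.
move=> h.
have -> : 'i%C * (a - b) = a * 'i%C + b * ('i%C)^*%C.
  have -> : ('i%C : C)^*%C = - 'i%C by apply: complex_eqP => /=; rewrite ?oppr0.
  by rewrite mulrN mulrBr mulrC [in X in _ - X]mulrC.
have -> : along_y f z = f \o (fun s : R => z + s%:C * 'i%C).
  apply/funext => s; rewrite /along_y /=; congr (f (z + _)).
  by simpc.
apply: wder_comp_curve; first by rewrite mul0r addr0.
suff h1 : cder (fun s : R => z + s%:C * 'i%C) 0 (0 + (1 * 'i%C + (0 : R)%:C * 0)).
  by move: h1; rewrite mulr0 addr0 mul1r add0r.
by apply: cderD; [exact: cder_cst|apply: cderM; [exact: cder_id|exact: cder_cst]].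
Qed.

Lemma wder_d f z a b : wder f z a b -> d_z f z = a /\ d_zbar f z = b.
Proof.
move=> h; rewrite /d_z /d_zbar /dx /dy.
have [_ ->] := cder_curve (along_x_cder h).
have [_ ->] := cder_curve (along_y_cder h).
have -> : (0 +i* 1) * ('i * (a - b)) = - (a - b) :> C.
  by rewrite mulrA -expr2 sqr_i mulN1r.
by split; field.
Qed.

Lemma wder_uniq f z a b a' b' : wder f z a b -> wder f z a' b' ->
  a = a' /\ b = b'.
Proof. by move=> /wder_d[<- <-] /wder_d[<- <-]. Qed.

End Calculus.

(** * Integrals along segments *)

Section SegmentIntegral.
Variable R : realType.
Local Notation C := R[i].
Implicit Types (z w a b : C) (f g : C -> C) (c : R -> C).

Lemma ex_antiderivative (g : R -> R) : continuous g ->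
  exists G : R -> R, forall t : R, 0 <= t <= 1 -> is_derive t 1 G (g t).
Proof.
move=> cg; exists (fun x => \int[lebesgue_measure]_(t in `[(-1)%R, x]) g t)%R.
move=> t /andP[t0 t1].
have int : lebesgue_measure.-integrable `[(-1)%R, 2%R] (EFin \o g).
  apply: continuous_compact_integrable; first exact: segment_compact.
  exact: continuous_subspaceT.
have [] := @continuous_FTC1_closed R g (-1) t 2 _ int _ (cg t); try lra.
move=> d e; rewrite -e derive1E; exact: DeriveDef.
Qed.

Lemma ex_cantiderivative (g : R -> C) : (forall t, clim (nbhs t) g (g t)) ->
  exists G : R -> C, forall t : R, 0 <= t <= 1 -> cder G t (g t).
Proof.
move=> cg.
have [t|Gr hr] := @ex_antiderivative (fun t => complex.Re (g t)).
  by have /climP[] := cg t.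
have [t|Gi hi] := @ex_antiderivative (fun t => complex.Im (g t)).
  by have /climP[] := cg t.
by exists (fun t => Gr t +i* Gi t) => t ht; apply/cderP; split; [exact: hr|exact: hi].
Qed.

Lemma real_increment_le (G d : R -> R) (M : R) :
  (forall t : R, 0 <= t <= 1 -> is_derive t 1 G (d t)) ->
  (forall t : R, 0 <= t <= 1 -> `|d t| <= M) -> `|G 1 - G 0| <= M.
Proof.
move=> h hM.
have [|t|x|c hc ->] := @MVT_segment R G d 0 1; first exact: ler01.
- by rewrite in_itv /= => /andP[h0 h1]; apply: h; rewrite !ltW.
- apply: derivable_within_continuous => t.
  by rewrite in_itv /= => ht; apply: ex_derive; exact: h.
by rewrite subr0 mulr1; apply: hM; move: hc; rewrite in_itv.
Qed.

(** The factor 2 comes from bounding the two coordinates separately. *)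
Lemma increment_le (G d : R -> C) (M : R) :
  (forall t : R, 0 <= t <= 1 -> cder G t (d t)) ->
  (forall t : R, 0 <= t <= 1 -> cmod (d t) <= M) -> cmod (G 1 - G 0) <= 2 * M.
Proof.
move=> h hM; apply: le_trans (cmod_le _) _; rewrite mulr_natl mulr2n cReB cImB.
apply: lerD.
- apply: (@real_increment_le (fun t => complex.Re (G t)) (fun t => complex.Re (d t))) => t ht.
    by have /cderP[] := h t ht.
  exact: le_trans (cmod_Re _) (hM t ht).
- apply: (@real_increment_le (fun t => complex.Im (G t)) (fun t => complex.Im (d t))) => t ht.
    by have /cderP[] := h t ht.
  exact: le_trans (cmod_Im _) (hM t ht).
Qed.

Lemma cderN c t d : cder c t d -> cder (fun s => - c s) t (- d).
Proof.
move=> h; have -> : - d = 0 * c t + (-1) * d by rewrite mul0r add0r mulN1r.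
have -> : (fun s => - c s) = (fun s => (-1) * c s).
  by apply/funext => s; rewrite mulN1r.
by apply: cderM => //; exact: cder_cst.
Qed.

Lemma cderB c c' t d d' : cder c t d -> cder c' t d' ->
  cder (fun s => c s - c' s) t (d - d').
Proof. by move=> h h'; apply: cderD => //; exact: cderN. Qed.

Lemma cderZ (k : C) c t d : cder c t d -> cder (fun s => k * c s) t (k * d).
Proof.
move=> h; have -> : k * d = 0 * c t + k * d by rewrite mul0r add0r.
by apply: cderM => //; exact: cder_cst.
Qed.

Lemma cder_eq_increment (G G' d : R -> C) :
  (forall t : R, 0 <= t <= 1 -> cder G t (d t)) ->
  (forall t : R, 0 <= t <= 1 -> cder G' t (d t)) -> G 1 - G 0 = G' 1 - G' 0.
Proof.
move=> h h'; apply/eqP; rewrite -subr_eq0 -cmod_eq0 eq_le cmod_ge0 andbT.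
have -> : G 1 - G 0 - (G' 1 - G' 0) = (G 1 - G' 1) - (G 0 - G' 0).
  by ring.
have := @increment_le (fun t => G t - G' t) (fun=> 0) 0; rewrite mulr0.
apply=> t ht.
  by rewrite -(subrr (d t)); apply: cderB; [exact: h|exact: h'].
by rewrite cmod0.
Qed.

Lemma cder_comp_real (G : R -> C) (g : R -> R) (t d : R) (e : C) :
  cder G (g t) e -> is_derive t 1 g d -> cder (fun s => G (g s)) t (d%:C * e).
Proof.
move=> /cderP[h1 h2] hg; apply/cderP; rewrite cReMr cImMr ![d * _]mulrC; split.
  exact: (@is_derive1_comp R (fun s => complex.Re (G s)) g t _ _ h1 hg).
exact: (@is_derive1_comp R (fun s => complex.Im (G s)) g t _ _ h2 hg).
Qed.

Definition line a b (t : R) : C := a + t%:C * (b - a).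

Lemma line_cder a b t : cder (line a b) t (b - a).
Proof.
suff : cder (line a b) t (0 + (1 * (b - a) + t%:C * 0)).
  by rewrite mulr0 addr0 mul1r add0r.
apply: cderD; first exact: cder_cst.
by apply: cderM; [exact: cder_id|exact: cder_cst].
Qed.

Lemma line0 a b : line a b 0 = a.
Proof. by rewrite /line mul0r addr0. Qed.

Lemma line1 a b : line a b 1 = b.
Proof. by rewrite /line mul1r addrC subrK. Qed.

Definition cont_at f z := clim (nbhs (z : C^o)) f (f z).

Lemma cont_cst (k : C) z : cont_at (fun=> k) z.
Proof. exact: clim_cst. Qed.

Lemma contD f g z : cont_at f z -> cont_at g z -> cont_at (fun w => f w + g w) z.
Proof. exact: climD. Qed.

Lemma contM f g z : cont_at f z -> cont_at g z -> cont_at (fun w => f w * g w) z.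
Proof. exact: climM. Qed.

(** The contour integral along a segment, as the increment of an antiderivative of
    the pulled back integrand: the rules for [cder] then give the properties of
    the integral. *)
Definition is_seg f a b (I : C) := exists G : R -> C,
  (forall t : R, 0 <= t <= 1 -> cder G t ((b - a) * f (line a b t))) /\
  I = G 1 - G 0.

Definition seg f a b : C := xget 0 (is_seg f a b).

Definition cont_on f a b := forall t : R, 0 <= t <= 1 -> cont_at f (line a b t).

(** The retraction of the line onto [0, 1]: it extends an integrand known to be
    continuous on the segment only to a continuous function on the line. *)
Let clamp (t : R) : R := (`|t| - `|t - 1| + 1) / 2.

Lemma clampE t : 0 <= t <= 1 -> clamp t = t.
Proof.
move=> /andP[t0 t1]; rewrite /clamp ger0_norm // ler0_norm; last by rewrite subr_le0.
by field.
Qed.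

Lemma clamp_itv t : 0 <= clamp t <= 1.
Proof.
rewrite /clamp; have [t0|t0] := leP 0 t; have [t1|t1] := leP 1 t.
- rewrite !ger0_norm ?subr_ge0 //; lra.
- rewrite ger0_norm // ltr0_norm ?subr_lt0 //; lra.
- lra.
- rewrite !ltr0_norm ?subr_lt0 //; lra.
Qed.

Lemma clamp_continuous : continuous clamp.
Proof.
move=> t; rewrite /clamp; apply: cvgM; last exact: cvg_cst.
apply: cvgD; last exact: cvg_cst.
apply: cvgB; first by apply: cvg_norm; exact: cvg_id.
by apply: cvg_norm; apply: cvgB; [exact: cvg_id|exact: cvg_cst].
Qed.

Lemma seg_ex f a b : cont_on f a b -> exists I, is_seg f a b I.
Proof.
move=> hf; have [|G hG] := @ex_cantiderivative (fun t => (b - a) * f (line a b (clamp t))).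
  move=> t; apply: climM; first exact: clim_cst.
  apply: (clim_comp (k := line a b (clamp t)) (g := f)); last exact/hf/clamp_itv.
  apply: climD; first exact: clim_cst.
  apply: climM; last exact: clim_cst.
  by apply: clim_real; exact: clamp_continuous.
exists (G 1 - G 0), G; split=> // t ht.
by rewrite -{2}(clampE ht); exact: hG.
Qed.

Lemma seg_uniq f a b I J : is_seg f a b I -> is_seg f a b J -> I = J.
Proof.
move=> [G [hG ->]] [H [hH ->]]; exact: cder_eq_increment hG hH.
Qed.

Lemma segE f a b I : is_seg f a b I -> seg f a b = I.
Proof.
by move=> h; apply/esym; apply: (seg_uniq h); rewrite /seg; apply: (xgetI 0 h).
Qed.

Lemma segP f a b : cont_on f a b -> is_seg f a b (seg f a b).
Proof. by move=> /seg_ex[I h]; rewrite (segE h). Qed.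

Lemma seg_primitive F f a b :
  (forall t : R, 0 <= t <= 1 -> wder F (line a b t) (f (line a b t)) 0) ->
  seg f a b = F b - F a.
Proof.
move=> h; apply: segE; exists (F \o line a b); split; last by rewrite /= line0 line1.
move=> t ht; rewrite mulrC -[_ * _]addr0 -(mul0r ((b - a)^*%C)).
by apply: wder_comp_curve; [exact: h|exact: line_cder].
Qed.

Lemma segD f g a b : cont_on f a b -> cont_on g a b ->
  seg (fun z => f z + g z) a b = seg f a b + seg g a b.
Proof.
move=> /segP[G [hG ->]] /segP[H [hH ->]]; apply: segE.
exists (fun t => G t + H t); split; last by rewrite opprD addrACA.
by move=> t ht; rewrite mulrDr; apply: cderD; [exact: hG|exact: hH].
Qed.

Lemma segZ (k : C) f a b : cont_on f a b ->
  seg (fun z => k * f z) a b = k * seg f a b.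
Proof.
move=> /segP[G [hG ->]]; apply: segE.
exists (fun t => k * G t); split; last by rewrite mulrBr.
by move=> t ht; rewrite mulrCA; apply: cderZ; exact: hG.
Qed.

Lemma cont_onD f g a b : cont_on f a b -> cont_on g a b ->
  cont_on (fun z => f z + g z) a b.
Proof. by move=> h h' t ht; apply: contD; [exact: h|exact: h']. Qed.

Lemma cont_onM f g a b : cont_on f a b -> cont_on g a b ->
  cont_on (fun z => f z * g z) a b.
Proof. by move=> h h' t ht; apply: contM; [exact: h|exact: h']. Qed.

Lemma cont_on_cst k a b : cont_on (fun=> k) a b.
Proof. by move=> t ht; exact: cont_cst. Qed.

Lemma segB f g a b : cont_on f a b -> cont_on g a b ->
  seg (fun z => f z - g z) a b = seg f a b - seg g a b.
Proof.
move=> hf hg.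
have -> : (fun z => f z - g z) = (fun z => f z + (-1) * g z).
  by apply/funext => z; rewrite mulN1r.
rewrite segD ?segZ ?mulN1r //; apply: cont_onM => //; exact: cont_on_cst.
Qed.

Lemma seg_eq f g a b : (forall t : R, 0 <= t <= 1 -> f (line a b t) = g (line a b t)) ->
  seg f a b = seg g a b.
Proof.
move=> h; congr xget; apply/funext => I; apply/propext.
by split=> -[G [hG ->]]; exists G; split=> // t ht;
  [rewrite -h|rewrite h] => //; exact: hG.
Qed.

Lemma seg_bound f a b (M : R) : cont_on f a b ->
  (forall t : R, 0 <= t <= 1 -> cmod (f (line a b t)) <= M) ->
  cmod (seg f a b) <= 2 * (cmod (b - a) * M).
Proof.
move=> /segP[G [hG ->]] hM; apply: increment_le hG _ => t ht.
by rewrite cmodM ler_wpM2l ?cmod_ge0 // hM.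
Qed.

Lemma line_line a b (s s' t : R) :
  line (line a b s) (line a b s') t = line a b (s + t * (s' - s)).
Proof. by rewrite /line rmorphD rmorphM rmorphB /=; ring. Qed.

(** Reparametrizing an antiderivative gives the integral over any subsegment,
    in either direction. *)
Lemma seg_sub f a b (s s' : R) : cont_on f a b -> 0 <= s <= 1 -> 0 <= s' <= 1 ->
  exists G : R -> C, [/\ seg f a b = G 1 - G 0,
    seg f (line a b s) (line a b s') = G s' - G s
    & seg f (line a b s') b = G 1 - G s'].
Proof.
move=> /segP[G [hG ->]] hs hs'; exists G.
have aux (u v : R) : 0 <= u <= 1 -> 0 <= v <= 1 ->
    seg f (line a b u) (line a b v) = G v - G u.
  move=> hu hv; apply: segE; exists (fun t => G (u + t * (v - u))); split; last first.
    by rewrite mul1r mul0r addr0 [u + _]addrC subrK.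
  move=> t /andP[t0 t1]; rewrite line_line.
  have -> : line a b v - line a b u = (v - u)%:C * (b - a).
    by rewrite /line rmorphB /=; ring.
  set s0 := u + t * (v - u).
  have h01 : 0 <= s0 <= 1.
    move: hu hv => /andP[? ?] /andP[? ?].
    have : 0 <= (1 - t) * u by rewrite mulr_ge0 ?subr_ge0.
    have : 0 <= t * v by rewrite mulr_ge0.
    have : 0 <= (1 - t) * (1 - u) by rewrite mulr_ge0 ?subr_ge0.
    have : 0 <= t * (1 - v) by rewrite mulr_ge0 ?subr_ge0.
    rewrite /s0; nra.
  have hl : is_derive t 1 (fun t : R => u + t * (v - u)) (v - u).
    have -> : (fun t : R => u + t * (v - u)) = cst u \+ (v - u) \*: id.
      by apply/funext => x /=; rewrite /GRing.scale /= mulrC.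
    apply: is_derive_eq; rewrite add0r /GRing.scale /= mulr1 //.
  rewrite -mulrA; apply: (cder_comp_real _ hl); exact: hG.
split=> //; first exact: aux.
by rewrite -{2}(line1 a b); apply: aux => //; rewrite ler01 lexx.
Qed.

Lemma seg_split f a b (s : R) : cont_on f a b -> 0 <= s <= 1 ->
  seg f a b = seg f a (line a b s) + seg f (line a b s) b.
Proof.
move=> hf hs; have h0 : (0 : R) <= 0 <= (1 : R) by rewrite lexx ler01.
have [G [-> h2 ->]] := seg_sub hf h0 hs.
by rewrite line0 in h2; rewrite h2; ring.
Qed.

Lemma seg_opp f a b : cont_on f a b -> seg f b a = - seg f a b.
Proof.
move=> hf; have h0 : (0 : R) <= 0 <= (1 : R) by rewrite lexx ler01.
have h1 : (0 : R) <= 1 <= (1 : R) by rewrite lexx ler01.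
have [G [-> h2 _]] := seg_sub hf h1 h0.
by rewrite line0 line1 in h2; rewrite h2 opprB.
Qed.

End SegmentIntegral.

(** * Triangles *)
Section Triangle.
Variable R : realType.
Local Notation C := R[i].
Implicit Types (z w a b c : C) (f g : C -> C).

Definition tri f a b c := seg f a b + seg f b c + seg f c a.

Definition cont_tri f a b c := [/\ cont_on f a b, cont_on f b c & cont_on f c a].

Definition mid a b := line a b (1 / 2).

Lemma half_itv : (0 : R) <= 1 / 2 <= (1 : R).
Proof. by apply/andP; split; lra. Qed.

Lemma tri_affine (k l : C) a b c : tri (fun z => k + l * z) a b c = 0.
Proof.
pose F z : C := k * z + l * (z * z) / 2.
have hF u v : seg (fun z => k + l * z) u v = F v - F u.
  apply: seg_primitive => t _; set w := line u v t.
  suff : wder F w (0 * w + k * 1 + ((0 * (w * w) + l * (1 * w + w * 1)) * 2^-1 + l * (w * w) * 0))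
    (0 * w + k * 0 + ((0 * (w * w) + l * (0 * w + w * 0)) * 2^-1 + l * (w * w) * 0)).
    set p := (X in wder _ _ X _); set q := (X in wder _ _ _ X).
    have -> : p = k + l * w by rewrite /p; field.
    by have -> : q = 0 by rewrite /q; ring.
  apply: wderD; first by apply: wderM; [exact: wder_cst|exact: wder_id].
  apply: wderM; last exact: wder_cst.
  apply: wderM; first exact: wder_cst.
  by apply: wderM; exact: wder_id.
by rewrite /tri !hF; ring.
Qed.

Lemma tri_bound f a b c (M : R) : cont_tri f a b c ->
  (forall t : R, 0 <= t <= 1 -> [/\ cmod (f (line a b t)) <= M,
     cmod (f (line b c t)) <= M & cmod (f (line c a t)) <= M]) ->
  cmod (tri f a b c) <= 2 * M * (cmod (b - a) + cmod (c - b) + cmod (a - c)).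
Proof.
move=> [h1 h2 h3] hM.
apply: (le_trans (cmodD _ _)); apply: (le_trans (lerD (cmodD _ _) (lexx _))).
have b1 : cmod (seg f a b) <= 2 * (cmod (b - a) * M).
  by apply: seg_bound => // t /hM[].
have b2 : cmod (seg f b c) <= 2 * (cmod (c - b) * M).
  by apply: seg_bound => // t /hM[].
have b3 : cmod (seg f c a) <= 2 * (cmod (a - c) * M).
  by apply: seg_bound => // t /hM[].
apply: le_trans (lerD (lerD b1 b2) b3) _.
by rewrite -!mulrDr -!mulrDl mulrA [2 * _ * M]mulrAC.
Qed.

Lemma triB f g a b c : cont_tri f a b c -> cont_tri g a b c ->
  tri (fun z => f z - g z) a b c = tri f a b c - tri g a b c.
Proof. by move=> [? ? ?] [? ? ?]; rewrite /tri !segB //; ring. Qed.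

Lemma cont_triB f g a b c : cont_tri f a b c -> cont_tri g a b c ->
  cont_tri (fun z => f z - g z) a b c.
Proof.
move=> [h1 h2 h3] [k1 k2 k3]; split=> t ht.
- by apply: climB; [exact: h1|exact: k1].
- by apply: climB; [exact: h2|exact: k2].
- by apply: climB; [exact: h3|exact: k3].
Qed.

Lemma tri_split4 f a b c : cont_tri f a b c ->
  cont_on f (mid a b) (mid b c) -> cont_on f (mid b c) (mid c a) ->
  cont_on f (mid c a) (mid a b) ->
  tri f a b c = tri f a (mid a b) (mid c a) + tri f (mid a b) b (mid b c) +
    tri f (mid c a) (mid b c) c + tri f (mid a b) (mid b c) (mid c a).
Proof.
move=> [h1 h2 h3] k1 k2 k3; rewrite /tri.
rewrite (seg_split h1 half_itv) (seg_split h2 half_itv) (seg_split h3 half_itv).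
rewrite -!/(mid _ _) (seg_opp k1) (seg_opp k2) (seg_opp k3); ring.
Qed.

End Triangle.

(** * Goursat's theorem *)

Section Goursat.
Variable R : realType.
Local Notation C := R[i].
Implicit Types (z w a b c : C) (f g : C -> C).

Lemma nested_limit (x s : nat -> R) : (forall n, `|x n.+1 - x n| <= s n) ->
  (forall n, s n.+1 = s n / 2) -> exists p, forall n, `|x n - p| <= 2 * s n.
Proof.
move=> hx hs; have s0 n : 0 <= s n by apply: le_trans (hx n); rewrite normr_ge0.
pose l n := x n - 2 * s n; pose u n := x n + 2 * s n.
have hl n k : l n <= l (n + k)%N.
  elim: k => [|k ih]; first by rewrite addn0.
  apply: le_trans ih _; rewrite addnS /l hs.
  have := hx (n + k)%N; rewrite ler_norml => /andP[]; lra.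
have hu n k : u (n + k)%N <= u n.
  elim: k => [|k ih]; first by rewrite addn0.
  apply: le_trans _ ih; rewrite addnS /u hs.
  have := hx (n + k)%N; rewrite ler_norml => /andP[]; lra.
have lu n m : l n <= u m.
  apply: le_trans (hl n m) _; rewrite addnC; apply: le_trans (hu m n).
  by rewrite /l /u; have := s0 (m + n)%N; lra.
pose E := [set y | exists n, y = l n].
have En n : E (l n) by exists n.
have ub m : ubound E (u m) by move=> _ [n ->]; exact: lu.
exists (sup E) => n; rewrite ler_norml; apply/andP; split.
  have : sup E <= u n by apply: ge_sup => //; exists (l 0%N).
  by rewrite /u; lra.
have : l n <= sup E by apply: ub_le_sup => //; exists (u 0%N).
by rewrite /l; lra.
Qed.

(** Bisected triangles shrink to a point at a distance comparable with their size. *)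
Lemma cnested_limit (x : nat -> C) (s : nat -> R) :
  (forall n, cmod (x n.+1 - x n) <= s n) -> (forall n, s n.+1 = s n / 2) ->
  exists p, forall n, cmod (x n - p) <= 4 * s n.
Proof.
move=> hx hs.
have [|p hp] := @nested_limit (fun n => complex.Re (x n)) s _ hs.
  by move=> n; rewrite -cReB; exact: le_trans (cmod_Re _) (hx n).
have [|q hq] := @nested_limit (fun n => complex.Im (x n)) s _ hs.
  by move=> n; rewrite -cImB; exact: le_trans (cmod_Im _) (hx n).
exists (p +i* q) => n; apply: le_trans (cmod_le _) _; rewrite cReB cImB /=.
by have := hp n; have := hq n; lra.
Qed.

Lemma midE a b : mid a b = (a + b) / 2.
Proof.
rewrite /mid /line; have -> : ((1 / 2 : R)%:C : C) = 1 / 2.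
  by rewrite rmorphM fmorphV rmorph1 rmorph_nat.
by field.
Qed.

Lemma cmod_half z : cmod (z / 2) = cmod z / 2.
Proof.
rewrite cmodM cmodV; congr (_ / _).
by have -> : (2 : C) = (2 : R)%:C; [rewrite rmorph_nat|rewrite cmodR ger0_norm].
Qed.

Definition perimeter a b c := cmod (b - a) + cmod (c - b) + cmod (a - c).

Definition convex_closed (K : C -> Prop) :=
  (forall a b (t : R), K a -> K b -> 0 <= t <= 1 -> K (line a b t)) /\
  (forall z, (forall e : R, 0 < e -> exists2 w, K w & cmod (w - z) < e) -> K z).

Lemma convex_closedI (K L : C -> Prop) : convex_closed K -> convex_closed L ->
  convex_closed (fun z => K z /\ L z).
Proof.
move=> [k1 k2] [l1 l2]; split.
  by move=> a b t [? ?] [? ?] ht; split; [exact: k1|exact: l1].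
move=> z h; split; [apply: k2|apply: l2] => e /h[w [? ?] ?]; by exists w.
Qed.

Lemma disc_convex_closed z0 (rho : R) :
  convex_closed (fun z => cmod (z - z0) <= rho).
Proof.
split=> [a b t ha hb /andP[t0 t1]|z h].
  have -> : line a b t - z0 = (1 - t)%:C * (a - z0) + t%:C * (b - z0).
    by rewrite /line rmorphB /=; ring.
  apply: le_trans (cmodD _ _) _; rewrite !cmodM !cmodR.
  rewrite ger0_norm ?subr_ge0 // (ger0_norm t0).
  have : (1 - t) * cmod (a - z0) <= (1 - t) * rho by rewrite ler_wpM2l ?subr_ge0.
  have : t * cmod (b - z0) <= t * rho by rewrite ler_wpM2l.
  lra.
apply/ler_addgt0Pr => e /h[w hw he].
have -> : z - z0 = (w - z0) + (z - w) by ring.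
by apply: le_trans (cmodD _ _) _; apply: lerD => //; rewrite cmodB ltW.
Qed.

Lemma halfplane_convex_closed w u (k : R) :
  convex_closed (fun z => k <= complex.Im ((z - w)^*%C * u)).
Proof.
split=> [a b t ha hb /andP[t0 t1]|z h].
  have -> : line a b t - w = (1 - t)%:C * (a - w) + t%:C * (b - w).
    by rewrite /line rmorphB /=; ring.
  rewrite cJD !cJM !conjc_real mulrDl -!mulrA cImD !cImMr.
  have : (1 - t) * k <= (1 - t) * complex.Im ((a - w)^*%C * u).
    by rewrite ler_wpM2l ?subr_ge0.
  have : t * k <= t * complex.Im ((b - w)^*%C * u) by rewrite ler_wpM2l.
  lra.
apply/ler_addgt0Pr => e e0.
have c0 : 0 < cmod u + 1 by rewrite ltr_wpDl ?cmod_ge0.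
have [|v hv he] := h (e / (cmod u + 1)); first by rewrite divr_gt0.
have -> : z - w = (v - w) + (z - v) by ring.
rewrite cJD mulrDl cImD; apply: le_trans hv _; rewrite -addrA lerDl.
rewrite addrC -lerBlDl sub0r lerNl.
have := cmod_Im ((z - v)^*%C * u); rewrite cmodM cmodJ ler_norml => /andP[h1 _].
apply: le_trans (_ : cmod (z - v) * cmod u <= _); first by rewrite lerNl.
apply: le_trans (_ : e / (cmod u + 1) * cmod u <= _).
  by rewrite ler_wpM2r ?cmod_ge0 // cmodB ltW.
rewrite mulrAC ler_pdivrMr // ler_wpM2l ?(ltW e0) //; lra.
Qed.

(** Goursat's theorem on a closed convex set: bisecting the triangle keeps a
    quarter of the integral, while differentiability at the limit point makes
    it small compared with the square of the perimeter. *)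
Theorem goursat (K : C -> Prop) f a b c : convex_closed K ->
  (forall z, K z -> exists d, wder f z d 0) -> K a -> K b -> K c ->
  tri f a b c = 0.
Proof.
move=> [Kc Kl] hf Ka Kb Kc'.
have contK u v : K u -> K v -> cont_on f u v.
  move=> hu hv t ht; have [d hd] := hf _ (Kc _ _ _ hu hv ht).
  exact: wder_clim hd.
have cont3 u v w : K u -> K v -> K w -> cont_tri f u v w.
  by move=> *; split; apply: contK.
pose good (T : C * C * C) := [/\ K T.1.1, K T.1.2 & K T.2].
pose I (T : C * C * C) := cmod (tri f T.1.1 T.1.2 T.2).
pose S (T : C * C * C) := perimeter T.1.1 T.1.2 T.2.
have step T : exists T', good T -> [/\ good T', I T / 4 <= I T', S T' = S T / 2
    & cmod (T'.1.1 - T.1.1) <= S T].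
  case: (EM (good T)) => [gT|]; last by exists T.
  case: T gT => [[x y] z] [/= Kx Ky Kz].
  have Kxy : K (mid x y) by apply: Kc => //; exact: half_itv.
  have Kyz : K (mid y z) by apply: Kc => //; exact: half_itv.
  have Kzx : K (mid z x) by apply: Kc => //; exact: half_itv.
  have split4 := tri_split4 (cont3 _ _ _ Kx Ky Kz) (contK _ _ Kxy Kyz)
    (contK _ _ Kyz Kzx) (contK _ _ Kzx Kxy).
  have n0 := (cmod_ge0 (y - x), cmod_ge0 (z - y), cmod_ge0 (x - z)).
  set I0 := cmod (tri f x y z).
  have [h1|h1] := leP (I0 / 4) (cmod (tri f x (mid x y) (mid z x))).
    exists (x, mid x y, mid z x) => _; split=> //=.
    - rewrite /S /perimeter /= !midE.
      have -> : (x + y) / 2 - x = (y - x) / 2 by field.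
      have -> : (z + x) / 2 - (x + y) / 2 = (z - y) / 2 by field.
      have -> : x - (z + x) / 2 = (x - z) / 2 by field.
      by rewrite !cmod_half -!mulrDl.
    - by rewrite subrr cmod0 /S /perimeter !addr_ge0 ?cmod_ge0.
  have [h2|h2] := leP (I0 / 4) (cmod (tri f (mid x y) y (mid y z))).
    exists (mid x y, y, mid y z) => _; split=> //=.
    - rewrite /S /perimeter /= !midE.
      have -> : y - (x + y) / 2 = (y - x) / 2 by field.
      have -> : (y + z) / 2 - y = (z - y) / 2 by field.
      have -> : (x + y) / 2 - (y + z) / 2 = (x - z) / 2 by field.
      by rewrite !cmod_half -!mulrDl.
    - rewrite /S /perimeter /= midE.
      have -> : (x + y) / 2 - x = (y - x) / 2 by field.
      by rewrite cmod_half; have := n0; move=> [[? ?] ?]; lra.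
  have [h3|h3] := leP (I0 / 4) (cmod (tri f (mid z x) (mid y z) z)).
    exists (mid z x, mid y z, z) => _; split=> //=.
    - rewrite /S /perimeter /= !midE.
      have -> : (y + z) / 2 - (z + x) / 2 = (y - x) / 2 by field.
      have -> : z - (y + z) / 2 = (z - y) / 2 by field.
      have -> : (z + x) / 2 - z = (x - z) / 2 by field.
      by rewrite !cmod_half -!mulrDl.
    - rewrite /S /perimeter /= midE.
      have -> : (z + x) / 2 - x = - ((x - z) / 2) by field.
      by rewrite cmodN cmod_half; have := n0; move=> [[? ?] ?]; lra.
  exists (mid x y, mid y z, mid z x) => _; split=> //=.
  - have : I0 <= cmod (tri f x (mid x y) (mid z x)) +
        cmod (tri f (mid x y) y (mid y z)) + cmod (tri f (mid z x) (mid y z) z) +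
        cmod (tri f (mid x y) (mid y z) (mid z x)).
      rewrite /I0 split4; apply: le_trans (cmodD _ _) _; rewrite lerD2r.
      by apply: le_trans (cmodD _ _) _; rewrite lerD2r cmodD.
    rewrite /I /= -/I0; lra.
  - rewrite /S /perimeter /= !midE.
    have -> : (y + z) / 2 - (x + y) / 2 = - ((x - z) / 2) by field.
    have -> : (z + x) / 2 - (y + z) / 2 = - ((y - x) / 2) by field.
    have -> : (x + y) / 2 - (z + x) / 2 = - ((z - y) / 2) by field.
    by rewrite !cmodN !cmod_half; lra.
  - rewrite /S /perimeter /= midE.
    have -> : (x + y) / 2 - x = (y - x) / 2 by field.
    by rewrite cmod_half; have := n0; move=> [[? ?] ?]; lra.
have [nx hnx] := choice step.
pose T n := iter n nx (a, b, c).
have gT n : good (T n) by elim: n => [|n /hnx[]//]; split.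
have hS n : S (T n.+1) = S (T n) / 2 by case: (hnx _ (gT n)).
have [p hp] := @cnested_limit (fun n => (T n).1.1) (fun n => S (T n))
  (fun n => let: And4 _ _ _ h := hnx _ (gT n) in h) hS.
have hSn n : S (T n) = S (T 0%N) / 2 ^+ n.
  elim: n => [|n ih]; first by rewrite expr0 divr1.
  by rewrite hS ih exprSr invfM mulrA.
have hIn n : I (T 0%N) / 4 ^+ n <= I (T n).
  elim: n => [|n ih]; first by rewrite expr0 divr1.
  case: (hnx _ (gT n)) => _ h _ _; apply: le_trans h.
  by rewrite exprSr invfM mulrA ler_wpM2r.
have S0 : 0 <= S (T 0%N) by rewrite /S /perimeter !addr_ge0 ?cmod_ge0.
have small e : 0 < e -> exists n, 6 * S (T n) < e.
  move=> e0; have [n hn] : exists n, 6 * S (T 0%N) / e < 2 ^+ n.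
    exists (Num.bound (6 * S (T 0%N) / e)).
    have h1 : 6 * S (T 0%N) / e < (Num.bound (6 * S (T 0%N) / e))%:R.
      by apply: archi_boundP; rewrite divr_ge0 ?mulr_ge0 // ltW.
    by apply: lt_le_trans h1 _; rewrite -natrX ler_nat ltnW // ltn_expl.
  exists n; rewrite hSn mulrA ltr_pdivrMr ?exprn_gt0 //.
  by rewrite [ltRHS]mulrC -ltr_pdivrMr.
have Kp : K p.
  apply: Kl => e /small[n hn]; exists (T n).1.1; first by case: (gT n).
  apply: le_lt_trans (hp n) _; apply: le_lt_trans hn.
  by rewrite ler_wpM2r // /S /perimeter ?addr_ge0 ?cmod_ge0 // ler_nat.
have [d [u [v [hu hv hd]]]] := hf p Kp.
(* the affine part of [f] at the limit point has zero integral over every triangle *)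
have near0 e : 0 < e -> \forall w \near (p : C^o),
    cmod (f w - (f p - d * p + d * w)) <= e * cmod (w - p).
  move=> e0; have e2 : 0 < e / 2 by rewrite divr_gt0.
  have := (hu _ e2, hv _ e2, hd); move=> [[h1 h2] h3].
  apply: filterS3 h1 h2 h3 => w; rewrite subr0 => h1 h2 h3.
  have -> : f w - (f p - d * p + d * w) =
      (w - p) * (u w - d) + (w - p)^*%C * v w.
    have -> : f w = f p + (f w - f p) by ring.
    by rewrite h3; ring.
  apply: le_trans (cmodD _ _) _; rewrite !cmodM cmodJ -mulrDr mulrC.
  by rewrite ler_wpM2r ?cmod_ge0 // (splitr e) lerD ?ltW.
have : forall e, 0 < e -> I (T 0%N) <= e * (12 * S (T 0%N) ^+ 2).
  move=> e e0; have /near_cmodP[del del0 hdel] := near0 e e0.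
  have [n hn] := small del del0.
  have [] := gT n; move: (hp n) hn; rewrite /I /S.
  have := hIn n; rewrite {2}/I /=.
  case: (T n) (hSn n) => [[x y] z] /=.
  rewrite {1}/S /= => eS hI hxp hn Kx Ky Kz.
  set s := perimeter x y z in eS hxp hn *.
  have n0 := (cmod_ge0 (y - x), cmod_ge0 (z - y), cmod_ge0 (x - z)).
  have cf := cont3 _ _ _ Kx Ky Kz.
  pose aff w := f p - d * p + d * w.
  have caff v1 v2 : cont_on aff v1 v2.
    move=> t ht; apply: climD; first exact: clim_cst.
    by apply: climM; [exact: clim_cst|exact: clim_id].
  have eq0 : tri f x y z = tri (fun w => f w - aff w) x y z.
    by rewrite triB // tri_affine subr0.
  have lineB v1 v2 (t : R) : 0 <= t <= 1 -> cmod (v1 - p) <= 5 * s ->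
      cmod (v2 - v1) <= s -> cmod (f (line v1 v2 t) - aff (line v1 v2 t)) <= e * (6 * s).
    move=> /andP[t0 t1] h1 h2.
    have h3 : cmod (line v1 v2 t - p) <= 6 * s.
      have -> : line v1 v2 t - p = (v1 - p) + t%:C * (v2 - v1) by rewrite /line; ring.
      apply: le_trans (cmodD _ _) _; rewrite cmodM cmodR ger0_norm //.
      have : t * cmod (v2 - v1) <= 1 * cmod (v2 - v1) by rewrite ler_wpM2r ?cmod_ge0.
      by lra.
    apply: le_trans (hdel _ _) _; last by rewrite ler_wpM2l // ltW.
    exact: le_lt_trans h3 hn.
  have s0 : 0 <= s by rewrite /s /perimeter !addr_ge0 ?cmod_ge0.
  have hyp : cmod (y - p) <= 5 * s.
    have -> : y - p = (y - x) + (x - p) by ring.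
    apply: le_trans (cmodD _ _) _; move: n0 => [[? ?] ?].
    have : cmod (y - x) <= s by rewrite /s /perimeter; lra.
    by lra.
  have hzp : cmod (z - p) <= 5 * s.
    have -> : z - p = - (x - z) + (x - p) by ring.
    apply: le_trans (cmodD _ _) _; rewrite cmodN; move: n0 => [[? ?] ?].
    have : cmod (x - z) <= s by rewrite /s /perimeter; lra.
    by lra.
  have bnd : cmod (tri f x y z) <= 2 * (e * (6 * s)) * s.
    rewrite eq0; apply: tri_bound; first exact: cont_triB.
    move=> t ht; move: n0 => [[? ?] ?]; split; apply: lineB => //;
      rewrite ?/s ?/perimeter; try lra.
    by move: hxp; rewrite /s /perimeter; lra.
  have hh : I (T 0%N) / 4 ^+ n <= e * (12 * s ^+ 2).
    by apply: le_trans hI _; apply: le_trans bnd _; rewrite expr2; lra.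
  move: hh; rewrite eS expr_div_n.
  have -> : ((2 : R) ^+ n) ^+ 2 = 4 ^+ n by rewrite -exprM mulnC exprM -natrX.
  rewrite !mulrA ler_pM2r // invr_gt0 exprn_gt0 //.
move=> hI; apply/eqP; rewrite -cmod_eq0 eq_le cmod_ge0 andbT.
apply/ler_addgt0Pr => e e0; rewrite add0r.
have c0 : 0 < 12 * S (T 0%N) ^+ 2 + 1 by rewrite ltr_wpDl // mulr_ge0 ?sqr_ge0.
have := hI (e / (12 * S (T 0%N) ^+ 2 + 1)); rewrite divr_gt0 // => /(_ isT).
move=> /le_trans; apply; rewrite mulrAC ler_pdivrMr // ler_wpM2l ?(ltW e0) //; lra.
Qed.

End Goursat.

(** * Cauchy's formula and regularity *)

Section Regularity.
Variable R : realType.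
Local Notation C := R[i].
Implicit Types (z w a b c : C) (f g : C -> C).

(** Twice the signed area of the triangle [0, a, b]. *)
Definition cross a b : R := complex.Im (a^*%C * b).

Lemma crossE a b : cross a b =
  complex.Re a * complex.Im b - complex.Im a * complex.Re b.
Proof. by rewrite /cross cImM cReJ cImJ mulNr. Qed.

(** Moving along the line does not change the area; [0 < cross (a - w) (b - w)] says
    that [w] lies strictly to the left of the edge from [a] to [b]. *)
Lemma cross_line a b w (t : R) :
  cross (line a b t - w) (b - a) = cross (a - w) (b - w).
Proof.
rewrite !crossE /line !cReB !cImB !cReD !cImD !cReMr !cImMr !cReB !cImB; ring.
Qed.

Lemma cross_le a b : cross a b <= cmod a * cmod b.
Proof.
apply: le_trans (ler_norm _) _; apply: le_trans (cmod_Im _) _.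
by rewrite cmodM cmodJ.
Qed.

Lemma cross_line_neq a b w (t : R) : 0 < cross (a - w) (b - w) -> line a b t - w != 0.
Proof.
rewrite -(cross_line a b w t); apply: contraTneq => ->.
by rewrite crossE /= !mul0r subrr ltxx.
Qed.

Lemma invE z : z != 0 -> z^-1 = ((cmod z ^+ 2)^-1)%:C * z^*%C.
Proof.
move=> z0; apply: (mulfI z0); rewrite mulfV // mulrCA cmod_sqr -rmorphM /=.
by rewrite mulVf // expf_neq0 // cmod_eq0.
Qed.

Lemma cont_on_pole f a b w n : cont_on f a b ->
  (forall t : R, 0 <= t <= 1 -> line a b t - w != 0) ->
  cont_on (fun z => f z * (z - w) ^- n) a b.
Proof.
move=> hf hn t ht; apply: climM; first exact: hf.
apply: climV; last by rewrite expf_neq0 // hn.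
elim: n => [|n ih]; first exact: clim_cst.
rewrite exprS; have -> : (fun x => (x - w) ^+ n.+1) = (fun x => (x - w) * (x - w) ^+ n).
  by apply/funext => x; rewrite exprS.
by apply: climM => //; apply: climB; [exact: clim_id|exact: clim_cst].
Qed.

(** The winding integral of an edge seen from its left has positive imaginary
    part, so the winding number of a triangle around an interior point does not
    vanish. *)
Lemma seg_inv_Im a b w : 0 < cross (a - w) (b - w) ->
  0 < complex.Im (seg (fun z => 1 * (z - w) ^- 1) a b).
Proof.
move=> hx; have hn t (ht : 0 <= t <= 1 :> bool) := @cross_line_neq a b w t hx.
have /segP[G [hG ->]] : cont_on (fun z => 1 * (z - w) ^- 1) a b.
  by apply: (@cont_on_pole (fun=> 1)) => [|t _]; [exact: cont_on_cst|exact: cross_line_neq].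
have hd (t : R) : 0 <= t <= 1 -> is_derive t 1 (fun s => complex.Im (G s))
    ((cmod (line a b t - w) ^+ 2)^-1 * cross (a - w) (b - w)).
  move=> ht; have /cderP[_] := hG t ht.
  rewrite mul1r expr1 invE ?cross_line_neq // mulrCA cImMr mulrC.
  by rewrite -(cross_line a b w t) /cross [(b - a) * _]mulrC mulrC.
have [|t|x|t ht] := @MVT R (fun s => complex.Im (G s))
  (fun t => (cmod (line a b t - w) ^+ 2)^-1 * cross (a - w) (b - w)) 0 1.
- exact: ltr01.
- by rewrite in_itv /= => /andP[h0 h1]; apply: hd; rewrite !ltW.
- apply: derivable_within_continuous => t.
  by rewrite in_itv /= => ht; apply: ex_derive; exact: hd.
rewrite cImB subr0 mulr1 => ->.
by rewrite mulr_gt0 // invr_gt0 exprn_gt0 // cmod_gt0 cross_line_neq.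
Qed.

Lemma small_scale (A B d e : R) : 0 <= A -> 0 <= B -> 0 < d -> 0 < e ->
  exists s : R, [/\ 0 < s, s <= 1, s * A < d & s * B <= e].
Proof.
move=> A0 B0 d0 e0; have A1 : 0 < A + 1 by rewrite ltr_wpDl.
have B1 : 0 < B + 1 by rewrite ltr_wpDl.
exists (Num.min 1 (Num.min (d / (A + 1)) (e / (B + 1)))); split.
- by rewrite !lt_min ltr01 !divr_gt0.
- by rewrite ge_min lexx.
- apply: le_lt_trans (_ : d / (A + 1) * A < d).
    by rewrite ler_wpM2r // !ge_min lexx !orbT.
  by rewrite mulrAC ltr_pdivrMr // ltr_pM2l //; lra.
- apply: le_trans (_ : e / (B + 1) * B <= e).
    by rewrite ler_wpM2r // !ge_min lexx !orbT.
  by rewrite mulrAC ler_pdivrMr // ler_pM2l //; lra.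
Qed.

(** The singular vertex [w] is harmless: Goursat's theorem on the part of the
    triangle away from [w] replaces it by a similar triangle as small as wanted,
    over which a bounded integrand has a small integral. *)
Lemma tri_vertex (D : C -> Prop) g w a b : convex_closed D -> D w -> D a -> D b ->
  (forall z, D z -> cont_at g z) ->
  (forall z, D z -> z != w -> exists d, wder g z d 0) ->
  0 < cross (a - w) (b - w) -> tri g w a b = 0.
Proof.
move=> hD Dw Da Db cg dg k0; set k := cross _ _ in k0.
have contD u v : D u -> D v -> cont_on g u v.
  by move=> hu hv t ht; apply: cg; apply: hD.1.
have shrink (s : R) : 0 < s -> s <= 1 ->
    tri g w a b = tri g w (line w a s) (line w b s).
  move=> s0 s1; have hs : 0 <= s <= 1 by rewrite (ltW s0) s1.
  set a' := line w a s; set b' := line w b s.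
  have Da' : D a' by exact: hD.1.
  have Db' : D b' by exact: hD.1.
  (* the part of the domain on the far side of the line through a' and b' *)
  pose L z := D z /\ s * k <= complex.Im ((z - w)^*%C * (b - a)).
  have cL : convex_closed L.
    by apply: convex_closedI => //; exact: halfplane_convex_closed.
  have kE : cross (a - w) (b - a) = k by rewrite -{1}(line0 a b) cross_line.
  have kE' : cross (b - w) (b - a) = k by rewrite -{1}(line1 a b) cross_line.
  have scale v : line w v s - w = s%:C * (v - w) by rewrite /line addrC addKr.
  have crossZ u v : cross (s%:C * u) v = s * cross u v.
    by rewrite /cross cJM conjc_real -mulrA cImMr.
  have La : L a by split=> //; rewrite -/(cross _ _) kE ler_piMl // ltW.
  have Lb : L b by split=> //; rewrite -/(cross _ _) kE' ler_piMl // ltW.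
  have La' : L a' by split=> //; rewrite -/(cross _ _) scale crossZ kE.
  have Lb' : L b' by split=> //; rewrite -/(cross _ _) scale crossZ kE'.
  have dL z : L z -> exists d, wder g z d 0.
    move=> [Dz hz]; apply: dg => //; apply: contraTneq hz => ->.
    by rewrite subrr conjc0 mul0r /= -ltNge mulr_gt0.
  have t1 := goursat cL dL La Lb Lb'.
  have t2 := goursat cL dL La Lb' La'.
  have e1 := seg_split (contD _ _ Dw Da) hs.
  have e2 := seg_split (contD _ _ Dw Db) hs.
  move: t1 t2; rewrite /tri -/a' -/b' in e1 e2 *.
  rewrite e1 (seg_opp (contD _ _ Dw Db)) e2 (seg_opp (contD _ _ Dw Db')).
  rewrite (seg_opp (contD _ _ Da' Db')) (seg_opp (contD _ _ Da Db')).
  rewrite (seg_opp (contD _ _ Db' Db)) -/a' -/b' => t1 t2.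
  apply/eqP; rewrite -subr_eq0; apply/eqP.
  by rewrite -[RHS](addr0 0) -{1}t1 -t2; ring.
have [e /= e0 he] : exists2 e : R, 0 < e &
    forall z, cmod (z - w) < e -> cmod (g z) <= cmod (g w) + 1.
  apply/near_cmodP; have := cg w Dw 1 ltr01; apply: filterS => z h.
  have -> : g z = g w + (g z - g w) by ring.
  by apply: le_trans (cmodD _ _) _; rewrite lerD2l ltW.
set M := cmod (g w) + 1 in he; have M0 : 0 <= M by rewrite addr_ge0 ?cmod_ge0.
pose P := cmod (a - w) + cmod (b - w).
have P0 : 0 <= P by rewrite addr_ge0 ?cmod_ge0.
apply/eqP; rewrite -cmod_eq0 eq_le cmod_ge0 andbT.
apply/ler_addgt0Pr => eps eps0; rewrite add0r.
have [|s [s0 s1 hsd hse]] := @small_scale P (8 * M * P) e eps P0 _ e0 eps0.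
  by rewrite !mulr_ge0.
rewrite (shrink s s0 s1); apply: le_trans hse.
have hs : 0 <= s <= 1 by rewrite (ltW s0) s1.
have Da' : D (line w a s) by exact: hD.1.
have Db' : D (line w b s) by exact: hD.1.
have scale v : line w v s - w = s%:C * (v - w) by rewrite /line addrC addKr.
have ha' : cmod (line w a s - w) <= s * P.
  rewrite scale cmodM cmodR ger0_norm ?(ltW s0) // ler_wpM2l ?(ltW s0) //.
  by rewrite lerDl cmod_ge0.
have hb' : cmod (line w b s - w) <= s * P.
  rewrite scale cmodM cmodR ger0_norm ?(ltW s0) // ler_wpM2l ?(ltW s0) //.
  by rewrite lerDr cmod_ge0.
have hw : cmod (w - w) <= s * P by rewrite subrr cmod0 mulr_ge0 // ltW.
have hB := disc_convex_closed w (s * P).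
apply: le_trans (tri_bound _ (M := M) _) _; first by split; apply: contD.
  move=> t ht; split; apply: he; apply: le_lt_trans hsd; exact: hB.1.
have h3 : cmod (line w b s - line w a s) <= 2 * (s * P).
  have -> : line w b s - line w a s = (line w b s - w) - (line w a s - w) by ring.
  by apply: le_trans (cmodD _ _) _; rewrite cmodN; lra.
apply: le_trans (_ : 2 * M * (s * P + 2 * (s * P) + s * P) <= _); last lra.
by rewrite ler_wpM2l ?mulr_ge0 // !lerD // cmodB.
Qed.

(** Goursat's theorem for the difference quotient of [f] at [w], on the three
    triangles that [w] spans with the edges. *)
Lemma cauchy_formula (D : C -> Prop) f w a b c : convex_closed D ->
  D w -> D a -> D b -> D c -> (forall z, D z -> exists d, wder f z d 0) ->
  0 < cross (a - w) (b - w) -> 0 < cross (b - w) (c - w) ->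
  0 < cross (c - w) (a - w) ->
  f w * tri (fun z => 1 * (z - w) ^- 1) a b c = tri (fun z => f z * (z - w) ^- 1) a b c.
Proof.
move=> hD Dw Da Db Dc hf h1 h2 h3.
have [d0 hd0] := hf w Dw.
pose g z := if z == w then d0 else (f z - f w) * (z - w)^-1.
have dg z : D z -> z != w -> exists d, wder g z d 0.
  move=> Dz zw; have [d hd] := hf z Dz.
  have zw0 : z - w != 0 by rewrite subr_eq0.
  pose d1 := (d - 0) * (z - w)^-1 + (f z - f w) * (- (1 - 0) / (z - w) ^+ 2).
  have : wder (fun x => (f x - f w) * (x - w)^-1) z d1
      ((0 - 0) * (z - w)^-1 + (f z - f w) * (- (0 - 0) / (z - w) ^+ 2)).
    apply: wderM; first by apply: wderB => //; exact: wder_cst.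
    by apply: wderV => //; apply: wderB; [exact: wder_id|exact: wder_cst].
  rewrite subrr oppr0 !mul0r mulr0 addr0 => h; exists d1; apply: wder_near h.
  have h4 : \forall x \near (z : C^o), x - w != 0.
    have h5 : clim (nbhs (z : C^o)) (fun x => x - w) (z - w).
      by apply: climB; [exact: clim_id|exact: clim_cst].
    exact: clim_neq0 h5 zw0.
  by apply: filterS h4 => x; rewrite subr_eq0 /g => /negPf ->.
have cgw : cont_at g w.
  move=> e e0; have e2 : 0 < e / 2 by rewrite divr_gt0.
  move: hd0 => [u [v [hu hv hE]]].
  apply: filterS3 (hu _ e2) (hv _ e2) hE => z; rewrite subr0 => k1 k2 k3.
  rewrite /g eqxx; have [_|zw] := eqVneq z w; first by rewrite subrr cmod0.
  have zw0 : z - w != 0 by rewrite subr_eq0.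
  have -> : (f z - f w) / (z - w) - d0 = (u z - d0) + (z - w)^*%C / (z - w) * v z.
    by rewrite k3; field.
  apply: le_lt_trans (cmodD _ _) _; rewrite (splitr e) ltrD //.
  by rewrite cmodM cmodM cmodV cmodJ mulfV ?mul1r // cmod_eq0.
have cg z : D z -> cont_at g z.
  move=> Dz; have [->//|zw] := eqVneq z w.
  by have [d] := dg z Dz zw; exact: wder_clim.
have contD u v : D u -> D v -> cont_on g u v.
  by move=> hu hv t ht; apply: cg; apply: hD.1.
have contf u v : D u -> D v -> cont_on f u v.
  by move=> hu hv t ht; have [d] := hf _ (hD.1 _ _ _ hu hv ht); exact: wder_clim.
have t1 := tri_vertex hD Dw Da Db cg dg h1.
have t2 := tri_vertex hD Dw Db Dc cg dg h2.
have t3 := tri_vertex hD Dw Dc Da cg dg h3.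
have tg : tri g a b c = 0.
  have -> : tri g a b c = tri g w a b + tri g w b c + tri g w c a.
    rewrite /tri (seg_opp (contD _ _ Dw Da)) (seg_opp (contD _ _ Dw Db)).
    by rewrite (seg_opp (contD _ _ Dw Dc)); ring.
  by rewrite t1 t2 t3 !addr0.
have edge u v : D u -> D v -> 0 < cross (u - w) (v - w) ->
    seg g u v = seg (fun z => f z * (z - w) ^- 1) u v -
                f w * seg (fun z => 1 * (z - w) ^- 1) u v.
  move=> Du Dv huv; have hn t (ht : 0 <= t <= 1 :> bool) := @cross_line_neq u v w t huv.
  have c1 : cont_on (fun z => 1 * (z - w) ^- 1) u v.
    by apply: (@cont_on_pole (fun=> 1)) => [|t _]; [exact: cont_on_cst|exact: cross_line_neq].
  have c2 : cont_on (fun z => f z * (z - w) ^- 1) u v.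
    by apply: cont_on_pole => [|t _]; [exact: contf|exact: cross_line_neq].
  rewrite -segZ // -segB //; last by apply: cont_onM => //; exact: cont_on_cst.
  apply: seg_eq => t ht; rewrite /g; have := @cross_line_neq u v w t huv.
  by rewrite subr_eq0 => /negPf ->; rewrite expr1; ring.
apply/eqP; rewrite eq_sym -subr_eq0 -tg /tri !edge //; apply/eqP; ring.
Qed.

Lemma wder_eps2 F z (d d' : C) :
  (forall e : R, 0 < e -> \forall v \near (z : C^o),
     cmod (F v - F z - ((v - z) * d + (v - z)^*%C * d')) <= e * cmod (v - z)) ->
  wder F z d d'.
Proof.
move=> h; pose rem v := F v - F z - ((v - z) * d + (v - z)^*%C * d').
exists (fun v => if v == z then d else d + rem v / (v - z)), (fun=> d').
split; last 1 first.
- near=> v; have [->|vz] := eqVneq v z; first by rewrite !subrr conjc0 !mul0r addr0.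
  have v0 : v - z != 0 by rewrite subr_eq0.
  by rewrite /rem; field.
- move=> e e0; have e2 : 0 < e / 2 by rewrite divr_gt0.
  apply: filterS (h _ e2) => v hv; have [_|vz] := eqVneq v z.
    by rewrite subrr cmod0.
  have v0 : v - z != 0 by rewrite subr_eq0.
  rewrite addrC addKr cmodM cmodV ltr_pdivrMr ?cmod_gt0 //.
  apply: le_lt_trans hv _; rewrite ltr_pM2r ?cmod_gt0 //; lra.
- exact: clim_cst.
Unshelve. all: by end_near. Qed.

Lemma wder_eps F z (d : C) :
  (forall e : R, 0 < e -> \forall v \near (z : C^o),
     cmod (F v - F z - (v - z) * d) <= e * cmod (v - z)) -> wder F z d 0.
Proof.
move=> h; apply: wder_eps2 => e /h; apply: filterS => v.
by rewrite mulr0 addr0.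
Qed.

(** Integrals of poles are differentiated through an explicit quadratic remainder. *)
Lemma wder_quadratic F z (d : C) (B : R) :
  (\forall v \near (z : C^o),
     cmod (F v - F z - (v - z) * d) <= B * cmod (v - z) ^+ 2) -> wder F z d 0.
Proof.
move=> h; apply: wder_eps => e e0.
have c0 : 0 < `|B| + 1 by rewrite ltr_wpDl.
have := @clim_id R z (e / (`|B| + 1)); rewrite divr_gt0 // => /(_ isT).
apply: filterS2 h => v h1 h2; apply: le_trans h1 _; rewrite expr2 mulrA.
rewrite ler_wpM2r ?cmod_ge0 //; apply: le_trans (_ : (`|B| + 1) * cmod (v - z) <= _).
  by rewrite ler_wpM2r ?cmod_ge0 //; have := ler_norm B; lra.
by rewrite mulrC -ler_pdivlMr // ltW.
Qed.

Section Kernel.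
Variables (f : C -> C) (a b w : C) (M d eta : R).
Hypotheses (cf : cont_on f a b) (d0 : 0 < d) (eta0 : 0 < eta).
Hypothesis hM : forall t : R, 0 <= t <= 1 -> cmod (f (line a b t)) <= M.
Hypothesis hd : forall v (t : R), cmod (v - w) < eta -> 0 <= t <= 1 ->
  d <= cmod (line a b t - v).

Let M0 : 0 <= M.
Proof.
by apply: le_trans (cmod_ge0 _) (hM (t := 0) _); rewrite lexx ler01.
Qed.

Let hneq v (t : R) : cmod (v - w) < eta -> 0 <= t <= 1 -> line a b t - v != 0.
Proof. by move=> h1 h2; rewrite -cmod_gt0; apply: lt_le_trans d0 (hd h1 h2). Qed.

Let ww : cmod (w - w) < eta. Proof. by rewrite subrr cmod0. Qed.

Let inv_le v (t : R) n : cmod (v - w) < eta -> 0 <= t <= 1 ->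
  cmod ((line a b t - v) ^- n) <= d ^- n.
Proof.
move=> h1 h2; rewrite cmodV cmodX lef_pV2 ?posrE ?exprn_gt0 ?cmod_gt0 ?hneq //.
by rewrite lerXn2r ?nnegrE ?cmod_ge0 ?(ltW d0) ?hd.
Qed.

Lemma wder_pole1 : wder (fun v => seg (fun z => f z * (z - v) ^- 1) a b) w
  (seg (fun z => f z * (z - w) ^- 2) a b) 0.
Proof.
apply: (wder_quadratic (B := 2 * (cmod (b - a) * (M * (d ^- 1 * d ^- 2))))).
have := @clim_id R w eta eta0; apply: filterS => v hv.
have cp u n : cmod (u - w) < eta -> cont_on (fun z => f z * (z - u) ^- n) a b.
  by move=> hu; apply: cont_on_pole => // t; exact: hneq.
rewrite -segB; [|exact: cp..].
rewrite -segZ; last exact: cp.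
rewrite -segB; last first.
- by apply: cont_onM; [exact: cont_on_cst|exact: cp].
- by move=> t ht; apply: climB; apply: cp.
rewrite (@seg_eq _ _ (fun z => (v - w) ^+ 2 * (f z * (z - v) ^- 1 * (z - w) ^- 2))); last first.
  by move=> t ht; have n1 := hneq hv ht; have n2 := hneq ww ht; field; rewrite n1 n2.
have cc : cont_on (fun z => f z * (z - v) ^- 1 * (z - w) ^- 2) a b.
  by apply: cont_on_pole => [|t]; [exact: cp|exact: hneq].
rewrite segZ // cmodM cmodX mulrC ler_wpM2r ?sqr_ge0 //.
apply: seg_bound => // t ht; rewrite -mulrA 2!cmodM.
by rewrite ler_pM ?mulr_ge0 ?cmod_ge0 ?hM // ler_pM ?cmod_ge0 ?inv_le.
Qed.

Lemma wder_pole2 : wder (fun v => seg (fun z => f z * (z - v) ^- 2) a b) w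
  (seg (fun z => 2 * (f z * (z - w) ^- 3)) a b) 0.
Proof.
apply: (wder_quadratic (B := 2 * (cmod (b - a) *
  (M * (d ^- 2 * d ^- 2) + 2 * (M * (d ^- 1 * d ^- 3)))))).
have := @clim_id R w eta eta0; apply: filterS => v hv.
have cp u n : cmod (u - w) < eta -> cont_on (fun z => f z * (z - u) ^- n) a b.
  by move=> hu; apply: cont_on_pole => // t; exact: hneq.
have cp2 : cont_on (fun z => 2 * (f z * (z - w) ^- 3)) a b.
  by apply: cont_onM; [exact: cont_on_cst|exact: cp].
rewrite -segB; [|exact: cp..].
rewrite -segZ; last exact: cp2.
rewrite -segB; last first.
- by apply: cont_onM; [exact: cont_on_cst|exact: cp2].
- by move=> t ht; apply: climB; apply: cp.
rewrite (@seg_eq _ _ (fun z => (v - w) ^+ 2 * (f z * (z - v) ^- 2 * (z - w) ^- 2 +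
    2 * (f z * (z - v) ^- 1 * (z - w) ^- 3)))); last first.
  by move=> t ht; have n1 := hneq hv ht; have n2 := hneq ww ht; field; rewrite n1 n2.
have cc m n : cont_on (fun z => f z * (z - v) ^- m * (z - w) ^- n) a b.
  by apply: cont_on_pole => [|t]; [exact: cp|exact: hneq].
have cc2 : cont_on (fun z => f z * (z - v) ^- 2 * (z - w) ^- 2 +
    2 * (f z * (z - v) ^- 1 * (z - w) ^- 3)) a b.
  by apply: cont_onD => //; apply: cont_onM => //; exact: cont_on_cst.
rewrite segZ // cmodM cmodX mulrC ler_wpM2r ?sqr_ge0 //.
apply: seg_bound => // t ht; apply: le_trans (cmodD _ _) _.
have c2 : cmod (2 : C) = 2.
  by have -> : (2 : C) = (2 : R)%:C; [rewrite rmorph_nat|rewrite cmodR ger0_norm].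
have bb m n : cmod (f (line a b t) * (line a b t - v) ^- m * (line a b t - w) ^- n)
    <= M * (d ^- m * d ^- n).
  rewrite -mulrA 2!cmodM.
  by rewrite ler_pM ?mulr_ge0 ?cmod_ge0 ?hM // ler_pM ?cmod_ge0 ?inv_le.
by apply: lerD; rewrite ?cmodM -?cmodM ?bb // cmodM c2 ler_wpM2l // bb.
Qed.

End Kernel.

Definition hol f z := exists d, wder f z d 0.

Lemma hol_cst (k : C) z : hol (fun=> k) z.
Proof. by exists 0; exact: wder_cst. Qed.

Lemma hol_id z : hol id z.
Proof. by exists 1; exact: wder_id. Qed.

Lemma holD f g z : hol f z -> hol g z -> hol (fun w => f w + g w) z.
Proof.
by move=> [d h] [e k]; exists (d + e); rewrite -(addr0 (0 : C)); exact: wderD.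
Qed.

Lemma holN f z : hol f z -> hol (fun w => - f w) z.
Proof. by move=> [d h]; exists (- d); rewrite -oppr0; exact: wderN. Qed.

Lemma holB f g z : hol f z -> hol g z -> hol (fun w => f w - g w) z.
Proof. by move=> h k; apply: holD => //; exact: holN. Qed.

Lemma holM f g z : hol f z -> hol g z -> hol (fun w => f w * g w) z.
Proof.
move=> [d h] [e k]; exists (d * g z + f z * e).
have -> : (0 : C) = 0 * g z + f z * 0 by rewrite mul0r mulr0 addr0.
exact: wderM.
Qed.

Lemma holV f z : hol f z -> f z != 0 -> hol (fun w => (f w)^-1) z.
Proof.
move=> [d h] f0; exists (- d / f z ^+ 2).
have -> : (0 : C) = - 0 / f z ^+ 2 by rewrite oppr0 mul0r.
exact: wderV.
Qed.

Lemma hol_near f g z : (\forall w \near (z : C^o), f w = g w) -> hol f z -> hol g z.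
Proof. by move=> h [d hd]; exists d; exact: wder_near hd. Qed.

Lemma hol_sum (I : Type) (r : seq I) (F : I -> C -> C) z :
  (forall i, hol (F i) z) -> hol (fun w => \sum_(i <- r) F i w) z.
Proof.
move=> h; elim: r => [|i r ih].
  by under eq_fun do rewrite big_nil; exact: hol_cst.
by under eq_fun do rewrite big_cons; exact: holD.
Qed.

Lemma hol_wder f z : hol f z -> wder f z (d_z f z) 0.
Proof. by move=> [d h]; have [-> _] := wder_d h. Qed.

Lemma derivable_hol f z : derivable (f : C^o -> C^o) z 1 -> hol f z.
Proof.
move=> /cvg_ex[/= l /ccvgP hl]; exists l; apply: wder_eps => e e0.
have := hl e e0; rewrite /dnbhs /within /= => /near_cmodP[rho rho0 h].
apply/near_cmodP; exists rho => // v hv.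
have [->|vz] := eqVneq v z; first by rewrite !subrr mul0r subrr cmod0 mulr0.
have v0 : v - z != 0 by rewrite subr_eq0.
have := h (v - z); rewrite subr0 => /(_ hv v0) /ltW.
rewrite /GRing.scale /= mulr1 subrK => h1.
have -> : f v - f z - (v - z) * l = (v - z) * ((v - z)^-1 * (f v - f z) - l).
  by field.
by rewrite cmodM mulrC ler_wpM2r ?cmod_ge0.
Qed.

Lemma holo_at_near f z : holo_at f z -> \forall w \near (z : C^o), hol f w.
Proof. by apply: filterS => w; exact: derivable_hol. Qed.

Lemma hol_poles f a b w (M d eta : R) : cont_on f a b -> 0 < d -> 0 < eta ->
  (forall t : R, 0 <= t <= 1 -> cmod (f (line a b t)) <= M) ->
  (forall v (t : R), cmod (v - w) < eta -> 0 <= t <= 1 -> d <= cmod (line a b t - v)) ->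
  wder (fun v => seg (fun z => f z * (z - v) ^- 1) a b) w
    (seg (fun z => f z * (z - w) ^- 2) a b) 0 /\
  hol (fun v => seg (fun z => f z * (z - v) ^- 2) a b) w.
Proof.
move=> cf d0 eta0 hM hd; split; first exact: (wder_pole1 cf d0 eta0 hM hd).
eexists; exact: (wder_pole2 cf d0 eta0 hM hd).
Qed.

(** A complex derivative is again complex differentiable: Cauchy's formula on a
    fixed triangle exhibits the function as a quotient of two integrals of
    simple poles, which can be differentiated at will. *)
Theorem holomorphic_regularity f z0 :
  (\forall w \near (z0 : C^o), hol f w) -> hol (d_z f) z0.
Proof.
move=> hf0.
have cf0 : \forall w \near (z0 : C^o), cmod (f w) <= cmod (f z0) + 1.
  have [d hd] : hol f z0 by exact: (nbhs_singleton hf0).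
  have := wder_clim hd ltr01; apply: filterS => z h.
  have -> : f z = f z0 + (f z - f z0) by ring.
  by apply: le_trans (cmodD _ _) _; rewrite lerD2l ltW.
have /near_cmodP[rho0 rho00 hrho] : \forall w \near (z0 : C^o),
    hol f w /\ cmod (f w) <= cmod (f z0) + 1.
  by apply: filterS2 hf0 cf0.
pose rho := rho0 / 2; have rhoP : 0 < rho by rewrite divr_gt0.
pose s := rho / 4; have s0 : 0 < s by rewrite divr_gt0.
pose D z := cmod (z - z0) <= rho.
have cD : convex_closed D := disc_convex_closed z0 rho.
have inD z : D z -> cmod (z - z0) < rho0.
  by rewrite /D /rho => h; apply: le_lt_trans h _; lra.
(* a triangle with [z0] well inside: [w] in the disc of radius [s / 16] stays at
   distance at least [s / 4] from all three edges *)
pose a := z0 + (2 * s +i* 0); pose b := z0 + ((- s) +i* s).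
pose c := z0 + ((- s) +i* (- s)).
have Dv (p q : R) : `|p| + `|q| <= rho -> D (z0 + (p +i* q)).
  move=> h; rewrite /D addrC addKr; apply: le_trans (cmod_le _) _; exact: h.
have Da : D a by apply: Dv; rewrite normr0 ger0_norm /s; lra.
have Db : D b by apply: Dv; rewrite normrN ger0_norm ?(ltW s0) // /s; lra.
have Dc : D c by apply: Dv; rewrite normrN ger0_norm ?(ltW s0) // /s; lra.
have crossB v : cmod (v - z0) < s / 8 -> [/\ s ^+ 2 <= cross (a - v) (b - v),
    s ^+ 2 <= cross (b - v) (c - v) & s ^+ 2 <= cross (c - v) (a - v)].
  move=> hv; have := le_lt_trans (cmod_Re _) hv; have := le_lt_trans (cmod_Im _) hv.
  rewrite cReB cImB !ltr_norml => /andP[q1 q2] /andP[p1 p2].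
  rewrite !crossE !cReB !cImB !cReD !cImD /=.
  set p := complex.Re v - complex.Re z0 in p1 p2; set q := complex.Im v - complex.Im z0 in q1 q2.
  have -> : complex.Re v = complex.Re z0 + p by rewrite /p addrC subrK.
  have -> : complex.Im v = complex.Im z0 + q by rewrite /q addrC subrK.
  have k1 : 0 <= s * (s - 3 * q - p) by rewrite mulr_ge0 ?(ltW s0) //; lra.
  have k2 : 0 <= s * (s + 2 * p) by rewrite mulr_ge0 ?(ltW s0) //; lra.
  have k3 : 0 <= s * (s + 3 * q - p) by rewrite mulr_ge0 ?(ltW s0) //; lra.
  split; lra.
have s2 : 0 < s ^+ 2 by rewrite exprn_gt0.
have lenB u v : `|complex.Re u - complex.Re v| + `|complex.Im u - complex.Im v| <= 4 * s ->
    cmod (u - v) <= 4 * s.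
  by move=> h; apply: le_trans (cmod_le _) _; rewrite cReB cImB.
have distB u v x (t : R) : s ^+ 2 <= cross (u - x) (v - x) -> cmod (v - u) <= 4 * s ->
    s / 4 <= cmod (line u v t - x).
  move=> h1 h2; rewrite -(cross_line u v x t) in h1.
  have h3 := le_trans h1 (cross_le _ _).
  have h4 : s ^+ 2 <= cmod (line u v t - x) * (4 * s).
    by apply: le_trans h3 _; rewrite ler_wpM2l ?cmod_ge0.
  rewrite -(ler_pM2r s0); move: h4; rewrite expr2; lra.
have lab : cmod (b - a) <= 4 * s.
  apply: lenB; rewrite /a /b !cReD !cImD /=.
  have -> : complex.Re z0 + - s - (complex.Re z0 + 2 * s) = - (3 * s) by ring.
  have -> : complex.Im z0 + s - (complex.Im z0 + 0) = s by ring.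
  by rewrite normrN !ger0_norm ?mulr_ge0 ?(ltW s0) //; lra.
have lbc : cmod (c - b) <= 4 * s.
  apply: lenB; rewrite /c /b !cReD !cImD /=.
  have -> : complex.Re z0 + - s - (complex.Re z0 + - s) = 0 by ring.
  have -> : complex.Im z0 + - s - (complex.Im z0 + s) = - (2 * s) by ring.
  by rewrite normrN normr0 !ger0_norm ?mulr_ge0 ?(ltW s0) //; lra.
have lca : cmod (a - c) <= 4 * s.
  apply: lenB; rewrite /c /a !cReD !cImD /=.
  have -> : complex.Re z0 + 2 * s - (complex.Re z0 + - s) = 3 * s by ring.
  have -> : complex.Im z0 + 0 - (complex.Im z0 + - s) = s by ring.
  by rewrite !ger0_norm ?mulr_ge0 ?(ltW s0) //; lra.
pose P g n v := tri (fun z => g z * (z - v) ^- n) a b c.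
have key g (M : R) : (forall z, D z -> cont_at g z) ->
    (forall z, D z -> cmod (g z) <= M) -> forall w, cmod (w - z0) < s / 16 ->
    wder (P g 1%N) w (P g 2%N w) 0 /\ hol (P g 2%N) w.
  move=> cg hM w hw.
  have hv v : cmod (v - w) < s / 16 -> cmod (v - z0) < s / 8.
    move=> h; have -> : v - z0 = (v - w) + (w - z0) by ring.
    by apply: le_lt_trans (cmodD _ _) _; lra.
  have edge u v : D u -> D v -> cmod (v - u) <= 4 * s ->
      (forall x, cmod (x - z0) < s / 8 -> s ^+ 2 <= cross (u - x) (v - x)) ->
      wder (fun y => seg (fun z => g z * (z - y) ^- 1) u v) w
        (seg (fun z => g z * (z - w) ^- 2) u v) 0 /\
      hol (fun y => seg (fun z => g z * (z - y) ^- 2) u v) w.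
    move=> Du Dv' luv huv; apply: (@hol_poles _ _ _ _ M (s / 4) (s / 16)).
    - by move=> t ht; apply: cg; apply: cD.1.
    - by rewrite divr_gt0.
    - by rewrite divr_gt0.
    - by move=> t ht; apply: hM; apply: cD.1.
    - by move=> x t hx _; apply: distB => //; apply: huv; exact: hv.
  have [e1 e1'] := edge a b Da Db lab (fun x hx => let: And3 h _ _ := crossB x hx in h).
  have [e2 e2'] := edge b c Db Dc lbc (fun x hx => let: And3 _ h _ := crossB x hx in h).
  have [e3 e3'] := edge c a Dc Da lca (fun x hx => let: And3 _ _ h := crossB x hx in h).
  split; last by do 2 apply: holD => //.
  by rewrite -(addr0 (0 : C)) -{1}(addr0 (0 : C)); do 2 apply: wderD => //.
have kf := key f (cmod (f z0) + 1).
have {}kf : forall w, cmod (w - z0) < s / 16 ->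
    wder (P f 1%N) w (P f 2%N w) 0 /\ hol (P f 2%N) w.
  apply: kf => z /inD /hrho[]// [d hd] _; exact: wder_clim hd.
have k1 : forall w, cmod (w - z0) < s / 16 ->
    wder (P (fun=> 1) 1%N) w (P (fun=> 1) 2%N w) 0 /\ hol (P (fun=> 1) 2%N) w.
  apply: (key _ 1) => z _; first exact: cont_cst.
  by rewrite cmod1.
pose N := P (fun=> 1) 1%N.
have hw8 w : cmod (w - z0) < s / 16 -> cmod (w - z0) < s / 8 by move=> h; lra.
have N0 w : cmod (w - z0) < s / 16 -> N w != 0.
  move=> /hw8 /crossB[x1 x2 x3].
  have : 0 < complex.Im (N w).
    by rewrite /N /P /tri !cImD !addr_gt0 //; apply: seg_inv_Im;
      apply: lt_le_trans s2 _.
  by apply: contraTneq => ->; rewrite /= ltxx.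
have fE w : cmod (w - z0) < s / 16 -> P f 1%N w * (N w)^-1 = f w.
  move=> hw; have /crossB[x1 x2 x3] := hw8 w hw.
  have Dw : D w by rewrite /D; apply: ltW; apply: lt_trans hw _; rewrite /s; lra.
  rewrite /P -(@cauchy_formula D f w a b c) //; try exact: lt_le_trans s2 _.
    by rewrite mulfK // N0.
  by move=> z /inD /hrho[].
have ball w : cmod (w - z0) < s / 16 -> \forall v \near (w : C^o), cmod (v - z0) < s / 16.
  move=> hw; have := @clim_id R w (s / 16 - cmod (w - z0)); rewrite subr_gt0 => /(_ hw).
  apply: filterS => v h; have -> : v - z0 = (v - w) + (w - z0) by ring.
  by apply: le_lt_trans (cmodD _ _) _; rewrite -ltrBrDr.
pose f1 w := P f 2%N w * (N w)^-1 + P f 1%N w * (- P (fun=> 1) 2%N w / N w ^+ 2).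
have wf w : cmod (w - z0) < s / 16 -> wder f w (f1 w) 0.
  move=> hw; have [h1 _] := kf w hw; have [h2 _] := k1 w hw.
  have h3 := wderV h2 (N0 w hw); have := wderM h1 h3.
  rewrite oppr0 !mul0r mulr0 addr0; apply: wder_near.
  by apply: filterS (ball w hw) => v; exact: fE.
have hz0 : cmod (z0 - z0) < s / 16 by rewrite subrr cmod0 divr_gt0.
have [a1 a2] := kf _ hz0; have [b1 b2] := k1 _ hz0.
have hN : hol N z0 by eexists; exact: b1.
apply: (@hol_near f1).
  apply: filterS (ball z0 hz0) => w hw.
  by have [-> _] := wder_d (wf w hw).
apply: holD; first by apply: holM => //; apply: holV => //; exact: N0.
apply: holM; first by eexists; exact: a1.
apply: holM; first exact: holN.
apply: holV; last by rewrite expf_neq0 // N0.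
by have -> : (fun w => N w ^+ 2) = (fun w => N w * N w) by []; exact: holM.
Qed.

(** Goursat's theorem makes the integral from the centre a primitive. *)
Lemma disc_primitive f : (forall z, cmod z < 1 -> hol f z) ->
  forall z, cmod z < 1 -> wder (seg f 0) z (f z) 0.
Proof.
move=> hf z hz; pose r := (1 + cmod z) / 2.
pose D v := cmod (v - 0) <= r; have cD : convex_closed D := disc_convex_closed 0 r.
have fD v : D v -> hol f v.
  by rewrite /D subr0 => h; apply: hf; apply: le_lt_trans h _; rewrite /r; lra.
have zD : D z by rewrite /D subr0 /r; lra.
have D0 : D 0 by rewrite /D subr0 cmod0 /r; have := cmod_ge0 z; lra.
have cont u v : D u -> D v -> cont_on f u v.
  by move=> hu hv t ht; have [d] := fD _ (cD.1 _ _ _ hu hv ht); exact: wder_clim.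
apply: wder_eps => e e0; have e2 : 0 < e / 2 by rewrite divr_gt0.
have r0 : 0 < (1 - cmod z) / 2 by rewrite divr_gt0 // subr_gt0.
have [d hd] := hf z hz.
have /near_cmodP[rho rho0 hrho] := wder_clim hd e2.
have hm : 0 < Num.min rho ((1 - cmod z) / 2) by rewrite lt_min rho0.
apply/near_cmodP; exists (Num.min rho ((1 - cmod z) / 2)) => // v.
rewrite lt_min => /andP[v1 v2].
have vD : D v.
  rewrite /D subr0; have -> : v = (v - z) + z by ring.
  by apply: le_trans (cmodD _ _) _; rewrite /r; lra.
have := goursat cD fD D0 zD vD; rewrite /tri (seg_opp (cont _ _ D0 vD)) => h.
have -> : seg f 0 v - seg f 0 z = seg f z v.
  by apply/eqP; rewrite eq_sym -subr_eq0; apply/eqP; rewrite -[RHS]h; ring.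
have -> : (v - z) * f z = seg (fun=> f z) z v.
  rewrite (@seg_primitive _ (fun w => w * f z)); first by ring.
  move=> t _; have := wderM (wder_id (line z v t)) (wder_cst (f z) (line z v t)).
  by rewrite mul0r !mulr0 !addr0 mul1r.
rewrite -segB; [|exact: cont|exact: cont_on_cst].
have -> : e * cmod (v - z) = 2 * (cmod (v - z) * (e / 2)) by field.
apply: seg_bound => [t ht|t /andP[t0 t1]].
  by apply: climB; [exact: cont|exact: clim_cst].
apply/ltW/hrho; apply: le_lt_trans v1.
have -> : line z v t - z = t%:C * (v - z) by rewrite /line addrC addKr.
by rewrite cmodM cmodR ger0_norm // ler_piMl ?cmod_ge0.
Qed.

End Regularity.

(** * Smooth functions and matrices of functions *)

Section SmoothFunctions.
Variable R : realType.
Local Notation C := R[i].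
Implicit Types (z w : C) (f g : C -> C) (U : set C).

Definition copen U := forall z, U z -> \forall w \near (z : C^o), U w.

Lemma punctured_open : copen (@punctured R).
Proof.
move=> z [z0 z1].
have h0 : \forall w \near (z : C^o), w != 0 by exact: clim_neq0 (clim_id z) z0.
have h : clim (nbhs (z : C^o)) (fun w => w - 1) (z - 1).
  by apply: climB; [exact: clim_id|exact: clim_cst].
have h1 : \forall w \near (z : C^o), w - 1 != 0.
  by apply: (clim_neq0 h); rewrite subr_eq0.
apply: filterS2 h0 h1 => w w0; rewrite subr_eq0 => w1; by split.
Qed.

Lemma Cn_on_cont U f : Cn_on 0 U f -> forall z, U z -> cont_at f z.
Proof. by move=> h z /h hz; apply/ccvgP; exact: hz. Qed.

(** The increment is taken along the two axes in turn; on each leg the mean value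
    inequality compares it with the partial derivative at [z]. *)
Lemma C1_wder U f z : copen U -> Cn_on 1 U f -> U z ->
  wder f z (d_z f z) (d_zbar f z).
Proof.
move=> oU [hd cx cy] Uz; apply: wder_eps2 => e e0.
have e4 : 0 < e / 4 by rewrite divr_gt0.
have /near_cmodP[rho rho0 hrho] : \forall w \near (z : C^o),
    [/\ U w, cmod (dx f w - dx f z) < e / 4 & cmod (dy f w - dy f z) < e / 4].
  apply: filterS3 (oU z Uz) (Cn_on_cont cx Uz e4) (Cn_on_cont cy Uz e4) => w.
  by split.
apply/near_cmodP; exists rho => // v hv.
pose h : R := complex.Re (v - z); pose k : R := complex.Im (v - z).
have hkv : v - z = h +i* k by rewrite /h /k; case: (v - z).
have incr (dir : C) (D : C -> C) (p : C) (l : R) :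
    (forall t : R, 0 <= t <= 1 -> cmod (p + (t * l)%:C * dir - z) < rho) ->
    (forall w, U w -> cder (fun s : R => f (w + s%:C * dir)) 0 (D w)) ->
    (forall w, cmod (w - z) < rho -> cmod (D w - D z) < e / 4) ->
    cmod (f (p + l%:C * dir) - f p - l%:C * D z) <= 2 * (`|l| * (e / 4)).
  move=> hp hD hc.
  pose G t := f (p + (t * l)%:C * dir) - (t * l)%:C * D z.
  have -> : f (p + l%:C * dir) - f p - l%:C * D z = G 1 - G 0.
    by rewrite /G mul1r mul0r !mul0r addr0 subr0; ring.
  have lin (t : R) : is_derive t 1 (fun t : R => t * l) l.
    have -> : (fun t : R => t * l) = l \*: id.
      by apply/funext => x /=; rewrite /GRing.scale /= mulrC.
    by apply: is_derive_eq; rewrite /GRing.scale /= mulr1.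
  have lin2 (t : R) : is_derive t 1 (fun s : R => s * l - t * l) l.
    have -> : (fun s : R => s * l - t * l) = (fun s : R => s * l) - cst (t * l) by [].
    by rewrite -[X in is_derive _ _ _ X]subr0; apply: is_deriveB.
  apply: (@increment_le _ G (fun t => l%:C * D (p + (t * l)%:C * dir) - l%:C * D z)).
    move=> t ht; apply: cderB; last first.
      rewrite -[X in cder _ _ X]addr0 -(mulr0 ((t * l)%:C)).
      by apply: cderM; [exact: cder_real|exact: cder_cst].
    set w := p + (t * l)%:C * dir.
    have Uw : U w by case: (hrho w (hp t ht)).
    have := @cder_comp_real _ (fun s : R => f (w + s%:C * dir))
       (fun s => s * l - t * l) t l (D w).
    rewrite subrr => /(_ (hD w Uw) (lin2 t)); apply: cder_near.
    by near=> s; congr f; rewrite /w rmorphB /=; ring.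
  move=> t ht; rewrite -mulrBr cmodM cmodR ler_wpM2l //.
  by apply/ltW/hc/hp.
pose p := z + k%:C * 'i%C.
have pv : v = p + h%:C * 1.
  apply: (addIr (- z)); rewrite hkv /p; apply: complex_eqP.
    by rewrite !(cReD, cReMr, cReN) /=; ring.
  by rewrite !(cImD, cImMr, cImN) /=; ring.
have hl : `|h| <= cmod (v - z) by exact: cmod_Re.
have kl : `|k| <= cmod (v - z) by exact: cmod_Im.
have sq (x y : R) : cmod (x +i* y) = Num.sqrt (x ^+ 2 + y ^+ 2) by rewrite cmodE.
have mono (t x y : R) : 0 <= t <= 1 -> cmod ((t * x) +i* y) <= cmod (x +i* y).
  move=> /andP[t0 t1]; rewrite !sq ler_sqrt ?addr_ge0 ?sqr_ge0 // lerD2r exprMn.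
  by rewrite ler_piMl ?sqr_ge0 // exprn_ile1.
have i1 : cmod (f (p + h%:C * 1) - f p - h%:C * dx f z) <= 2 * (`|h| * (e / 4)).
  apply: incr => [t ht|w Uw|w /hrho[]//].
    apply: le_lt_trans hv; rewrite hkv.
    have -> : p + (t * h)%:C * 1 - z = (t * h) +i* k.
      rewrite /p; apply: complex_eqP.
        by rewrite !(cReD, cReMr, cReN) /=; ring.
      by rewrite !(cImD, cImMr, cImN) /=; ring.
    exact: mono.
  have [h1 _] := hd w Uw; have := curve_cder h1; apply: cder_near.
  by near=> s; rewrite /along_x mulr1.
have i2 : cmod (f (z + k%:C * 'i%C) - f z - k%:C * dy f z) <= 2 * (`|k| * (e / 4)).
  apply: incr => [t ht|w Uw|w /hrho[]//].
    apply: le_lt_trans hv; rewrite hkv.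
    have -> : z + (t * k)%:C * 'i%C - z = 0 +i* (t * k).
      apply: complex_eqP.
        by rewrite !(cReD, cReMr, cReN) /=; ring.
      by rewrite !(cImD, cImMr, cImN) /=; ring.
    move: ht => /andP[t0 t1]; rewrite !sq ler_sqrt ?addr_ge0 ?sqr_ge0 //.
    rewrite expr0n /= add0r exprMn; apply: ler_wpDl; first exact: sqr_ge0.
    by rewrite ler_piMl ?sqr_ge0 // exprn_ile1.
  have [_ h1] := hd w Uw; have := curve_cder h1; apply: cder_near.
  by near=> s; rewrite /along_y; congr f; simpc.
have -> : f v - f z - ((v - z) * d_z f z + (v - z)^*%C * d_zbar f z) =
    (f (p + h%:C * 1) - f p - h%:C * dx f z) +
    (f (z + k%:C * 'i%C) - f z - k%:C * dy f z).
  rewrite -pv -/p.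
  have -> : (v - z) * d_z f z + (v - z)^*%C * d_zbar f z =
      h%:C * dx f z + k%:C * dy f z.
    have -> : (v - z)^*%C = h%:C - 'i%C * k%:C by rewrite hkv; simpc.
    have -> : v - z = h%:C + 'i%C * k%:C by rewrite hkv; simpc.
    rewrite /d_z /d_zbar; have -> : 0 +i* 1 = 'i%C :> C by [].
    have i2' : 'i%C * 'i%C = -1 :> C by rewrite -expr2 sqr_i.
    transitivity (h%:C * dx f z - ('i%C * 'i%C) * k%:C * dy f z); first by field.
    by rewrite i2'; ring.
  by ring.
apply: le_trans (cmodD _ _) _; apply: le_trans (lerD i1 i2) _.
have aux (x y m : R) : x <= m -> y <= m -> 2 * x + 2 * y <= 4 * m.
  by clear; lra.
have -> : e * cmod (v - z) = 4 * (cmod (v - z) * (e / 4)) by field.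
by apply: aux; rewrite ler_wpM2r // ltW.
Unshelve. all: by end_near. Qed.

Definition dif f z := exists a b, wder f z a b.

Lemma dif_wder f z : dif f z -> wder f z (d_z f z) (d_zbar f z).
Proof. by move=> [a [b h]]; have [-> ->] := wder_d h. Qed.

Lemma dif_cst (k : C) z : dif (fun=> k) z.
Proof. by exists 0, 0; exact: wder_cst. Qed.

Lemma difD f g z : dif f z -> dif g z -> dif (fun w => f w + g w) z.
Proof. by move=> [a [b h]] [a' [b' h']]; do 2 eexists; exact: (wderD h h'). Qed.

Lemma difM f g z : dif f z -> dif g z -> dif (fun w => f w * g w) z.
Proof. by move=> [a [b h]] [a' [b' h']]; do 2 eexists; exact: (wderM h h'). Qed.

Lemma difV f z : dif f z -> f z != 0 -> dif (fun w => (f w)^-1) z.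
Proof. by move=> [a [b h]] f0; do 2 eexists; exact: (wderV h f0). Qed.

Lemma dif_near f g z : (\forall w \near (z : C^o), f w = g w) -> dif f z -> dif g z.
Proof. by move=> e [a [b h]]; exists a, b; exact: wder_near h. Qed.

Lemma dif_sum (I : Type) (r : seq I) (F : I -> C -> C) z :
  (forall i, dif (F i) z) -> dif (fun w => \sum_(i <- r) F i w) z.
Proof.
move=> h; elim: r => [|i r ih].
  by under eq_fun do rewrite big_nil; exact: dif_cst.
by under eq_fun do rewrite big_cons; exact: difD.
Qed.

Lemma dif_prod (I : Type) (r : seq I) (F : I -> C -> C) z :
  (forall i, dif (F i) z) -> dif (fun w => \prod_(i <- r) F i w) z.
Proof.
move=> h; elim: r => [|i r ih].
  by under eq_fun do rewrite big_nil; exact: dif_cst.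
by under eq_fun do rewrite big_cons; exact: difM.
Qed.

Lemma smooth_dif U f z : copen U -> smooth_on U f -> U z -> dif f z.
Proof. by move=> oU h Uz; do 2 eexists; exact: C1_wder oU (h 1%N) Uz. Qed.

Lemma smooth_dif_dz U f z : copen U -> smooth_on U f -> U z -> dif (d_z f) z.
Proof.
move=> oU h Uz; have [_ hx hy] := h 2%N.
have dfx : dif (dx f) z by do 2 eexists; exact: C1_wder oU hx Uz.
have dfy : dif (dy f) z by do 2 eexists; exact: C1_wder oU hy Uz.
rewrite /d_z.
have -> : (fun z : C => (dx f z - (0 +i* 1) * dy f z) / 2) =
    (fun z => (dx f z + (- (0 +i* 1)) * dy f z) * 2^-1).
  by apply/funext => w; rewrite mulNr.
apply: difM; last exact: dif_cst.
by apply: difD => //; apply: difM => //; exact: dif_cst.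
Qed.

Definition mxd m n (M : C -> 'M[C]_(m, n)) z (A B : 'M[C]_(m, n)) :=
  forall i j, wder (fun w => M w i j) z (A i j) (B i j).

Lemma mxd_d m n (M : C -> 'M[C]_(m, n)) z A B : mxd M z A B ->
  mx_d_z M z = A /\ mx_d_zbar M z = B.
Proof.
by move=> h; split; apply/matrixP => i j; rewrite mxE; have [] := wder_d (h i j).
Qed.

Lemma mxd_uniq m n (M : C -> 'M[C]_(m, n)) z A B A' B' :
  mxd M z A B -> mxd M z A' B' -> A = A' /\ B = B'.
Proof. by move=> /mxd_d[<- <-] /mxd_d[<- <-]. Qed.

Lemma mxd_dif m n (M : C -> 'M[C]_(m, n)) z :
  (forall i j, dif (fun w => M w i j) z) -> mxd M z (mx_d_z M z) (mx_d_zbar M z).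
Proof. by move=> h i j; rewrite !mxE; exact: dif_wder. Qed.

Lemma mxd_cst m n (K : 'M[C]_(m, n)) z : mxd (fun=> K) z 0 0.
Proof. by move=> i j; rewrite !mxE; exact: wder_cst. Qed.

Lemma mxd_near m n (M N : C -> 'M[C]_(m, n)) z A B :
  (\forall w \near (z : C^o), M w = N w) -> mxd M z A B -> mxd N z A B.
Proof.
by move=> e h i j; apply: wder_near (h i j); apply: filterS e => w ->.
Qed.

Lemma mxdD m n (M N : C -> 'M[C]_(m, n)) z A B A' B' :
  mxd M z A B -> mxd N z A' B' -> mxd (fun w => M w + N w) z (A + A') (B + B').
Proof.
move=> h k i j; have := wderD (h i j) (k i j); rewrite !mxE.
by apply: wder_near; near=> w; rewrite mxE.
Unshelve. all: by end_near. Qed.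

Lemma mxdN m n (M : C -> 'M[C]_(m, n)) z A B :
  mxd M z A B -> mxd (fun w => - M w) z (- A) (- B).
Proof.
move=> h i j; have := wderN (h i j); rewrite !mxE.
by apply: wder_near; near=> w; rewrite mxE.
Unshelve. all: by end_near. Qed.

Lemma mxdM m n p (M : C -> 'M[C]_(m, n)) (N : C -> 'M[C]_(n, p)) z A B A' B' :
  mxd M z A B -> mxd N z A' B' ->
  mxd (fun w => M w *m N w) z (A *m N z + M z *m A') (B *m N z + M z *m B').
Proof.
move=> h k i j; rewrite !mxE -!big_split /=.
have := wder_sum (index_enum _) (fun l => wderM (h i l) (k l j)).
by apply: wder_near; near=> w; rewrite mxE.
Unshelve. all: by end_near. Qed.

Lemma mxdZ m n (f : C -> C) (M : C -> 'M[C]_(m, n)) z a b A B :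
  wder f z a b -> mxd M z A B ->
  mxd (fun w => f w *: M w) z (a *: M z + f z *: A) (b *: M z + f z *: B).
Proof.
move=> h k i j; have := wderM h (k i j); rewrite !mxE.
by apply: wder_near; near=> w; rewrite mxE.
Unshelve. all: by end_near. Qed.

Lemma mxd_trace n (M : C -> 'M[C]_n) z A B : mxd M z A B ->
  wder (fun w => \tr (M w)) z (\tr A) (\tr B).
Proof. by move=> h; exact: wder_sum (fun i => h i i). Qed.

Lemma adjE m n (A : 'M[C]_(m, n)) i j : (A ^t*) i j = (A j i)^*%C.
Proof. by rewrite !mxE conjCE. Qed.

Lemma mxd_adj m n (M : C -> 'M[C]_(m, n)) z A B : mxd M z A B ->
  mxd (fun w => (M w) ^t*) z (B ^t*) (A ^t*).
Proof.
move=> h i j; have := wder_conj (h j i); rewrite !adjE.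
by apply: wder_near; near=> w; rewrite adjE.
Unshelve. all: by end_near. Qed.

Lemma dif_det n (M : C -> 'M[C]_n) z : (forall i j, dif (fun w => M w i j) z) ->
  dif (fun w => \det (M w)) z.
Proof.
move=> h; rewrite /determinant; apply: dif_sum => s; apply: difM.
  exact: dif_cst.
by apply: dif_prod => i; exact: h.
Qed.

Lemma mxd_inv n (M : C -> 'M[C]_n) z A B : mxd M z A B -> M z \in unitmx ->
  mxd (fun w => invmx (M w)) z (- (invmx (M z) *m A *m invmx (M z)))
    (- (invmx (M z) *m B *m invmx (M z))).
Proof.
move=> h u; have dM i j : dif (fun w => M w i j) z by do 2 eexists; exact: h.
have ddet := dif_det dM; have [a [b hdet]] := ddet.
have det0 : \det (M z) != 0 by move: u; rewrite unitmxE unitfE.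
have near_unit : \forall w \near (z : C^o), M w \in unitmx.
  by apply: filterS (clim_neq0 (wder_clim hdet) det0) => w; rewrite unitmxE unitfE.
have dinv i j : dif (fun w => invmx (M w) i j) z.
  have : dif (fun w => (\det (M w))^-1 * ((-1) ^+ (j + i) *
      \det (row' j (col' i (M w))))) z.
    apply: difM; first exact: difV.
    apply: difM; first exact: dif_cst.
    apply: dif_det => k l; apply: dif_near (dM (lift j k) (lift i l)).
    by near=> w; rewrite !mxE.
  apply: dif_near; apply: filterS near_unit => w uw.
  by rewrite /invmx uw !mxE.
have hi := mxd_dif dinv; set A' := mx_d_z _ z in hi; set B' := mx_d_zbar _ z in hi.
have := mxdM hi h; move=> /(mxd_near _ (N := fun=> 1%:M)) h1.
have {}h1 : mxd (fun=> 1%:M) z (A' *m M z + invmx (M z) *m A)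
    (B' *m M z + invmx (M z) *m B).
  by apply: h1; apply: filterS near_unit => w uw; rewrite mulVmx.
have [e1 e2] := mxd_uniq h1 (mxd_cst _ _).
have solve X Y : X *m M z + invmx (M z) *m Y = 0 ->
    X = - (invmx (M z) *m Y *m invmx (M z)).
  move=> /eqP; rewrite addr_eq0 => /eqP e.
  by rewrite -mulNmx -e mulmxK.
by rewrite -(solve _ _ e1) -(solve _ _ e2).
Unshelve. all: by end_near. Qed.

Lemma mxd_hol m n (M : C -> 'M[C]_(m, n)) z : (forall i j, hol (fun w => M w i j) z) ->
  mxd M z (mx_d_z M z) 0.
Proof. by move=> h i j; rewrite !mxE; exact: hol_wder. Qed.

End SmoothFunctions.

(** * Hermitian forms and the pointwise estimate *)

Section HermitianAlgebra.
Variable R : realType.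
Local Notation C := R[i].

Lemma adjM m n p (A : 'M[C]_(m, n)) (B : 'M[C]_(n, p)) :
  (A *m B) ^t* = B ^t* *m A ^t*.
Proof. by rewrite trmx_mul map_mxM. Qed.

Lemma adjD m n (A B : 'M[C]_(m, n)) : (A + B) ^t* = A ^t* + B ^t*.
Proof. by rewrite raddfD map_mxD. Qed.

Lemma adjB m n (A B : 'M[C]_(m, n)) : (A - B) ^t* = A ^t* - B ^t*.
Proof. by rewrite raddfB map_mxB. Qed.

Lemma adjK m n (A : 'M[C]_(m, n)) : (A ^t*) ^t* = A.
Proof. exact: trmxCK. Qed.

Lemma adj_inv n (A : 'M[C]_n) : (invmx A) ^t* = invmx (A ^t*).
Proof. by rewrite trmx_inv map_invmx. Qed.

Lemma adjZ m n (k : C) (A : 'M[C]_(m, n)) : (k *: A) ^t* = k^*%C *: A ^t*.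
Proof. by apply/matrixP => i j; rewrite adjE !mxE -conjCE rmorphM conjCE. Qed.

Lemma invmx_mul n (A B : 'M[C]_n) : A \in unitmx -> B \in unitmx ->
  invmx (A *m B) = invmx B *m invmx A.
Proof.
move=> uA uB; have uAB : A *m B \in unitmx by rewrite unitmx_mul uA.
rewrite -[RHS](mulKmx uAB) -[A *m B *m (_ *m _)]mulmxA (mulKVmx uB) (mulmxV uA).
by rewrite mulmx1.
Qed.

Lemma unitmx_adj n (A : 'M[C]_n) : (A ^t* \in unitmx) = (A \in unitmx).
Proof. by rewrite map_unitmx unitmx_tr. Qed.

Lemma trace_adj n (A : 'M[C]_n) : \tr (A ^t*) = (\tr A)^*%C.
Proof.
by rewrite /mxtrace -conjCE rmorph_sum; apply: eq_bigr => i _; rewrite adjE ?conjCE.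
Qed.

Lemma frobenius m n (A : 'M[C]_(m, n)) :
  \tr (A *m A ^t*) = (\sum_i \sum_j cmod (A i j) ^+ 2)%:C.
Proof.
rewrite /mxtrace rmorph_sum; apply: eq_bigr => i _ /=.
rewrite mxE rmorph_sum; apply: eq_bigr => j _ /=.
by rewrite adjE cmod_sqr.
Qed.

Lemma conj_cmod (z : C) : z^*%C * z = (cmod z ^+ 2)%:C.
Proof. by rewrite mulrC cmod_sqr. Qed.

Definition posdef n (H : 'M[C]_n) := H ^t* = H /\
  forall v : 'cV[C]_n, v != 0 -> 0 < (v ^t* *m H *m v) 0 0.

(** The adjoint of an endomorphism for the Hermitian form of matrix [H]. *)
Definition dagger n (H X : 'M[C]_n) : 'M[C]_n := invmx H *m X ^t* *m H.

Lemma cmod_ge0c (x : C) : 0 <= x -> (cmod x)%:C = x.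
Proof. by move=> x0; rewrite -normE ger0_norm. Qed.

Lemma posdef_factor n (H : 'M[C]_n) : posdef H ->
  exists2 Q, Q \in unitmx & H = Q ^t* *m Q.
Proof.
move=> [Hh Hp]; have nH : H \is normalmx by apply/normalmxP; rewrite Hh.
have /orthomx_spectralP := nH; set P := spectralmx H; set sp := spectral_diag H.
have uP : P \is unitarymx := spectral_unitarymx H.
have iP : P \in unitmx := spectral_unit H.
rewrite (invmx_unitary uP) => HE.
have spos i : 0 < sp 0 i.
  pose v : 'cV[C]_n := P ^t* *m delta_mx i 0.
  have v0 : v != 0.
    apply: contraTneq isT => e; have : P *m v = 0 by rewrite e mulmx0.
    rewrite /v mulmxA (unitarymxP uP) mul1mx => /matrixP/(_ i 0).
    by rewrite !mxE !eqxx => /eqP; rewrite oner_eq0.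
  have := Hp v v0; rewrite HE /v adjM adjK.
  rewrite !mulmxA mulmxtVK // -!mulmxA [P *m _]mulmxA (unitarymxP uP) mul1mx.
  have -> : ((delta_mx i 0 : 'cV[C]_n) ^t* *m (diag_mx sp *m (delta_mx i 0 : 'cV[C]_n))) 0 0 = sp 0 i.
    rewrite mxE (bigD1 i) //= big1 ?addr0.
      rewrite adjE !mxE !eqxx conjc1 mul1r (bigD1 i) //= big1 ?addr0.
        by rewrite !mxE !eqxx mulr1n mulr1.
      by move=> j ji; rewrite !mxE eq_sym (negPf ji) mulr0n mul0r.
    by move=> j ji; rewrite adjE !mxE (negPf ji) conjc0 mul0r.
  by [].
have [d dE] : exists d : 'rV[C]_n, forall j, d 0 j = (Num.sqrt (cmod (sp 0 j)))%:C.
  by exists (\row_j (Num.sqrt (cmod (sp 0 j)))%:C) => j; rewrite mxE.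
exists (diag_mx d *m P).
  rewrite unitmx_mul iP andbT unitmxE det_diag unitfE prodf_seq_neq0.
  apply/allP => j _; rewrite dE /=; apply/negP => /eqP [] /eqP.
  rewrite sqrtr_eq0 leNgt; move/negP; apply.
  by rewrite cmod_gt0; apply: lt0r_neq0.
rewrite adjM -!mulmxA [_ *m (diag_mx d *m P)]mulmxA HE -mulmxA; congr (_ *m (_ *m _)).
rewrite tr_diag_mx map_diag_mx mulmx_diag; congr diag_mx; apply/rowP => j.
rewrite !mxE dE /= conjCE conjc_real -rmorphM /=.
rewrite -expr2 sqr_sqrtr ?cmod_ge0 //.
by rewrite cmod_ge0c // ltW.
Qed.

(** Schur triangularization in a basis orthonormal for [H]. *)
Lemma schur_frame n (H X : 'M[C]_n.+1) : posdef H ->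
  exists Q, [/\ Q \in unitmx, H = Q ^t* *m Q & is_trig_mx (Q *m X *m invmx Q)].
Proof.
move=> /posdef_factor[Q0 uQ0 HE].
have [P uP] := @Schur _ n.+1 (Q0 *m X *m invmx Q0) (ltn0Sn _).
have iP := unitarymx_unit uP.
rewrite /similar_to /= conjumx // => tr; exists (P *m Q0); split.
- by rewrite unitmx_mul iP.
- by rewrite adjM mulmxA -[_ *m P]mulmxA (mulmx1C (unitarymxP uP)) mulmx1.
- by move: tr; rewrite invmx_mul // !mulmxA.
Qed.

Section Frame.
Variables (n : nat) (H Q : 'M[C]_n).
Hypotheses (uQ : Q \in unitmx) (HE : H = Q ^t* *m Q).
Let fr X := Q *m X *m invmx Q.

Lemma frameM X Y : fr (X *m Y) = fr X *m fr Y.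
Proof. by rewrite /fr !mulmxA mulmxKV. Qed.

Lemma frameB X Y : fr (X - Y) = fr X - fr Y.
Proof. by rewrite /fr mulmxBr mulmxBl. Qed.

Lemma frame_tr X : \tr (fr X) = \tr X.
Proof. by rewrite /fr mxtrace_mulC mulKmx. Qed.

Lemma frame_dagger X : fr (dagger H X) = (fr X) ^t*.
Proof.
rewrite /fr /dagger HE !adjM adj_inv invmx_mul ?unitmx_adj //.
by rewrite !mulmxA mulmxV // mul1mx mulmxK.
Qed.

Lemma frame_inj X Y : fr X = fr Y -> X = Y.
Proof.
rewrite /fr => h; rewrite -[X](mulKmx uQ) -[Y](mulKmx uQ).
by rewrite -[Q *m X](mulmxKV uQ) h mulmxKV.
Qed.

Lemma frame1 : fr 1%:M = 1%:M.
Proof. by rewrite /fr mulmx1 mulmxV. Qed.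

Lemma frameZ k X : fr (k *: X) = k *: fr X.
Proof. by rewrite /fr -scalemxAr -scalemxAl. Qed.

Lemma frame_det X : \det (fr X) = \det X.
Proof.
rewrite /fr !det_mulmx det_inv mulrAC mulfV ?mul1r //.
Qed.

End Frame.

Lemma dagger_tr_ge0 n (H X : 'M[C]_n) : posdef H ->
  \tr (X *m dagger H X) = (complex.Re (\tr (X *m dagger H X)))%:C /\
  0 <= complex.Re (\tr (X *m dagger H X)).
Proof.
move=> /posdef_factor[Q uQ HE].
rewrite -(frame_tr uQ) (frameM uQ) (frame_dagger uQ HE) frobenius; split=> //=.
by apply: sumr_ge0 => i _; apply: sumr_ge0 => j _; rewrite sqr_ge0.
Qed.

Definition i0 : 'I_3 := ord0.
Definition i1 : 'I_3 := lift ord0 ord0.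
Definition i2 : 'I_3 := lift ord0 (lift ord0 ord0).

Lemma sum3 (V : nmodType) (F : 'I_3 -> V) : \sum_i F i = F i0 + F i1 + F i2.
Proof. by rewrite !big_ord_recl big_ord0 addr0 addrA. Qed.

Lemma prod3 (F : 'I_3 -> C) : \prod_i F i = F i0 * F i1 * F i2.
Proof. by rewrite !big_ord_recl big_ord0 mulr1 mulrA. Qed.

Lemma ord3P (P : 'I_3 -> Prop) : P i0 -> P i1 -> P i2 -> forall i, P i.
Proof.
move=> h0 h1 h2 [[|[|[|//]]] hi].
- by have <- : i0 = Ordinal hi by apply: val_inj.
- by have <- : i1 = Ordinal hi by apply: val_inj.
- by have <- : i2 = Ordinal hi by apply: val_inj.
Qed.

Lemma cmod2_eq0 (z : C) : cmod z ^+ 2 = 0 -> z = 0.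
Proof. by move=> /eqP; rewrite expf_eq0 /= cmod_eq0 => /eqP. Qed.

(** The trace conditions make the characteristic polynomial [t^3 - q], so the three
    eigenvalues have the same modulus.  In a triangularizing orthonormal frame the
    excess of [|X|^2] over [3 |q|^(2/3)] is therefore the size of the strictly
    triangular part, which the diagonal of the commutator controls; without excess
    [X] is diagonal in that frame. *)
Lemma cyclic_pointwise (H X : 'M[C]_3) (q : C) : posdef H ->
  \tr X = 0 -> \tr (X *m X) = 0 -> \det X = q ->
  let B := X *m dagger H X - dagger H X *m X in
  let s := complex.Re (\tr (X *m dagger H X)) in
  let k := complex.Re (\tr (B *m B)) in
  exists rho : R, [/\ 0 <= rho, rho ^+ 3 = cmod q ^+ 2,
    \tr (B *m B) = k%:C, 3 * rho <= s & (s - 3 * rho) ^+ 2 <= 2 * k] /\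
  (s = 3 * rho -> X *m dagger H X = rho%:C%:M /\ X *m X *m X = q%:M).
Proof.
move=> pH t1 t2 dX /=.
have [Q [uQ HE trig]] := schur_frame X pH.
set B := X *m dagger H X - dagger H X *m X.
have [T TE] : exists T, T = Q *m X *m invmx Q by eexists.
rewrite -TE in trig.
have T01 : T i0 i1 = 0 by move/is_trig_mxP: trig; apply.
have T02 : T i0 i2 = 0 by move/is_trig_mxP: trig; apply.
have T12 : T i1 i2 = 0 by move/is_trig_mxP: trig; apply.
have e1 : T i0 i0 + T i1 i1 + T i2 i2 = 0.
  by rewrite -(sum3 (fun i => T i i)) -[LHS]/(\tr T) TE frame_tr.
have e2 : T i0 i0 ^+ 2 + T i1 i1 ^+ 2 + T i2 i2 ^+ 2 = 0.
  have : \tr (T *m T) = 0 by rewrite TE -(frameM uQ) frame_tr.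
  by rewrite /mxtrace sum3 !mxE !sum3 T01 T02 T12; move=> <-; ring.
have e3 : T i0 i0 * T i1 i1 * T i2 i2 = q.
  by rewrite -(prod3 (fun i => T i i)) -det_trig // TE frame_det.
(* the elementary symmetric functions of the eigenvalues are [0], [0] and [q] *)
have cube : [/\ T i0 i0 ^+ 3 = q, T i1 i1 ^+ 3 = q & T i2 i2 ^+ 3 = q].
  have h2 : T i2 i2 = - T i0 i0 - T i1 i1.
    by apply/eqP; rewrite -subr_eq0 -e1; apply/eqP; ring.
  have h : T i0 i0 ^+ 2 + T i0 i0 * T i1 i1 + T i1 i1 ^+ 2 = 0.
    apply: (mulfI (x := 2)); first by rewrite pnatr_eq0.
    by rewrite mulr0 -e2 h2; ring.
  rewrite -e3 h2; split.
  - apply/eqP; rewrite -subr_eq0; apply/eqP.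
    by rewrite -(mulr0 (T i0 i0)) -h; ring.
  - apply/eqP; rewrite -subr_eq0; apply/eqP.
    by rewrite -(mulr0 (T i1 i1)) -h; ring.
  - apply/eqP; rewrite -subr_eq0; apply/eqP.
    by rewrite -(mulr0 (- T i0 i0 - T i1 i1)) -h; ring.
have [c0 c1 c2] := cube.
have eqmod (x y : C) : x ^+ 3 = q -> y ^+ 3 = q -> cmod x = cmod y.
  move=> hx hy; apply/eqP; rewrite -(@eqrXn2 _ 3) ?cmod_ge0 //.
  by rewrite -!cmodX hx hy.
pose rho := cmod (T i0 i0) ^+ 2; exists rho.
have m1 : cmod (T i1 i1) ^+ 2 = rho by rewrite (eqmod _ _ c1 c0).
have m2 : cmod (T i2 i2) ^+ 2 = rho by rewrite (eqmod _ _ c2 c0).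
(* the squared size of the strictly triangular part *)
pose nu := cmod (T i1 i0) ^+ 2 + cmod (T i2 i0) ^+ 2 + cmod (T i2 i1) ^+ 2.
have sE : complex.Re (\tr (X *m dagger H X)) = 3 * rho + nu.
  rewrite -(frame_tr uQ) (frameM uQ) (frame_dagger uQ HE) -TE frobenius /=.
  by rewrite !sum3 T01 T02 T12 cmod0 m1 m2 /nu /rho; ring.
pose Bt := T *m T ^t* - T ^t* *m T.
have frB : Q *m B *m invmx Q = Bt.
  by rewrite frameB (frameM uQ X) (frameM uQ _ X) (frame_dagger uQ HE) -TE.
have Bh : Bt ^t* = Bt by rewrite /Bt adjB !adjM adjK.
have trB : \tr (B *m B) = (\sum_i \sum_j cmod (Bt i j) ^+ 2)%:C.
  by rewrite -(frame_tr uQ) (frameM uQ) frB -{2}Bh frobenius.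
have nonneg (z : C) : 0 <= cmod z ^+ 2 by rewrite sqr_ge0.
have sq0 : (cmod (0 : C) ^+ 2)%:C = 0 by rewrite cmod0 expr0n.
have b0 : Bt i0 i0 = - (cmod (T i1 i0) ^+ 2 + cmod (T i2 i0) ^+ 2)%:C.
  rewrite /Bt !mxE !sum3 !adjE T01 T02 !cmod_sqr !conj_cmod sq0.
  by rewrite [(_ + _ : R)%:C]rmorphD /=; ring.
have b2 : Bt i2 i2 = (cmod (T i2 i0) ^+ 2 + cmod (T i2 i1) ^+ 2)%:C.
  rewrite /Bt !mxE !sum3 !adjE T02 T12 !cmod_sqr !conj_cmod sq0.
  by rewrite [(_ + _ : R)%:C]rmorphD /=; ring.
have nu0 : 0 <= nu by rewrite /nu !addr_ge0.
have h1 : cmod (Bt i0 i0) ^+ 2 = (cmod (T i1 i0) ^+ 2 + cmod (T i2 i0) ^+ 2) ^+ 2.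
  by rewrite b0 cmodN cmodR ger0_norm // addr_ge0.
have h2 : cmod (Bt i2 i2) ^+ 2 = (cmod (T i2 i0) ^+ 2 + cmod (T i2 i1) ^+ 2) ^+ 2.
  by rewrite b2 cmodR ger0_norm // addr_ge0.
split; first split.
- exact: sqr_ge0.
- by rewrite /rho exprAC -cmodX c0.
- by rewrite trB.
- by rewrite sE lerDl.
- rewrite sE addrAC subrr add0r trB /= !sum3.
  have : nu ^+ 2 <= 2 * ((cmod (T i1 i0) ^+ 2 + cmod (T i2 i0) ^+ 2) ^+ 2 +
      (cmod (T i2 i0) ^+ 2 + cmod (T i2 i1) ^+ 2) ^+ 2).
    rewrite /nu.
    have := (nonneg (T i1 i0), nonneg (T i2 i0), nonneg (T i2 i1)).
    move: (cmod (T i1 i0) ^+ 2) (cmod (T i2 i0) ^+ 2) (cmod (T i2 i1) ^+ 2).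
    move=> x y z [[x0 y0] z0].
    have : 0 <= (x - z) ^+ 2 by rewrite sqr_ge0.
    have : 0 <= y * x by rewrite mulr_ge0.
    have : 0 <= y * z by rewrite mulr_ge0.
    have : 0 <= y * y by rewrite mulr_ge0.
    nra.
  move=> /le_trans; apply; rewrite ler_pM2l // -h1 -h2.
  have := (nonneg (Bt i0 i1), nonneg (Bt i0 i2), nonneg (Bt i1 i0), nonneg (Bt i1 i1),
    nonneg (Bt i1 i2), nonneg (Bt i2 i0), nonneg (Bt i2 i1)).
  move=> [[[[[[? ?] ?] ?] ?] ?] ?]; lra.
rewrite sE => /eqP; rewrite -subr_eq0 addrAC subrr add0r => /eqP nu00.
have n1 := nonneg (T i1 i0); have n2 := nonneg (T i2 i0); have n3 := nonneg (T i2 i1).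
have T10 : T i1 i0 = 0 by apply: cmod2_eq0; move: nu00; rewrite /nu; lra.
have T20 : T i2 i0 = 0 by apply: cmod2_eq0; move: nu00; rewrite /nu; lra.
have T21 : T i2 i1 = 0 by apply: cmod2_eq0; move: nu00; rewrite /nu; lra.
have off i j : i != j -> T i j = 0.
  by move: i j; do 2 apply: ord3P => //.
split; apply: (frame_inj uQ).
  rewrite (frameM uQ) (frame_dagger uQ HE) -TE.
  rewrite -[_%:M]scalemx1 frameZ (frame1 uQ) scalemx1.
  apply/matrixP => i j; rewrite !mxE.
  have [<-|ij] := eqVneq i j.
    rewrite (bigD1 i) //= big1 ?addr0 ?mulr1n => [|l li].
      by rewrite adjE cmod_sqr; congr (_%:C); move: i; apply: ord3P.
    by rewrite off ?mul0r // eq_sym.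
  rewrite mulr0n big1 // => l _; rewrite adjE.
  have [<-|li] := eqVneq i l; first by rewrite (off j i) ?conjc0 ?mulr0 // eq_sym.
  by rewrite off ?mul0r.
rewrite !(frameM uQ) -TE -[_%:M]scalemx1 frameZ (frame1 uQ) scalemx1.
have TT i j : (T *m T) i j = if i == j then T i i ^+ 2 else 0.
  rewrite mxE; case: ifPn => [/eqP <-|ij].
    rewrite (bigD1 i) //= big1 ?addr0 // => l li.
    by rewrite off ?mul0r // eq_sym.
  rewrite big1 // => l _; have [<-|li] := eqVneq i l; last by rewrite off ?mul0r.
  by rewrite (off i j) ?mulr0.
apply/matrixP => i j; rewrite !mxE.
have [<-|ij] := eqVneq i j.
  rewrite (bigD1 i) //= big1 ?addr0 ?mulr1n => [|l li].
    by rewrite TT eqxx -exprSr; move: i; apply: ord3P.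
  by rewrite TT eq_sym (negPf li) mul0r.
rewrite mulr0n big1 // => l _; rewrite TT; case: ifPn => [/eqP <-|_]; last by rewrite mul0r.
by rewrite (off i j) ?mulr0.
Qed.

End HermitianAlgebra.

(** * The Bochner formula *)

(** Noncommutative identities behind the Bochner formula; [G] is the inverse of
    the metric [H]. *)
Section MatrixIdentities.
Variables (F : comNzRingType) (n : nat).
Implicit Types A B D G H K N S T U X Y : 'M[F]_n.

Lemma dagger_dz_identity G H X S : H *m G = 1%:M ->
  (- (G *m X *m G) *m S + G *m 0) *m H + (G *m S) *m X =
  (G *m S *m H) *m (G *m X) - (G *m X) *m (G *m S *m H).
Proof.
move=> HG; rewrite mulmx0 addr0 [RHS]addrC !mulNmx !mulmxA; congr (_ + _).
by rewrite -[G *m S *m H *m G]mulmxA HG mulmx1.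
Qed.

Lemma dagger_dzbar_identity G H Y S U : G *m H = 1%:M ->
  (- (G *m Y *m G) *m S + G *m U) *m H + (G *m S) *m Y =
  G *m (U + S *m (Y *m G) - (Y *m G) *m S) *m H.
Proof.
move=> GH; rewrite mulmxBr mulmxDr mulmxBl mulmxDl mulmxDl !mulNmx !mulmxA.
rewrite -[G *m S *m Y *m G *m H]mulmxA GH mulmx1.
by rewrite -addrA addrC.
Qed.

Lemma trace_dz_identity D T A U :
  \tr (U *m D + T *m (D *m A - A *m D)) = \tr ((U + A *m T - T *m A) *m D).
Proof.
rewrite mulmxBr mulmxBl mulmxDl raddfD raddfB [in RHS]raddfB raddfD /= -addrA.
congr (_ + _); rewrite !mulmxA; congr (_ - _).
by rewrite mxtrace_mulC mulmxA.
Qed.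

Lemma trace_commutator_identity (k : F) T D :
  \tr ((k *: (T *m D - D *m T) *m T - T *m (k *: (T *m D - D *m T))) *m D) =
  k * \tr ((T *m D - D *m T) *m (T *m D - D *m T)).
Proof.
set B := T *m D - D *m T.
rewrite -scalemxAl -scalemxAr -scalerBr -scalemxAl linearZ /=; congr (_ * _).
have -> : \tr (B *m B) = \tr (B *m (T *m D)) - \tr (B *m (D *m T)).
  by rewrite {2}/B mulmxBr raddfB.
rewrite mulmxBl raddfB /= !mulmxA; congr (_ - _).
by rewrite -[T *m B *m D]mulmxA [LHS]mxtrace_mulC.
Qed.

End MatrixIdentities.

Section Bochner.
Variable R : realType.
Local Notation C := R[i].

Lemma mxd_adj0 m n (M : C -> 'M[C]_(m, n)) z X : mxd M z X 0 ->
  mxd (fun w => (M w) ^t*) z 0 (X ^t*).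
Proof. by move=> h i j; have := mxd_adj h i j; rewrite adjE !mxE conjc0. Qed.

Lemma adj_covariant_derivative n (U G X S : 'M[C]_n) : G ^t* = G ->
  (U + G *m X *m S - S *m (G *m X)) ^t* =
  U ^t* + S ^t* *m (X ^t* *m G) - X ^t* *m G *m S ^t*.
Proof. by move=> hG; rewrite adjB adjD !adjM hG. Qed.

Lemma mxd_eq m n (M : C -> 'M[C]_(m, n)) z X Y X' Y' :
  mxd M z X Y -> X = X' -> Y = Y' -> mxd M z X' Y'.
Proof. by move=> h <- <-. Qed.

Section AtAPoint.
Variables (H T : C -> 'M[C]_3) (z t2 : C).
Hypothesis nearH : \forall w \near (z : C^o),
  [/\ (H w) ^t* = H w, H w \in unitmx, forall i j, dif (fun x => H x i j) w
    & forall i j, hol (fun x => T x i j) w].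
Hypothesis dHz : forall i j, dif (d_z (fun x => H x i j)) z.
Hypothesis dTz : forall i j, hol (d_z (fun x => T x i j)) z.

(** [N] is the covariant derivative [T' + AT - TA] of [T] for the Chern connection [A]. *)
Let A w := invmx (H w) *m mx_d_z H w.
Let D w := dagger (H w) (T w).
Let N w := mx_d_z T w + A w *m T w - T w *m A w.

Hypothesis curv : - mx_d_zbar A z + t2 *: (T z *m D z - D z *m T z) = 0.

Lemma mxd_hermitian w : (\forall x \near (w : C^o), (H x) ^t* = H x) ->
  (forall i j, dif (fun x => H x i j) w) ->
  mxd H w (mx_d_z H w) ((mx_d_z H w) ^t*).
Proof.
move=> hh hd; have h := mxd_dif hd.
have h' := mxd_near hh (mxd_adj h).
have [_ e] := mxd_uniq h h'; by rewrite -[X in mxd _ _ _ X]e.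
Qed.

Let nearS : \forall w \near (z : C^o), [/\ H w \in unitmx, (H w) ^t* = H w,
  mxd H w (mx_d_z H w) ((mx_d_z H w) ^t*) & mxd T w (mx_d_z T w) 0].
Proof.
have h := nearH; have h2 := near_join h.
apply: filterS2 h h2 => w [hw uw dw tw] hnear; split=> //.
  by apply: mxd_hermitian => //; apply: filterS hnear => x [].
exact: mxd_hol.
Qed.

(** [T] is holomorphic, so its adjoint is parallel in the holomorphic direction. *)
Lemma mxd_dagger w : H w \in unitmx -> (H w) ^t* = H w ->
  mxd H w (mx_d_z H w) ((mx_d_z H w) ^t*) -> mxd T w (mx_d_z T w) 0 ->
  mxd D w (D w *m A w - A w *m D w) (dagger (H w) (N w)).
Proof.
move=> uw hw hH hT; have hI := mxd_inv hH uw; have hA := mxd_adj0 hT.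
have h := mxdM (mxdM hI hA) hH.
have e1 := @dagger_dz_identity _ _ (invmx (H w)) (H w) (mx_d_z H w) ((T w) ^t*) (mulmxV uw).
have e2 := @dagger_dzbar_identity _ _ (invmx (H w)) (H w) ((mx_d_z H w) ^t*)
  ((T w) ^t*) ((mx_d_z T w) ^t*) (mulVmx uw).
have e3 : (N w) ^t* = (mx_d_z T w) ^t* +
   (T w) ^t* *m ((mx_d_z H w) ^t* *m invmx (H w)) -
   (mx_d_z H w) ^t* *m invmx (H w) *m (T w) ^t*.
  by apply: adj_covariant_derivative; rewrite adj_inv hw.
apply: (mxd_eq h e1); rewrite /dagger e3; exact: e2.
Qed.

Definition sigma w := \tr (T w *m D w).

Let sder w := \tr (N w *m D w).

Lemma wder_sigma_at w : H w \in unitmx -> (H w) ^t* = H w ->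
  mxd H w (mx_d_z H w) ((mx_d_z H w) ^t*) -> mxd T w (mx_d_z T w) 0 ->
  wder sigma w (sder w) ((sder w)^*%C).
Proof.
move=> uw hw hH hT; have hD := mxd_dagger uw hw hH hT.
have := mxd_trace (mxdM hT hD).
rewrite trace_dz_identity mul0mx add0r.
suff -> : (sder w)^*%C = \tr (T w *m dagger (H w) (N w)) by [].
rewrite /sder -trace_adj adjM /D /dagger !adjM adjK hw adj_inv hw.
by rewrite -mulmxA mxtrace_mulC -!mulmxA.
Qed.

Lemma wder_sigma : \forall w \near (z : C^o), wder sigma w (sder w) ((sder w)^*%C).
Proof.
by apply: filterS nearS => w [? ? ? ?]; exact: wder_sigma_at.
Qed.

(** The Laplacian of [|T|^2], once [sder] is known to be its gradient.  The two terms
    come from the curvature, which the equation for the harmonic metric turns into a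
    commutator, and from the antiholomorphic derivative of the adjoint of [T]. *)
Lemma bochner : exists m,
  wder sder z m
   (t2 * \tr ((T z *m D z - D z *m T z) *m (T z *m D z - D z *m T z)) +
    \tr (N z *m dagger (H z) (N z))).
Proof.
have [uz hz hH hT] := nbhs_singleton nearS.
have hD := mxd_dagger uz hz hH hT.
have hI := mxd_inv hH uz.
have hX : mxd (mx_d_z H) z (mx_d_z (mx_d_z H) z) (mx_d_zbar (mx_d_z H) z).
  apply: mxd_dif => i j; have := dHz i j; apply: dif_near.
  by near=> w; rewrite mxE.
have hA : mxd A z (mx_d_z A z) (mx_d_zbar A z).
  by apply: mxd_dif => i j; do 2 eexists; exact: (mxdM hI hX i j).
have hT' : mxd (mx_d_z T) z (mx_d_z (mx_d_z T) z) 0.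
  apply: mxd_hol => i j; have := dTz i j; apply: hol_near.
  by near=> w; rewrite mxE.
have hN := mxdD (mxdD hT' (mxdM hA hT)) (mxdN (mxdM hT hA)).
have h := mxd_trace (mxdM hN hD).
set q := (X in wder _ _ _ X) in h.
suff <- : q = t2 * \tr ((T z *m D z - D z *m T z) *m (T z *m D z - D z *m T z)) +
    \tr (N z *m dagger (H z) (N z)) by eexists; exact: h.
rewrite /q mulmx0 mul0mx addr0 !add0r raddfD /=; congr (_ + _).
have -> : mx_d_zbar A z = t2 *: (T z *m D z - D z *m T z).
  by apply/eqP; rewrite eq_sym -subr_eq0 addrC curv.
exact: trace_commutator_identity.
Unshelve. all: by end_near. Qed.

End AtAPoint.

End Bochner.

(** * Maximum principles *)
Section MaximumPrinciple.
Variable R : realType.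
Local Notation C := R[i].

Lemma second_derivative_test (f f1 : R -> R) (c d : R) :
  (\forall x \near c, f x <= f c) ->
  (\forall x \near c, is_derive (x : R) 1 f (f1 x)) -> is_derive c 1 f1 d ->
  f1 c = 0 /\ d <= 0.
Proof.
move=> fmax h1 h2.
have : \forall x \near c, f x <= f c /\ is_derive (x : R) 1 f (f1 x).
  by apply: filterS2 fmax h1 => x; split.
move=> /nbhs_ballP[e /= e0 he].
have inb (x : R) : `|x - c| < e -> f x <= f c /\ is_derive (x : R) 1 f (f1 x).
  by move=> h; apply: he; rewrite /ball /= distrC.
have f1c : f1 c = 0.
  have [|_ hc] := inb c; first by rewrite subrr normr0.
  have itv (t : R) : t \in `]c - e, c + e[ -> `|t - c| < e.
    by rewrite in_itv /= ltr_distl.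
  have h0 : is_derive c 1 f 0.
    apply: (@derive1_at_max R f (c - e) (c + e) c); first lra.
    - by move=> t /itv /inb[_ ht]; apply: ex_derive.
    - by rewrite in_itv /=; lra.
    - by move=> t /itv /inb[].
  by rewrite -(@derive_val _ _ _ _ _ _ _ hc) (@derive_val _ _ _ _ _ _ _ h0).
split=> //; rewrite leNgt; apply/negP => d0.
have /is_derive1_caratheodory[g [gE cg gc]] := h2.
have : \forall x \near c, 0 < g x.
  have := cg; rewrite /prop_for /continuous_at gc => /cvgrPdist_lt/(_ d d0).
  by apply: filterS => x; rewrite ltr_distlC subrr => /andP[].
move=> /nbhs_ballP[e' /= e'0 he'].
pose r := Num.min e e' / 2.
have r0 : 0 < r by rewrite divr_gt0 // lt_min e0.
have re : r < e.
  have h : Num.min e e' <= e by rewrite ge_min lexx.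
  by rewrite /r; lra.
have re' : r < e'.
  have h : Num.min e e' <= e' by rewrite ge_min lexx orbT.
  by rewrite /r; lra.
have inr (x : R) : c <= x <= c + r -> `|x - c| < e /\ `|x - c| < e'.
  by move=> /andP[x1 x2]; rewrite ger0_norm ?subr_ge0 //; split; lra.
have [|x|x|x hx] := @MVT R f f1 c (c + r).
- by rewrite ltrDl.
- rewrite in_itv /= => /andP[x1 x2].
  by have [|/inb[]] := inr x; rewrite ?(ltW x1) ?(ltW x2).
- apply: derivable_within_continuous => y; rewrite in_itv /= => hy.
  by have [/inb[_ h] _] := inr y hy; apply: ex_derive.
have : f (c + r) <= f c.
  by have [|/inb[]] := inr (c + r); rewrite ?lexx ?lerDl ?(ltW r0).
rewrite -subr_le0 leNgt => /negP nh e1; apply: nh; rewrite e1 addrC addKr.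
rewrite mulr_gt0 //; move: hx; rewrite in_itv /= => /andP[x1 x2].
have := gE x; rewrite f1c subr0 => ->; rewrite mulr_gt0 ?subr_gt0 //.
apply: he'; rewrite /ball /= distrC.
by have [|//] := inr x; rewrite (ltW x1) (ltW x2).
Qed.

(** The second derivatives along the two axes are [2 Re (k + m)] and [2 Re (k - m)];
    in their sum [m] cancels. *)
Lemma wirtinger_max_test (u : C -> R) (a : C -> C) (p m k : C) :
  (\forall w \near (p : C^o), wder (fun z => (u z)%:C) w (a w) ((a w)^*%C)) ->
  wder a p m k -> (\forall w \near (p : C^o), u w <= u p) ->
  a p = 0 /\ complex.Re k <= 0.
Proof.
move=> h1 h2 h3.
have go (dir : C) : let F s := u (p + s%:C * dir) in
    2 * complex.Re (a p * dir) = 0 /\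
    2 * complex.Re ((m * dir + k * dir^*%C) * dir) <= 0.
  move=> F; pose c (s : R) := p + s%:C * dir.
  have hc s : cder c s dir.
    have -> : dir = 0 + (1 * dir + s%:C * 0) by rewrite mulr0 addr0 mul1r add0r.
    apply: cderD; first exact: cder_cst.
    by rewrite mulr0 addr0 mul1r -/c; move: (cderM (cder_id s) (cder_cst dir s));
      rewrite mulr0 addr0 mul1r.
  have c0 : c 0 = p by rewrite /c mul0r addr0.
  have hcl : clim (nbhs (0 : R)) c p by have := cder_clim (hc 0); rewrite c0.
  have := @second_derivative_test F (fun s => 2 * complex.Re (a (c s) * dir)) 0
    (2 * complex.Re ((m * dir + k * dir^*%C) * dir)).
  rewrite c0; apply.
  - have h3' : \forall s \near (0 : R), u (c s) <= u p by exact: clim_near hcl h3.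
    apply: filterS h3' => s.
    by rewrite /F mul0r addr0.
  - have h1' : \forall s \near (0 : R), wder (fun z => (u z)%:C) (c s) (a (c s)) ((a (c s))^*%C).
      exact: clim_near hcl h1.
    apply: filterS h1' => s hs.
    have /cderP[] := wder_comp_curve hs (hc s); rewrite /= => h _.
    suff -> : 2 * complex.Re (a (c s) * dir) =
      complex.Re (a (c s) * dir + (a (c s))^*%C * dir^*%C) by [].
    by rewrite cReD -cJM cReJ; ring.
  - have h4 : wder a (c 0) m k by rewrite c0.
    have /cderP[h5 _] := cderM (wder_comp_curve h4 (hc 0)) (cder_cst dir 0).
    rewrite mulr0 addr0 in h5.
    have -> : (fun s => 2 * complex.Re (a (c s) * dir)) =
        2 \*: (fun s => complex.Re ((a \o c) s * dir)) by [].
    exact: is_deriveZ.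
have [x1 x2] := go 1; have [y1 y2] := go 'i%C.
have Ja : ('i%C : C)^*%C = - 'i%C by apply: complex_eqP => /=; rewrite ?oppr0.
move: x1 x2 y1 y2; rewrite conjc1 Ja !mulr1.
have -> : (m * 'i%C + k * - 'i%C) * 'i%C = - (m - k).
  have e : 'i%C * 'i%C = -1 :> C by rewrite -expr2 sqr_i.
  transitivity ((m - k) * ('i%C * 'i%C)); first by ring.
  by rewrite e mulrN1.
rewrite ReiNIm cReN cReB cReD => x1 x2 y1 y2; split; last lra.
by apply: complex_eqP => /=; lra.
Qed.

Lemma wder_real_comp (g : R -> R) (s : C -> R) (p a b : C) (d : R) :
  wder (fun w => (s w)%:C) p a b -> is_derive (s p) 1 g d ->
  wder (fun w => (g (s w))%:C) p (d%:C * a) (d%:C * b).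
Proof.
move=> hs /is_derive1_caratheodory[L [LE cL Lp]].
have cs : s @ (p : C^o) --> s p.
  by have /climP[] := wder_clim hs.
have cLs : clim (nbhs (p : C^o)) (fun w => (L (s w))%:C) d%:C.
  apply: clim_real; rewrite -Lp; exact: (cvg_comp _ _ cs cL).
case: hs => u [v [hu hv h]].
exists (fun w => (L (s w))%:C * u w), (fun w => (L (s w))%:C * v w); split.
- exact: climM.
- exact: climM.
apply: filterS h => w h; rewrite -rmorphB /= LE rmorphM /= rmorphB /= h; ring.
Qed.

Lemma wder_ln (s : C -> R) (p a b : C) : 0 < s p ->
  wder (fun w => (s w)%:C) p a b ->
  wder (fun w => (ln (s w))%:C) p (a / (s p)%:C) (b / (s p)%:C).
Proof.
move=> s0 h; have hl := is_derive1_ln s0.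
by have := wder_real_comp h hl; rewrite fmorphV /= ![_^-1 * _]mulrC.
Qed.

Lemma wder_sqmod (c p : C) :
  wder (fun w => (cmod (w - c) ^+ 2)%:C) p ((p - c)^*%C) (p - c).
Proof.
have h : wder (fun w => w - c) p (1 - 0) (0 - 0).
  by apply: wderB; [exact: wder_id|exact: wder_cst].
have := wderM h (wder_conj h); rewrite !subr0 conjc0 conjc1 mulr0 mul1r mul0r mulr1 addr0 add0r.
by apply: wder_near; near=> w; rewrite cmod_sqr.
Unshelve. all: by end_near. Qed.

(** [gauge al be ka w] is [|w|^(2 al) |w - 1|^(2 be) (1 + |w|^2)^ka]. *)
Definition gauge (al be ka : R) (w : C) : R :=
  expR (al * ln (cmod w ^+ 2) + be * ln (cmod (w - 1) ^+ 2) +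
        ka * ln (1 + cmod w ^+ 2)).

(** The logarithm of a gauge is harmonic up to its last factor, whose Laplacian is
    the right-hand side; [mu] is minus the logarithmic gradient of the gauge. *)
Lemma weighted_max_test (al be ka : R) (s : C -> R) (a : C -> C) (p m k : C) :
  punctured p -> (\forall w \near (p : C^o), 0 < s w) ->
  (\forall w \near (p : C^o), wder (fun z => (s z)%:C) w (a w) ((a w)^*%C)) ->
  wder a p m k ->
  (\forall w \near (p : C^o), s w * gauge al be ka w <= s p * gauge al be ka p) ->
  exists mu : C, a p = mu * (s p)%:C /\
    complex.Re k * s p - cmod (a p) ^+ 2 <=
      - (ka * s p ^+ 2 / (1 + cmod p ^+ 2) ^+ 2).
Proof.
move=> pp s0 hs ha hmax.
pose q (w : C) : R := 1 + cmod w ^+ 2.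
have q0 (w : C) : 0 < q w by rewrite /q ltr_pwDl // sqr_ge0.
pose u (w : C) : R := ln (s w) + (al * ln (cmod (w - 0) ^+ 2) + be * ln (cmod (w - 1) ^+ 2) +
  ka * ln (q w)).
pose mu (w : C) : C := al%:C * ((w - 0)^*%C / (cmod (w - 0) ^+ 2)%:C) +
  be%:C * ((w - 1)^*%C / (cmod (w - 1) ^+ 2)%:C) + ka%:C * (w^*%C / (q w)%:C).
pose b (w : C) : C := a w / (s w)%:C + mu w.
have sq0 (c w : C) : w - c != 0 -> 0 < cmod (w - c) ^+ 2.
  by move=> h; rewrite exprn_gt0 // cmod_gt0.
have wq w : wder (fun x => (q x)%:C) w (w^*%C) w.
  have := wderD (wder_cst 1 w) (wder_sqmod 0 w); rewrite !add0r subr0.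
  by apply: wder_near; near=> x; rewrite /q rmorphD /= subr0.
have hb w : punctured w -> 0 < s w -> wder (fun z => (s z)%:C) w (a w) ((a w)^*%C) ->
    wder (fun z => (u z)%:C) w (b w) ((b w)^*%C).
  move=> [w0 w1] sw hw.
  have w0' : w - 0 != 0 by rewrite subr0.
  have w1' : w - 1 != 0 by rewrite subr_eq0.
  have h0 := wder_ln (sq0 0 w w0') (wder_sqmod 0 w).
  have h1 := wder_ln (sq0 1 w w1') (wder_sqmod 1 w).
  have h2 := wder_ln (q0 w) (wq w).
  have h3 := wder_ln sw hw.
  have hz (x : R) (f : C -> C) y z : wder f w y z -> wder (fun v => x%:C * f v) w (x%:C * y) (x%:C * z).
    move=> hf; have := wderM (wder_cst x%:C w) hf; by rewrite !mul0r !add0r.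
  have := wderD h3 (wderD (wderD (hz al _ _ _ h0) (hz be _ _ _ h1)) (hz ka _ _ _ h2)).
  set X := (X in wder _ _ _ X).
  have -> : X = (b w)^*%C.
    have Jr (x y : R) (c : C) : (x%:C * (c^*%C / y%:C))^*%C = x%:C * (c / y%:C).
      by rewrite !cJM conjcK conjc_inv !conjc_real.
    by rewrite /b cJD cJM conjc_inv conjc_real /mu (cJD (_ + _)) (cJD (al%:C * _)) !Jr.
  apply: wder_near; near=> v; rewrite /u.
  by rewrite !rmorphD /= !rmorphM.
have hmu : wder mu p (- (al%:C / (p - 0) ^+ 2) - be%:C / (p - 1) ^+ 2 -
    ka%:C * (p^*%C / (q p)%:C) ^+ 2) (ka%:C / (q p)%:C ^+ 2).
  have [p0 p1] := pp.
  have pole (c : C) : p - c != 0 ->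
      wder (fun w => (w - c)^*%C / (cmod (w - c) ^+ 2)%:C) p (- 1 / (p - c) ^+ 2) 0.
    move=> pc; have h : wder (fun w => w - c) p (1 - 0) (0 - 0).
      by apply: wderB; [exact: wder_id|exact: wder_cst].
    have n0 : \forall w \near (p : C^o), w - c != 0 by exact: clim_neq0 (wder_clim h) pc.
    have := wderV h pc; rewrite !subr0 oppr0 mul0r; apply: wder_near.
    apply: filterS n0 => w wc; rewrite -cmod_sqr invfM mulrCA mulfV ?mulr1 //.
    by rewrite conjc_eq0.
  have qC : (q p)%:C != 0 :> C by rewrite (inj_eq (@complexI R)) gt_eqF.
  have hq : wder (fun w => w^*%C / (q w)%:C) p (- (p^*%C / (q p)%:C) ^+ 2) (((q p)%:C ^+ 2)^-1).
    have := wderM (wder_conj (wder_id p)) (wderV (wq p) qC).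
    rewrite conjc0 conjc1 mul0r mul1r add0r.
    set x := (X in wder _ _ X _); set y := (X in wder _ _ _ X).
    have -> : x = - (p^*%C / (q p)%:C) ^+ 2 by rewrite /x; field.
    have -> // : y = ((q p)%:C ^+ 2)^-1.
    have e : (q p)%:C = 1 + p * p^*%C by rewrite cmod_sqr -(rmorph1 (real_complex R)) -rmorphD.
    by rewrite /y; move: qC; rewrite e => qC; field.
  have hz (x : R) (f : C -> C) y z : wder f p y z -> wder (fun v => x%:C * f v) p (x%:C * y) (x%:C * z).
    move=> hf; have := wderM (wder_cst x%:C p) hf; by rewrite !mul0r !add0r.
  have p0' : p - 0 != 0 by rewrite subr0.
  have p1' : p - 1 != 0 by rewrite subr_eq0.
  have := wderD (wderD (hz al _ _ _ (pole 0 p0')) (hz be _ _ _ (pole 1 p1'))) (hz ka _ _ _ hq).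
  by rewrite !mulr0 !add0r !mulN1r !mulrN.
have [p0 p1] := pp.
have sp0 : 0 < s p := nbhs_singleton s0.
have hsp := nbhs_singleton hs.
have sC0 : (s p)%:C != 0 :> C by rewrite (inj_eq (@complexI R)) gt_eqF.
have hinv := wderV hsp sC0.
have hbp := wderD (wderM ha hinv) hmu.
have [] := @wirtinger_max_test u b p _ _ _ hbp.
- apply: filterS3 (punctured_open pp) s0 hs => w; exact: hb.
- apply: filterS2 s0 hmax => w sw; rewrite -ler_ln ?posrE ?mulr_gt0 ?expR_gt0 //.
  by rewrite !lnM ?posrE ?expR_gt0 // !expRK /u !subr0.
rewrite /b => e1 e2; exists (- mu p); split.
  move/eqP: e1; rewrite addr_eq0 => /eqP <-.
  by rewrite mulfVK.
move: e2.
set K := (X in complex.Re X).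
have -> : K = ((s p)^-1)%:C * k - ((s p) ^- 2)%:C * (a p * (a p)^*%C) + (ka * (q p) ^- 2)%:C.
  rewrite /K fmorphV rmorphM !fmorphV !rmorphXn /=.
  by field; rewrite sC0 /= (inj_eq (@complexI R)) gt_eqF.
rewrite cReD cReB cmod_sqr cReMr -!rmorphM /= => e2.
rewrite -(ler_pM2l (_ : 0 < (s p) ^- 2)) ?invr_gt0 ?exprn_gt0 //.
rewrite -subr_le0; apply: le_trans e2; rewrite le_eqVlt; apply/orP; left; apply/eqP.
by rewrite -/(q p); field; rewrite !gt_eqF // q0.
Unshelve. all: by end_near. Qed.

End MaximumPrinciple.

(** * Maxima on the punctured sphere *)

Section PuncturedSphere.
Variable R : realType.
Local Notation C := R[i].

Definition decays (W : C -> R) := forall e : R, 0 < e -> exists2 eta : R, 0 < eta &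
  forall z, punctured z -> cmod z < eta \/ cmod (z - 1) < eta \/ eta^-1 < cmod z ->
    W z < e.

(** Extended by [0], [W] is continuous on the plane, and a large square contains its
    maximum. *)
Lemma punctured_max (W : C -> R) z1 :
  (forall z, punctured z -> W w @[w --> (z : C^o)] --> W z) ->
  (forall z, punctured z -> 0 <= W z) -> decays W -> punctured z1 -> 0 < W z1 ->
  exists p, [/\ punctured p, 0 < W p & forall z, punctured z -> W z <= W p].
Proof.
move=> cW W0 dW pz1 W1.
pose E (z : C) : R := if (z == 0) || (z == 1) then 0 else W z.
have EW (z : C) : punctured z -> E z = W z.
  by move=> [z0 z1']; rewrite /E (negPf z0) (negPf z1').
have nE (z : C) : ~ punctured z -> z = 0 \/ z = 1.
  move=> np; have [->|z0] := eqVneq z 0; first by left.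
  have [->|z1'] := eqVneq z 1; first by right.
  by case: np; split.
have E0 (z : C) : 0 <= E z.
  rewrite /E; case: ifPn => // /norP[z0 z1']; exact: W0.
have cE (z : C) : E w @[w --> (z : C^o)] --> E z.
  have [pz|/nE zz] := EM (@punctured R z).
    rewrite EW //; apply: cvg_trans (cW z pz).
    have FF : Filter (nbhs (z : C^o)) by exact: nbhs_filter.
    apply: (@near_eq_cvg _ _ (nbhs (z : C^o)) FF).
    have o : \forall w \near (z : C^o), punctured w by exact: punctured_open.
    by near=> w; rewrite EW //; near: w.
  have -> : E z = 0 by rewrite /E; case: zz => ->; rewrite eqxx ?orbT.
  have FF : Filter (nbhs (z : C^o)) by exact: nbhs_filter.
  apply/(@cvgrPdist_lt _ _ _ _ FF) => e e0; have [eta eta0 h] := dW e e0.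
  have o := @clim_id R z eta eta0; near=> w.
  have hw : cmod (w - z) < eta by near: w.
  rewrite sub0r normrN ger0_norm ?E0 //.
  have [pw|/nE ww] := EM (@punctured R w); last first.
    by rewrite /E; case: ww => ->; rewrite eqxx ?orbT.
  rewrite EW //; apply: h => //; case: zz hw => ->; first by rewrite subr0; left.
  by right; left.
pose f (x : R * R) : R := E (x.1 +i* x.2).
have cf : continuous f.
  move=> x; have h : clim (nbhs x) (fun y : R * R => y.1 +i* y.2) (x.1 +i* x.2).
    by apply/climP; split=> /=; [exact: cvg_fst|exact: cvg_snd].
  move/ccvgP: h => h; exact: (cvg_comp _ _ h (cE _)).
have [eta eta0 h] := dW _ W1.
pose rho := eta^-1; pose A := (`[(- rho)%R, rho] `*` `[(- rho)%R, rho])%classic : set (R * R).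
have inA z : cmod z <= rho -> A (complex.Re z, complex.Im z).
  move=> hz; have := cmod_Re z; have := cmod_Im z; rewrite !ler_norml.
  by move=> /andP[? ?] /andP[? ?]; split=> /=; rewrite in_itv /=; apply/andP; split; lra.
have reim z : f (complex.Re z, complex.Im z) = E z by rewrite /f /=; case: z.
have z1A : cmod z1 <= rho.
  rewrite leNgt; apply/negP => hz; have := h z1 pz1; rewrite ltxx => F.
  by suff : false by []; apply: F; right; right.
have A0 : A !=set0 by exists (complex.Re z1, complex.Im z1); exact: inA.
have Ac : compact A by apply: compact_setX; exact: segment_compact.
have [c cA cmax] := compact_EVT_max A0 Ac (continuous_subspaceT cf).
pose p := c.1 +i* c.2.
have pmax z : cmod z <= rho -> E z <= E p.
  by move=> hz; rewrite -reim; apply: cmax; apply/mem_set; exact: inA.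
have Ep : 0 < E p by apply: lt_le_trans (pmax z1 z1A); rewrite EW.
have pp : punctured p.
  by apply: contrapT => /nE pp; move: Ep; rewrite /E; case: pp => ->; rewrite eqxx ?orbT ltxx.
exists p; rewrite -(EW p) //; split=> // z pz; rewrite -EW //.
have [/pmax//|hz] := leP (cmod z) rho.
rewrite EW //; apply: le_trans (pmax z1 z1A); rewrite EW //; apply: ltW.
by apply: h => //; right; right.
Unshelve. all: by end_near.
Qed.

Lemma expR_ln_small (b c e : R) : 0 < b -> 0 < e ->
  exists2 eta : R, 0 < eta & forall r, 0 < r -> r < eta -> c * expR (b * ln r) < e.
Proof.
move=> b0 e0; have c1 : 0 < `|c| + 1 by rewrite ltr_wpDl.
exists (expR (ln (e / (`|c| + 1)) / b)); first exact: expR_gt0.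
move=> r r0; rewrite -[r in r < _]lnK ?posrE // ltr_expR ltr_pdivlMr // mulrC => h.
have : expR (b * ln r) < e / (`|c| + 1).
  by rewrite -[ltRHS]lnK ?posrE ?divr_gt0 // ltr_expR.
rewrite ltr_pdivlMr // mulrC; apply: le_lt_trans.
by rewrite ler_wpM2r ?expR_ge0 //; have := ler_norm c; lra.
Qed.

Lemma abs_bound (b x c : R) : `|x| <= c -> b * x <= `|b| * c.
Proof.
move=> h; apply: le_trans (ler_norm _) _.
by rewrite normrM ler_wpM2l.
Qed.

Lemma ln_bound (x : R) : 1 / 4 <= x <= 4 -> `|ln x| <= ln 4.
Proof.
move=> /andP[x1 x2]; have x0 : 0 < x by lra.
have e : ln (1 / 4) = - ln 4 :> R by rewrite mul1r lnV ?posrE.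
by rewrite ler_norml -e !ler_ln ?posrE // x1 x2.
Qed.

(** Near a puncture the factors of the gauge that do not vanish or blow up there stay
    within constants, whose logarithms [c] collects; the remaining power of the local
    coordinate has a positive exponent. *)
Lemma gauge_decay (s : C -> R) (al be ka a0 a1 ai K eta : R) :
  0 < eta -> 0 < a0 + 2 * al -> 0 < a1 + 2 * be -> ai + 2 * (al + be + ka) < 0 ->
  (forall z, 0 < cmod z < eta -> s z <= K * expR (a0 * ln (cmod z))) ->
  (forall z, 0 < cmod (z - 1) < eta -> s z <= K * expR (a1 * ln (cmod (z - 1)))) ->
  (forall z, eta^-1 < cmod z -> s z <= K * expR (ai * ln (cmod z))) ->
  decays (fun z => s z * gauge al be ka z).
Proof.
move=> eta0 h0 h1 hi s0 s1 si e e0.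
pose c : R := (`|al| + `|be| + `|ka|) * ln 4 + `|be| * (2 * ln 2) + `|ka| * ln 4.
have ln20 : 0 <= ln 2 :> R by rewrite ln_ge0 // ler1n.
have ln40 : 0 <= ln 4 :> R by rewrite ln_ge0 // ler1n.
have lnsq (r : R) : 0 < r -> ln (r ^+ 2) = 2 * ln r.
  by move=> r0; rewrite expr2 lnM ?posrE // mulr_natl mulr2n.
have m0 : 0 <= `|al| * ln 4 by rewrite mulr_ge0.
have m1 : 0 <= `|be| * ln 4 by rewrite mulr_ge0.
have m2 : 0 <= `|ka| * ln 4 by rewrite mulr_ge0.
have m3 : 0 <= `|be| * (2 * ln 2) by rewrite !mulr_ge0.
have [e1 e10 he1] := @expR_ln_small (a0 + 2 * al) (`|K| * expR c) e h0 e0.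
have [e2 e20 he2] := @expR_ln_small (a1 + 2 * be) (`|K| * expR c) e h1 e0.
have hi' : 0 < - (ai + 2 * (al + be + ka)) by rewrite oppr_gt0.
have [e3 e30 he3] := @expR_ln_small _ (`|K| * expR c) e hi' e0.
pose eta' := Num.min (Num.min eta (1 / 2)) (Num.min e1 (Num.min e2 e3)).
have eta'0 : 0 < eta' by rewrite !lt_min eta0 e10 e20 e30 divr_gt0.
have final z (x l : R) : s z <= K * expR (x * ln l) -> forall b y,
    al * ln (cmod z ^+ 2) + be * ln (cmod (z - 1) ^+ 2) + ka * ln (1 + cmod z ^+ 2) <= b + c ->
    x * ln l + b = y -> `|K| * expR c * expR y < e -> s z * gauge al be ka z < e.
  move=> hs b y hb hy; apply: le_lt_trans.
  have hs' : s z <= `|K| * expR (x * ln l).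
    by apply: le_trans hs _; rewrite ler_wpM2r ?expR_ge0 ?ler_norm.
  apply: le_trans (ler_wpM2r (expR_ge0 _) hs') _.
  rewrite -!mulrA ler_wpM2l // -!expRD ler_expR -hy; lra.
exists eta' => // z [z0 z1].
have r0 : 0 < cmod z by rewrite cmod_gt0.
have r1 : 0 < cmod (z - 1) by rewrite cmod_gt0 subr_eq0.
have sq0 : 0 <= cmod z ^+ 2 by rewrite sqr_ge0.
have tri1 : cmod (z - 1) <= cmod z + 1.
  by apply: le_trans (cmodD _ _) _; rewrite cmodN cmod1.
have tri2 : cmod z <= cmod (z - 1) + 1.
  have {1}-> : z = (z - 1) + 1 by ring.
  by apply: le_trans (cmodD _ _) _; rewrite cmod1.
have tri3 : 1 <= cmod (z - 1) + cmod z.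
  have := cmodD (- (z - 1)) z; rewrite cmodN.
  by rewrite opprB subrK cmod1.
rewrite !lt_min; move=> [|[|]].
- move=> /andP[/andP[b1 b2] /andP[b3 _]].
  apply: (final _ a0 (cmod z) (s0 z _) (2 * al * ln (cmod z))); last first.
  + exact: (he1 _ r0 b3).
  + by ring.
  + have x1 : `|ln (cmod (z - 1) ^+ 2)| <= ln 4 by apply: ln_bound; nra.
    have x2 : `|ln (1 + cmod z ^+ 2)| <= ln 4 by apply: ln_bound; nra.
    have := abs_bound be x1; have := abs_bound ka x2.
    rewrite (lnsq _ r0) /c; lra.
  + by rewrite r0.
- move=> /andP[/andP[b1 b2] /andP[_ /andP[b3 _]]].
  apply: (final _ a1 (cmod (z - 1)) (s1 z _) (2 * be * ln (cmod (z - 1)))); last first.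
  + exact: (he2 _ r1 b3).
  + by ring.
  + have x1 : `|ln (cmod z ^+ 2)| <= ln 4 by apply: ln_bound; nra.
    have x2 : `|ln (1 + cmod z ^+ 2)| <= ln 4 by apply: ln_bound; nra.
    have := abs_bound al x1; have := abs_bound ka x2.
    rewrite (lnsq _ r1) /c; lra.
  + by rewrite r1.
rewrite /eta' => hz.
have inv_lt (x : R) : 0 < x -> eta' <= x -> x^-1 < cmod z.
  by move=> x0 hx; apply: le_lt_trans hz; rewrite lef_pV2 ?posrE.
have b1 : eta^-1 < cmod z by apply: inv_lt => //; rewrite /eta' !ge_min lexx.
have b2 : 2 < cmod z.
  by have := @inv_lt (1 / 2); rewrite mul1r invrK; apply; rewrite ?invr_gt0 // /eta' mul1r !ge_min lexx !orbT.
have b3 : (cmod z)^-1 < e3.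
  rewrite -[e3]invrK ltf_pV2 ?posrE ?invr_gt0 //.
  by apply: inv_lt => //; rewrite /eta' !ge_min lexx !orbT.
apply: (final _ ai (cmod z) (si z b1) (2 * (al + be + ka) * ln (cmod z))); last first.
+ have := he3 (cmod z)^-1; rewrite invr_gt0 => /(_ r0 b3).
  rewrite lnV ?posrE // mulrN mulNr opprK; exact.
+ by ring.
rewrite !lnsq //.
have lq : ln (1 + cmod z ^+ 2) = 2 * ln (cmod z) + ln ((1 + cmod z ^+ 2) / cmod z ^+ 2).
  by rewrite -lnsq // -lnM ?posrE ?divr_gt0 ?exprn_gt0 ?ltr_pwDl // mulrC divfK // expf_neq0 // gt_eqF.
have l1 : ln (cmod (z - 1)) = ln (cmod z) + ln (cmod (z - 1) / cmod z).
  by rewrite -lnM ?posrE ?divr_gt0 // mulrC divfK // gt_eqF.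
have x1 : `|ln (cmod (z - 1) / cmod z)| <= ln 2.
  have e' : ln (1 / 2) = - ln 2 :> R by rewrite mul1r lnV ?posrE.
  rewrite ler_norml -e' !ler_ln ?posrE ?divr_gt0 //.
  by rewrite ler_pdivlMr // ler_pdivrMr //; apply/andP; split; lra.
have x2 : `|ln ((1 + cmod z ^+ 2) / cmod z ^+ 2)| <= ln 4.
  apply: ln_bound; rewrite ler_pdivlMr ?ler_pdivrMr ?exprn_gt0 //.
  by apply/andP; split; nra.
have x1' : `|2 * ln (cmod (z - 1) / cmod z)| <= 2 * ln 2.
  by rewrite normrM ger0_norm // ler_wpM2l.
have := abs_bound be x1'; have := abs_bound ka x2.
rewrite lq l1 /c; lra.
Qed.

Lemma gauge_gt0 (al be ka : R) (z : C) : 0 < gauge al be ka z.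
Proof. exact: expR_gt0. Qed.

Lemma gauge_continuous (al be ka : R) (z : C) : punctured z ->
  gauge al be ka w @[w --> (z : C^o)] --> gauge al be ka z.
Proof.
move=> [z0 z1]; rewrite /gauge.
have FF : Filter (nbhs (z : C^o)) by exact: nbhs_filter.
have h0 : clim (nbhs (z : C^o)) (fun w => w - 1) (z - 1).
  by apply: climB; [exact: clim_id|exact: clim_cst].
have c0 : cmod w @[w --> (z : C^o)] --> cmod z by exact: clim_cmod (clim_id z).
have c1 : cmod (w - 1) @[w --> (z : C^o)] --> cmod (z - 1) by exact: clim_cmod h0.
have sq (f : C -> R) (l : R) : f w @[w --> (z : C^o)] --> l ->
    f w ^+ 2 @[w --> (z : C^o)] --> l ^+ 2.
  move=> h; rewrite expr2; have -> : (fun w => f w ^+ 2) = (fun w => f w * f w).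
    by apply/funext => w; rewrite expr2.
  exact: (@cvgM R C^o (nbhs (z : C^o)) FF f f l l h h).
have lnc (f : C -> R) (l : R) : 0 < l -> f w @[w --> (z : C^o)] --> l ->
    ln (f w) @[w --> (z : C^o)] --> ln l.
  by move=> l0 h; exact: (cvg_comp _ _ h (continuous_ln l0)).
have g0 : 0 < cmod z ^+ 2 by rewrite exprn_gt0 // cmod_gt0.
have g1 : 0 < cmod (z - 1) ^+ 2 by rewrite exprn_gt0 // cmod_gt0 subr_eq0.
suff h : al * ln (cmod w ^+ 2) + be * ln (cmod (w - 1) ^+ 2) +
    ka * ln (1 + cmod w ^+ 2) @[w --> (z : C^o)] -->
    al * ln (cmod z ^+ 2) + be * ln (cmod (z - 1) ^+ 2) + ka * ln (1 + cmod z ^+ 2).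
  exact: (cvg_comp _ _ h (@continuous_expR R _)).
apply: cvgD; first apply: cvgD.
- by apply: cvgM; [exact: cvg_cst|apply: lnc => //; exact: sq].
- by apply: cvgM; [exact: cvg_cst|apply: lnc => //; exact: sq].
- apply: cvgM; [exact: cvg_cst|apply: lnc; first by rewrite ltr_pwDl // sqr_ge0].
  by apply: cvgD; [exact: cvg_cst|exact: sq].
Qed.

End PuncturedSphere.

(** * Norms of endomorphisms in adapted frames *)
Section FrameGrowth.
Variable R : realType.
Local Notation C := R[i].

Lemma cmod_sum_le (n : nat) (F : 'I_n -> C) (B : R) :
  (forall i, cmod (F i) <= B) -> cmod (\sum_i F i) <= n%:R * B.
Proof.
elim: n F => [|n ih] F hF; first by rewrite big_ord0 cmod0 mul0r.
rewrite big_ord_recl; apply: le_trans (cmodD _ _) _.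
by rewrite -natr1 addrC mulrDl mul1r lerD ?ih.
Qed.

Lemma det2 (A : 'M[C]_2) : \det A = A 0 0 * A 1 1 - A 0 1 * A 1 0.
Proof.
rewrite (expand_det_row _ 0) !big_ord_recl big_ord0 addr0 /cofactor !det_mx11 !mxE.
rewrite /= expr0 mul1r expr1 mulN1r mulrN.
by congr (_ * A _ _ - A _ _ * A _ _); apply: val_inj.
Qed.

Lemma quad_delta n (G : 'M[C]_n) i :
  (((delta_mx i 0 : 'cV[C]_n) ^t*) *m G *m (delta_mx i 0 : 'cV[C]_n)) 0 0 = G i i.
Proof.
rewrite mxE (bigD1 i) //= big1 ?addr0.
  rewrite [X in _ * X]mxE !eqxx mulr1 mxE (bigD1 i) //= big1 ?addr0.
    by rewrite adjE mxE !eqxx conjc1 mul1r.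
  by move=> j ji; rewrite adjE !mxE (negPf ji) conjc0 mul0r.
by move=> j ji; rewrite [X in _ * X]mxE (negPf ji) mulr0.
Qed.

Lemma posdef_diag n (G : 'M[C]_n) i : posdef G -> 0 < complex.Re (G i i).
Proof.
move=> [_ hp]; have := hp (delta_mx i 0).
have n0 : (delta_mx i 0 : 'cV[C]_n) != 0.
  apply: contraTneq isT => /matrixP/(_ i 0); rewrite !mxE !eqxx => /eqP.
  by rewrite oner_eq0.
by move=> /(_ n0); rewrite quad_delta ltcE => /andP[].
Qed.

(** The squared Hermitian norm of an endomorphism is controlled by its matrix in
    any frame, the norms of the frame, and those of the dual frame; in rank three
    the latter are products of two of the former, divided by the determinant. *)
Lemma frame_norm_bound (G M : 'M[C]_3) (d S : R) (g : 'I_3 -> R) :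
  posdef G -> \det G = d%:C -> 0 < d ->
  (forall i, complex.Re (G i i) <= g i ^+ 2) -> (forall i, 0 <= g i) ->
  (forall i j, cmod (M i j) * g i * (g (lift j ord0) * g (lift j ord_max)) <= S) ->
  complex.Re (\tr (M *m dagger G M)) <= 9 * (9 * S) ^+ 2 / d.
Proof.
move=> pG dG d0 hg g0 hS.
have uG : G \in unitmx by rewrite unitmxE dG unitfE (inj_eq (@complexI R)) gt_eqF.
have [Q uQ GE] := posdef_factor pG.
pose h (j : 'I_3) := g (lift j ord0) * g (lift j ord_max) / Num.sqrt d.
have sd : 0 < Num.sqrt d by rewrite sqrtr_gt0.
have h0 j : 0 <= h j by rewrite /h divr_ge0 ?mulr_ge0 // ltW.
have Qle a i : cmod (Q a i) <= g i.
  rewrite -ler_sqr ?nnegrE ?cmod_ge0 //; apply: le_trans (hg i).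
  rewrite GE mxE (@raddf_sum _ _ (@complex.Re R : Rcomplex R -> R)) /=.
  rewrite (bigD1 a) //= adjE conj_cmod /= lerDl; apply: sumr_ge0 => k _.
  by rewrite adjE conj_cmod /= sqr_ge0.
have GiE : invmx G = invmx Q *m (invmx Q) ^t*.
  by rewrite GE invmx_mul ?unitmx_adj // adj_inv.
(* the diagonal of the inverse consists of principal 2 x 2 minors divided by [det G] *)
have Gd j : complex.Re (invmx G j j) <= h j ^+ 2.
  rewrite /invmx uG !mxE dG /cofactor -signr_odd oddD addbb expr0 mul1r.
  rewrite det2 !mxE -fmorphV cReMr /h expr_div_n sqr_sqrtr ?(ltW d0) // mulrC.
  rewrite ler_wpM2r ?invr_ge0 ?(ltW d0) //.
  have l0 : (0 : 'I_2) = ord0 by apply: val_inj.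
  have l1 : (1 : 'I_2) = ord_max by apply: val_inj.
  rewrite l0 l1; set k := lift j ord0; set l := lift j ord_max.
  have Gh : G l k = (G k l)^*%C by have [e _] := pG; rewrite -[LHS](congr1 (fun X : 'M[C]_3 => X l k) e) adjE.
  have Gr i : G i i = (complex.Re (G i i))%:C.
    have [e _] := pG; have := congr1 (fun X : 'M[C]_3 => X i i) e.
    by rewrite adjE; case: (G i i) => a b [/eqP]; rewrite -subr_eq0 -opprD oppr_eq0 -mulr2n mulrn_eq0 /= => /eqP ->.
  rewrite Gh cmod_sqr cReB Gr (Gr l) -rmorphM /= exprMn.
  have := ler_pM (ltW (posdef_diag k pG)) (ltW (posdef_diag l pG)) (hg k) (hg l).
  by apply: le_trans; rewrite gerBl sqr_ge0.
have Qile j b : cmod (invmx Q j b) <= h j.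
  rewrite -ler_sqr ?nnegrE ?cmod_ge0 //; apply: le_trans (Gd j).
  rewrite GiE mxE (@raddf_sum _ _ (@complex.Re R : Rcomplex R -> R)) /=.
  rewrite (bigD1 b) //= adjE cmod_sqr /= lerDl; apply: sumr_ge0 => k _.
  by rewrite adjE cmod_sqr /= sqr_ge0.
have ent a b : cmod ((Q *m M *m invmx Q) a b) <= 9 * S / Num.sqrt d.
  rewrite mxE; have -> : 9 * S / Num.sqrt d = 3%:R * (3%:R * (S / Num.sqrt d)) by ring.
  apply: cmod_sum_le => j; rewrite mxE mulr_suml; apply: cmod_sum_le => i.
  rewrite !cmodM ler_pdivlMr //.
  apply: le_trans (hS i j).
  have t1 : cmod (Q a i) * cmod (M i j) <= cmod (M i j) * g i.
    by rewrite mulrC ler_wpM2l ?cmod_ge0.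
  have t2 : cmod (invmx Q j b) * Num.sqrt d <= g (lift j ord0) * g (lift j ord_max).
    by rewrite -ler_pdivlMr //; exact: Qile.
  rewrite -[leLHS]mulrA; apply: (ler_pM _ _ t1 t2).
    by apply: mulr_ge0; exact: cmod_ge0.
  by apply: mulr_ge0; [exact: cmod_ge0|exact: ltW].
rewrite -(frame_tr uQ) (frameM uQ) (frame_dagger uQ GE) frobenius /=.
have -> : 9 * (9 * S) ^+ 2 / d = \sum_(i < 3) \sum_(j < 3) (9 * S / Num.sqrt d) ^+ 2.
  rewrite !sumr_const !card_ord expr_div_n sqr_sqrtr ?(ltW d0) //.
  by rewrite -mulrnA -[RHS]mulr_natl -!mulrA.
apply: ler_sum => i _; apply: ler_sum => j _.
by rewrite ler_sqr ?nnegrE ?cmod_ge0 // (le_trans (cmod_ge0 _) (ent i j)).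
Qed.

End FrameGrowth.

(** * Growth of the Higgs field at the punctures *)

Section FlagFrames.
Variable R : realType.
Local Notation C := R[i].
Implicit Types U V : {vspace 'cV[C]_3}.

Lemma vspace_step U V d : (U <= V)%VS -> \dim U = d -> \dim V = d.+1 ->
  exists2 b, b \in V & forall v, v \in V -> exists c, v - c *: b \in U.
Proof.
move=> UV dU dV; have /subvPn[b bV bU] : ~~ (V <= U)%VS.
  by apply/negP => /dimvS; rewrite dU dV ltnn.
exists b => // v vV.
have UbV : (U + <[b]> <= V)%VS by rewrite subv_add UV -memvE.
have dUb : (d < \dim (U + <[b]>))%N.
  rewrite ltnNge; apply/negP => h; move/negP: bU; apply.
  have : (U == U + <[b]>)%VS by rewrite eqEdim addvSl dU.
  by move/eqP ->; apply: (subvP (addvSr U <[b]>)); exact: memv_line.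
have /eqP e : (U + <[b]> == V)%VS by rewrite eqEdim UbV dV.
move: vV; rewrite -e => /memv_addP[u uU [w /vlineP[c ->] ->]].
by exists c; rewrite addrK.
Qed.

(** One vector for each step of the flag gives a basis, in which an endomorphism that
    lowers the flag is strictly triangular. *)
Lemma flag_frame (l : nat -> {vspace 'cV[C]_3}) (N : 'M[C]_3) :
  full_flag l -> (forall i, (i < 3)%N -> mx_stable N (l i) (l i.+1)) ->
  exists B : 'M[C]_3, [/\ B \in unitmx, forall j : 'I_3, col j B \in l j
    & forall i j : 'I_3, (i <= j)%N -> (invmx B *m N *m B) i j = 0].
Proof.
move=> [dl sl] hN.
have /choice[b hb] : forall j : 'I_3, exists b, b \in l j /\
    forall v, v \in l j -> exists c, v - c *: b \in l j.+1.
  move=> j; have j3 := ltn_ord j.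
  have [|||b b1 b2] := @vspace_step (l j.+1) (l j) (3 - j.+1)%N.
  - exact: sl.
  - exact: dl.
  - by rewrite dl ?(ltnW j3) // subnSK.
  - by exists b.
pose B : 'M[C]_3 := \matrix_(i, j) b j i 0.
have cB j : col j B = b j by apply/matrixP => i k; rewrite !mxE ord1.
have gen k : forall m, (k + m = 3)%N -> forall v, v \in l m ->
    exists2 c : 'cV[C]_3, v = B *m c & forall i : 'I_3, (i < m)%N -> c i 0 = 0.
  elim: k => [|k ih] m km v vl.
    exists 0; last by move=> i _; rewrite mxE.
    rewrite mulmx0; apply/eqP; rewrite -memv0.
    have /eqP : \dim (l m) = 0%N by rewrite dl -km ?subnn.
    by rewrite dimv_eq0 => /eqP <-.
  have m3 : (m < 3)%N by rewrite -km addSn ltnS leq_addl.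
  have [_ /(_ v vl)[c hc]] := hb (Ordinal m3).
  have [||c' e z] := ih m.+1 _ (v - c *: b (Ordinal m3)) => //; first by rewrite -km addnS addSn.
  exists (c *: delta_mx (Ordinal m3) 0 + c').
    by rewrite mulmxDr -scalemxAr -colE cB -e addrC subrK.
  move=> i im; rewrite !mxE z ?addr0; last exact: leqW.
  have -> : (i == Ordinal m3) = false by apply/negbTE; rewrite neq_ltn im.
  by rewrite mulr0.
have uB : B \in unitmx.
  have /choice[c hc] : forall j : 'I_3, exists c : 'cV[C]_3, delta_mx j 0 = B *m c.
    move=> j; have [||c e _] := gen 3 0%N _ (delta_mx j 0) => //; last by exists c.
    have /eqP -> : (l 0%N == fullv)%VS by rewrite eqEdim subvf /= dl // dimvf /dim /= muln1.
    exact: memvf.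
  apply: (proj1 (@mulmx1_unit _ _ B (\matrix_(i, j) c j i 0) _)).
  apply/matrixP => i j; have := congr1 (fun x : 'cV[C]_3 => x i 0) (hc j).
  rewrite mxE eqxx andbT [RHS]mxE => e; rewrite [RHS]mxE e mxE.
  by apply: eq_bigr => k _; congr (_ * _); rewrite mxE.
exists B; split=> // [j|i j ij]; first by rewrite cB; have [] := hb j.
have jl : N *m b j \in l j.+1.
  have /subvP := hN j (ltn_ord j); apply.
  by have := memv_img (linfun (mulmx N)) (proj1 (hb j)); rewrite lfunE.
have [|c e z] := gen (3 - j.+1)%N j.+1 _ _ jl; first by rewrite subnK.
have : col j (invmx B *m N *m B) = c by rewrite colE -mulmxA -colE cB -mulmxA e mulKmx.
by move/matrixP/(_ i 0); rewrite mxE => ->; exact: z.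
Qed.

End FlagFrames.

Section LocalBounds.
Variable R : realType.
Local Notation C := R[i].

Lemma posdef_congr n (H V : 'M[C]_n) : posdef H -> V \in unitmx ->
  posdef (V ^t* *m H *m V).
Proof.
move=> [hh hp] uV; split; first by rewrite !adjM adjK hh !mulmxA.
move=> v v0; have Vv : V *m v != 0.
  by apply: contra_neq v0 => e; rewrite -[v](mulKmx uV) e mulmx0.
by have := hp _ Vv; rewrite adjM !mulmxA.
Qed.

Lemma det_adj n (A : 'M[C]_n) : \det (A ^t*) = (\det A)^*%C.
Proof. by rewrite det_map_mx det_tr; exact: conjCE. Qed.

Lemma frame_relation n (T X W B : 'M[C]_n) c : W \in unitmx -> B \in unitmx ->
  T *m W = c *: (W *m X) ->
  T = c *: ((W *m B) *m (invmx B *m X *m B) *m invmx (W *m B)).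
Proof.
move=> uW uB h; rewrite invmx_mul // !mulmxA mulmxK // mulmxK //.
by rewrite -[LHS](mulmxK uW) h -scalemxAl.
Qed.

Lemma trace_square_conj n (X V : 'M[C]_n) : V \in unitmx ->
  \tr ((V *m X *m invmx V) *m (V *m X *m invmx V)) = \tr (X *m X).
Proof. by move=> uV; rewrite -(frameM uV X X) frame_tr. Qed.

Lemma trace_dagger_conj n (H X V : 'M[C]_n) : H \in unitmx -> V \in unitmx ->
  \tr ((V *m X *m invmx V) *m dagger H (V *m X *m invmx V)) =
  \tr (X *m dagger (V ^t* *m H *m V) X).
Proof.
move=> uH uV; have uVa : V ^t* \in unitmx by rewrite unitmx_adj.
have -> : dagger H (V *m X *m invmx V) = V *m dagger (V ^t* *m H *m V) X *m invmx V.
  rewrite /dagger !adjM adj_inv !invmx_mul ?unitmx_mul ?uVa ?uH // !mulmxA.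
  by rewrite mulmxV // mul1mx mulmxK.
by rewrite -(frameM uV) frame_tr.
Qed.

Lemma trace_dagger_scale n (H X : 'M[C]_n) c :
  \tr ((c *: X) *m dagger H (c *: X)) = (cmod c ^+ 2)%:C * \tr (X *m dagger H X).
Proof.
rewrite /dagger adjZ -scalemxAr -scalemxAl -scalemxAl -scalemxAr scalerA.
by rewrite linearZ /= cmod_sqr.
Qed.

Lemma hol_lip (f : C -> C) z : hol f z -> exists L eta : R, [/\ 0 <= L, 0 < eta &
  forall w, cmod (w - z) < eta -> cmod (f w - f z) <= L * cmod (w - z)].
Proof.
move=> [d [u [v [hu hv h]]]].
have h' : \forall w \near (z : C^o), cmod (f w - f z) <= (cmod d + 2) * cmod (w - z).
  have hu1 := hu 1 ltr01; have hv1 := hv 1 ltr01.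
  near=> w.
  have -> : f w - f z = (w - z) * u w + (w - z)^*%C * v w by near: w.
  apply: le_trans (cmodD _ _) _; rewrite !cmodM cmodJ -mulrDr mulrC ler_wpM2r ?cmod_ge0 //.
  have u1 : cmod (u w) <= cmod d + 1.
    have e : cmod (u w - d) < 1 by near: w.
    have := cmodD (u w - d) d; rewrite subrK; lra.
  have v1 : cmod (v w) <= 1.
    have e : cmod (v w - 0) < 1 by near: w.
    by move: e; rewrite subr0 => /ltW.
  lra.
have /near_cmodP[eta eta0 he] := h'.
exists (cmod d + 2), eta; split=> //; first by rewrite addr_ge0 ?cmod_ge0.
Unshelve. all: by end_near. Qed.

Lemma mx_hol_lip m n (M : C -> 'M[C]_(m, n)) z : (forall i j, hol (fun w => M w i j) z) ->
  exists L eta : R, [/\ 0 <= L, 0 < eta & forall w, cmod (w - z) < eta ->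
    forall i j, cmod (M w i j - M z i j) <= L * cmod (w - z)].
Proof.
move=> h.
have /choice[x hx] : forall p : 'I_m * 'I_n, exists y : R * R, [/\ 0 <= y.1, 0 < y.2 &
    forall w, cmod (w - z) < y.2 -> cmod (M w p.1 p.2 - M z p.1 p.2) <= y.1 * cmod (w - z)].
  by move=> [i j]; have [L [eta [? ? ?]]] := hol_lip (h i j); exists (L, eta).
exists (\sum_p (x p).1), (\big[Num.min/1]_p (x p).2); split.
- by apply: sumr_ge0 => p _; have [] := hx p.
- by apply/bigmin_gtP; split=> // p _; have [] := hx p.
move=> w hw i j; have [_ _ hp] := hx (i, j).
apply: le_trans (hp w _) _; first by apply: lt_le_trans hw _; exact: (bigmin_le _ (i, j)).
rewrite ler_wpM2r ?cmod_ge0 // (bigD1 (i, j)) //= lerDl.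
by apply: sumr_ge0 => p _; have [] := hx p.
Qed.

(** With weights [-1/3, 0, 1/3], a matrix entry strictly below the diagonal raises the
    weight by at least [1/3], while the other entries, divisible by the local
    coordinate, lower it by at most [2/3] and gain [1]. *)
Lemma weighted_frame_bound (G M : 'M[C]_3) (D d K L r : R) :
  posdef G -> \det G = D%:C -> 0 < D -> 0 <= K -> 0 <= L -> 0 < r <= 1 ->
  (forall i : 'I_3, complex.Re (G i i) <= (K * expR ((weight R i - d) * ln r)) ^+ 2) ->
  (forall i j : 'I_3, cmod (M i j) <= L * (if (i <= j)%N then r else 1)) ->
  complex.Re (\tr (M *m dagger G M)) <=
    9 * (9 * (L * K ^+ 3)) ^+ 2 / D * expR ((2 / 3 - 6 * d) * ln r).
Proof.
move=> pG dG D0 K0 L0 /andP[r0 r1] hG hM.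
have key (i j : 'I_3) : 1 / 3 <= ((i <= j)%N)%:R + weight R i +
    weight R (lift j ord0) + weight R (lift j ord_max).
  have w0 : weight R i0 = - 1 / 3 by rewrite -[nat_of_ord i0]/0%N /weight; field.
  have w1 : weight R i1 = 0 by rewrite -[nat_of_ord i1]/1%N /weight; field.
  have w2 : weight R i2 = 1 / 3 by rewrite -[nat_of_ord i2]/2%N /weight; field.
  have [a0 a1 a2] : [/\ lift i0 ord0 = i1, lift i1 ord0 = i0 & lift i2 ord0 = i0].
    by split; apply: val_inj.
  have [b0 b1 b2] : [/\ lift i0 ord_max = i2, lift i1 ord_max = i2 & lift i2 ord_max = i1].
    by split; apply: val_inj.
  by move: i j; do 2 apply: ord3P; rewrite ?(a0, a1, a2) ?(b0, b1, b2) ?(w0, w1, w2) /=; lra.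
have lr : ln r <= 0 by apply: ln_le0.
apply: le_trans (@frame_norm_bound R G M D (L * K ^+ 3 * expR ((1 / 3 - 3 * d) * ln r))
  (fun i => K * expR ((weight R i - d) * ln r)) pG dG D0 hG _ _) _.
- by move=> i; rewrite mulr_ge0 ?expR_ge0.
- move=> i j.
  have hm : cmod (M i j) <= L * expR (((i <= j)%N)%:R * ln r).
    by apply: le_trans (hM i j) _; case: ifP => _; rewrite ?mul1r ?mul0r ?expR0 ?lnK ?posrE.
  set a := weight R i; set b := weight R (lift j ord0); set c := weight R (lift j ord_max).
  apply: (@le_trans _ _ (L * expR (((i <= j)%N)%:R * ln r) * (K * expR ((a - d) * ln r)) *
    (K * expR ((b - d) * ln r) * (K * expR ((c - d) * ln r))))).
    by do 2 (apply: ler_wpM2r; first by rewrite ?mulr_ge0 ?expR_ge0).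
  have -> : L * expR (((i <= j)%N)%:R * ln r) * (K * expR ((a - d) * ln r)) *
    (K * expR ((b - d) * ln r) * (K * expR ((c - d) * ln r))) =
    L * K ^+ 3 * expR ((((i <= j)%N)%:R + a + b + c - 3 * d) * ln r).
    have -> : (((i <= j)%N)%:R + a + b + c - 3 * d) * ln r = ((i <= j)%N)%:R * ln r +
      (a - d) * ln r + (b - d) * ln r + (c - d) * ln r by ring.
    by rewrite !expRD; ring.
  rewrite ler_wpM2l ?mulr_ge0 ?exprn_ge0 // ler_expR ler_wnM2r //.
  by have := key i j; rewrite -/a -/b -/c; lra.
rewrite [(2 / 3 - 6 * d) * ln r](_ : _ = (1 / 3 - 3 * d) * ln r + (1 / 3 - 3 * d) * ln r); last by field.
rewrite expRD le_eqVlt; apply/orP; left; apply/eqP; field.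
by rewrite gt_eqF.
Qed.

End LocalBounds.

Section Punctures.
Variable R : realType.
Local Notation C := R[i].
Variable E : higgs R.
Hypothesis E_par : strongly_parabolic E.

(** The Higgs field in the chart at a puncture, the change of frame to the
    chart over [C], and the scalar relating the two. *)
Definition chart_hol (P : marked) (zeta : C) : 'M[C]_3 :=
  match P with
  | Pzero => hol0 E zeta | Pone => hol0 E (1 + zeta) | Pinfty => holoo E zeta
  end.

Definition chart_change (P : marked) (zeta : C) : 'M[C]_3 :=
  match P with Pinfty => invmx (trans E zeta^-1) | _ => 1%:M end.

Definition chart_factor (P : marked) (zeta : C) : C :=
  match P with
  | Pzero => (zeta * (zeta - 1))^-1
  | Pone => ((1 + zeta) * zeta)^-1
  | Pinfty => - zeta / (zeta - 1)
  end.

(** Twice the growth exponent of [Theta0] in a constant chart frame. *)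
Definition chart_order (P : marked) : R := if P is Pinfty then 2 else - 2.

Lemma loc_vecE P zeta v : loc_vec E P zeta v = chart_change P zeta *m v.
Proof. by case: P => //=; rewrite mul1mx. Qed.

Lemma hol_hol0 i j z : hol (fun w => hol0 E w i j) z.
Proof.
have [_ [h _] _ _ _] := E_par; exact: nbhs_singleton (holo_at_near (h i j z)).
Qed.

Lemma hol_chart P i j : hol (fun w => chart_hol P w i j) 0.
Proof.
have [_ [h h'] _ _ _] := E_par; case: P => /=.
- exact: hol_hol0.
- have [d [u [v [hu hv e]]]] := hol_hol0 i j 1; exists d.
  have sh : clim (nbhs (0 : C^o)) (fun w => 1 + w) 1.
    by rewrite -{2}(addr0 1); apply: climD; [exact: clim_cst|exact: clim_id].
  exists (fun w => u (1 + w)), (fun w => v (1 + w)); split.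
  + exact: clim_comp sh hu.
  + exact: clim_comp sh hv.
  have e' : \forall w \near (0 : C^o), hol0 E (1 + w) i j - hol0 E 1 i j =
     (1 + w - 1) * u (1 + w) + (1 + w - 1)^*%C * v (1 + w).
    exact: clim_near sh e.
  by apply: filterS e' => w; rewrite addr0 subr0 [1 + w - 1]addrAC subrr add0r.
- exact: nbhs_singleton (holo_at_near (h' i j 0)).
Qed.

Lemma chart_change_unit P zeta : zeta != 0 -> chart_change P zeta \in unitmx.
Proof.
move=> z0; case: P => /=; rewrite ?unitmx1 // unitmx_inv unitmxE.
by have [[_ dt] _ _ _ _] := E_par; rewrite dt ?unitr1 ?invr_neq0.
Qed.

Lemma chart_change_det P zeta : zeta != 0 -> \det (chart_change P zeta) = 1.
Proof.
move=> z0; case: P => /=; rewrite ?det1 // det_inv.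
by have [[_ dt] _ _ _ _] := E_par; rewrite dt ?invr1 ?invr_neq0.
Qed.

Lemma loc_pt_punctured P (zeta : C) : 0 < cmod zeta < 1 -> punctured (loc_pt P zeta).
Proof.
move=> /andP[]; rewrite cmod_gt0 => z0 z1.
have n1 : zeta != 1 by apply: contraTneq z1 => ->; rewrite cmod1 ltxx.
case: P => /=; split=> //.
- apply: contraTneq z1 => /eqP; rewrite addr_eq0 => /eqP e.
  by rewrite -[zeta]opprK -e cmodN cmod1 ltxx.
- by rewrite addrC -subr_eq0 addrK.
- by rewrite invr_eq0.
- by apply: contra_neq n1 => e; rewrite -[zeta]invrK e invr1.
Qed.

Lemma chart_relation P zeta : 0 < cmod zeta < 1 ->
  Theta0 E (loc_pt P zeta) *m chart_change P zeta =
  chart_factor P zeta *: (chart_change P zeta *m chart_hol P zeta).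
Proof.
move=> hz; have [n0 n1] := loc_pt_punctured P hz.
case: P n0 n1 => /= n0 n1; rewrite ?mulmx1 ?mul1mx // /Theta0.
  by congr (_ *: _); congr (_^-1); ring.
have z0 : zeta != 0 by rewrite -invr_eq0.
have [[_ dt] _ /(_ _ n0 n1) h _ _] := E_par.
have u : trans E zeta^-1 \in unitmx by rewrite unitmxE dt ?unitr1.
rewrite -/(Theta0 E zeta^-1) -[LHS](mulKmx u) [X in invmx _ *m X]mulmxA h.
rewrite invrK -scalemxAl -mulmxA mulmxV // mulmx1 /Thetaoo scalerA -scalemxAr.
congr (_ *: _); rewrite exprVn invrK; field; rewrite z0 subr_eq0.
by rewrite andbT; apply: contra_neq n1 => ->; rewrite invr1.
Qed.

Lemma chart_factor_bound P zeta : 0 < cmod zeta < 1 / 2 ->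
  cmod (chart_factor P zeta) ^+ 2 <= 4 * expR (chart_order P * ln (cmod zeta)).
Proof.
move=> /andP[r0 r1].
have half (w : C) : cmod w = 1 -> 1 / 2 <= cmod (zeta + w).
  move=> hw; have := cmodD (zeta + w) (- zeta); rewrite addrAC subrr add0r cmodN hw; lra.
have h1 : 1 / 2 <= cmod (zeta - 1) by apply: half; rewrite cmodN cmod1.
have h2 : 1 / 2 <= cmod (1 + zeta) by rewrite addrC; apply: half; rewrite cmod1.
have e2 (x : R) : expR (2 * x * ln (cmod zeta)) = expR (x * ln (cmod zeta)) ^+ 2.
  by rewrite expr2 -expRD; congr expR; ring.
have inv (x : R) : 1 / 2 <= x -> (x^-1) ^+ 2 <= 4.
  move=> hx; have -> : 4 = 2 ^+ 2 :> R by rewrite -natrX.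
  have x0 : 0 < x by lra.
  by rewrite ler_sqr ?nnegrE ?invr_ge0 ?(ltW x0) // invf_ple ?posrE //; lra.
have em : expR (- 2 * ln (cmod zeta)) = (cmod zeta)^-1 ^+ 2.
  have -> : - 2 * ln (cmod zeta) = 2 * (- 1) * ln (cmod zeta) by ring.
  by rewrite e2 mulN1r expRN lnK ?posrE.
have ep : expR (2 * ln (cmod zeta)) = cmod zeta ^+ 2.
  by rewrite -[2]mulr1 e2 mul1r lnK ?posrE.
case: P => /=; rewrite ?em ?ep.
- by rewrite cmodV cmodM invfM exprMn mulrC ler_wpM2r ?sqr_ge0 // inv.
- by rewrite cmodV cmodM invfM exprMn ler_wpM2r ?sqr_ge0 // inv.
- by rewrite cmodM cmodN cmodV exprMn mulrC ler_wpM2r ?sqr_ge0 // inv.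
Qed.

(** The estimate that ties the parabolic weights to the residues: in a frame
    adapted to the flag the Higgs field has squared norm
    [O(|zeta|^(2/3 - delta))] relative to the pole of its chart. *)
Lemma higgs_growth H P (d : R) : 0 < d ->
  (forall z, punctured z -> posdef (H z) /\ \det (H z) = 1) -> adapted E H ->
  exists K eta : R, 0 < eta /\ forall zeta : C, 0 < cmod zeta < eta ->
    complex.Re (\tr (Theta0 E (loc_pt P zeta) *m
      dagger (H (loc_pt P zeta)) (Theta0 E (loc_pt P zeta)))) <=
    K * expR ((chart_order P + 2 / 3 - d) * ln (cmod zeta)).
Proof.
move=> d0 hH adH; have [_ _ _ _ /(_ P)[fl st]] := E_par.
have [B [uB cB trB]] := flag_frame fl st.
have cB0 : chart_hol P 0 = res E P \/ chart_hol P 0 = - res E P.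
  by case: (P) => /=; rewrite ?addr0 ?opprK; [right|left|right].
have trB' (i j : 'I_3) : (i <= j)%N -> (invmx B *m chart_hol P 0 *m B) i j = 0.
  move=> ij; case: cB0 => ->; first exact: trB.
  by rewrite mulmxN mulNmx mxE trB ?oppr0.
have d6 : 0 < d / 6 by rewrite divr_gt0.
have /choice[x hx] : forall j : 'I_3, exists y : R * R, 0 < y.2 /\
    forall zeta, 0 < cmod zeta < y.2 ->
    hnorm H (loc_pt P zeta) (loc_vec E P zeta (col j B)) <= y.1 * cmod zeta `^ (weight R j - d / 6).
  move=> j; have := adH P j (fun=> col j B) (ltnW (ltn_ord j)).
  case=> [k|g _]; first by apply: filterE => w; exact: derivable_cst.
  by have [K [eta [e0 h]]] := g (cB j) _ d6; exists (K, eta).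
have [M ME] : exists M : C -> 'M[C]_3, forall zeta, M zeta = invmx B *m chart_hol P zeta *m B.
  by eexists.
have holM i j : hol (fun w => M w i j) 0.
  have -> : (fun w => M w i j) =
      (fun w => \sum_k (\sum_l invmx B i l * chart_hol P w l k) * B k j).
    by apply/funext => w; rewrite ME mxE; apply: eq_bigr => k _; rewrite mxE.
  apply: hol_sum => k; apply: holM; last exact: hol_cst.
  by apply: hol_sum => l; apply: holM; [exact: hol_cst|exact: hol_chart].
have [L [eta1 [L0 eta10 hL]]] := mx_hol_lip holM.
pose L' : R := L + \sum_i \sum_j cmod (M 0 i j).
pose K : R := \sum_j `|(x j).1|.
have K0 : 0 <= K by apply: sumr_ge0.
have L'0 : 0 <= L' by rewrite addr_ge0 ?sumr_ge0 // => i _; rewrite sumr_ge0 // => j _; exact: cmod_ge0.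
pose eta := Num.min (Num.min (1 / 2) eta1) (\big[Num.min/1]_j (x j).2).
exists (4 * (9 * (9 * (L' * K ^+ 3)) ^+ 2 / cmod (\det B) ^+ 2)), eta; split.
  rewrite !lt_min eta10 divr_gt0 //=; apply/bigmin_gtP; split=> // j _.
  by have [] := hx j.
move=> zeta /andP[r0]; rewrite !lt_min => /andP[/andP[r1 r2] r3].
have n0 : zeta != 0 by rewrite -cmod_gt0.
have r01 : 0 < cmod zeta < 1 by rewrite r0 /=; lra.
have pp := loc_pt_punctured P r01.
set p := loc_pt P zeta in pp *; have [pH dH] := hH p pp.
pose V := chart_change P zeta *m B.
have uV : V \in unitmx by rewrite unitmx_mul uB chart_change_unit.
have TE : Theta0 E p = chart_factor P zeta *: (V *m M zeta *m invmx V).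
  rewrite ME; exact: (frame_relation (chart_change_unit P n0) uB (chart_relation P r01)).
pose G := V ^t* *m H p *m V.
have pG : posdef G by exact: posdef_congr.
have dG : \det G = (cmod (\det B) ^+ 2)%:C.
  rewrite /G !det_mulmx dH mulr1 chart_change_det // mul1r.
  have -> : \det (V ^t*) = (\det B)^*%C.
    by rewrite det_adj /V det_mulmx chart_change_det // mul1r.
  by rewrite conj_cmod.
have dB0 : 0 < cmod (\det B) ^+ 2.
  by rewrite exprn_gt0 // cmod_gt0 -unitfE -unitmxE.
have trE : \tr (Theta0 E p *m dagger (H p) (Theta0 E p)) =
    (cmod (chart_factor P zeta) ^+ 2)%:C * \tr (M zeta *m dagger G (M zeta)).
  have uH : H p \in unitmx by rewrite unitmxE dH unitr1.
  by rewrite TE trace_dagger_scale trace_dagger_conj.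
have Gd (j : 'I_3) : complex.Re (G j j) <= (K * expR ((weight R j - d / 6) * ln (cmod zeta))) ^+ 2.
  have [_ hj] := hx j; have := hj zeta.
  have -> : 0 < cmod zeta < (x j).2.
    by rewrite r0; apply: lt_le_trans r3 _; exact: bigmin_le.
  move=> /(_ isT); rewrite loc_vecE -/p /hnorm.
  have -> : ((chart_change P zeta *m col j B) ^t* *m H p *m (chart_change P zeta *m col j B)) 0 0
      = G j j.
    by rewrite colE mulmxA -/V adjM -(quad_delta G j) /G !mulmxA.
  have Gj0 : 0 <= complex.Re (G j j) by apply: ltW; exact: posdef_diag.
  rewrite /powR gt_eqF // => hs.
  have hs' : Num.sqrt (complex.Re (G j j)) <= K * expR ((weight R j - d / 6) * ln (cmod zeta)).
    apply: le_trans hs _; rewrite ler_wpM2r ?expR_ge0 //.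
    apply: le_trans (ler_norm _) _; rewrite /K (bigD1 j) //= lerDl; exact: sumr_ge0.
  by rewrite -[leLHS]sqr_sqrtr // ler_sqr ?nnegrE ?sqrtr_ge0 // mulr_ge0 ?expR_ge0.
have hM (i j : 'I_3) : cmod (M zeta i j) <= L' * (if (i <= j)%N then cmod zeta else 1).
  have := hL zeta; rewrite subr0 => /(_ r2 i j) h.
  have s0 : 0 <= \sum_i \sum_j cmod (M 0 i j).
    by apply: sumr_ge0 => a _; apply: sumr_ge0 => b _; exact: cmod_ge0.
  case: ifP => ij.
    have e : M 0 i j = 0 by rewrite ME; exact: trB'.
    move: h; rewrite e subr0 => /le_trans; apply.
    by rewrite ler_wpM2r ?cmod_ge0 // lerDl.
  have h2 : cmod (M 0 i j) <= \sum_i \sum_j cmod (M 0 i j).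
    rewrite (bigD1 i) //= (bigD1 j) //= -addrA lerDl addr_ge0 //.
      by apply: sumr_ge0 => b _; exact: cmod_ge0.
    by apply: sumr_ge0 => a _; apply: sumr_ge0 => b _; exact: cmod_ge0.
  have h3 : L * cmod zeta <= L by rewrite ler_piMr //; lra.
  have := cmodD (M zeta i j - M 0 i j) (M 0 i j); rewrite subrK mulr1 /L'; lra.
rewrite trE cReMr.
have r01' : 0 < cmod zeta <= 1 by rewrite r0 /=; lra.
have b1 := weighted_frame_bound pG dG dB0 K0 L'0 r01' Gd hM.
have r12 : 0 < cmod zeta < 1 / 2 by rewrite r0.
have b2 := chart_factor_bound P r12.
have [_ b3] := dagger_tr_ge0 (M zeta) pG.
apply: le_trans (ler_pM (sqr_ge0 _) b3 b2 b1) _.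
have -> : (chart_order P + 2 / 3 - d) * ln (cmod zeta) =
  chart_order P * ln (cmod zeta) + (2 / 3 - 6 * (d / 6)) * ln (cmod zeta) by field.
by rewrite expRD le_eqVlt; apply/orP; left; apply/eqP; ring.
Qed.

(** Nilpotency of the residues makes [tr theta^2] vanish to first order
    relative to the pole of its chart. *)
Lemma trace_square_growth P : exists K eta : R, 0 < eta /\ forall zeta : C,
  0 < cmod zeta < eta ->
  cmod (\tr (Theta0 E (loc_pt P zeta) *m Theta0 E (loc_pt P zeta))) ^+ 2 <=
  K * expR ((2 * chart_order P + 2) * ln (cmod zeta)).
Proof.
have [_ _ _ _ /(_ P)[fl st]] := E_par.
have [B [uB cB trB]] := flag_frame fl st.
pose g zeta := \tr (chart_hol P zeta *m chart_hol P zeta).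
have g0 : g 0 = 0.
  have -> : g 0 = \tr (res E P *m res E P).
    by rewrite /g; case: (P) => /=; rewrite ?addr0 ?mulmxN ?mulNmx ?opprK.
  pose N := invmx B *m res E P *m B.
  have -> : \tr (res E P *m res E P) = \tr (N *m N).
    have uB' : invmx B \in unitmx by rewrite unitmx_inv.
    by have := trace_square_conj (res E P) uB'; rewrite invmxK => <-.
  rewrite /mxtrace big1 // => i _; rewrite mxE big1 // => k _.
  have [ik|ki] := leqP i k; first by rewrite [N i k]trB ?mul0r.
  by rewrite [N k i]trB ?mulr0 // ltnW.
have holg : hol g 0.
  apply: hol_sum => i; have -> : (fun w => (chart_hol P w *m chart_hol P w) i i) =
      (fun w => \sum_k chart_hol P w i k * chart_hol P w k i).
    by apply/funext => w; rewrite mxE.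
  by apply: hol_sum => k; apply: holM; exact: hol_chart.
have [L [eta1 [L0 eta10 hL]]] := hol_lip holg.
exists (16 * L ^+ 2), (Num.min (1 / 2) eta1); split.
  by rewrite lt_min eta10 divr_gt0.
move=> zeta /andP[r0]; rewrite lt_min => /andP[r1 r2].
have n0 : zeta != 0 by rewrite -cmod_gt0.
have r01 : 0 < cmod zeta < 1 by rewrite r0 /=; lra.
have r12 : 0 < cmod zeta < 1 / 2 by rewrite r0.
set p := loc_pt P zeta; set c := chart_factor P zeta.
have uV : chart_change P zeta \in unitmx by rewrite chart_change_unit.
have TE : Theta0 E p = c *: (chart_change P zeta *m chart_hol P zeta *m invmx (chart_change P zeta)).
  by rewrite -[LHS](mulmxK uV) (chart_relation P r01) -scalemxAl.
have -> : \tr (Theta0 E p *m Theta0 E p) = c ^+ 2 * g zeta.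
  rewrite TE -scalemxAl -scalemxAr scalerA linearZ /= expr2; congr (_ * _).
  exact: trace_square_conj.
have b2 := chart_factor_bound P r12; rewrite -/c in b2.
have b1 : cmod (g zeta) <= L * cmod zeta.
  by have := hL zeta; rewrite g0 !subr0; apply.
rewrite cmodM cmodX exprMn.
have b3 : (cmod c ^+ 2) ^+ 2 <= (4 * expR (chart_order P * ln (cmod zeta))) ^+ 2.
  by rewrite ler_sqr ?nnegrE ?sqr_ge0 // mulr_ge0 ?expR_ge0.
have b4 : cmod (g zeta) ^+ 2 <= (L * cmod zeta) ^+ 2.
  by rewrite ler_sqr ?nnegrE ?mulr_ge0 ?cmod_ge0.
apply: le_trans (ler_pM (sqr_ge0 _) (sqr_ge0 _) b3 b4) _.
have -> : (2 * chart_order P + 2) * ln (cmod zeta) = (chart_order P * ln (cmod zeta) +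
  chart_order P * ln (cmod zeta)) + (ln (cmod zeta) + ln (cmod zeta)) by ring.
by rewrite !expRD lnK ?posrE // le_eqVlt; apply/orP; left; apply/eqP; ring.
Qed.

End Punctures.

(** * The maximum principle on the punctured sphere *)

Section CauchySchwarz.
Variable R : realType.
Local Notation C := R[i].

Lemma trace_bilinear (F : comNzRingType) n (N X P Q : 'M[F]_n) mu nu :
  \tr ((N - mu *: X) *m (P - nu *: Q)) =
  \tr (N *m P) - nu * \tr (N *m Q) - mu * \tr (X *m P) + mu * nu * \tr (X *m Q).
Proof.
have trB (U V : 'M[F]_n) : \tr (U - V) = \tr U - \tr V by rewrite raddfB.
rewrite mulmxBl !mulmxBr -!scalemxAl -!scalemxAr !trB !mxtraceZ.
by rewrite opprB addrA addrAC mulrA; ring.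
Qed.

Lemma critical_arithmetic (t b x s q d : R) (A mu : C) : 0 < s -> A = mu * s%:C ->
  cmod mu ^+ 2 * s <= x -> (t * b + x) * s - cmod A ^+ 2 <= - (- 3 * d * s ^+ 2 / q) ->
  t * b <= 3 * d * s / q.
Proof.
move=> s0 -> cs; rewrite cmodM cmodR (ger0_norm (ltW s0)) exprMn.
have -> : - (- 3 * d * s ^+ 2 / q) = 3 * d * s / q * s by ring.
move: (3 * d * s / q) => Y hle; rewrite -(ler_pM2r s0).
have : cmod mu ^+ 2 * s * s <= x * s by rewrite ler_wpM2r // ltW.
by rewrite expr2 in hle *; lra.
Qed.

(** Here [s / rho - 3] is the relative excess of the energy.  The bound on the
    commutator by a multiple of [d] and its lower bound by the square of the excess
    are incompatible with an excess larger than [e] when [d] is small. *)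
Lemma gap_arithmetic (t s rho k u d e : R) : 0 < t -> 0 < rho -> rho^-1 <= 2 * u ^+ 2 ->
  0 < u -> 0 < d -> 0 < e -> 12 * d * (3 + e) < e ^+ 2 * t -> 3 * rho <= s ->
  t * k <= 3 * d * s / u ^+ 2 -> (s - 3 * rho) ^+ 2 <= 2 * k -> s / rho <= 3 + e.
Proof.
move=> t0 rp0 rpl u0 d0 e0 k4 hp hc hB.
pose y := s / rho; have sE : s = y * rho by rewrite /y divfK // gt_eqF.
have y3 : 3 <= y by rewrite /y ler_pdivlMr.
rewrite -/y leNgt; apply/negP => hy.
have uu : 0 < u ^+ 2 by rewrite exprn_gt0.
have rr : 0 < rho ^+ 2 by rewrite exprn_gt0.
have k1 : t * (s - 3 * rho) ^+ 2 <= 6 * d * s / u ^+ 2.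
  have -> : 6 * d * s / u ^+ 2 = 2 * (3 * d * s / u ^+ 2) by ring.
  apply: le_trans (ler_wpM2l (ltW t0) hB) _.
  by rewrite mulrCA ler_wpM2l.
have k2 : t * (y - 3) ^+ 2 <= 12 * d * y.
  have -> : t * (y - 3) ^+ 2 = t * (s - 3 * rho) ^+ 2 / rho ^+ 2.
    by rewrite sE; field; rewrite gt_eqF.
  rewrite ler_pdivrMr //; apply: le_trans k1 _.
  rewrite ler_pdivrMr // sE.
  have rpu : 1 <= 2 * u ^+ 2 * rho by rewrite -ler_pdivrMr // mul1r.
  have h0 : 0 <= 6 * d * (y * rho).
    by apply: mulr_ge0; apply: mulr_ge0; lra.
  have := ler_wpM2l h0 rpu; rewrite mulr1 => /le_trans; apply.
  by rewrite le_eqVlt; apply/orP; left; apply/eqP; ring.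
have k3 : t * (e ^+ 2 * y) < t * ((y - 3) ^+ 2 * (3 + e)).
  rewrite ltr_pM2l //.
  have -> : (y - 3) ^+ 2 * (3 + e) = e ^+ 2 * y + (y - 3 - e) * ((3 + e) * (y - 3) + 3 * e) by ring.
  rewrite ltrDl; apply: mulr_gt0; first by lra.
  by apply: addr_gt0; apply: mulr_gt0; lra.
have y0 : 0 < y by lra.
have e3 : 0 < 3 + e by lra.
have k5 : 12 * d * (3 + e) * y < e ^+ 2 * t * y by rewrite ltr_pM2r.
have k6 := ler_wpM2r (ltW e3) k2.
have e5 : e ^+ 2 * t * y = t * (e ^+ 2 * y) by ring.
have e6 : 12 * d * y * (3 + e) = 12 * d * (3 + e) * y by ring.
have e7 : t * (y - 3) ^+ 2 * (3 + e) = t * ((y - 3) ^+ 2 * (3 + e)) by ring.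
rewrite e6 e7 in k6; rewrite e5 in k5.
by have := lt_trans k5 (lt_le_trans k3 k6); rewrite ltxx.
Qed.

Lemma small_exponent (e g c t : R) : 0 < e -> 0 < g -> 0 < c -> 0 < t ->
  exists d, [/\ 0 < d, 12 * d * (3 + e) < e ^+ 2 * t & d * c < g].
Proof.
move=> e0 g0 c0 t0; have e3 : 0 < 12 * (3 + e) by lra.
pose x := e ^+ 2 * t / (12 * (3 + e)).
have x0 : 0 < x by apply: divr_gt0 => //; apply: mulr_gt0 => //; exact: exprn_gt0.
have m0 : 0 < Num.min x (g / c) by rewrite lt_min x0 divr_gt0.
have m1 : Num.min x (g / c) <= x by rewrite ge_min lexx.
have m2 : Num.min x (g / c) <= g / c by rewrite ge_min lexx orbT.
exists (Num.min x (g / c) / 2); move: (Num.min x (g / c)) m0 m1 m2 => m m0 m1 m2; split.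
- exact: divr_gt0.
- have : m / 2 < x by apply: lt_le_trans m1; lra.
  by rewrite /x ltr_pdivlMr // mulrCA mulrA.
- rewrite -ltr_pdivlMr //; apply: lt_le_trans m2; lra.
Qed.

(** A point where the energy exceeds the sharp bound gives a contradiction once [d] is
    small: the gauge changes the logarithms by [d] times a quantity bounded above. *)
Lemma sharp_arithmetic (ly l3 lyp op oz l2 d : R) : 0 < d ->
  ly + d * oz <= lyp + d * op -> lyp <= l3 -> op <= l2 ->
  d * (`|l2 - oz| + 1) < ly - l3 -> False.
Proof.
move=> d0 hy hl ho.
have h : d * (op - oz) <= d * (`|l2 - oz| + 1).
  by rewrite ler_wpM2l ?(ltW d0) //; have := ler_norm (l2 - oz); lra.
by rewrite mulrBr in h; lra.
Qed.

Lemma bilinear_arithmetic (u n a b x mu : C) : a = mu * x ->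
  x = (complex.Re x)%:C -> b = a^*%C ->
  u = n - mu^*%C * a - mu * b + mu * mu^*%C * x -> 0 <= complex.Re u ->
  cmod mu ^+ 2 * complex.Re x <= complex.Re n.
Proof.
move=> -> xE -> ->; rewrite xE /= cJM conjc_real; move: (complex.Re x) => s.
have -> : n - mu^*%C * (mu * s%:C) - mu * (mu^*%C * s%:C) + mu * mu^*%C * s%:C =
  n - (mu * mu^*%C) * s%:C by ring.
by rewrite cmod_sqr -rmorphM cReB /= subr_ge0.
Qed.

(** Positivity of [N - mu X], the component of [N] orthogonal to [X]. *)
Lemma dagger_cauchy_schwarz n (H X N : 'M[C]_n) mu : posdef H ->
  \tr (N *m dagger H X) = mu * \tr (X *m dagger H X) ->
  cmod mu ^+ 2 * complex.Re (\tr (X *m dagger H X)) <=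
  complex.Re (\tr (N *m dagger H N)).
Proof.
move=> pH e; have [rX _] := dagger_tr_ge0 X pH.
have [_] := dagger_tr_ge0 (N - mu *: X) pH.
have eXN : \tr (X *m dagger H N) = (\tr (N *m dagger H X))^*%C.
  have [hh _] := pH.
  rewrite -trace_adj adjM /dagger !adjM adjK adj_inv hh.
  by rewrite -[H *m _ *m _]mulmxA [RHS]mxtrace_mulC !mulmxA.
have -> : dagger H (N - mu *: X) = dagger H N - mu^*%C *: dagger H X.
  by rewrite /dagger adjB adjZ mulmxBr mulmxBl -scalemxAr -scalemxAl.
have := trace_bilinear N X (dagger H N) (dagger H X) mu mu^*%C.
move: e rX eXN; exact: bilinear_arithmetic.
Qed.

End CauchySchwarz.

Section PuncturedMaximum.
Variable R : realType.
Local Notation C := R[i].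

Lemma puncture_decay (s : C -> R) (al be ka : R) (c : marked -> R) :
  (forall P, exists K eta : R, 0 < eta /\ forall zeta : C, 0 < cmod zeta < eta ->
    s (loc_pt P zeta) <= K * expR (c P * ln (cmod zeta))) ->
  0 < c Pzero + 2 * al -> 0 < c Pone + 2 * be ->
  0 < c Pinfty - 2 * (al + be + ka) ->
  decays (fun z => s z * gauge al be ka z).
Proof.
move=> h h0 h1 hi.
have [K0 [e0 [e00 b0]]] := h Pzero; have [K1 [e1 [e10 b1]]] := h Pone.
have [K2 [e2 [e20 b2]]] := h Pinfty.
pose K : R := `|K0| + `|K1| + `|K2|; pose eta := Num.min e0 (Num.min e1 e2).
have n0 : 0 <= `|K0| by []. have n1 : 0 <= `|K1| by []. have n2 : 0 <= `|K2| by [].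
have le (k x y : R) : k <= K -> x <= k * expR y -> x <= K * expR y.
  by move=> hk /le_trans; apply; rewrite ler_wpM2r ?expR_ge0.
apply: (@gauge_decay R s al be ka (c Pzero) (c Pone) (- c Pinfty) K eta) => //.
- by rewrite !lt_min e00 e10 e20.
- by rewrite addrC -opprB oppr_lt0.
- move=> z /andP[z0]; rewrite !lt_min => /and3P[ze _ _].
  apply: (le K0); first by have := ler_norm K0; rewrite /K; lra.
  by apply: b0; rewrite z0.
- move=> z /andP[z0]; rewrite !lt_min => /and3P[_ ze _].
  apply: (le K1); first by have := ler_norm K1; rewrite /K; lra.
  have := b1 (z - 1); rewrite /= [1 + _]addrC subrK; apply; by rewrite z0.
- move=> z ze; have eta0 : 0 < eta by rewrite !lt_min e00 e10 e20.
  have z0 : 0 < cmod z by apply: lt_trans ze; rewrite invr_gt0.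
  have : (cmod z)^-1 < eta by rewrite -[eta]invrK ltf_pV2 ?posrE ?invr_gt0.
  rewrite !lt_min => /and3P[_ _ ze2].
  apply: (le K2); first by have := ler_norm K2; rewrite /K; lra.
  have := b2 z^-1; rewrite /= invrK cmodV lnV ?posrE // mulrN -mulNr; apply.
  by rewrite invr_gt0 z0.
Qed.

Lemma gauged_max (s : C -> R) (al be ka : R) (c : marked -> R) z1 :
  (forall z, punctured z -> s w @[w --> (z : C^o)] --> s z) ->
  (forall z, punctured z -> 0 <= s z) ->
  (forall P, exists K eta : R, 0 < eta /\ forall zeta : C, 0 < cmod zeta < eta ->
    s (loc_pt P zeta) <= K * expR (c P * ln (cmod zeta))) ->
  0 < c Pzero + 2 * al -> 0 < c Pone + 2 * be ->
  0 < c Pinfty - 2 * (al + be + ka) -> punctured z1 -> 0 < s z1 ->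
  exists p, [/\ punctured p, 0 < s p & forall z, punctured z ->
    s z * gauge al be ka z <= s p * gauge al be ka p].
Proof.
move=> cs s0 hs h0 h1 hi pz1 s1.
have [|||p [pp Wp hmax]] := @punctured_max R (fun z => s z * gauge al be ka z) z1 _ _
  (puncture_decay hs h0 h1 hi) pz1.
- move=> z pz; have FF : Filter (nbhs (z : C^o)) by exact: nbhs_filter.
  have hg : gauge al be ka w @[w --> (z : C^o)] --> gauge al be ka z.
    exact: gauge_continuous.
  exact: (@cvgM R C^o (nbhs (z : C^o)) FF _ _ _ _ (cs z pz) hg).
- by move=> z pz; rewrite mulr_ge0 ?s0 // ltW // gauge_gt0.
- by rewrite mulr_gt0 // gauge_gt0.
exists p; split=> //.
by move: Wp; rewrite pmulr_lgt0 // gauge_gt0.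
Qed.

End PuncturedMaximum.

(** * Decoupling of the harmonic metric *)
Section Decoupling.
Variable R : realType.
Local Notation C := R[i].
Variable E : higgs R.
Hypothesis E_par : strongly_parabolic E.

Local Notation T := (Theta0 E).

Lemma hol_Theta i j z : punctured z -> hol (fun w => T w i j) z.
Proof.
move=> [z0 z1]; have -> : (fun w => T w i j) = (fun w => (w * (w - 1))^-1 * hol0 E w i j).
  by apply/funext => w; rewrite mxE.
apply: holM; last exact: hol_hol0.
apply: holV; last by rewrite mulf_neq0 // subr_eq0.
by apply: holM; [exact: hol_id|apply: holB; [exact: hol_id|exact: hol_cst]].
Qed.

Lemma punctured_near (P : C -> Prop) z : (forall w, punctured w -> P w) -> punctured z ->
  \forall w \near (z : C^o), P w.
Proof. by move=> h /punctured_open; apply: filterS => w; exact: h. Qed.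

Lemma hol_dTheta i j z : punctured z -> hol (d_z (fun w => T w i j)) z.
Proof.
move=> pz; apply: holomorphic_regularity.
by apply: punctured_near pz => w; exact: hol_Theta.
Qed.

Lemma trace_square_hol z : punctured z -> hol (fun w => \tr (T w *m T w)) z.
Proof.
move=> pz; apply: hol_sum => i.
have -> : (fun w => (T w *m T w) i i) = (fun w => \sum_k T w i k * T w k i).
  by apply/funext => w; rewrite mxE.
by apply: hol_sum => k; apply: holM; exact: hol_Theta.
Qed.

(** A quadratic differential on the sphere with at most three simple poles vanishes.
    Otherwise its modulus, multiplied by a gauge with [ka > 0], would attain a maximum;
    but its logarithm is harmonic and that of the gauge strictly subharmonic. *)
Lemma quadratic_differential_eq0 (g : C -> C) z :
  (forall w, punctured w -> hol g w) ->
  (forall P, exists K eta : R, 0 < eta /\ forall zeta : C, 0 < cmod zeta < eta ->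
    cmod (g (loc_pt P zeta)) ^+ 2 <= K * expR ((2 * chart_order R P + 2) * ln (cmod zeta))) ->
  punctured z -> g z = 0.
Proof.
move=> gh growth_g pz; apply/eqP/negP => /negP gz.
pose s w := cmod (g w) ^+ 2.
have cs w : punctured w -> s x @[x --> (w : C^o)] --> s w.
  move=> /gh[d /wder_clim h]; have FF : Filter (nbhs (w : C^o)) by exact: nbhs_filter.
  have hc : cmod (g x) @[x --> (w : C^o)] --> cmod (g w) by exact: clim_cmod h.
  have -> : s w = cmod (g w) * cmod (g w) by rewrite /s expr2.
  have -> : s = fun x => cmod (g x) * cmod (g x) by apply/funext => x; rewrite /s expr2.
  exact: (@cvgM R C^o (nbhs (w : C^o)) FF _ _ _ _ hc hc).
have s0 w : punctured w -> 0 <= s w by move=> _; exact: sqr_ge0.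
have sz : 0 < s z by rewrite exprn_gt0 // cmod_gt0.
(* this gauge vanishes to an order above [2] at [0] and [1] and its order at infinity
   stays below the decay [6] of [s] *)
have [|||p [pp sp hmax]] := @gauged_max R s (5 / 4) (5 / 4) (1 / 4)
  (fun P => 2 * chart_order R P + 2) z cs s0 growth_g _ _ _ pz sz.
- by rewrite /=; lra.
- by rewrite /=; lra.
- by rewrite /=; lra.
have gp : g p != 0 by apply: contraTneq sp => e; rewrite /s e cmod0 expr0n ltxx.
pose a w := d_z g w * (g w)^*%C.
have hg w : punctured w -> wder g w (d_z g w) 0 by move/gh/hol_wder.
have [d2 hd2] : hol (d_z g) p.
  by apply: holomorphic_regularity; apply: punctured_near pp.
have hs w : punctured w -> wder (fun x => (s x)%:C) w (a w) ((a w)^*%C).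
  move=> /hg h; have := wderM h (wder_conj h); rewrite conjc0 mulr0 mul0r addr0 add0r.
  rewrite /a cJM conjcK [_^*%C * g w]mulrC; apply: wder_near.
  have FF : Filter (nbhs (w : C^o)) by exact: nbhs_filter.
  by apply: filterE => x; rewrite cmod_sqr.
have ha := wderM hd2 (wder_conj (hg p pp)).
have sn : \forall w \near (p : C^o), 0 < s w.
  have n0 : \forall w \near (p : C^o), g w != 0.
    have [d h] := gh p pp; exact: clim_neq0 (wder_clim h) gp.
  by apply: filterS n0 => w gw; rewrite exprn_gt0 // cmod_gt0.
have [mu [_]] := weighted_max_test pp sn (punctured_near hs pp) ha (punctured_near hmax pp).
rewrite mul0r add0r cmod_sqr /= /a cmodM cmodJ exprMn subrr => h.
have : 0 < 1 / 4 * s p ^+ 2 / (1 + cmod p ^+ 2) ^+ 2.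
  apply: divr_gt0; first by apply: mulr_gt0; [lra|exact: exprn_gt0].
  by rewrite exprn_gt0 // ltr_pwDl // sqr_ge0.
lra.
Qed.

Lemma trace_square_eq0 z : punctured z -> \tr (T z *m T z) = 0.
Proof.
exact: (@quadratic_differential_eq0 (fun w => \tr (T w *m T w)) z trace_square_hol
  (trace_square_growth E_par)).
Qed.

(** The reason for the exponents [d, d, - 3 d] in the gauge of the energy:
    [|z (z - 1)|^2 / (1 + |z|^2)^3] is bounded. *)
Lemma puncture_product_bound (p : C) (rho : R) : punctured p -> 0 < rho ->
  ln rho = - (2 / 3) * (ln (cmod p ^+ 2) + ln (cmod (p - 1) ^+ 2)) ->
  [/\ 0 < 1 + cmod p ^+ 2,
    ln (cmod p ^+ 2) + ln (cmod (p - 1) ^+ 2) - 3 * ln (1 + cmod p ^+ 2) <= ln 2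
    & rho^-1 <= 2 * (1 + cmod p ^+ 2) ^+ 2].
Proof.
move=> pp rp0 lrp.
have sz0 : 0 < cmod p ^+ 2 by have [p0 _] := pp; rewrite exprn_gt0 // cmod_gt0.
have sz1 : 0 < cmod (p - 1) ^+ 2 by have [_ p1] := pp; rewrite exprn_gt0 // cmod_gt0 subr_eq0.
set u := 1 + cmod p ^+ 2; have u1 : 1 <= u by rewrite lerDl ltW.
have u0 : 0 < u by apply: lt_le_trans u1.
have tri : cmod (p - 1) ^+ 2 <= 2 * u.
  have h : cmod (p - 1) <= cmod p + 1 by have := cmodD p (- 1); rewrite cmodN cmod1.
  have h' : cmod (p - 1) ^+ 2 <= (cmod p + 1) ^+ 2.
    by rewrite ler_sqr ?nnegrE ?cmod_ge0 ?addr_ge0 ?cmod_ge0.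
  apply: le_trans h' _; have := sqr_ge0 (cmod p - 1).
  have -> : 2 * u = (cmod p + 1) ^+ 2 + (cmod p - 1) ^+ 2 by rewrite /u; ring.
  by rewrite lerDl.
have prod : cmod p ^+ 2 * cmod (p - 1) ^+ 2 <= 2 * u ^+ 2.
  have -> : 2 * u ^+ 2 = u * (2 * u) by ring.
  by apply: ler_pM => //; [exact: ltW|exact: ltW|rewrite lerDr].
have lprod : ln (cmod p ^+ 2) + ln (cmod (p - 1) ^+ 2) <= ln (2 * u ^+ 2).
  rewrite -lnM ?posrE // ler_ln ?posrE //; first exact: mulr_gt0.
  by apply: mulr_gt0 => //; exact: exprn_gt0.
have lu : 0 <= ln u by rewrite ln_ge0.
have l2 : 0 <= ln 2 :> R by rewrite ln_ge0 // ler1n.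
have lu2 : ln (2 * u ^+ 2) = ln 2 + 2 * ln u.
  by rewrite lnM ?posrE ?exprn_gt0 // lnXn // mulr_natl.
rewrite lu2 in lprod; split=> //.
  by move: lprod lu; move: (ln u) (ln (cmod _ ^+ 2)) (ln (cmod _ ^+ 2)) => a b c; clear; lra.
rewrite -ler_ln ?posrE ?invr_gt0 ?mulr_gt0 ?exprn_gt0 // lnV ?posrE // lrp lu2.
move: lprod lu l2; move: (ln u) (ln 2) (ln (cmod _ ^+ 2)) (ln (cmod _ ^+ 2)) => a b c d.
by clear; lra.
Qed.

Section Harmonic.
Hypothesis E_det : forall z : C, z != 0 -> z != 1 ->
  \det (T z) = (z ^+ 2 * (z - 1) ^+ 2)^-1.
Variables (tau : C) (H : C -> 'M[C]_3).
Hypotheses (tau0 : tau != 0) (H_harm : harmonic_metric E tau H).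

Lemma metric_posdef z : punctured z -> posdef (H z) /\ \det (H z) = 1.
Proof. by have [h _ d _ _] := H_harm => pz; split; [exact: h|exact: d]. Qed.

Lemma metric_unit z : punctured z -> H z \in unitmx.
Proof. by move/metric_posdef => [_ d]; rewrite unitmxE d unitr1. Qed.

Lemma metric_dif z i j : punctured z ->
  dif (fun w => H w i j) z /\ dif (d_z (fun w => H w i j)) z.
Proof.
move=> pz; have [_ h _ _ _] := H_harm; split.
- exact: smooth_dif (@punctured_open R) (h i j) pz.
- exact: smooth_dif_dz (@punctured_open R) (h i j) pz.
Qed.

Lemma nearH z : punctured z -> \forall w \near (z : C^o),
  [/\ (H w) ^t* = H w, H w \in unitmx, forall i j, dif (fun x => H x i j) w
    & forall i j, hol (fun x => T x i j) w].
Proof.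
apply: punctured_near => w pw; split.
- by have [[]] := metric_posdef pw.
- exact: metric_unit.
- by move=> i j; have [] := metric_dif i j pw.
- by move=> i j; exact: hol_Theta.
Qed.

Lemma curvature z : punctured z -> - mx_d_zbar (fun w => invmx (H w) *m mx_d_z H w) z +
  (`|tau| ^+ 2) *: (T z *m dagger (H z) (T z) - dagger (H z) (T z) *m T z) = 0.
Proof. by have [_ _ _ _ h] := H_harm; exact: h. Qed.

Definition energy z := complex.Re (\tr (T z *m dagger (H z) (T z))).

Lemma trace_free z : \tr (T z) = 0.
Proof.
by have [_ _ _ h _] := E_par; rewrite linearZ /= h mulr0.
Qed.

(** At a maximum of a gauged energy the gradient of the energy is [mu] times the energy,
    and by the Cauchy-Schwarz inequality the gradient term of the Bochner formula is at
    least [|mu|^2] times the energy.  It cancels the square of the gradient, and what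
    remains bounds the commutator. *)
Lemma commutator_bound (d : R) p : punctured p -> 0 < energy p ->
  (forall z, punctured z -> energy z * gauge (2 / 3 + d) (2 / 3 + d) (- 3 * d) z <=
    energy p * gauge (2 / 3 + d) (2 / 3 + d) (- 3 * d) p) ->
  (forall z, punctured z -> 0 < energy z) ->
  let D := dagger (H p) (T p) in
  let B := T p *m D - D *m T p in
  \tr (B *m B) = (complex.Re (\tr (B *m B)))%:C ->
  cmod tau ^+ 2 * complex.Re (\tr (B *m B)) <= 3 * d * energy p / (1 + cmod p ^+ 2) ^+ 2.
Proof.
move=> pp ep hmax e0 D B rB.
have [pH _] := metric_posdef pp.
have dH i j : dif (d_z (fun x => H x i j)) p by have [] := metric_dif i j pp.
have dT i j := hol_dTheta i j pp.
pose N w := mx_d_z T w + (invmx (H w) *m mx_d_z H w) *m T w -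
  T w *m (invmx (H w) *m mx_d_z H w).
pose a w := \tr (N w *m dagger (H w) (T w)).
pose k := `|tau| ^+ 2 * \tr (B *m B) + \tr (N p *m dagger (H p) (N p)).
have [m hm] : exists m, wder a p m k by exact: bochner (nearH pp) dH dT (curvature pp).
have hs : \forall w \near (p : C^o),
    wder (fun z => \tr (T z *m dagger (H z) (T z))) w (a w) ((a w)^*%C).
  exact: wder_sigma (nearH pp).
have hs' : \forall w \near (p : C^o), wder (fun z => (energy z)%:C) w (a w) ((a w)^*%C).
  have o : \forall w \near (p : C^o), punctured w by exact: punctured_open.
  apply: filterS2 (near_join o) hs => w o'; apply: wder_near.
  apply: filterS o' => x /metric_posdef[px _].
  by have [e _] := dagger_tr_ge0 (T x) px.
have [mu [amu hle]] := weighted_max_test pp (punctured_near e0 pp) hs' hm (punctured_near hmax pp).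
have eT : \tr (T p *m dagger (H p) (T p)) = (energy p)%:C.
  by have [e _] := dagger_tr_ge0 (T p) pH.
have aN : \tr (N p *m dagger (H p) (T p)) = mu * \tr (T p *m dagger (H p) (T p)).
  by rewrite eT; exact: amu.
pose x := complex.Re (\tr (N p *m dagger (H p) (N p))).
have cs : cmod mu ^+ 2 * energy p <= x by exact: dagger_cauchy_schwarz pH aN.
pose b := complex.Re (\tr (B *m B)).
have ek : complex.Re k = cmod tau ^+ 2 * b + x.
  by rewrite /k rB normE -rmorphXn cReD cReMr.
rewrite ek in hle; exact: critical_arithmetic ep amu cs hle.
Qed.

Lemma energy_growth P (d : R) : 0 < d -> exists K eta : R, 0 < eta /\
  forall zeta : C, 0 < cmod zeta < eta ->
  energy (loc_pt P zeta) <= K * expR ((chart_order R P + 2 / 3 - d) * ln (cmod zeta)).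
Proof.
move=> d0; have [_ _ _ adH _] := H_harm.
exact: (higgs_growth E_par P d0 metric_posdef adH).
Qed.

Lemma energy_ge0 z : punctured z -> 0 <= energy z.
Proof. by move=> /metric_posdef[pH _]; have [] := dagger_tr_ge0 (T z) pH. Qed.

Lemma energy_cont z : punctured z -> energy w @[w --> (z : C^o)] --> energy z.
Proof.
move=> pz; have h := nbhs_singleton (wder_sigma (nearH pz)).
by have /climP[] := wder_clim h.
Qed.

(** [rho = |q|^(2/3)] is the common squared modulus of the eigenvalues of [theta]. *)
Lemma spectral_size z : punctured z -> exists rho : R, [/\ 0 < rho,
  ln rho = - (2 / 3) * (ln (cmod z ^+ 2) + ln (cmod (z - 1) ^+ 2)),
  3 * rho <= energy z,
  (let D := dagger (H z) (T z) in let B := T z *m D - D *m T z in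
   \tr (B *m B) = (complex.Re (\tr (B *m B)))%:C /\
   (energy z - 3 * rho) ^+ 2 <= 2 * complex.Re (\tr (B *m B))) &
  energy z = 3 * rho -> T z *m dagger (H z) (T z) = rho%:C%:M /\
    T z *m T z *m T z = ((z ^+ 2 * (z - 1) ^+ 2)^-1)%:M].
Proof.
move=> pz; have [z0 z1] := pz; have [pH _] := metric_posdef pz.
have [rho [[r0 r3 rB hle hsq] heq]] :=
  cyclic_pointwise pH (trace_free z) (trace_square_eq0 pz) (E_det z0 z1).
have c0 : 0 < cmod z by rewrite cmod_gt0.
have c1 : 0 < cmod (z - 1) by rewrite cmod_gt0 subr_eq0.
have rpos : 0 < rho.
  rewrite lt_neqAle r0 andbT; apply/eqP => e; move: r3; rewrite -e expr0n => /esym/eqP.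
  by rewrite expf_eq0 /= cmod_eq0 invr_eq0 mulf_eq0 !expf_eq0 /= subr_eq0 (negPf z0) (negPf z1).
exists rho; split=> //.
have lnX (r : R) n : 0 < r -> ln (r ^+ n) = n%:R * ln r.
  by move=> rr; rewrite lnXn // mulr_natl.
have := congr1 (@ln R) r3; rewrite cmodV cmodM !cmodX exprVn lnV ?posrE ?exprn_gt0 ?mulr_gt0 ?exprn_gt0 //.
rewrite !lnX ?mulr_gt0 ?exprn_gt0 // lnM ?posrE ?exprn_gt0 // !lnX //; lra.
Qed.

(** Otherwise the energy times a gauge of order [|q|^(-2/3)], corrected by a small
    exponent [d] that makes it decay at the punctures, would have a maximum where the
    energy exceeds [3 rho] by a fixed factor, although its commutator is [O(d)]. *)
Lemma energy_sharp z rho : punctured z -> 0 < rho ->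
  ln rho = - (2 / 3) * (ln (cmod z ^+ 2) + ln (cmod (z - 1) ^+ 2)) ->
  energy z <= 3 * rho.
Proof.
move=> pz r0 lr; rewrite leNgt; apply/negP => hlt.
pose y := energy z / rho; have y3 : 3 < y by rewrite /y ltr_pdivlMr.
pose e := (y - 3) / 2; have e0 : 0 < e by rewrite divr_gt0 // subr_gt0.
have e30 : 0 < 3 + e by rewrite addr_gt0.
have ey : 3 + e < y by rewrite /e; lra.
have y0 : 0 < y by lra.
pose g := ln y - ln (3 + e).
have g0 : 0 < g by rewrite subr_gt0 ltr_ln ?posrE //; lra.
(* the logarithm of the gauge is [- ln rho] plus [d] times [om], and [om <= ln 2] *)
pose om (x : C) : R := ln (cmod x ^+ 2) + ln (cmod (x - 1) ^+ 2) - 3 * ln (1 + cmod x ^+ 2).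
pose c := `|ln 2 - om z| + 1; have c0 : 0 < c by rewrite ltr_wpDl.
have t0 : 0 < cmod tau ^+ 2 by rewrite exprn_gt0 // cmod_gt0.
have [d [d0 dd1 dg]] := small_exponent e0 g0 c0 t0.
have ez : 0 < energy z by apply: lt_trans hlt; rewrite mulr_gt0.
have epos x : punctured x -> 0 < energy x.
  move=> px; have [rx [rx0 _ h _ _]] := spectral_size px.
  by apply: lt_le_trans h; rewrite mulr_gt0.
(* at each puncture a power [d] of the local coordinate remains *)
have [|||p [pp ep hmax]] := @gauged_max R energy (2 / 3 + d) (2 / 3 + d) (- 3 * d)
  (fun P => chart_order R P + 2 / 3 - d) z energy_cont energy_ge0
  (fun P => energy_growth P d0) _ _ _ pz ez.
- by rewrite /=; lra.
- by rewrite /=; lra.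
- by rewrite /=; lra.
have [rp [rp0 lrp hp [rB hB] _]] := spectral_size pp.
have hc := commutator_bound pp ep hmax epos rB.
pose yp := energy p / rp.
have yp3 : 3 <= yp by rewrite /yp ler_pdivlMr.
have gE x rx : punctured x -> 0 < rx ->
    ln rx = - (2 / 3) * (ln (cmod x ^+ 2) + ln (cmod (x - 1) ^+ 2)) ->
    ln (energy x * gauge (2 / 3 + d) (2 / 3 + d) (- 3 * d) x) = ln (energy x / rx) + d * om x.
  move=> px rx0 lx; have ex := epos x px.
  by rewrite !lnM ?posrE ?expR_gt0 ?invr_gt0 // expRK lnV ?posrE // lx /om; ring.
have hy : ln y + d * om z <= ln yp + d * om p.
  rewrite /y /yp -!gE // ler_ln ?posrE ?mulr_gt0 ?expR_gt0 ?epos //.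
  exact: hmax.
have [u0 omp rpl] := puncture_product_bound pp rp0 lrp.
have ypb : yp <= 3 + e.
  exact: (gap_arithmetic t0 rp0 rpl u0 d0 e0 dd1 hp hc hB).
have yp0 : 0 < yp by rewrite divr_gt0.
have lyp : ln yp <= ln (3 + e) by rewrite ler_ln ?posrE.
exact: sharp_arithmetic d0 hy lyp omp dg.
Qed.

(** The sharp bound is an equality by the pointwise estimate, so [theta] has no strictly
    triangular part: it is normal, with eigenvalues of equal modulus. *)
Theorem decoupled z : punctured z -> exists rho : R, [/\ 0 < rho,
  rho ^+ 3 = cmod (\det (T z)) ^+ 2,
  T z *m dagger (H z) (T z) = rho%:C%:M
  & T z *m T z *m T z = (\det (T z))%:M].
Proof.
move=> pz; have [rho [r0 lr h1 _ h2]] := spectral_size pz.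
have [z0 z1] := pz.
have e : energy z = 3 * rho by apply/eqP; rewrite eq_le h1 (energy_sharp pz r0 lr).
have [e1 e2] := h2 e; exists rho; split=> //; last by rewrite E_det.
have c0 : 0 < cmod z by rewrite cmod_gt0.
have c1 : 0 < cmod (z - 1) by rewrite cmod_gt0 subr_eq0.
have lnX (r : R) n : 0 < r -> ln (r ^+ n) = n%:R * ln r.
  by move=> rr; rewrite lnXn // mulr_natl.
rewrite E_det // cmodV cmodM !cmodX; apply: (@ln_inj R).
- by rewrite posrE exprn_gt0.
- by rewrite posrE exprn_gt0 // invr_gt0 mulr_gt0 ?exprn_gt0.
rewrite !lnX ?invr_gt0 ?mulr_gt0 ?exprn_gt0 // lnV ?posrE ?mulr_gt0 ?exprn_gt0 //.
rewrite lnM ?posrE ?exprn_gt0 // lr !lnX //; lra.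
Qed.

End Harmonic.
End Decoupling.

(** * Parallel eigenlines *)

(** Identities in a matrix ring, decided entrywise after expansion into
    noncommutative monomials. *)
Ltac mxexpand := rewrite ?(mulmxBl, mulmxDl, mulmxBr, mulmxDr, mulmxN, mulNmx, mulmxA,
  =^~ scalemxAl, =^~ scalemxAr, scalerDr, scalerBr, scalerN, scalerA, mul_scalar_mx,
  mul_mx_scalar, opprD, opprB, opprK).
Ltac mxatoms := repeat match goal with
  |- context [mulmx ?a ?b] => let x := fresh "x" in move: (mulmx a b) => x end.
Ltac mxring := mxexpand; mxatoms; apply/matrixP => ? ?; rewrite !mxE; ring.

Section CovariantConstancy.
Variable F : fieldType.

(** If [T] is invertible, [X T + T X = 0] and [X T^2 + T X T + T^2 X = 0] force
    [X = 0]: the second sum telescopes to [X T^2]. *)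
Lemma anticommuting_eq0 n (T X : 'M[F]_n) : T \in unitmx -> X *m T + T *m X = 0 ->
  X *m T *m T + T *m X *m T + T *m T *m X = 0 -> X = 0.
Proof.
move=> uT h1 h2.
have e : X *m T *m T = 0.
  have -> : X *m T *m T = (X *m T *m T + T *m X *m T + T *m T *m X) - T *m (X *m T + T *m X).
    by mxring.
  by rewrite h1 h2 mulmx0 subr0.
by rewrite -[X](mulmxK uT) -[X *m T](mulmxK uT) e !mul0mx.
Qed.

(** The algebra behind covariant constancy: [k] stands for [q'/q], [T1] for
    [dT/dz], and the hypotheses are the derivatives of [T^3 = q] and of
    [D = r T^2], with [r'/r = - 2 k / 3]. *)
Lemma covariant_constancy n (T T1 A : 'M[F]_n) (k q r : F) : T \in unitmx ->
  3 != 0 :> F -> r != 0 -> T *m T *m T = q%:M ->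
  T1 *m T *m T + T *m T1 *m T + T *m T *m T1 = (k * q)%:M ->
  (- (2 / 3) * k * r) *: (T *m T) + r *: (T1 *m T + T *m T1) =
    (r *: (T *m T)) *m A - A *m (r *: (T *m T)) ->
  T1 = (k / 3) *: T + T *m A - A *m T.
Proof.
move=> uT n3 r0 T3 h1 h2.
suff h : T1 + A *m T - T *m A - (k / 3) *: T = 0.
  have -> : T1 = (T1 + A *m T - T *m A - (k / 3) *: T) + ((k / 3) *: T + T *m A - A *m T).
    by mxring.
  by rewrite h add0r.
apply: (anticommuting_eq0 uT).
  have -> : (T1 + A *m T - T *m A - (k / 3) *: T) *m T + T *m (T1 + A *m T - T *m A - (k / 3) *: T) =
    r^-1 *: ((- (2 / 3) * k * r) *: (T *m T) + r *: (T1 *m T + T *m T1) -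
    ((r *: (T *m T)) *m A - A *m (r *: (T *m T)))).
    mxexpand; mxatoms; apply/matrixP => ? ?; rewrite !mxE; field; by rewrite n3 r0.
  by rewrite h2 subrr scaler0.
have -> : (T1 + A *m T - T *m A - (k / 3) *: T) *m T *m T + T *m (T1 + A *m T - T *m A - (k / 3) *: T) *m T +
   T *m T *m (T1 + A *m T - T *m A - (k / 3) *: T) =
  (T1 *m T *m T + T *m T1 *m T + T *m T *m T1 - k *: (T *m T *m T)) +
  (A *m (T *m T *m T) - (T *m T *m T) *m A).
  mxexpand; mxatoms; apply/matrixP => ? ?; rewrite !mxE; field; by rewrite n3.
rewrite h1 T3 mul_scalar_mx mul_mx_scalar subrr addr0 scale_scalar_mx subrr //.
Qed.

Lemma scaled_square_comm n (X : 'M[F]_n) a :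
  (a *: (X *m X)) *m X = X *m (a *: (X *m X)).
Proof. by rewrite -scalemxAl -scalemxAr mulmxA. Qed.

(** Derivative of the form [H] along the flow of [k - (x A + c T + c^* D)]: the metric is
    parallel for [A], whose terms cancel. *)
Lemma metric_flow_identity n (H A As T Ts D Ds : 'M[F]_n) (x xb c cb ka kb : F) :
  H *m D = Ts *m H -> Ds *m H = H *m T ->
  (kb%:M - (xb *: As + cb *: Ts + c *: Ds)) *m H + (x *: (H *m A) + xb *: (As *m H)) +
  H *m (ka%:M - (x *: A + c *: T + cb *: D)) =
  (kb + ka) *: H - (2 * c) *: (H *m T) - (2 * cb) *: (Ts *m H).
Proof. by move=> h1 h2; mxexpand; rewrite h1 h2; mxring. Qed.

(** [T - l] intertwines the flow with its twist by [k]. *)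
Lemma eigen_flow_identity n (A T D : 'M[F]_n) (x c cb k l : F) : D *m T = T *m D ->
  (x *: (k *: T + T *m A - A *m T) - (k * x * l)%:M) -
    (T - l%:M) *m (x *: A + c *: T + cb *: D) =
  ((k * x)%:M - (x *: A + c *: T + cb *: D)) *m (T - l%:M).
Proof.
move=> h; rewrite -[(k * x * l)%:M]scalemx1 -[(k * x)%:M]scalemx1.
by mxexpand; rewrite h ?mulmx1 ?mul1mx -?[l%:M]scalemx1; mxexpand; rewrite ?mulmx1 ?mul1mx; mxring.
Qed.

End CovariantConstancy.

Section MatrixCurves.
Variable R : realType.
Local Notation C := R[i].

Definition mcder m n (M : R -> 'M[C]_(m, n)) (t : R) (d : 'M[C]_(m, n)) :=
  forall i j, cder (fun s => M s i j) t (d i j).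

Lemma mcderM m n p (M : R -> 'M[C]_(m, n)) (N : R -> 'M[C]_(n, p)) t d e :
  mcder M t d -> mcder N t e -> mcder (fun s => M s *m N s) t (d *m N t + M t *m e).
Proof.
move=> hM hN i j; have -> : (fun s => (M s *m N s) i j) = (fun s => \sum_k M s i k * N s k j).
  by apply/funext => s; rewrite mxE.
have -> : (d *m N t + M t *m e) i j = \sum_k (d i k * N t k j + M t i k * e k j).
  by rewrite !mxE -big_split.
by apply: cder_sum => k; apply: cderM.
Qed.

Lemma mulN_entry n (A B : 'M[C]_n) i j : (- A *m B) i j = - (A *m B) i j.
Proof. by rewrite mulNmx [LHS]mxE. Qed.

Lemma mcderB m n (M N : R -> 'M[C]_(m, n)) t d e :
  mcder M t d -> mcder N t e -> mcder (fun s => M s - N s) t (d - e).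
Proof.
move=> hM hN i j; have -> : (fun s => (M s - N s) i j) = (fun s => M s i j - N s i j).
  by apply/funext => s; rewrite !mxE.
by rewrite !mxE; apply: cderB.
Qed.

Lemma mcder_scalar n (f : R -> C) t d : cder f t d ->
  mcder (fun s => (f s)%:M : 'M[C]_n) t d%:M.
Proof.
move=> h i j; have -> : (fun s => (f s)%:M i j) = (fun s => f s *+ (i == j)).
  by apply/funext => s; rewrite !mxE.
rewrite mxE; case: (i == j) => //=; rewrite mulr0n.
by under eq_fun do rewrite mulr0n; exact: cder_cst.
Qed.

Lemma mcder_adj m n (M : R -> 'M[C]_(m, n)) t d :
  mcder M t d -> mcder (fun s => (M s) ^t*) t (d ^t*).
Proof.
move=> h i j; have -> : (fun s => ((M s) ^t*) i j) = (fun s => (M s j i)^*%C).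
  by apply/funext => s; rewrite adjE.
by rewrite adjE; apply: cder_conj.
Qed.

Lemma mcder_curve m n (M : C -> 'M[C]_(m, n)) (p : R -> C) t d X Y :
  mxd M (p t) X Y -> cder p t d -> mcder (fun s => M (p s)) t (d *: X + d^*%C *: Y).
Proof.
move=> hM hp i j; rewrite !mxE [d * _]mulrC [_^*%C * _]mulrC.
exact: (wder_comp_curve (hM i j) hp).
Qed.

Lemma mcder_cst m n (K : 'M[C]_(m, n)) t : mcder (fun=> K) t 0.
Proof. by move=> i j; rewrite mxE; exact: cder_cst. Qed.

(** Comparison with the solution of a scalar linear equation. *)
Lemma integrating_factor (f f1 phi phi1 : R -> R) : {within `[0, 1], continuous f} ->
  (forall t : R, 0 < t < 1 -> is_derive t 1 f (f1 t)) ->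
  (forall t : R, 0 <= t <= 1 -> is_derive t 1 phi (phi1 t)) ->
  (forall t : R, 0 < t < 1 -> f1 t <= phi1 t * f t) ->
  forall t : R, 0 <= t <= 1 -> f t <= f 0 * expR (phi t - phi 0).
Proof.
move=> cf df dphi hf t ht.
pose g s := f s * expR (- phi s).
have de (s : R) : 0 <= s <= 1 ->
    is_derive s 1 (fun x : R => expR (- phi x)) (- phi1 s * expR (- phi s)).
  move=> hs; have ds := dphi s hs.
  have h1 : is_derive s 1 (fun x : R => - phi x) (- phi1 s) by exact: is_deriveN.
  have := @is_derive1_comp R expR (fun x => - phi x) s _ _ (is_derive_expR _) h1.
  by rewrite mulrC.
have dg (s : R) : 0 < s < 1 ->
    is_derive s 1 g (f s *: (- phi1 s * expR (- phi s)) + expR (- phi s) *: f1 s).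
  move=> hs; have fs := df s hs; have es : 0 <= s <= 1 by case/andP: hs => /ltW -> /ltW ->.
  by have := de s es => ds; apply: is_deriveM.
have cg : {within `[0, 1], continuous g}.
  move=> s; apply: cvgM; first exact: cf.
  apply: derivable_within_continuous => x; rewrite in_itv /= => hx.
  by have dx := de x hx; apply: ex_derive.
case/andP: (ht) => t0 t1.
have h : g t <= g 0.
  apply: (ler0_derive1_nincr _ _ cg (lexx 0) t0 t1) => s; rewrite in_itv /= => hs.
    by have ds := dg s hs; apply: ex_derive.
  rewrite derive1E (@derive_val _ _ _ _ _ _ _ (dg s hs)) /GRing.scale /=.
  have -> : f s * (- phi1 s * expR (- phi s)) + expR (- phi s) * f1 s =
    (f1 s - phi1 s * f s) * expR (- phi s) by ring.
  by rewrite mulr_le0_ge0 ?expR_ge0 // subr_le0 hf.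
have := ler_wpM2r (expR_ge0 (phi t)) h.
by rewrite /g -!mulrA -!expRD addNr expR0 mulr1 [- phi 0 + _]addrC.
Qed.

End MatrixCurves.

Section Transport.
Variable R : realType.
Local Notation C := R[i].

(** The value of the sesquilinear form of matrix [M] on [u]. *)
Definition quad n (u : 'cV[C]_n) (M : 'M[C]_n) : C := (u ^t* *m M *m u) 0 0.

Lemma quadD n (u : 'cV[C]_n) M N : quad u (M + N) = quad u M + quad u N.
Proof. by rewrite /quad mulmxDr mulmxDl mxE. Qed.

Lemma quadB n (u : 'cV[C]_n) M N : quad u (M - N) = quad u M - quad u N.
Proof. by rewrite /quad mulmxBr mulmxBl !mxE. Qed.

Lemma quadZ n (u : 'cV[C]_n) k M : quad u (k *: M) = k * quad u M.
Proof. by rewrite /quad -scalemxAr -scalemxAl mxE. Qed.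

Lemma quad_adj n (u : 'cV[C]_n) M : quad u (M ^t*) = (quad u M)^*%C.
Proof. by rewrite /quad -adjE !adjM adjK mulmxA. Qed.

Lemma quad_hermitian n (u : 'cV[C]_n) M : M ^t* = M ->
  quad u M = (complex.Re (quad u M))%:C.
Proof.
move=> hM; have := quad_adj u M; rewrite hM; case: (quad u M) => a b [/eqP].
rewrite -subr_eq0 opprK -mulr2n mulrn_eq0 /= => /eqP ->.
by [].
Qed.

Lemma quad_ge0 n (u : 'cV[C]_n) H : posdef H -> 0 <= complex.Re (quad u H).
Proof.
move=> [_ hp]; have [->|u0] := eqVneq u 0.
  by rewrite /quad mulmx0 mxE.
by have := hp u u0; rewrite -/(quad u H) ltcE => /andP[_ /ltW].
Qed.

Lemma quad_eq0 n (u : 'cV[C]_n) H : posdef H -> complex.Re (quad u H) = 0 -> u = 0.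
Proof.
move=> [_ hp] h; apply/eqP/negP => /negP u0; have := hp u u0.
by rewrite -/(quad u H) ltcE h ltxx andbF.
Qed.

Lemma quad_cder n (u : R -> 'cV[C]_n) (H : R -> 'M[C]_n) (t : R) K H1 :
  mcder u t (K *m u t) -> mcder H t H1 ->
  cder (fun s => quad (u s) (H s)) t (quad (u t) (K ^t* *m H t + H1 + H t *m K)).
Proof.
move=> hu hH; have := mcderM (mcderM (mcder_adj hu) hH) hu; move=> /(_ 0 0).
rewrite -/(quad _ _) /quad.
suff -> : ((K *m u t) ^t* *m H t + (u t) ^t* *m H1) *m u t + (u t) ^t* *m H t *m (K *m u t) =
  (u t) ^t* *m (K ^t* *m H t + H1 + H t *m K) *m u t by [].
by rewrite adjM !mulmxDl !mulmxDr !mulmxDl !mulmxA.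
Qed.

Lemma adj_scalar n k : (k%:M : 'M[C]_n) ^t* = (k^*%C)%:M.
Proof. by rewrite tr_scalar_mx map_scalar_mx /= conjCE. Qed.

(** Along the flow of [A + c T + (c T)^dagger], twisted by [k], the unitary part
    [A] does not change the norm. *)
Lemma norm_flow n (u : R -> 'cV[C]_n) (H : R -> 'M[C]_n) (t : R) (T A : 'M[C]_n) k x c :
  (H t) ^t* = H t -> H t \in unitmx ->
  mcder u t ((k%:M - (x *: A + c *: T + c^*%C *: dagger (H t) T)) *m u t) ->
  mcder H t (x *: (H t *m A) + x^*%C *: (A ^t* *m H t)) ->
  is_derive t 1 (fun s => complex.Re (quad (u s) (H s)))
    (2 * complex.Re k * complex.Re (quad (u t) (H t)) -
     4 * complex.Re (c * quad (u t) (H t *m T))).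
Proof.
move=> hh uz hu hH; have h := quad_cder hu hH; move: hh uz h {hu hH}.
move: (H t) (u t) => h1 v hh uz h.
have i1 : h1 *m dagger h1 T = T ^t* *m h1 by rewrite /dagger -mulmxA mulKVmx.
have i2 : (dagger h1 T) ^t* *m h1 = h1 *m T.
  by rewrite /dagger !adjM adjK adj_inv hh -!mulmxA mulVmx ?mulmx1.
have e := metric_flow_identity A (A ^t*) x x^*%C c c^*%C k k^*%C i1 i2.
rewrite !adjB !adjD !adjZ adj_scalar conjcK e in h.
have /cderP[hr _] := h; move: hr; rewrite !quadB !quadZ !cReB.
have -> : quad v (T ^t* *m h1) = (quad v (h1 *m T))^*%C.
  by rewrite -quad_adj adjM hh.
rewrite (quad_hermitian v hh); move: (complex.Re (quad v h1)) (quad v (h1 *m T)) => nu y.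
have -> : complex.Re ((k^*%C + k) * nu%:C) = 2 * complex.Re k * nu.
  by rewrite mulrC cReMr cReD cReJ; ring.
have -> : 2 * c^*%C * y^*%C = (2 * c * y)^*%C by rewrite !cJM conjc_nat.
have -> : complex.Re (2 * c * y) = 2 * complex.Re (c * y).
  by rewrite -mulrA -(rmorph_nat (real_complex R)) cReMr.
rewrite cReJ.
have -> : complex.Re (2 * c * y) = 2 * complex.Re (c * y).
  by rewrite -mulrA -(rmorph_nat (real_complex R)) cReMr.
move=> hr; suff <- : 2 * complex.Re k * nu - 2 * complex.Re (c * y) - 2 * complex.Re (c * y) =
    2 * complex.Re k * nu - 4 * complex.Re (c * y) by [].
by ring.
Qed.

(** Positivity of [H] at [T u + 2 c^* u]. *)
Lemma quad_size_bound n (u : 'cV[C]_n) (H T : 'M[C]_n) rho c : posdef H ->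
  dagger H T *m T = rho%:C%:M ->
  - (4 * complex.Re (c * quad u (H *m T))) <=
    (rho + 4 * cmod c ^+ 2) * complex.Re (quad u H).
Proof.
move=> pH e; have [hh _] := pH; have uH : H \in unitmx.
  by have [Q uQ ->] := posdef_factor pH; rewrite unitmx_mul unitmx_adj uQ.
have := quad_ge0 (T *m u + (2 * c)^*%C *: u) pH.
have -> : quad (T *m u + (2 * c)^*%C *: u) H =
    quad u (T ^t* *m H *m T + (2 * c)^*%C *: (T ^t* *m H) + (2 * c) *: (H *m T) +
      (2 * c * (2 * c)^*%C) *: H).
  have -> : T *m u + (2 * c)^*%C *: u = (T + ((2 * c)^*%C)%:M) *m u.
    by rewrite mulmxDl mul_scalar_mx.
  rewrite /quad adjM adjD adj_scalar conjcK.
  rewrite -!mulmxA; congr ((_ *m _) 0 0); rewrite !mulmxA; congr (_ *m _).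
  by mxexpand; mxatoms; apply/matrixP => ? ?; rewrite !mxE; ring.
have -> : T ^t* *m H *m T = rho%:C *: H.
  have i1 : H *m dagger H T = T ^t* *m H by rewrite /dagger -mulmxA mulKVmx.
  by rewrite -i1 -mulmxA e mul_mx_scalar.
rewrite !quadD !quadZ; have -> : quad u (T ^t* *m H) = (quad u (H *m T))^*%C.
  by rewrite -quad_adj adjM hh.
rewrite cmod_sqr (quad_hermitian u hh).
move: (complex.Re (quad u H)) (quad u (H *m T)) => nu y.
have e2 : complex.Re (2 * c * y) = 2 * complex.Re (c * y).
  by rewrite -mulrA -(rmorph_nat (real_complex R)) cReMr.
have e4 : cmod (2 * c) ^+ 2 = 4 * cmod c ^+ 2.
  by rewrite cmodM -(rmorph_nat (real_complex R)) cmodR ger0_norm // exprMn -natrX.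
rewrite !cReD !cReMr -[_^*%C * _]cJM cReJ e2 e4 /=.
by move: (cmod c ^+ 2) => k; lra.
Qed.

Lemma clim_sum (T : Type) (F : set_system T) (FF : Filter F) (I : Type) (r : seq I)
    (f : I -> T -> C) (l : I -> C) : (forall i, clim F (f i) (l i)) ->
  clim F (fun x => \sum_(i <- r) f i x) (\sum_(i <- r) l i).
Proof.
move=> h; elim: r => [|i r ih].
  by rewrite big_nil; under eq_fun do rewrite big_nil; exact: clim_cst.
by rewrite big_cons; under eq_fun do rewrite big_cons; exact: climD.
Qed.

Lemma mx_clim_quad n (F : set_system R) (FF : Filter F) (u : R -> 'cV[C]_n) (H : R -> 'M[C]_n) t :
  (forall i, clim F (fun s => u s i 0) (u t i 0)) ->
  (forall i j, clim F (fun s => H s i j) (H t i j)) ->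
  clim F (fun s => quad (u s) (H s)) (quad (u t) (H t)).
Proof.
move=> hu hH.
have e x : quad (u x) (H x) = \sum_j (\sum_i (u x i 0)^*%C * H x i j) * u x j 0.
  rewrite /quad mxE; apply: eq_bigr => j _; congr (_ * _).
  by rewrite mxE; apply: eq_bigr => i _; rewrite adjE.
rewrite e; have -> : (fun s => quad (u s) (H s)) =
    (fun s => \sum_j (\sum_i (u s i 0)^*%C * H s i j) * u s j 0) by apply/funext => x; rewrite e.
apply: clim_sum => j; apply: climM => //; apply: clim_sum => i.
by apply: climM => //; exact: climJ.
Qed.

Lemma mx_clim_mul m n k (F : set_system R) (FF : Filter F) (M : R -> 'M[C]_(m, n))
    (N : R -> 'M[C]_(n, k)) t :
  (forall i j, clim F (fun s => M s i j) (M t i j)) ->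
  (forall i j, clim F (fun s => N s i j) (N t i j)) ->
  forall i j, clim F (fun s => (M s *m N s) i j) ((M t *m N t) i j).
Proof.
move=> hM hN i j; rewrite mxE; have -> : (fun s => (M s *m N s) i j) =
    (fun s => \sum_k M s i k * N s k j) by apply/funext => x; rewrite mxE.
by apply: clim_sum => l; apply: climM.
Qed.

Lemma clim_within (F : set_system R) (FF : Filter F) (D : set R) (f : R -> C) l :
  clim F f l -> clim (within D F) f l.
Proof. by move=> h e e0; apply: filterS (h e e0) => x. Qed.

Lemma transport_cont (f : R -> C) : {within `[0, 1]%classic, continuous (fun t => complex.Re (f t))} ->
  {within `[0, 1]%classic, continuous (fun t => complex.Im (f t))} ->
  forall t : R, 0 <= t <= 1 -> clim (within `[0, 1]%classic (nbhs t)) f (f t).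
Proof.
move=> /subspace_continuousP h1 /subspace_continuousP h2 t ht.
have tI : `[0, 1]%classic t by rewrite /= in_itv.
by apply/climP; split; [exact: h1|exact: h2].
Qed.

Lemma within_Re (f : R -> C) :
  (forall t : R, 0 <= t <= 1 -> clim (within `[0, 1]%classic (nbhs t)) f (f t)) ->
  {within `[0, 1], continuous (fun t => complex.Re (f t))}.
Proof.
move=> h; apply/subspace_continuousP => t; rewrite /= in_itv /= => /h.
by move=> /climP[].
Qed.

End Transport.

Section HiggsTransport.
Variable R : realType.
Local Notation C := R[i].
Variable E : higgs R.
Hypothesis E_par : strongly_parabolic E.
Local Notation T := (Theta0 E).
Hypothesis E_det : forall z : C, z != 0 -> z != 1 ->
  \det (T z) = (z ^+ 2 * (z - 1) ^+ 2)^-1.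
Variables (tau : C) (H : C -> 'M[C]_3).
Hypotheses (tau0 : tau != 0) (H_harm : harmonic_metric E tau H).

Definition cubic (z : C) : C := (z ^+ 2 * (z - 1) ^+ 2)^-1.

(** The logarithmic derivative of [cubic]. *)
Definition dlog_cubic (z : C) : C := - (2 / z + 2 / (z - 1)).

Local Notation D := (fun z => dagger (H z) (T z)).

Lemma cubic_neq0 z : punctured z -> cubic z != 0.
Proof.
by move=> [z0 z1]; rewrite invr_eq0 mulf_neq0 ?expf_neq0 // subr_eq0.
Qed.

Lemma log_derivative_cube (s g q Q k : C) : g != 0 -> g ^+ 3 = 27 * (q * Q) ->
  s * (g * g) + g * (s * g + g * s) = 0 * (q * Q) + 27 * (k * q * Q + q * 0^*%C) ->
  s = k * g / 3.
Proof.
move=> g0 g3 e; have sq0 : 3 * g ^+ 2 != 0 by rewrite mulf_neq0 ?expf_neq0 ?pnatr_eq0.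
apply: (mulfI sq0); transitivity (k * g ^+ 3); last by field.
have -> : 3 * g ^+ 2 * s = s * (g * g) + g * (s * g + g * s) by ring.
by rewrite e g3 conjc0; ring.
Qed.

Lemma wder_cubic z : punctured z -> wder cubic z (dlog_cubic z * cubic z) 0.
Proof.
move=> pz; have [z0 z1] := pz; have z1' : z - 1 != 0 by rewrite subr_eq0.
have h1 := wder_id z; have h2 := wderB h1 (wder_cst 1 z).
have h := wderM (wderM h1 h1) (wderM h2 h2).
have n0 : (z * z) * ((z - 1) * (z - 1)) != 0 by rewrite !mulf_neq0.
have := wderV h n0; rewrite /= => {}h.
have -> : cubic = fun w => (w * w * ((w - 1) * (w - 1)))^-1.
  by apply/funext => w; rewrite /cubic !expr2.
set a := (X in wder _ _ X _) in h; set b := (X in wder _ _ _ X) in h.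
have -> : dlog_cubic z * (z * z * ((z - 1) * (z - 1)))^-1 = a.
  by rewrite /a /dlog_cubic; field; rewrite z0 z1'.
have -> // : 0 = b by rewrite /b; field; rewrite z0 z1'.
Qed.

Lemma higgs_unit z : punctured z -> T z \in unitmx.
Proof.
by move=> pz; have [z0 z1] := pz; rewrite unitmxE E_det // unitfE; exact: cubic_neq0.
Qed.

Lemma higgs_cube z : punctured z -> T z *m T z *m T z = (cubic z)%:M.
Proof.
move=> pz; have [z0 z1] := pz.
by have [rho [_ _ _]] := decoupled E_par E_det tau0 H_harm pz; rewrite E_det.
Qed.

Lemma higgs_size z : punctured z -> exists rho : R, [/\ 0 < rho,
  rho ^+ 3 = cmod (cubic z) ^+ 2 & T z *m D z = rho%:C%:M].
Proof.
move=> pz; have [z0 z1] := pz.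
by have [rho [r0 r3 e _]] := decoupled E_par E_det tau0 H_harm pz; exists rho; rewrite r3 E_det.
Qed.

(** [D] is [rho] times the inverse of [T], and [T^3 = q].  Writing [rho] as a trace makes
    its derivative available from the Bochner computation. *)
Lemma spectral_dagger z : punctured z ->
  D z = (\tr (T z *m D z) / (3 * cubic z)) *: (T z *m T z) /\
  \tr (T z *m D z) ^+ 3 = 27 * (cubic z * (cubic z)^*%C).
Proof.
move=> pz; have [rho [r0 r3 e]] := higgs_size pz.
have q0 := cubic_neq0 pz; have n3 : 3 != 0 :> C by rewrite pnatr_eq0.
have tE : \tr (T z *m D z) = 3 * rho%:C by rewrite e mxtrace_scalar mulr_natl.
split.
  rewrite tE -[LHS](mulKmx (higgs_unit pz)) e mul_mx_scalar.
  have -> : 3 * rho%:C / (3 * cubic z) = rho%:C / cubic z by field.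
  have -> : T z *m T z = cubic z *: invmx (T z).
    by rewrite -[LHS](mulmxK (higgs_unit pz)) (higgs_cube pz) mul_scalar_mx.
  by rewrite scalerA divfK.
rewrite tE exprMn cmod_sqr -r3 (rmorphXn (real_complex R)) /=; congr (_ * _).
by rewrite -natrX.
Qed.

(** [theta] is parallel up to the logarithmic derivative of its eigenvalues: compare
    the derivatives of [T^3 = q] and of [D = r T^2] with that of the adjoint. *)
Lemma higgs_covariant z : punctured z ->
  mx_d_z T z = (dlog_cubic z / 3) *: T z + T z *m chern_form H z - chern_form H z *m T z.
Proof.
move=> pz; have n3 : 3 != 0 :> C by rewrite pnatr_eq0.
have q0 := cubic_neq0 pz.
set k := dlog_cubic z; set A := chern_form H z; set T1 := mx_d_z T z.
have hT : mxd T z T1 0 by apply: mxd_hol => i j; exact: hol_Theta.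
have uz := metric_unit H_harm pz; have [[hh _] _] := metric_posdef H_harm pz.
have hH : mxd H z (mx_d_z H z) ((mx_d_z H z) ^t*).
  apply: mxd_hermitian => [|i j]; last by have [] := metric_dif H_harm i j pz.
  by apply: punctured_near pz => w /(metric_posdef H_harm)[[]].
have hD := mxd_dagger uz hh hH hT.
have hq := wder_cubic pz.
have hs := nbhs_singleton (wder_sigma (nearH E_par H_harm pz)).
set s := (X in wder _ _ X _) in hs; set sg := (X in wder X _ _ _) in hs.
have o : \forall w \near (z : C^o), punctured w by exact: punctured_open.
have sD w : punctured w -> D w = (sg w / (3 * cubic w)) *: (T w *m T w).
  by move=> /spectral_dagger[].
have s3 w : punctured w -> sg w ^+ 3 = 27 * (cubic w * (cubic w)^*%C).
  by move=> /spectral_dagger[].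
have sg0 : sg z != 0.
  apply/eqP => e; have := s3 z pz; rewrite e expr0n /= => /esym/eqP.
  by rewrite !mulf_eq0 conjc_eq0 (negPf q0) pnatr_eq0.
have es : s = k * sg z / 3.
  have h1 := wderM hs (wderM hs hs).
  have h2 := wderM (wder_cst 27 z) (wderM hq (wder_conj hq)).
  have near3 : \forall w \near (z : C^o), sg w * (sg w * sg w) = 27 * (cubic w * (cubic w)^*%C).
    by apply: filterS o => w /s3 <-; rewrite exprS expr2.
  have [e _] := wder_uniq (wder_near near3 h1) h2.
  exact: log_derivative_cube sg0 (s3 z pz) e.
pose r w := sg w / (3 * cubic w).
have r0 : r z != 0 by rewrite mulf_neq0 // invr_eq0 mulf_neq0.
have [b hr] : exists b, wder r z (- (2 / 3) * k * r z) b.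
  have q3 : 3 * cubic z != 0 by rewrite mulf_neq0.
  have h := wderM hs (wderV (wderM (wder_cst 3 z) hq) q3).
  set a := (X in wder _ _ X _) in h; set b := (X in wder _ _ _ X) in h.
  exists b; suff -> : - (2 / 3) * k * r z = a by [].
  by rewrite /a es /r; field; rewrite q0.
have hrTT := mxdZ hr (mxdM hT hT).
have nearD : \forall w \near (z : C^o), r w *: (T w *m T w) = D w.
  by apply: filterS o => w /sD.
have [e2 _] := mxd_uniq (mxd_near nearD hrTT) hD.
have hT3 := mxdM (mxdM hT hT) hT.
have near3 : \forall w \near (z : C^o), T w *m T w *m T w = cubic w *: (1%:M : 'M[C]_3).
  by apply: filterS o => w /higgs_cube ->; rewrite scalemx1.
have [e3 _] := mxd_uniq (mxd_near near3 hT3) (mxdZ hq (mxd_cst 1%:M z)).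
have c1 : T1 *m T z *m T z + T z *m T1 *m T z + T z *m T z *m T1 = (k * cubic z)%:M.
  by move: e3; rewrite mulmxDl scaler0 addr0 scalemx1.
have c2 : (- (2 / 3) * k * r z) *: (T z *m T z) + r z *: (T1 *m T z + T z *m T1) =
    (r z *: (T z *m T z)) *m A - A *m (r z *: (T z *m T z)).
  by rewrite e2 -(sD z pz).
exact: covariant_constancy (higgs_unit pz) n3 r0 (higgs_cube pz) c1 c2.
Qed.

Lemma conn_formE z x : conn_form E tau H z x =
  x *: chern_form H z + (x * tau) *: T z + (x * tau)^*%C *: D z.
Proof. by rewrite /conn_form scalerDr scalerA cJM. Qed.

(** A path [p] in the punctured plane with a branch [lam] of the eigenvalue along it and
    the primitive [L] of [lam dz]. *)
Section AlongAPath.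
Variables (p p1 lam L : R -> C) (m M : R).
Hypotheses (m0 : 0 < m)
  (pm : forall t : R, 0 <= t <= 1 -> m <= cmod (p t) /\ m <= cmod (p t - 1))
  (dp : forall t : R, cder p t (p1 t)) (p1M : forall t, cmod (p1 t) <= M)
  (dlam : forall t : R, 0 <= t <= 1 ->
    cder lam t (dlog_cubic (p t) / 3 * p1 t * lam t))
  (dL : forall t : R, 0 <= t <= 1 -> cder L t (lam t * p1 t)).

Lemma path_punctured t : 0 <= t <= 1 -> punctured (p t).
Proof.
move=> /pm[h0 h1]; split; first by rewrite -cmod_gt0; exact: lt_le_trans h0.
by rewrite -subr_eq0 -cmod_gt0; exact: lt_le_trans h1.
Qed.

Let A t := chern_form H (p t).
Let flow t : 'M[C]_3 :=
  p1 t *: A t + (p1 t * tau) *: T (p t) + (p1 t * tau)^*%C *: D (p t).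

Lemma metric_along_path t : 0 <= t <= 1 ->
  mcder (fun s => H (p s)) t
    (p1 t *: (H (p t) *m A t) + (p1 t)^*%C *: ((A t) ^t* *m H (p t))).
Proof.
move=> ht; have pz := path_punctured ht; have uz := metric_unit H_harm pz.
have [[hh _] _] := metric_posdef H_harm pz.
have hH : mxd H (p t) (mx_d_z H (p t)) ((mx_d_z H (p t)) ^t*).
  apply: mxd_hermitian => [|i j]; last by have [] := metric_dif H_harm i j pz.
  by apply: punctured_near pz => w /(metric_posdef H_harm)[[]].
have e1 : H (p t) *m A t = mx_d_z H (p t) by rewrite /A /chern_form mulKVmx.
have e2 : (A t) ^t* *m H (p t) = (mx_d_z H (p t)) ^t*.
  by have := adjM (H (p t)) (A t); rewrite e1 hh => ->.
by rewrite e2 e1; exact: mcder_curve.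
Qed.

(** Norms change along the flow, twisted by [k], only through [theta]. *)
Lemma norm_along_path (u : R -> 'cV[C]_3) k t : 0 <= t <= 1 ->
  mcder u t ((k%:M - flow t) *m u t) ->
  is_derive t 1 (fun s => complex.Re (quad (u s) (H (p s))))
    (2 * complex.Re k * complex.Re (quad (u t) (H (p t))) -
     4 * complex.Re (p1 t * tau * quad (u t) (H (p t) *m T (p t)))).
Proof.
move=> ht hu; have pz := path_punctured ht; have uz := metric_unit H_harm pz.
have [[hh _] _] := metric_posdef H_harm pz.
exact: (norm_flow hh uz hu (metric_along_path ht)).
Qed.

Lemma is_transport_flow S0 v0 : is_transport (conn_form E tau H) p S0 ->
  exists v : R -> 'cV[C]_3, [/\ v 0 = v0, v 1 = S0 *m v0,
    forall t : R, 0 <= t <= 1 -> forall i, clim (within `[0, 1]%classic (nbhs t)) (fun s => v s i 0) (v t i 0)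
    & forall t : R, 0 < t < 1 -> mcder v t (- flow t *m v t)].
Proof.
move=> [S [S00 S1 cS dS]]; exists (fun t => S t *m v0); split.
- by rewrite S00 mul1mx.
- by rewrite S1.
- move=> t ht i; apply: mx_clim_mul => // [a b|a b].
    by have [h1 h2] := cS a b; exact: transport_cont.
  exact: clim_cst.
move=> t ht; have hS : mcder S t (- flow t *m S t).
  move=> i j; have [d e] := dS t i j ht.
  have [_ ep] := cder_curve (dp t).
  have := curve_cder d; rewrite e ep conn_formE.
  by rewrite mulN_entry.
have := mcderM hS (mcder_cst v0 t); by rewrite mulmx0 addr0 -mulmxA.
Qed.

Lemma within_metric (t : R) : 0 <= t <= 1 -> forall i j,
  clim (within `[0, 1]%classic (nbhs t)) (fun s => H (p s) i j) (H (p t) i j).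
Proof.
move=> ht i j; apply: clim_within.
exact: cder_clim (metric_along_path ht i j).
Qed.

(** [(T - lam) v] solves a linear homogeneous equation with initial value [0].  The
    equation comes from differentiability at interior times only, so uniqueness is
    proved by Gronwall's inequality for the squared norm. *)
Lemma eigenline_parallel v0 :
  T (p 0) *m v0 = lam 0 *: v0 ->
  forall v : R -> 'cV[C]_3, v 0 = v0 ->
  (forall t : R, 0 <= t <= 1 -> forall i,
    clim (within `[0, 1]%classic (nbhs t)) (fun s => v s i 0) (v t i 0)) ->
  (forall t : R, 0 < t < 1 -> mcder v t (- flow t *m v t)) ->
  forall t : R, 0 <= t <= 1 -> T (p t) *m v t = lam t *: v t.
Proof.
move=> ev v v00 cv dv.
have in01 (t : R) : 0 < t < 1 -> 0 <= t <= 1 by move=> /andP[/ltW -> /ltW ->].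
pose W t := T (p t) - (lam t)%:M.
pose w t := W t *m v t.
pose kap t := dlog_cubic (p t) / 3 * p1 t.
have dT t : 0 <= t <= 1 -> mcder (fun s => T (p s)) t (p1 t *: mx_d_z T (p t)).
  move=> ht; have pz := path_punctured ht.
  have hT : mxd T (p t) (mx_d_z T (p t)) 0 by apply: mxd_hol => i j; exact: hol_Theta.
  by have := mcder_curve hT (dp t); rewrite scaler0 addr0.
have dW t : 0 <= t <= 1 -> mcder W t (p1 t *: mx_d_z T (p t) - (kap t * lam t)%:M).
  by move=> ht; apply: mcderB; [exact: dT|apply: mcder_scalar; exact: dlam].
have dw t : 0 < t < 1 -> mcder w t (((kap t)%:M - flow t) *m w t).
  move=> ht; have pz := path_punctured (in01 t ht).
  have := mcderM (dW t (in01 t ht)) (dv t ht); rewrite higgs_covariant //.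
  have comm : D (p t) *m T (p t) = T (p t) *m D (p t).
    have [eD _] := spectral_dagger pz; rewrite eD; exact: scaled_square_comm.
  have := eigen_flow_identity (A t) (p1 t) (p1 t * tau) (p1 t * tau)^*%C
    (dlog_cubic (p t) / 3) (lam t) comm.
  rewrite -/(flow t) -/(kap t) -/(W t) => e.
  by rewrite mulmxA [_ *m - flow t]mulmxN -mulmxDl e -mulmxA.
have cw (t : R) : 0 <= t <= 1 -> forall i, clim (within `[0, 1]%classic (nbhs t)) (fun s => w s i 0) (w t i 0).
  move=> ht i; apply: mx_clim_mul => // [a b|a b].
    by apply: clim_within; exact: cder_clim (dW t ht a b).
  by rewrite (ord1 b); exact: cv.
pose f t := complex.Re (quad (w t) (H (p t))).
have cf : {within `[0, 1], continuous f}.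
  apply: within_Re => t ht; apply: mx_clim_quad => [i|i j]; first exact: cw.
  exact: within_metric.
have f0 t : 0 <= t <= 1 -> 0 <= f t.
  move=> ht; apply: quad_ge0; exact: (metric_posdef H_harm (path_punctured ht)).1.
pose B := 2 * (4 / m * M) + (1 + m ^- 8 + 4 * (M * cmod tau) ^+ 2).
have M0 : 0 <= M by apply: le_trans (p1M 0); exact: cmod_ge0.
have hB (t : R) : 0 <= t <= 1 -> 2 * complex.Re (kap t) * f t -
    4 * complex.Re (p1 t * tau * quad (w t) (H (p t) *m T (p t))) <= B * f t.
  move=> ht; have pz := path_punctured ht; have [m1 m2] := pm ht.
  have [rho [r0 r3 e]] := higgs_size pz.
  have e' : D (p t) *m T (p t) = rho%:C%:M.
    have [eD _] := spectral_dagger pz; rewrite -e eD; exact: scaled_square_comm.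
  have [pH _] := metric_posdef H_harm pz.
  have h1 := quad_size_bound (w t) (p1 t * tau) pH e'; rewrite -/(f t) in h1.
  have inv (x : C) : m <= cmod x -> (cmod x)^-1 <= m^-1.
    by move=> hx; rewrite lef_pV2 ?posrE //; exact: lt_le_trans hx.
  have i1 := inv _ m1; have i2 := inv _ m2.
  have k1 : complex.Re (kap t) <= 4 / m * M.
    apply: le_trans (ler_norm _) _; apply: le_trans (cmod_Re _) _; rewrite cmodM.
    apply: ler_pM; rewrite ?cmod_ge0 // cmodM.
    have c3 : cmod 3^-1 = 3^-1 :> R by rewrite cmodV -(rmorph_nat (real_complex R)) cmodR ger0_norm.
    have c2 : cmod 2 = 2 :> R by rewrite -(rmorph_nat (real_complex R)) cmodR ger0_norm.
    have d1 : cmod (dlog_cubic (p t)) <= 4 / m.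
      rewrite /dlog_cubic cmodN; apply: le_trans (cmodD _ _) _.
      by rewrite !cmodM c2 !cmodV; lra.
    by rewrite c3; have := cmod_ge0 (dlog_cubic (p t)); lra.
  have k2 : rho <= 1 + m ^- 8.
    have hc : cmod (cubic (p t)) ^+ 2 <= m ^- 8.
      have -> : m ^- 8 = (m^-1 ^+ 2 * m^-1 ^+ 2) ^+ 2 by rewrite -exprVn; ring.
      rewrite ler_sqr ?nnegrE ?cmod_ge0 //; last by rewrite mulr_ge0 // sqr_ge0.
      rewrite /cubic cmodV cmodM !cmodX invfM -!exprVn.
      by apply: ler_pM; rewrite ?sqr_ge0 // ler_sqr ?nnegrE ?invr_ge0 ?cmod_ge0 // ltW.
    apply: le_trans (_ : 1 + rho ^+ 3 <= _); last by rewrite r3 lerD2l.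
    have [r1|r1] := leP rho 1; first by rewrite (le_trans r1) // lerDl exprn_ge0 // ltW.
    apply: le_trans (_ : rho ^+ 3 <= _); last by rewrite lerDr.
    by rewrite exprS ler_peMr ?(ltW r0) // exprn_ege1 // ltW.
  have k3 : cmod (p1 t * tau) ^+ 2 <= (M * cmod tau) ^+ 2.
    rewrite ler_sqr ?nnegrE ?mulr_ge0 ?cmod_ge0 // cmodM ler_wpM2r ?cmod_ge0 //.
  have ft := f0 t ht.
  have h2 : 2 * complex.Re (kap t) * f t <= 2 * (4 / m * M) * f t.
    by rewrite ler_wpM2r // ler_wpM2l.
  have h3 : (rho + 4 * cmod (p1 t * tau) ^+ 2) * f t <=
      (1 + m ^- 8 + 4 * (M * cmod tau) ^+ 2) * f t.
    by rewrite ler_wpM2r // lerD // ler_wpM2l.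
  have -> : B * f t = 2 * (4 / m * M) * f t + (1 + m ^- 8 + 4 * (M * cmod tau) ^+ 2) * f t.
    by rewrite /B mulrDl.
  exact: lerD h2 (le_trans h1 h3).
have f00 : f 0 = 0.
  have w0 : w 0 = 0 by rewrite /w /W mulmxBl mul_scalar_mx v00 ev subrr.
  by rewrite /f w0 /quad mulmx0 mxE.
have dB (t : R) : 0 <= t <= 1 -> is_derive t 1 (fun s : R => B * s) (B * 1).
  by move=> _; apply: is_deriveZ; exact: is_derive_id.
have hle (t : R) : 0 < t < 1 -> is_derive t 1 f _ := fun ht => norm_along_path (in01 t ht) (dw t ht).
move=> t ht; have := integrating_factor cf hle dB _ ht.
rewrite f00 mul0r => h.
have ft0 : f t = 0.
  apply/eqP; rewrite eq_le f0 // andbT; apply: h => s hs; rewrite mulr1.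
  by apply: hB; exact: in01.
have w0 : w t = 0.
  by apply: quad_eq0 ft0; exact: (metric_posdef H_harm (path_punctured ht)).1.
by apply/eqP; rewrite -subr_eq0 -mul_scalar_mx -mulmxBl; apply/eqP.
Qed.

(** On a parallel eigenline, [theta] and its adjoint act by [lam] and its conjugate, so
    the squared norm satisfies a scalar linear equation. *)
Lemma transport_eigenline S0 v0 : is_transport (conn_form E tau H) p S0 ->
  T (p 0) *m v0 = lam 0 *: v0 ->
  T (p 1) *m (S0 *m v0) = lam 1 *: (S0 *m v0) /\
  complex.Re (quad (S0 *m v0) (H (p 1))) =
  complex.Re (quad v0 (H (p 0))) * expR (- 4 * complex.Re (tau * (L 1 - L 0))).
Proof.
move=> hS ev; have [v [v00 v1 cv dv]] := is_transport_flow v0 hS.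
have par := eigenline_parallel ev v00 cv dv.
have in01 (t : R) : 0 < t < 1 -> 0 <= t <= 1 by move=> /andP[/ltW -> /ltW ->].
have l01 : 0 <= (1 : R) <= 1 by rewrite ler01 lexx.
split; first by rewrite -v1; apply: par.
pose f t := complex.Re (quad (v t) (H (p t))).
have cf : {within `[0, 1], continuous f}.
  apply: within_Re => t ht; apply: mx_clim_quad => [i|i j]; first exact: cv.
  exact: within_metric.
(* the scalar equation gives an inequality in each direction, for [f] and for [- f] *)
pose phi1 t := - 4 * complex.Re (tau * (lam t * p1 t)).
have df (t : R) : 0 < t < 1 -> is_derive t 1 f (phi1 t * f t).
  move=> ht; have hv : mcder v t ((0%:M - flow t) *m v t) by rewrite raddf0 sub0r; exact: dv.
  have := norm_along_path (in01 t ht) hv; rewrite mulr0 mul0r sub0r.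
  have -> : quad (v t) (H (p t) *m T (p t)) = lam t * quad (v t) (H (p t)).
    by rewrite /quad !mulmxA -mulmxA par ?in01 // -scalemxAr mxE.
  have [[hh _] _] := metric_posdef H_harm (path_punctured (in01 t ht)).
  rewrite (quad_hermitian (v t) hh) -/(f t).
  have -> : p1 t * tau * (lam t * (f t)%:C) = (f t)%:C * (tau * (lam t * p1 t)) by ring.
  rewrite cReMr; suff -> : phi1 t * f t = - (4 * (f t * complex.Re (tau * (lam t * p1 t)))) by [].
  by rewrite /phi1; ring.
pose phi t := - 4 * complex.Re (tau * L t).
have dphi (t : R) : 0 <= t <= 1 -> is_derive t 1 phi (phi1 t).
  move=> ht; have := cderM (cder_cst tau t) (dL ht); rewrite mul0r add0r => /cderP[h _].
  exact: is_deriveZ.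
have dfN (t : R) : 0 < t < 1 -> is_derive t 1 (fun s => - f s) (phi1 t * - f t).
  by move=> ht; have h := df t ht; rewrite mulrN; exact: is_deriveN.
have cfN : {within `[0, 1], continuous (fun s => - f s)}.
  by move=> s; apply: cvgN; exact: cf.
have le1 := integrating_factor cf df dphi (fun t _ => lexx _) l01.
have le2 := integrating_factor cfN dfN dphi (fun t _ => lexx _) l01.
have -> : - 4 * complex.Re (tau * (L 1 - L 0)) = phi 1 - phi 0.
  by rewrite mulrBr cReB /phi; ring.
rewrite -v1 -v00 -[RHS]/(f 0 * _) -[LHS]/(f 1); apply/eqP; rewrite eq_le le1 /=.
by rewrite mulNr lerN2 in le2.
Qed.

End AlongAPath.

End HiggsTransport.

(** * The cube root of the cubic differential *)

Section ComplexExponential.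
Variable R : realType.
Local Notation C := R[i].

Lemma cisD (s t : R) : cis (s + t) = cis s * cis t :> C.
Proof.
by apply: complex_eqP; rewrite /cis /= ?(cosD, sinD) //; rewrite addrC mulrC; congr (_ + _); exact: mulrC.
Qed.

Lemma cis0 : cis 0 = 1 :> C.
Proof. by rewrite /cis cos0 sin0. Qed.

Lemma cmod_cis (t : R) : cmod (cis t : C) = 1.
Proof. by rewrite cmodE /= cos2Dsin2 sqrtr1. Qed.

Lemma cis_neq0 (t : R) : cis t != 0 :> C.
Proof. by rewrite -cmod_eq0 cmod_cis oner_eq0. Qed.

Lemma cisX (t : R) n : cis t ^+ n = cis (n%:R * t) :> C.
Proof.
elim: n => [|n ih]; first by rewrite mul0r cis0.
by rewrite exprS ih -cisD mulrSr mulrDl mul1r addrC.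
Qed.

Lemma cder_cis (a t : R) : cder (fun s : R => cis (a * s) : C) t (a%:C * 'i%C * cis (a * t)).
Proof.
have h1 : is_derive t 1 (fun x : R => a * x) (a * 1).
  by apply: is_deriveZ; exact: is_derive_id.
have -> : a%:C * 'i%C * cis (a * t) = (- (a * sin (a * t))) +i* (a * cos (a * t)).
  by apply: complex_eqP => /=; ring.
apply/cderP; rewrite /cis /=; split.
- have := @is_derive1_comp R cos (fun x => a * x) t _ _ (is_derive_cos _) h1.
  by rewrite mulr1 mulNr mulrC.
- have := @is_derive1_comp R sin (fun x => a * x) t _ _ (is_derive_sin _) h1.
  by rewrite mulr1 mulrC.
Qed.

Definition cexp (z : C) : C := (expR (complex.Re z))%:C * cis (complex.Im z).

Lemma cexpD z w : cexp (z + w) = cexp z * cexp w.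
Proof. by rewrite /cexp cReD cImD expRD cisD rmorphM /=; ring. Qed.

Lemma cexp0 : cexp 0 = 1.
Proof. by rewrite /cexp /= expR0 cis0 mulr1. Qed.

Lemma cexp_neq0 z : cexp z != 0.
Proof.
rewrite mulf_neq0 ?cis_neq0 // (inj_eq (@complexI R)) gt_eqF //; exact: expR_gt0.
Qed.

Lemma cexpX z n : cexp z ^+ n = cexp (n%:R * z).
Proof.
elim: n => [|n ih]; first by rewrite mul0r cexp0.
by rewrite exprS ih -cexpD mulrSr mulrDl mul1r addrC.
Qed.

Lemma cexp_real (x : R) : cexp x%:C = (expR x)%:C.
Proof. by rewrite /cexp /= cis0 mulr1. Qed.

Lemma wder_Re z : wder (fun w : C => (complex.Re w)%:C) z (1 / 2)%:C (1 / 2)%:C.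
Proof.
exists (fun=> (1 / 2)%:C), (fun=> (1 / 2)%:C); split; try exact: clim_cst.
have FF : Filter (nbhs (z : C^o)) by exact: nbhs_filter.
apply: filterE => w; rewrite -rmorphB /=; case: w => a b; case: z {FF} => c d.
by apply: complex_eqP => /=; field.
Qed.

Lemma wder_Im z :
  wder (fun w : C => (complex.Im w)%:C) z (0 +i* (- (1 / 2))) (0 +i* (1 / 2)).
Proof.
exists (fun=> 0 +i* (- (1 / 2))), (fun=> 0 +i* (1 / 2)); split; try exact: clim_cst.
have FF : Filter (nbhs (z : C^o)) by exact: nbhs_filter.
apply: filterE => w; rewrite -rmorphB /=; case: w => a b; case: z {FF} => c d.
by apply: complex_eqP => /=; field.
Qed.

Lemma wder_cexp z : wder cexp z (cexp z) 0.
Proof.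
have hE := wder_real_comp (wder_Re z) (is_derive_expR (complex.Re z)).
have hc := wder_real_comp (wder_Im z) (is_derive_cos (complex.Im z)).
have hs := wder_real_comp (wder_Im z) (is_derive_sin (complex.Im z)).
have h := wderM hE (wderD hc (wderM (wder_cst 'i%C z) hs)).
set a := (X in wder _ _ X _) in h; set b := (X in wder _ _ _ X) in h.
have -> : cexp z = a by apply: complex_eqP; rewrite /a /cexp /cis /=; field.
have -> : (0 : C) = b by apply: complex_eqP; rewrite /b /=; field.
apply: wder_near h; have FF : Filter (nbhs (z : C^o)) by exact: nbhs_filter.
by apply: filterE => w; apply: complex_eqP; rewrite /cexp /cis /=; ring.
Qed.

Lemma wder_comp (g f : C -> C) z a b : wder g (f z) a 0 -> wder f z b 0 ->
  wder (fun w => g (f w)) z (a * b) 0.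
Proof.
move=> [u [v [hu hv h]]] hf; have cf := wder_clim hf; move: hf => [x [y [hx hy h']]].
exists (fun w => u (f w) * x w + v (f w) * (y w)^*%C),
  (fun w => u (f w) * y w + v (f w) * (x w)^*%C); split.
- have -> : a * b = a * b + 0 * 0^*%C by rewrite mul0r addr0.
  by apply: climD; apply: climM => //; [exact: clim_comp cf hu|exact: clim_comp cf hv|exact: climJ].
- have e : (0 : C) = a * 0 + 0 * b^*%C by rewrite mulr0 mul0r addr0.
  rewrite [X in clim _ _ X]e.
  by apply: climD; apply: climM => //; [exact: clim_comp cf hu|exact: clim_comp cf hv|exact: climJ].
have h2 : \forall w \near (z : C^o), g (f w) - g (f z) =
    (f w - f z) * u (f w) + (f w - f z)^*%C * v (f w) by exact: clim_near cf h.
apply: filterS2 h2 h' => w -> ->.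
have cj (p X Y : C) : (p * X + p^*%C * Y)^*%C = p^*%C * X^*%C + p * Y^*%C.
  by rewrite cJD !cJM conjcK.
by rewrite cj; ring.
Qed.

End ComplexExponential.

Section Branch.
Variable R : realType.
Local Notation C := R[i].

(** [- log (1 - u)] on the unit disc. *)
Definition neglog (u : C) : C := seg (fun s => (1 - s)^-1) 0 u.

(** [(1 - u)^(-2/3)] on the unit disc. *)
Definition branch (u : C) : C := cexp ((2 / 3)%:C * neglog u).

(** A primitive of [q^(1/3) dz] after the substitution [z = zeta^3]. *)
Definition primitive (zeta : C) : C := seg (fun s => 3 * branch (s ^+ 3)) 0 zeta.

Lemma one_sub_neq0 (u : C) : cmod u < 1 -> 1 - u != 0.
Proof.
by move=> hu; rewrite subr_eq0; apply: contraTneq hu => <-; rewrite cmod1 ltxx.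
Qed.

Lemma wder_neglog u : cmod u < 1 -> wder neglog u (1 - u)^-1 0.
Proof.
move: u; apply: disc_primitive => z hz; apply: holV; last exact: one_sub_neq0.
by apply: holB; [exact: hol_cst|exact: hol_id].
Qed.

Lemma seg_refl (f : C -> C) a : seg f a a = 0.
Proof.
apply: segE; exists (fun=> 0); rewrite !subrr; split=> // t _.
by rewrite mul0r; exact: cder_cst.
Qed.

Lemma hol_constant (f : C -> C) a b :
  (forall t : R, 0 <= t <= 1 -> wder f (line a b t) 0 0) -> f a = f b.
Proof.
move=> h; apply/esym/eqP; rewrite -subr_eq0 -(@seg_primitive _ f (fun=> 0)) //.
apply/eqP; apply: segE; exists (fun=> 0); rewrite subrr; split=> // t _.
by rewrite mulr0; exact: cder_cst.
Qed.

Lemma disc_line (u : C) (t : R) : cmod u < 1 -> 0 <= t <= 1 -> cmod (line 0 u t) < 1.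
Proof.
move=> hu /andP[t0 t1]; rewrite /line add0r subr0 cmodM cmodR ger0_norm //.
by apply: le_lt_trans hu; rewrite ler_piMl ?cmod_ge0.
Qed.

(** The derivative of the product vanishes. *)
Lemma cexp_neglog u : cmod u < 1 -> cexp (neglog u) * (1 - u) = 1.
Proof.
move=> hu; have := @hol_constant (fun w => cexp (neglog w) * (1 - w)) 0 u.
rewrite /neglog seg_refl cexp0 subr0 mulr1 => <- // t ht.
have hl := disc_line hu ht; have n0 := one_sub_neq0 hl.
have h := wderM (wder_comp (wder_cexp _) (wder_neglog hl)) (wderB (wder_cst 1 _) (wder_id _)).
set a := (X in wder _ _ X _) in h; set b := (X in wder _ _ _ X) in h.
have ea : a = 0 by rewrite /a; field.
have eb : b = 0 by rewrite /b; ring.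
by rewrite ea eb in h.
Qed.

Lemma branch_cube u : cmod u < 1 -> branch u ^+ 3 * (1 - u) ^+ 2 = 1.
Proof.
move=> hu; rewrite /branch cexpX.
have -> : 3%:R * ((2 / 3)%:C * neglog u) = neglog u + neglog u.
  rewrite mulrA -(rmorph_nat (real_complex R)) -rmorphM /=.
  by have -> : 3 * (2 / 3) = 2 :> R; [field|rewrite rmorph_nat mulr_natl mulr2n].
by rewrite cexpD -expr2 -exprMn cexp_neglog // expr1n.
Qed.

Lemma branch_neq0 u : branch u != 0.
Proof. exact: cexp_neq0. Qed.

Lemma wder_branch u : cmod u < 1 ->
  wder branch u ((2 / 3)%:C / (1 - u) * branch u) 0.
Proof.
move=> hu; have h := wderM (wder_cst (2 / 3)%:C u) (wder_neglog hu).
have n0 := one_sub_neq0 hu.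
set b := (X in wder _ _ _ X) in h; have eb : b = 0 by rewrite /b; ring.
rewrite eb in h; have := wder_comp (wder_cexp _) h.
have -> // : (2 / 3)%:C / (1 - u) * branch u =
  cexp ((2 / 3)%:C * neglog u) * (0 * neglog u + (2 / 3)%:C / (1 - u)).
by rewrite /branch; ring.
Qed.

Lemma cmod_cube (z : C) : cmod z < 1 -> cmod (z ^+ 3) < 1.
Proof. by move=> hz; rewrite cmodX exprn_ilt1 ?cmod_ge0. Qed.

Lemma wder_cube (z : C) : wder (fun w : C => w ^+ 3) z (3 * z ^+ 2) 0.
Proof.
have h := wderM (wder_id z) (wderM (wder_id z) (wder_id z)).
set a := (X in wder _ _ X _) in h; set b := (X in wder _ _ _ X) in h.
have -> : 3 * z ^+ 2 = a by rewrite /a /=; ring.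
have -> : (0 : C) = b by rewrite /b; ring.
apply: wder_near h; have FF : Filter (nbhs (z : C^o)) by exact: nbhs_filter.
by apply: filterE => w /=; ring.
Qed.

Lemma primitive_hol z : cmod z < 1 -> hol (fun s => 3 * branch (s ^+ 3)) z.
Proof.
move=> hz; apply: holM; first exact: hol_cst.
have h := @wder_comp R branch (fun w => w ^+ 3) z _ _ (wder_branch (cmod_cube hz)) (wder_cube z).
by eexists; exact: h.
Qed.

Lemma wder_primitive z : cmod z < 1 -> wder primitive z (3 * branch (z ^+ 3)) 0.
Proof. by move: z; apply: disc_primitive => z; exact: primitive_hol. Qed.

(** The integrand depends on [zeta^3] only, so rotating the segment of integration by a
    cube root of unity multiplies [dz] alone. *)
Lemma primitive_rotation e z : e ^+ 3 = 1 -> cmod z < 1 ->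
  primitive (e * z) = e * primitive z.
Proof.
move=> e3 hz; apply: segE.
have [|G [hG GE]] := @segP R (fun s => 3 * branch (s ^+ 3)) 0 z.
  move=> t ht; have [d h] := primitive_hol (disc_line hz ht); exact: wder_clim h.
exists (fun t => e * G t); split; last by rewrite /primitive GE mulrBr.
move=> t ht; have := cderM (cder_cst e t) (hG t ht); rewrite mul0r add0r !subr0.
suff -> : e * (z * (3 * branch (line 0 z t ^+ 3))) =
  e * z * (3 * branch (line 0 (e * z) t ^+ 3)) by [].
have -> : line 0 (e * z) t = e * line 0 z t by rewrite /line !add0r !subr0; ring.
by rewrite exprMn e3 mul1r mulrA.
Qed.

Lemma seg_real (f : C -> C) (x : R) :
  (forall t : R, 0 <= t <= 1 -> (f (t * x)%:C)^*%C = f (t * x)%:C) ->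
  cont_on f 0 x%:C -> (seg f 0 x%:C)^*%C = seg f 0 x%:C.
Proof.
move=> hf /segP[G [hG GE]]; apply/esym/segE; exists (fun t => (G t)^*%C).
split; last by rewrite GE cJB.
move=> t ht; have := cder_conj (hG t ht).
have e : line 0 x%:C t = (t * x)%:C by rewrite /line add0r subr0 -rmorphM.
by rewrite cJM subr0 conjc_real e hf.
Qed.

Lemma conj_fixed_real (z : C) : z^*%C = z -> z = (complex.Re z)%:C.
Proof.
case: z => a b [/eqP]; rewrite -subr_eq0 -opprD oppr_eq0 -mulr2n mulrn_eq0 /= => /eqP ->.
by [].
Qed.

Lemma real_disc (x : R) : 0 <= x < 1 -> cmod (x%:C : C) < 1.
Proof. by move=> /andP[x0 x1]; rewrite cmodR ger0_norm. Qed.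

Lemma branch_real (x : R) : 0 <= x < 1 -> branch x%:C = (((1 - x) `^ (2 / 3))^-1)%:C.
Proof.
move=> hx; have hd := real_disc hx; case/andP: hx => x0 x1.
have : (neglog x%:C)^*%C = neglog x%:C.
  apply: seg_real => [t ht|t ht].
    by rewrite conjc_inv cJB conjc1 conjc_real.
  have [d h] := holV (holB (hol_cst 1 (line 0 x%:C t)) (hol_id _)) (one_sub_neq0 (disc_line hd ht)).
  exact: wder_clim h.
move=> /conj_fixed_real e.
have := branch_cube hd; rewrite /branch e -rmorphM cexp_real.
rewrite -(rmorph1 (real_complex R)) -rmorphB -!rmorphXn -rmorphM => /complexI /=.
move: (expR _) (expR_gt0 (2 / 3 * complex.Re (neglog x%:C))) => y y0 h.
congr (_%:C); have px : 0 < 1 - x by rewrite subr_gt0.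
apply/eqP; rewrite -(@eqrXn2 _ 3) ?invr_ge0 ?powR_ge0 ?(ltW y0) //.
apply/eqP; rewrite exprVn -[(_ `^ _) ^+ 3]powR_mulrn ?powR_ge0 // -powRrM.
have -> : 2 / 3 * 3%:R = 2%:R :> R by field.
rewrite powR_mulrn ?(ltW px) //.
by apply: (mulIf (expf_neq0 2 (lt0r_neq0 px))); rewrite h mulVf // expf_neq0 // lt0r_neq0.
Qed.

Lemma primitive0 : primitive 0 = 0.
Proof. exact: seg_refl. Qed.

Lemma primitive_real (x : R) : 0 <= x < 1 -> (primitive x%:C)^*%C = primitive x%:C.
Proof.
move=> hx; have hd := real_disc hx; case/andP: hx => x0 x1.
apply: seg_real => [t /andP[t0 t1]|t ht]; last first.
  by have [d h] := primitive_hol (disc_line hd ht); exact: wder_clim h.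
have y0 : 0 <= t * x by exact: mulr_ge0.
have y1 : t * x < 1 by apply: le_lt_trans x1; rewrite ler_piMl.
have -> : (t * x)%:C ^+ 3 = ((t * x) ^+ 3)%:C :> C by rewrite rmorphXn.
rewrite cJM branch_real; last by rewrite exprn_ge0 // exprn_ilt1.
by rewrite conjc_real conjc_nat.
Qed.

(** The eigenvalue of [theta] over [z = zeta^3]: in the coordinate [zeta] it is a
    single-valued function near the branch point. *)
Definition eigenvalue (zeta : C) : C := branch (zeta ^+ 3) / zeta ^+ 2.

Lemma eigenvalue_cube zeta : zeta != 0 -> cmod zeta < 1 ->
  eigenvalue zeta ^+ 3 = cubic (zeta ^+ 3).
Proof.
move=> z0 z1; have h := branch_cube (cmod_cube z1).
have n0 := one_sub_neq0 (cmod_cube z1).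
rewrite /eigenvalue /cubic expr_div_n.
have -> : (zeta ^+ 3 - 1) ^+ 2 = (1 - zeta ^+ 3) ^+ 2 by ring.
have -> : branch (zeta ^+ 3) ^+ 3 = (1 - zeta ^+ 3) ^- 2.
  by apply: (mulIf (expf_neq0 2 n0)); rewrite h mulVf // expf_neq0.
by rewrite -!exprM -invfM mulrC.
Qed.

Lemma eigenvalue_cder (zeta : R -> C) t d : cder zeta t d -> zeta t != 0 ->
  cmod (zeta t) < 1 ->
  cder (fun s => eigenvalue (zeta s)) t
    (dlog_cubic (zeta t ^+ 3) / 3 * (3 * zeta t ^+ 2 * d) * eigenvalue (zeta t)).
Proof.
move=> hz z0 z1; have n0 := one_sub_neq0 (cmod_cube z1).
have hb := @wder_comp R branch (fun w => w ^+ 3) _ _ _ (wder_branch (cmod_cube z1)) (wder_cube (zeta t)).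
have hv := wderV (wderM (wder_id (zeta t)) (wder_id (zeta t))) (mulf_neq0 z0 z0).
have e23 : (2 / 3)%:C = 2 / 3 :> C by rewrite rmorphM /= fmorphV !(rmorph_nat (real_complex R)).
rewrite e23 in hb; have := wder_comp_curve (wderM hb hv) hz; rewrite /=.
set a := (X in cder _ t X) => h.
have -> : dlog_cubic (zeta t ^+ 3) / 3 * (3 * zeta t ^+ 2 * d) * eigenvalue (zeta t) = a.
  rewrite /a /eigenvalue /dlog_cubic.
  have n1 : zeta t ^+ 3 - 1 != 0 by rewrite -oppr_eq0 opprB.
  by move: (branch _) (d^*%C) => x y; field; rewrite z0 n0 n1.
have e : (fun s => eigenvalue (zeta s)) =
    ((fun w => branch (w ^+ 3) * (w * w)^-1) \o zeta).
  by apply/funext => s; rewrite /eigenvalue /= expr2.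
by rewrite e.
Qed.

Lemma primitive_cder (zeta : R -> C) t d : cder zeta t d -> zeta t != 0 ->
  cmod (zeta t) < 1 ->
  cder (fun s => primitive (zeta s)) t (eigenvalue (zeta t) * (3 * zeta t ^+ 2 * d)).
Proof.
move=> hz z0 z1; have := wder_comp_curve (wder_primitive z1) hz.
rewrite mul0r addr0; suff -> : eigenvalue (zeta t) * (3 * zeta t ^+ 2 * d) =
  3 * branch (zeta t ^+ 3) * d by [].
by rewrite /eigenvalue; field.
Qed.

Definition cbrt (x : R) : R := x `^ (1 / 3).

Lemma cbrt_cube x : 0 <= x -> cbrt x ^+ 3 = x.
Proof.
move=> x0; rewrite -powR_mulrn ?powR_ge0 // -powRrM.
by have -> : 1 / 3 * 3%:R = 1 :> R; [field|rewrite powRr1].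
Qed.

Lemma cbrt_gt0 x : 0 < x -> 0 < cbrt x.
Proof. exact: powR_gt0. Qed.

Lemma cbrt_lt1 x : 0 <= x < 1 -> cbrt x < 1.
Proof.
move=> /andP[x0 x1]; rewrite ltNge; apply/negP => h.
have : 1 <= cbrt x ^+ 3 by exact: exprn_ege1.
by rewrite cbrt_cube // leNgt x1.
Qed.

Lemma cbrt_disc x : 0 < x < 1 -> (cbrt x)%:C != 0 :> C /\ cmod ((cbrt x)%:C : C) < 1.
Proof.
move=> /andP[x0 x1]; split.
  by rewrite (inj_eq (@complexI R)) gt_eqF // cbrt_gt0.
by apply: real_disc; rewrite powR_ge0 cbrt_lt1 // ltW.
Qed.

Lemma is_derive_cbrt (x : R) : 0 < x -> is_derive x 1 cbrt ((3 * cbrt x ^+ 2)^-1).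
Proof.
move=> x0; have := @is_derive1_powR R (1 / 3) x x0.
have -> : 1 / 3 * x `^ (1 / 3 - 1) = (3 * cbrt x ^+ 2)^-1 => //.
have -> : 1 / 3 - 1 = - (1 / 3 * 2%:R) :> R by field.
rewrite powRN powRrM powR_mulrn ?powR_ge0 // -/(cbrt x).
by field; rewrite gt_eqF // cbrt_gt0.
Qed.

Lemma eigenvalue_integrand (x : R) : 0 < x < 1 ->
  eigenvalue (cbrt x)%:C = (integrand x)%:C.
Proof.
move=> /andP[x0 x1]; rewrite /eigenvalue.
have -> : (cbrt x)%:C ^+ 3 = x%:C :> C by rewrite -rmorphXn /= cbrt_cube // ltW.
have -> : (cbrt x)%:C ^+ 2 = (x `^ (2 / 3))%:C :> C.
  rewrite -rmorphXn /= -powR_mulrn ?powR_ge0 // -powRrM.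
  by congr ((_ `^ _)%:C); field.
rewrite branch_real ?x1 ?(ltW x0) // /integrand invfM mulrC.
by rewrite [RHS]rmorphM /= !fmorphV mulrC.
Qed.

End Branch.

(** * Periods *)

Section ImproperIntegral.
Variable R : realType.
Local Notation mu := (@lebesgue_measure R).

(** The integrand may blow up at both endpoints: exhaust the interval by compact ones
    and pass to the limit by monotone convergence. *)
Lemma improper_FTC (f G : R -> R) (a b : R) : a < b ->
  (forall x : R, a < x < b -> 0 <= f x) ->
  (forall x : R, a < x < b -> is_derive x 1 G (f x)) ->
  (forall x : R, a < x < b -> {for x, continuous f}) ->
  G x @[x --> a^'+] --> G a -> G x @[x --> b^'-] --> G b ->
  (\int[mu]_(x in `[a, b]) f x)%R = G b - G a.
Proof.
move=> ab f0 dG cf Ga Gb; pose w := b - a; have w0 : 0 < w by rewrite subr_gt0.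
(* the compact exhaustion; the shift keeps [e n <= w / 3] *)
pose e n : R := w * harmonic n.+2; have e0 n : 0 < e n by rewrite mulr_gt0 // invr_gt0.
have e3 n : e n <= w / 3.
  rewrite /e ler_pM2l // /harmonic lef_pV2 ?posrE // ler_nat.
  by [].
pose c n := a + e n; pose d n := b - e n.
have cd n : c n < d n by have := e3 n; rewrite /c /d /w; have := e0 n; move: w0; rewrite /w; lra.
have e_cvg : e n @[n --> \oo] --> 0.
  rewrite -(mulr0 w); apply: cvgM; first exact: cvg_cst.
  have := @cvg_harmonic R; rewrite -(cvg_shiftn 2); under eq_fun do rewrite addn2.
  exact.
pose F n : set R := `[c n, d n]%classic.
have sub n x : F n x -> a < x < b.
  rewrite /F /= in_itv /= => /andP[x1 x2]; have := e0 n; move: x1 x2; rewrite /c /d.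
  by move=> x1 x2 en; apply/andP; split; lra.
have en_mono n m : (n <= m)%N -> e m <= e n.
  by move=> nm; rewrite /e ler_pM2l // /harmonic lef_pV2 ?posrE // ler_nat.
have ndF : nondecreasing_seq F.
  move=> n m nm; rewrite subsetEset => x; rewrite /F /= !in_itv /=.
  have := en_mono n m nm; rewrite /c /d => h /andP[x1 x2]; apply/andP; split; lra.
have mF n : measurable (F n) by exact: measurable_itv.
have cFx n : {within F n, continuous f}.
  apply: continuous_in_subspaceT => x /set_mem /sub; exact: cf.
have mf0 n : measurable_fun (F n) f by apply: subspace_continuous_measurable_fun.
have mf n : measurable_fun (F n) (fun x => (f x)%:E) by apply/measurable_EFinP.
have ge0 n x : F n x -> (0 <= (f x)%:E)%E by move=> /sub /f0; rewrite lee_fin.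
have cv := @ge0_nondecreasing_set_cvg_integral _ _ _ _ _ mu ndF mF mf ge0.
have int n : (\int[mu]_(x in F n) (f x)%:E = (G (d n) - G (c n))%:E)%E.
  rewrite (@continuous_FTC2 R f G) // ?EFinB //.
  - exact: cFx.
  - split.
    + move=> x; rewrite in_itv /= => /andP[x1 x2].
      have hx : a < x < b by apply: (sub n); rewrite /F /= in_itv /= (ltW x1) (ltW x2).
      by have h := dG x hx; apply: ex_derive.
    + have hx : a < c n < b by apply: (sub n); rewrite /F /= in_itv /= lexx ltW.
      have h := dG _ hx; apply: cvg_at_right_filter.
      by apply/differentiable_continuous/derivable1_diffP; apply: ex_derive.
    + have hx : a < d n < b by apply: (sub n); rewrite /F /= in_itv /= lexx ltW.
      have h := dG _ hx; apply: cvg_at_left_filter.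
      by apply/differentiable_continuous/derivable1_diffP; apply: ex_derive.
  - move=> x; rewrite in_itv /= => /andP[x1 x2].
    have hx : a < x < b by apply: (sub n); rewrite /F /= in_itv /= (ltW x1) (ltW x2).
    by have h := dG x hx; rewrite derive1E derive_val.
have cc : G (c n) @[n --> \oo] --> G a.
  move/cvg_at_rightP : Ga; apply; split; first by move=> n; rewrite /c ltrDl.
  have h : a + e n @[n --> \oo] --> a + 0 by apply: cvgD; [exact: cvg_cst|exact: e_cvg].
  by rewrite addr0 in h.
have cdn : G (d n) @[n --> \oo] --> G b.
  move/cvg_at_leftP : Gb; apply; split; first by move=> n; rewrite /d gtrBl.
  have h : b - e n @[n --> \oo] --> b - 0 by apply: cvgB; [exact: cvg_cst|exact: e_cvg].
  by rewrite subr0 in h.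
have cv2 : (\int[mu]_(x in F n) (f x)%:E)%E @[n --> \oo] --> (G b - G a)%:E.
  under eq_fun do rewrite int.
  by apply: cvg_EFin; [exact: nearW|exact: cvgB].
have U : \bigcup_n F n = `]a, b[%classic.
  apply/seteqP; split => x; first by move=> [n _ /sub]; rewrite /= in_itv.
  rewrite /= in_itv /= => /andP[x1 x2].
  have m0 : 0 < Num.min (x - a) (b - x) by rewrite lt_min !subr_gt0 x1.
  have /cvgrPdist_lt/(_ _ m0)[n _ hn] := e_cvg.
  exists n => //; have := hn n (leqnn n); rewrite sub0r normrN ger0_norm ?(ltW (e0 n)) // lt_min.
  by move=> /andP[h1 h2]; rewrite /F /= in_itv /= /c /d; apply/andP; split; lra.
have eI := cvg_unique _ cv cv2; rewrite U in eI.
have moo : measurable_fun `]a, b[ (fun x => (f x)%:E).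
  by rewrite -U; apply/measurable_fun_bigcup.
by rewrite /Rintegral (integral_itv_bndoo _ _ moo) eI.
Qed.

Lemma continuous_of_is_derive (G : R -> R) (b f : R) : is_derive b 1 G f ->
  {for b, continuous G}.
Proof.
by move=> h; apply/differentiable_continuous/derivable1_diffP; apply: ex_derive.
Qed.

Lemma improper_FTC_left (f G : R -> R) (a b : R) : a < b ->
  (forall x : R, a < x < b -> 0 <= f x) ->
  (forall x : R, a < x < b -> is_derive x 1 G (f x)) ->
  (forall x : R, a < x < b -> {for x, continuous f}) ->
  G x @[x --> a^'+] --> G a -> is_derive b 1 G (f b) ->
  (\int[mu]_(x in `[a, b]) f x)%R = G b - G a.
Proof.
move=> ab h1 h2 h3 h4 /continuous_of_is_derive h5.
exact: (improper_FTC ab h1 h2 h3 h4 (cvg_at_left_filter h5)).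
Qed.

Lemma improper_FTC_right (f G : R -> R) (a b : R) : a < b ->
  (forall x : R, a < x < b -> 0 <= f x) ->
  (forall x : R, a < x < b -> is_derive x 1 G (f x)) ->
  (forall x : R, a < x < b -> {for x, continuous f}) ->
  is_derive a 1 G (f a) -> G x @[x --> b^'-] --> G b ->
  (\int[mu]_(x in `[a, b]) f x)%R = G b - G a.
Proof.
move=> ab h1 h2 h3 /continuous_of_is_derive h4 h5.
exact: (improper_FTC ab h1 h2 h3 (cvg_at_right_filter h4) h5).
Qed.

End ImproperIntegral.

Section Periods.
Variable R : realType.
Local Notation C := R[i].
Local Notation mu := (@lebesgue_measure R).

(** The primitive of [integrand] that vanishes at [0], through the complex one, which
    links the periods to the transport along the loops. *)
Definition real_primitive (x : R) : R := complex.Re (primitive (cbrt x)%:C).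

Lemma cder_cbrt (x : R) : 0 < x ->
  cder (fun s : R => (cbrt s)%:C : C) x ((3 * cbrt x ^+ 2)^-1)%:C.
Proof. by move=> x0; apply: cder_real; exact: is_derive_cbrt. Qed.

Lemma real_primitive_derive (x : R) : 0 < x < 1 ->
  is_derive x 1 real_primitive (integrand x).
Proof.
move=> hx; have [n0 n1] := cbrt_disc hx; case/andP: (hx) => x0 x1.
have /cderP[h _] := primitive_cder (cder_cbrt x0) n0 n1; move: h.
have -> // : eigenvalue (cbrt x)%:C * (3 * (cbrt x)%:C ^+ 2 * ((3 * cbrt x ^+ 2)^-1)%:C) =
  (integrand x)%:C.
rewrite eigenvalue_integrand // -(rmorph_nat (real_complex R)) -rmorphXn -!rmorphM /=.
by rewrite mulfV ?mulr1 // mulf_neq0 // expf_neq0 // gt_eqF // cbrt_gt0.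
Qed.

Lemma integrand_continuous (x : R) : 0 < x < 1 -> {for x, continuous (@integrand R)}.
Proof.
move=> hx; have [n0 n1] := cbrt_disc hx; case/andP: (hx) => x0 x1.
have h := cder_clim (eigenvalue_cder (cder_cbrt x0) n0 n1).
have /climP[hr _] := h.
have e : \forall s \near x, complex.Re (eigenvalue (cbrt s)%:C) = integrand s.
  have o : \forall s \near x, s \in `]0, 1[ by apply: near_in_itvoo; rewrite in_itv.
  apply: filterS o => s hs; have {}hs : 0 < s < 1 by move: hs; rewrite in_itv.
  exact: (f_equal (@complex.Re R) (eigenvalue_integrand hs)).
have ex := nbhs_singleton e; rewrite /prop_for /continuous_at -ex.
apply: cvg_trans hr; apply: near_eq_cvg; by apply: filterS e => s ->.
Qed.

Lemma real_primitive0 : real_primitive 0 = 0.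
Proof. by rewrite /real_primitive /cbrt powR0 ?primitive0 // divf_neq0. Qed.

Lemma real_primitive_at0 : real_primitive x @[x --> 0^'+] --> real_primitive 0.
Proof.
have hc : clim (0^'+ : set_system R) (fun x => (cbrt x)%:C) (0%:C : C).
  by apply: clim_real; apply: powR_cvg0; rewrite divr_gt0.
have h0 : cmod (0 : C) < 1 by rewrite cmod0.
have hp : clim (0^'+ : set_system R) (fun x => primitive (cbrt x)%:C) (primitive 0 : C).
  exact: clim_comp hc (wder_clim (wder_primitive h0)).
have /climP[h _] := hp.
by rewrite real_primitive0; move: h; rewrite primitive0.
Qed.

Lemma integrand_ge0 (x : R) : 0 <= integrand x.
Proof. by rewrite /integrand invr_ge0 mulr_ge0 ?powR_ge0. Qed.

Lemma integral_left (b : R) : 0 < b < 1 ->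
  (\int[mu]_(t in `[0%R, b]) integrand t)%R = real_primitive b.
Proof.
move=> /andP[b0 b1].
have in01 x : 0 < x < b -> 0 < x < 1 by move=> /andP[-> /lt_trans ->].
have h1 (x : R) : 0 < x < b -> 0 <= integrand x by move=> _; exact: integrand_ge0.
have h2 (x : R) : 0 < x < b -> is_derive x 1 real_primitive (integrand x).
  by move=> /in01; exact: real_primitive_derive.
have h3 (x : R) : 0 < x < b -> {for x, continuous (@integrand R)}.
  by move=> /in01; exact: integrand_continuous.
have hb : 0 < b < 1 by rewrite b0.
rewrite (improper_FTC_left b0 h1 h2 h3 real_primitive_at0 (real_primitive_derive hb)).
by rewrite real_primitive0 subr0.
Qed.

Lemma integrand_sym (x : R) : integrand (1 - x) = integrand x.
Proof. by rewrite /integrand subKr mulrC. Qed.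

Lemma integral_right (b : R) : 0 < b < 1 ->
  (\int[mu]_(t in `[b, 1%R]) integrand t)%R = real_primitive (1 - b).
Proof.
move=> /andP[b0 b1].
have in01 x : b < x < 1 -> 0 < x < 1 by move=> /andP[/(lt_trans b0) -> ->].
have flip (x : R) : 0 < x < 1 -> is_derive x 1 (fun s => - real_primitive (1 - s)) (integrand x).
  move=> /andP[x0 x1]; have hx : 0 < 1 - x < 1 by rewrite subr_gt0 x1 gtrBl.
  have h1 : is_derive x 1 (fun s : R => 1 - s) (0 - 1).
    by apply: is_deriveB.
  have := @is_derive1_comp R real_primitive (fun s : R => 1 - s) x _ _ (real_primitive_derive hx) h1.
  move=> h2; have := is_deriveN h2.
  by rewrite sub0r mulrN1 opprK integrand_sym.
pose G (s : R) := - real_primitive (1 - s).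
have h1 (x : R) : b < x < 1 -> 0 <= integrand x by move=> _; exact: integrand_ge0.
have h2 (x : R) : b < x < 1 -> is_derive x 1 G (integrand x).
  by move=> /in01; exact: flip.
have h3 (x : R) : b < x < 1 -> {for x, continuous (@integrand R)}.
  by move=> /in01; exact: integrand_continuous.
have hb : 0 < b < 1 by rewrite b0.
have h5 : G x @[x --> 1^'-] --> G 1.
  apply/cvg_at_leftP => u [u1 uc]; rewrite /G subrr; apply: cvgN.
  have /cvg_at_rightP h := real_primitive_at0; apply: (h (fun n => 1 - u n)); split.
    by move=> n; rewrite subr_gt0.
  have hc : 1 - u n @[n --> \oo] --> (1 - 1 : R) by apply: cvgB; [exact: cvg_cst|exact: uc].
  by rewrite subrr in hc.
have e := improper_FTC_right b1 h1 h2 h3 (flip b hb) h5.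
rewrite e /G (subrr (1 : R)) real_primitive0.
by move: (real_primitive _) => y; rewrite oppr0 sub0r opprK.
Qed.

Lemma real_primitive_gt0 (b : R) : 0 < b < 1 -> 0 < real_primitive b.
Proof.
move=> hb; case/andP: (hb) => b0 b1.
have hb2 : 0 < b / 2 < 1 by apply/andP; split; lra.
have h0 : 0 <= real_primitive (b / 2).
  by rewrite -integral_left //; apply: Rintegral_ge0 => x _; exact: integrand_ge0.
have [|||x hx e] := @MVT R real_primitive (@integrand R) (b / 2) b.
- lra.
- move=> x; rewrite in_itv /= => /andP[x0 x1]; apply: real_primitive_derive.
  by apply/andP; split; lra.
- apply: derivable_within_continuous => x; rewrite in_itv /= => /andP[x0 x1].
  have h : is_derive x 1 real_primitive (integrand x).
    by apply: real_primitive_derive; apply/andP; split; lra.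
  exact: ex_derive.
have ip : 0 < integrand x.
  move: hx; rewrite in_itv /= => /andP[x0 x1].
  have y0 : 0 < x by move: b0 x0; clear; lra.
  have y1 : 0 < 1 - x by move: b1 x1; clear; lra.
  by rewrite /integrand invr_gt0 mulr_gt0 // powR_gt0.
have d0 : 0 < b - b / 2 by move: b0; clear; lra.
have := mulr_gt0 ip d0; rewrite -e; move: h0; move: (real_primitive _) (real_primitive _).
by clear => y z; lra.
Qed.

(** The length of [0, 1/2] in the flat metric [|q|^(2/3)]; by symmetry that of [1/2, 1]. *)
Definition half_period : R := real_primitive (1 / 2).

Lemma half_in01 : 0 < (1 / 2 : R) < 1.
Proof. by apply/andP; split; lra. Qed.

Lemma half_period_gt0 : 0 < half_period.
Proof. exact: real_primitive_gt0 half_in01. Qed.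

Lemma primitive_half : primitive (cbrt (1 / 2))%:C = half_period%:C.
Proof.
apply: conj_fixed_real; apply: primitive_real.
by have /andP[h0 h1] := half_in01; rewrite powR_ge0 cbrt_lt1 // ltW.
Qed.

Lemma period0E : period0 = 2 * (eps - 1) * half_period%:C :> C.
Proof. by rewrite /period0 integral_left ?half_in01. Qed.

Lemma period1E : period1 = - (2 * (eps - 1) * half_period%:C) :> C.
Proof.
rewrite /period1 integral_right ?half_in01 //.
have -> : 1 - 1 / 2 = 1 / 2 :> R by field.
by rewrite rmorphN mulrN.
Qed.

End Periods.

(** * Cube roots of unity *)

Section RootsOfUnity.
Variable R : realType.
Local Notation C := R[i].
Local Notation s3 := (Num.sqrt 3 : R).

Lemma sqrt3_sq : s3 ^+ 2 = 3.
Proof. by rewrite sqr_sqrtr. Qed.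

Lemma sqrt3_gt0 : 0 < s3.
Proof. by rewrite sqrtr_gt0. Qed.

Lemma angle_pi6 : cos (pi / 6 : R) = s3 / 2 /\ sin (pi / 6 : R) = 1 / 2.
Proof.
have p0 := pi_gt0 R.
have c0 : 0 < cos (pi / 6 : R).
  by apply: cos_gt0_pihalf; apply/andP; split; move: p0; clear; lra.
have n0 : 0 < sin (pi / 6 : R).
  by apply: sin_gt0_pi; apply/andP; split; move: p0; clear; lra.
have h : cis (pi / 6 : R) ^+ 3 = 'i%C.
  rewrite cisX; have -> : 3%:R * (pi / 6) = pi / 2 :> R by field.
  by rewrite /cis cos_pihalf sin_pihalf.
have e1 := cos2Dsin2 (pi / 6 : R).
move: h e1 c0 n0; rewrite /cis; move: (cos _) (sin _) => c n h e1 c0 n0.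
have := f_equal (@complex.Re R) h; rewrite /= => h1.
have h2 : c * (c ^+ 2 - 3 * n ^+ 2) = 0 by rewrite -[RHS]h1; ring.
have h3 : c ^+ 2 = 3 * n ^+ 2.
  by move/eqP: h2; rewrite mulf_eq0 gt_eqF //= subr_eq0 => /eqP.
have n2 : n ^+ 2 = (1 / 2) ^+ 2 by move: e1 h3; clear; lra.
have en : n = 1 / 2.
  by apply/eqP; rewrite -(@eqrXn2 _ 2) ?divr_ge0 ?(ltW n0) //; apply/eqP.
split=> //; apply/eqP; rewrite -(@eqrXn2 _ 2) ?divr_ge0 ?sqrtr_ge0 ?(ltW c0) //.
by apply/eqP; rewrite h3 n2 [RHS]expr_div_n sqrt3_sq; field.
Qed.

Lemma cis_pi6 : cis (pi / 6) = (s3 / 2) +i* (1 / 2) :> C.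
Proof. by rewrite /cis; have [-> ->] := angle_pi6. Qed.

Lemma epsE : eps = (- (1 / 2)) +i* (s3 / 2) :> C.
Proof.
rewrite /eps; have -> : 2 * pi / 3 = 4%:R * (pi / 6) :> R by field.
have e := sqrt3_sq.
rewrite -cisX cis_pi6 -[4%N]/(2 * 2)%N exprM.
have -> : ((s3 / 2) +i* (1 / 2)) ^+ 2 = (1 / 2) +i* (s3 / 2) :> C.
  by apply: complex_eqP => /=; [move: e; rewrite !expr2; nra|field].
by apply: complex_eqP => /=; [move: e; rewrite !expr2; nra|field].
Qed.

Lemma eps_sum : 1 + eps + eps ^+ 2 = 0 :> C.
Proof.
have e := sqrt3_sq; rewrite epsE.
by apply: complex_eqP => /=; [move: e; rewrite !expr2; nra|field].
Qed.

Lemma eps_cube : eps ^+ 3 = 1 :> C.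
Proof.
apply/eqP; rewrite -subr_eq0; apply/eqP.
have -> : eps ^+ 3 - 1 = (eps - 1) * (1 + eps + eps ^+ 2) :> C by ring.
by rewrite eps_sum mulr0.
Qed.

Lemma eps_neq1 : eps != 1 :> C.
Proof.
rewrite epsE; apply/eqP => /(f_equal (@complex.Re R)) /=; lra.
Qed.

Lemma eps_sub1 : eps - 1 = s3%:C * cis (5 * pi / 6) :> C.
Proof.
have -> : 5 * pi / 6 = 4%:R * (pi / 6) + pi / 6 :> R by field.
rewrite cisD -cisX -{1}[4%N]/(2 * 2)%N.
have e := sqrt3_sq.
have h : cis (pi / 6) ^+ (2 * 2) = eps :> C.
  by rewrite cisX /eps; congr cis; field.
rewrite h cis_pi6 epsE; apply: complex_eqP => /=.
  by move: e; rewrite !expr2; nra.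
have q : s3 / 2 * (s3 / 2) = 3 / 4 by rewrite -[3 in RHS]e; field.
by rewrite q; field.
Qed.

End RootsOfUnity.

(** * Endomorphisms that permute an eigenbasis cyclically *)
Section Eigenbasis.
Variables (F : fieldType) (n : nat).
Implicit Types (K V M : 'M[F]_n) (f : 'I_n -> F) (y : 'cV[F]_n).

Lemma mul_col_sum V y : V *m y = \sum_k y k 0 *: col k V.
Proof.
by apply/colP => i; rewrite mxE summxE; apply: eq_bigr => k _; rewrite !mxE mulrC.
Qed.

Lemma unitmx_kernel V : (forall y, V *m y = 0 -> y = 0) -> V \in unitmx.
Proof.
move=> h; rewrite unitmxE unitfE -det_tr; apply/negP => /det0P[v v0 e].
case/negP: v0; apply/eqP/trmx_inj; rewrite trmx0; apply: h.
by rewrite -[LHS]trmxK trmx_mul trmxK e trmx0.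
Qed.

Lemma mul_eigenbasis V M f : (forall k, M *m col k V = f k *: col k V) ->
  M *m V = V *m diag_mx (\row_k f k).
Proof.
move=> h; apply/matrixP => i k; have := f_equal (fun u : 'cV_n => u i 0) (h k).
have -> : M *m col k V = col k (M *m V) by rewrite !colE mulmxA.
rewrite [in LHS]mxE => ->; rewrite [RHS]mxE (bigD1 k) //= big1 => [|j jk]; last first.
  by rewrite !mxE (negbTE jk) mulr0n mulr0.
by rewrite !mxE eqxx mulr1n addr0 mulrC.
Qed.

Lemma trace_eigenbasis V M f : V \in unitmx ->
  (forall k, M *m col k V = f k *: col k V) -> \tr M = \sum_k f k.
Proof.
move=> uV /mul_eigenbasis e.
have -> : M = V *m diag_mx (\row_k f k) *m invmx V by rewrite -e mulmxK.
by rewrite mxtrace_mulC mulKmx // mxtrace_diag; apply: eq_bigr => k _; rewrite mxE.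
Qed.

Lemma unitmx_eigenbasis V M f : V \in unitmx ->
  (forall k, M *m col k V = f k *: col k V) -> (forall k, f k != 0) -> M \in unitmx.
Proof.
move=> uV /mul_eigenbasis e f0; have : M *m V \in unitmx.
  rewrite e unitmx_mul uV /= unitmxE det_diag unitfE.
  by apply/prodf_neq0 => k _; rewrite mxE.
by rewrite unitmx_mul => /andP[].
Qed.

Lemma eigenline_1dim K V f w j : V \in unitmx -> injective f ->
  (forall k, K *m col k V = f k *: col k V) ->
  K *m w = f j *: w -> exists c, w = c *: col j V.
Proof.
move=> uV fI h hw; pose y := invmx V *m w.
have ew : w = \sum_k y k 0 *: col k V by rewrite -mul_col_sum mulKVmx.
have e : V *m (\col_k ((f k - f j) * y k 0)) = 0.
  rewrite mul_col_sum; under eq_bigr do rewrite mxE mulrBl scalerBl mulrC -!scalerA -h.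
  rewrite sumrB; apply/eqP; rewrite subr_eq0; apply/eqP.
  under [RHS]eq_bigr do rewrite scalerA mulrC.
  under [RHS]eq_bigr do rewrite mulrC -scalerA.
  rewrite -scaler_sumr -ew -hw [in RHS]ew mulmx_sumr.
  by apply: eq_bigr => k _; rewrite scalemxAr.
have e0 : (\col_k ((f k - f j) * y k 0)) = 0 by rewrite -(mulKmx uV (\col__ _)) e mulmx0.
exists (y j 0); rewrite {1}ew (bigD1 j) //= big1 ?addr0 // => k kj.
have := f_equal (fun u : 'cV_n => u k 0) e0; rewrite !mxE => /eqP.
rewrite mulf_eq0 subr_eq0 (inj_eq fI) (negbTE kj) /= => /eqP ->.
by rewrite scale0r.
Qed.

End Eigenbasis.

Section CyclicMonodromy.
Variable F : fieldType.
Variables (V T0 T1 : 'M[F]_3) (c d : 'I_3 -> F).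
Hypotheses (uV : V \in unitmx)
  (hc : forall k, T0 *m col k V = c k *: col (k + 1) V)
  (hd : forall k, T1 *m col k V = d k *: col (k + 1) V)
  (c0 : forall k, c k != 0) (d0 : forall k, d k != 0).

Lemma cyclic_unit (T : 'M[F]_3) (a : 'I_3 -> F) :
  (forall k, T *m col k V = a k *: col (k + 1) V) -> (forall k, a k != 0) ->
  T \in unitmx.
Proof.
move=> h a0; suff : T *m T *m T \in unitmx by rewrite !unitmx_mul => /andP[].
apply: (@unitmx_eigenbasis _ _ V _ (fun k => a k * a (k + 1) * a (k + 1 + 1))) => // k.
  rewrite -!mulmxA h -scalemxAr -scalemxAr h -scalemxAr h !scalerA.
  by congr (_ *: col _ V); apply: val_inj; case: k => [[|[|[|]]]].
by rewrite !mulf_neq0.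
Qed.

Let u0 : T0 \in unitmx := cyclic_unit hc c0.
Let u1 : T1 \in unitmx := cyclic_unit hd d0.

Lemma inv_cyclic (T : 'M[F]_3) (a : 'I_3 -> F) k : T \in unitmx ->
  T *m col k V = a k *: col (k + 1) V -> a k != 0 ->
  invmx T *m col (k + 1) V = (a k)^-1 *: col k V.
Proof.
move=> uT h ak; apply: (can_inj (mulKmx uT)).
by rewrite mulKVmx // -scalemxAr h scalerA mulVf // scale1r.
Qed.

(** In the basis [col k V] all the products whose traces are taken are diagonal. *)
Lemma trace_X : \tr (invmx T0 *m invmx (invmx T1)) = \sum_k d k / c k.
Proof.
apply: (trace_eigenbasis uV) => k.
by rewrite invmxK -mulmxA hd -scalemxAr (inv_cyclic u0 (hc k)) // scalerA.
Qed.

Lemma trace_Y : \tr (invmx (invmx T0) *m invmx T1) = \sum_k c k / d k.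
Proof.
rewrite mxtrace_mulC; apply: (trace_eigenbasis uV) => k.
by rewrite invmxK -mulmxA hc -scalemxAr (inv_cyclic u1 (hd k)) // scalerA.
Qed.

Lemma trace_Z :
  \tr (invmx T0 *m invmx T1 *m invmx (invmx T0) *m invmx (invmx T1)) =
  \sum_k d k * c (k + 1) / d (k + 1) / c k.
Proof.
apply: (trace_eigenbasis uV) => k.
rewrite !invmxK -!mulmxA hd -scalemxAr hc -!scalemxAr (inv_cyclic u1 (hd _)) //.
by rewrite -!scalemxAr (inv_cyclic u0 (hc k)) // !scalerA.
Qed.

End CyclicMonodromy.

Section CyclicEigenbasis.
Variable R : realType.
Local Notation C := R[i].

Lemma eps_shift (k : 'I_3) : eps ^+ (k + 1)%R = eps * eps ^+ k :> C.
Proof.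
by case: k => [[|[|[|//]]] i] /=; rewrite -exprS // eps_cube.
Qed.

Lemma eps_pow_cube n : (eps ^+ n) ^+ 3 = 1 :> C.
Proof. by rewrite -exprM mulnC exprM eps_cube expr1n. Qed.

Lemma eps_pow_inj : injective (fun k : 'I_3 => eps ^+ k : C).
Proof.
have n0 : eps != 0 :> C by exact: cis_neq0.
have n1 := eps_neq1 R.
have n2 : eps ^+ 2 != 1 :> C.
  apply: contraNneq n1 => e; have := eps_cube R; by rewrite exprS e mulr1 => ->.
have n3 : eps ^+ 2 != eps :> C.
  apply: contraNneq n1 => e; apply/eqP/(mulfI n0); by rewrite mulr1 -expr2.
move=> [i hi] [j hj] /= h; apply: val_inj => /=; apply/eqP; move: h => /eqP.
case: i hi => [|[|[|//]]] _; case: j hj => [|[|[|//]]] _ //; rewrite ?expr0 ?expr1.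
- by rewrite eq_sym (negbTE n1).
- by rewrite eq_sym (negbTE n2).
- by rewrite (negbTE n1).
- by rewrite eq_sym (negbTE n3).
- by rewrite (negbTE n2).
- by rewrite (negbTE n3).
Qed.

(** The three cube roots of [l^3] are all eigenvalues of [K], with multiplicity
    one: the spectral projection [(K^2 + m K + m^2) / (3 m^2)] for a root [m] has
    trace [1]. *)
Lemma cyclic_eigenbasis (K : 'M[C]_3) (l : C) : l != 0 ->
  K *m K *m K = (l ^+ 3)%:M -> \tr K = 0 -> \tr (K *m K) = 0 ->
  exists2 V, V \in unitmx & forall k, K *m col k V = (eps ^+ k * l) *: col k V.
Proof.
move=> l0 K3 t1 t2; pose m (k : 'I_3) : C := eps ^+ k * l.
have m0 k : m k != 0 by rewrite mulf_neq0 // expf_neq0 // cis_neq0.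
have m3 k : m k ^+ 3 = l ^+ 3 by rewrite exprMn eps_pow_cube mul1r.
have three : 3 != 0 :> C by rewrite pnatr_eq0.
have ex k : exists v : 'cV[C]_3, v != 0 /\ K *m v = m k *: v.
  pose P := K *m K + m k *: K + (m k ^+ 2)%:M.
  have KP : K *m P = m k *: P.
    rewrite /P !mulmxDr !scalerDr mulmxA K3 -scalemxAr scalerA mul_mx_scalar.
    rewrite scale_scalar_mx -expr2 -exprS m3 addrC addrA addrAC.
    by congr (_ + _); rewrite addrC.
  have P0 : P != 0.
    apply/eqP => e; have : \tr P = 0 by rewrite e mxtrace0.
    rewrite /P !mxtraceD mxtraceZ t1 t2 mulr0 !add0r mxtrace_scalar => /eqP.
    by rewrite mulrn_eq0 /= expf_eq0 (negbTE (m0 k)).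
  have [j vj] : exists j, col j P != 0.
    apply/existsP; move: P0; apply: contraNT; rewrite negb_exists => /forallP h.
    apply/eqP/matrixP => a b; have := h b; rewrite negbK => /eqP/colP/(_ a).
    by rewrite !mxE.
  by exists (col j P); split=> //; rewrite !colE mulmxA KP -scalemxAl.
have [v hv] := choice ex.
pose V := \matrix_(i, k) v k i 0.
have cV k : col k V = v k by apply/colP => i; rewrite !mxE.
exists V; last by move=> k; rewrite cV; have [] := hv k.
apply: unitmx_kernel => y; rewrite mul_col_sum => e0.
have e1 : \sum_k (y k 0 * m k) *: v k = 0.
  transitivity (K *m \sum_k y k 0 *: col k V); last by rewrite e0 mulmx0.
  rewrite mulmx_sumr; apply: eq_bigr => k _.
  by rewrite cV -scalemxAr (hv k).2 scalerA.
have e2 : \sum_k (y k 0 * m k * m k) *: v k = 0.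
  transitivity (K *m \sum_k (y k 0 * m k) *: v k); last by rewrite e1 mulmx0.
  rewrite mulmx_sumr; apply: eq_bigr => k _.
  by rewrite -scalemxAr (hv k).2 scalerA.
apply/colP => j; rewrite mxE.
have : (3 * m j ^+ 2 * y j 0) *: v j = 0.
  have <- : \sum_k (y k 0 * (m k ^+ 2 + m j * m k + m j ^+ 2)) *: v k = 0.
    transitivity (\sum_k (y k 0 * m k * m k) *: v k +
      m j *: (\sum_k (y k 0 * m k) *: v k) + m j ^+ 2 *: (\sum_k y k 0 *: col k V)).
      rewrite !scaler_sumr -!big_split; apply: eq_bigr => k _ /=.
      rewrite cV !scalerA -[X in _ = X + _]scalerDl -[RHS]scalerDl; congr (_ *: _).
      by move: (y k 0) (m k) (m j) => p q u; ring.
    by rewrite e0 e1 e2 !scaler0 !addr0.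
  rewrite (bigD1 j) //= big1 ?addr0; first by congr (_ *: _); ring.
  move=> k kj; have d0 : m k - m j != 0.
    rewrite subr_eq0 /m (inj_eq (mulIf l0)); apply: contraNneq kj => /eps_pow_inj ->.
    by rewrite eqxx.
  suff -> : m k ^+ 2 + m j * m k + m j ^+ 2 = 0 by rewrite mulr0 scale0r.
  apply/(mulfI d0); rewrite mulr0.
  have -> : (m k - m j) * (m k ^+ 2 + m j * m k + m j ^+ 2) = m k ^+ 3 - m j ^+ 3 by ring.
  by rewrite !m3 subrr.
have c0 : 3 * m j ^+ 2 != 0 by rewrite mulf_neq0 // expf_neq0.
by move=> /eqP; rewrite scaler_eq0 (negbTE (hv j).1) orbF mulf_eq0 (negbTE c0) => /eqP.
Qed.

End CyclicEigenbasis.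

(** * Transport around the branch points *)

Section Paths.
Variable R : realType.
Local Notation C := R[i].
Implicit Types (c s y : C) (m : R).

(** The two parametrizations [c + s y] of the line by the distance [y] from one of
    the branch points [0] and [1]; the cubic differential is the same in both. *)
Definition chart01 (c s : C) := (c = 0 /\ s = 1) \/ (c = 1 /\ s = -1).

Lemma chart01_dlog c s y : chart01 c s -> dlog_cubic (c + s * y) * s = dlog_cubic y.
Proof.
case=> [[-> ->]|[-> ->]]; first by rewrite add0r mul1r mulr1.
rewrite /dlog_cubic !mulN1r; have -> : 1 - y - 1 = - y by ring.
have -> : 1 - y = - (y - 1) by ring.
by rewrite mulrN1 !invrN; ring.
Qed.

Lemma chart01_away c s y m : chart01 c s -> m <= cmod y -> cmod y <= 1 - m ->
  m <= cmod (c + s * y) /\ m <= cmod (c + s * y - 1).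
Proof.
move=> cs m1 m2; have h : m <= cmod (1 - y).
  by have := cmodD (1 - y) y; rewrite subrK cmod1; move: m2; clear; lra.
case: cs => [[-> ->]|[-> ->]].
  by rewrite add0r mul1r [cmod (y - 1)]cmodB.
rewrite mulN1r; split=> //.
have -> : 1 - y - 1 = - y by ring.
by rewrite cmodN.
Qed.

Lemma cube_disc (z : C) m : 0 < m -> m <= cmod z ^+ 3 <= 1 - m ->
  z != 0 /\ cmod z < 1.
Proof.
move=> m0 /andP[h1 h2]; split.
  rewrite -cmod_gt0 lt0r cmod_ge0 andbT; apply: contraTneq h1 => ->.
  by rewrite expr0n /= -ltNge.
rewrite ltNge; apply/negP => /(exprn_ege1 3) h3; move: m0 h2 h3; clear; lra.
Qed.

Lemma segment_derive (u v : C) t : cder (segment u v) t (v - u).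
Proof.
have h1 := cder_real (is_derive_id t 1).
have := cderD (cder_cst u t) (cderM h1 (cder_cst (v - u) t)).
by rewrite rmorph1 mul1r mulr0 addr0 add0r.
Qed.

Lemma segment0 (u v : C) : segment u v 0 = u.
Proof. by rewrite /segment mul0r addr0. Qed.

Lemma segment1 (u v : C) : segment u v 1 = v.
Proof. by rewrite /segment mul1r addrC subrK. Qed.

Lemma between (a b t : R) : 0 <= t <= 1 ->
  Num.min a b <= a + t * (b - a) <= Num.max a b.
Proof.
move=> /andP[t0 t1]; have s0 : 0 <= 1 - t by rewrite subr_ge0.
have -> : a + t * (b - a) = (1 - t) * a + t * b by ring.
have ea (x : R) : x = (1 - t) * x + t * x by ring.
rewrite [in X in X && _](ea (Num.min a b)) [in X in _ && X](ea (Num.max a b)).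
by rewrite !lerD ?ler_wpM2l ?ge_min ?le_max ?lexx ?orbT.
Qed.

Definition radial (a b t : R) : C := (cbrt (a + t * (b - a)))%:C.

Lemma radial_path c s (a b : R) : 0 < a < 1 -> 0 < b < 1 ->
  exists2 m, 0 < m & forall t : R, 0 <= t <= 1 ->
    [/\ segment (c + s * a%:C) (c + s * b%:C) t = c + s * radial a b t ^+ 3,
        c + s * b%:C - (c + s * a%:C) = s * (3 * radial a b t ^+ 2 *
          (((3 * cbrt (a + t * (b - a)) ^+ 2)^-1)%:C * (b - a)%:C)),
        cder (radial a b) t (((3 * cbrt (a + t * (b - a)) ^+ 2)^-1)%:C * (b - a)%:C)
      & m <= cmod (radial a b t) ^+ 3 <= 1 - m].
Proof.
move=> ha hb; pose m := Num.min (Num.min a b) (1 - Num.max a b).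
have m0 : 0 < m.
  rewrite !lt_min subr_gt0 gt_max.
  by case/andP: ha => -> ->; case/andP: hb => -> ->.
exists m => // t ht; have /andP[h1 h2] := between a b ht.
have y0 : 0 < a + t * (b - a).
  by apply: lt_le_trans h1; rewrite lt_min; case/andP: ha => -> _; case/andP: hb => ->.
have k0 : cbrt (a + t * (b - a)) != 0 by rewrite gt_eqF // cbrt_gt0.
split.
- rewrite /segment /radial -rmorphXn /= cbrt_cube ?(ltW y0) // rmorphD rmorphM rmorphB /=; ring.
- have -> : c + s * b%:C - (c + s * a%:C) = s * (b - a)%:C by rewrite rmorphB /=; ring.
  congr (s * _); rewrite mulrA /radial -(rmorph_nat (real_complex R)) -rmorphXn -!rmorphM /=.
  by congr (_%:C); field.
- have h : is_derive t 1 (fun t : R => a + t * (b - a)) (b - a).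
    have := is_deriveD (is_derive_cst a t 1) (is_deriveM (is_derive_id t 1) (is_derive_cst (b - a) t 1)).
    by rewrite scaler0 add0r add0r; congr is_derive; rewrite /GRing.scale /= mulr1.
  have := @is_derive1_comp R (@cbrt R) (fun t : R => a + t * (b - a)) t _ _ (is_derive_cbrt y0) h.
  by move=> /cder_real; rewrite rmorphM.
- rewrite /radial cmodR ger0_norm ?powR_ge0 // cbrt_cube ?(ltW y0) //.
  apply/andP; split; first by apply: le_trans h1; rewrite ge_min lexx.
  apply: le_trans h2 _; have : m <= 1 - Num.max a b by rewrite ge_min lexx orbT.
  by move: (Num.max a b) => x; clear; lra.
Qed.

(** The coordinate [zeta] along a small circle turns by a third of a turn. *)
Definition third_turn (r t : R) : C := (cbrt r)%:C * cis (2 * pi / 3 * t).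

Definition third_speed (r t : R) : C :=
  (cbrt r)%:C * ((2 * pi / 3)%:C * 'i%C * cis (2 * pi / 3 * t)).

Lemma third_turn_path c s (r : R) : 0 < r < 1 ->
  exists2 m, 0 < m & forall t : R,
    [/\ circle c (c + s * r%:C) t = c + s * third_turn r t ^+ 3,
        cder (circle c (c + s * r%:C)) t (s * (3 * third_turn r t ^+ 2 * third_speed r t)),
        cder (third_turn r) t (third_speed r t),
        cmod (s * (3 * third_turn r t ^+ 2 * third_speed r t)) =
          cmod s * (3 * cbrt r ^+ 3 * (2 * pi / 3))
      & m <= cmod (third_turn r t) ^+ 3 <= 1 - m].
Proof.
move=> hr; case/andP: (hr) => r0 r1.
have q0 : 0 <= cbrt r by exact: powR_ge0.
have q3 : cbrt r ^+ 3 = r by rewrite cbrt_cube // ltW.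
have mt t : cmod (third_turn r t) = cbrt r.
  by rewrite /third_turn cmodM cmod_cis mulr1 cmodR ger0_norm.
have m0 : 0 < Num.min r (1 - r) by rewrite lt_min r0 subr_gt0.
exists (Num.min r (1 - r)) => // t.
have d3 : cder (third_turn r) t (third_speed r t).
  by have := cderM (cder_cst (cbrt r)%:C t) (cder_cis (2 * pi / 3) t); rewrite mul0r add0r.
have eC u : circle c (c + s * r%:C) u = c + s * third_turn r u ^+ 3.
  rewrite /circle /third_turn exprMn -rmorphXn /= q3 cisX.
  have -> : 3%:R * (2 * pi / 3 * u) = 2 * pi * u by field.
  by ring.
split=> //.
- have := cderD (cder_cst c t) (cderM (cder_cst s t) (wder_comp_curve (wder_cube _) d3)).
  rewrite !mul0r !add0r addr0 => h.
  have -> // : circle c (c + s * r%:C) = (fun u => c + s * third_turn r u ^+ 3).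
  by apply/funext => u; exact: eC.
- rewrite 2!cmodM [cmod (3 * _)]cmodM cmodX mt /third_speed !cmodM !cmodR cmod_cis (ger0_norm q0).
  have pi0 : 0 <= 2 * pi / 3 :> R by rewrite divr_ge0 // mulr_ge0 // pi_ge0.
  rewrite (ger0_norm pi0).
  have -> : cmod (3 : C) = 3 by rewrite -(rmorph_nat (real_complex R)) cmodR ger0_norm.
  have -> : cmod ('i%C : C) = 1 by rewrite cmodE /= expr0n expr1n add0r sqrtr1.
  ring.
- rewrite mt q3 ge_min lexx /=.
  have : Num.min r (1 - r) <= 1 - r by rewrite ge_min lexx orbT.
  by move: (Num.min _ _) => x; clear; lra.
Qed.

Lemma third_turn0 (r : R) : third_turn r 0 = (cbrt r)%:C.
Proof. by rewrite /third_turn mulr0 cis0 mulr1. Qed.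

Lemma third_turn1 (r : R) : third_turn r 1 = eps * (cbrt r)%:C.
Proof. by rewrite /third_turn mulr1 mulrC. Qed.

Lemma circle0 (c e : C) : circle c e 0 = e.
Proof. by rewrite /circle mulr0 cis0 mulr1 addrC subrK. Qed.

Lemma circle1 (c e : C) : circle c e 1 = e.
Proof.
have h : cis (2 * pi) = 1 :> C.
  by rewrite /cis -[2 * pi]/(2%:R * pi) mulr_natl cos2pi sin2pi.
by rewrite /circle mulr1 h mulr1 addrC subrK.
Qed.

(** After a full turn of [z] the branch of the eigenvalue has changed by [eps]. *)
Lemma eigenvalue_rotation (z : C) : eigenvalue (eps * z) = eps * eigenvalue z.
Proof.
rewrite /eigenvalue !exprMn eps_cube mul1r invfM.
have -> : eps ^- 2 = eps :> C.
  have n0 : eps != 0 :> C by exact: cis_neq0.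
  by apply: (mulfI (expf_neq0 2 n0)); rewrite mulfV ?expf_neq0 // -exprSr eps_cube.
ring.
Qed.

(** The increments of the primitive along the way in, the circle and the way back add up
    to [(eps - 1) h]; the radius of the circle drops out. *)
Lemma loop_exponent (q : R) (tau s om x h : C) :
  q * expR (-4 * complex.Re (tau * (s * om * x - s * om * h))) *
    expR (-4 * complex.Re (tau * (s * om * (eps * x) - s * om * x))) *
    expR (-4 * complex.Re (tau * (s * (om * eps) * h - s * (om * eps) * x))) =
  q * expR (-2 * complex.Re (tau * (om * (s * (2 * (eps - 1) * h))))).
Proof.
rewrite -mulrA -mulrA -!expRD -!mulrDr -!cReD -!mulrDr; congr (_ * expR _).
have -> : -4 = -2 * 2 :> R by ring.
have d (z : C) : 2 * complex.Re z = complex.Re (2 * z) by case: z => a b /=; ring.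
by rewrite -[LHS]mulrA d; congr (_ * complex.Re _); ring.
Qed.

End Paths.

Section LoopTransport.
Variable R : realType.
Local Notation C := R[i].
Variable E : higgs R.
Hypothesis E_par : strongly_parabolic E.
Hypothesis E_det : forall z : C, z != 0 -> z != 1 ->
  \det (Theta0 E z) = (z ^+ 2 * (z - 1) ^+ 2)^-1.
Variables (tau : C) (H : C -> 'M[C]_3).
Hypotheses (tau0 : tau != 0) (H_harm : harmonic_metric E tau H).
Local Notation T := (Theta0 E).
Local Notation omega := (conn_form E tau H).
Implicit Types (c s om : C) (v : 'cV[C]_3) (S : 'M[C]_3).

(** Transport of an eigenvector of [theta] along a path lifted to the coordinate
    [zeta], in which the branches of the eigenvalue are single-valued. *)
Lemma transport_lift c s om (p p1 zeta d : R -> C) (m M : R) S v :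
  chart01 c s -> om ^+ 3 = 1 -> 0 < m ->
  (forall t : R, cder p t (p1 t)) -> (forall t : R, cmod (p1 t) <= M) ->
  (forall t : R, 0 <= t <= 1 ->
    [/\ p t = c + s * zeta t ^+ 3, p1 t = s * (3 * zeta t ^+ 2 * d t),
        cder zeta t (d t) & m <= cmod (zeta t) ^+ 3 <= 1 - m]) ->
  is_transport omega p S ->
  T (p 0) *m v = (om * eigenvalue (zeta 0)) *: v ->
  T (p 1) *m (S *m v) = (om * eigenvalue (zeta 1)) *: (S *m v) /\
  complex.Re (quad (S *m v) (H (p 1))) = complex.Re (quad v (H (p 0))) *
    expR (-4 * complex.Re (tau * (s * om * primitive (zeta 1) - s * om * primitive (zeta 0)))).
Proof.
move=> cs om3 m0 dp p1M hp hS hv.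
have zd (t : R) : 0 <= t <= 1 -> zeta t != 0 /\ cmod (zeta t) < 1.
  by move=> /hp[_ _ _]; exact: cube_disc.
apply: (transport_eigenline E_par E_det tau0 H_harm m0 (p := p) (p1 := p1)
  (lam := fun t => om * eigenvalue (zeta t)) (L := fun t => s * om * primitive (zeta t))
  _ dp p1M _ _ hS hv).
- move=> t ht; have [-> _ _ /andP[h1 h2]] := hp t ht.
  by apply: chart01_away; rewrite ?cmodX.
- move=> t ht; have [z0 z1] := zd t ht; have [ep e1 dz _] := hp t ht.
  have := cderM (cder_cst om t) (eigenvalue_cder dz z0 z1).
  rewrite mul0r add0r; set a := (X in cder _ t X -> _).
  suff -> : dlog_cubic (p t) / 3 * p1 t * (om * eigenvalue (zeta t)) = a by [].
  rewrite ep e1 /a -(chart01_dlog (zeta t ^+ 3) cs); ring.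
- move=> t ht; have [z0 z1] := zd t ht; have [ep e1 dz _] := hp t ht.
  have := cderM (cder_cst (s * om) t) (primitive_cder dz z0 z1).
  rewrite mul0r add0r e1; set a := (X in cder _ t X -> _).
  suff -> : om * eigenvalue (zeta t) * (s * (3 * zeta t ^+ 2 * d t)) = a by [].
  rewrite /a; ring.
Qed.

Lemma transport_radial c s om (a b : R) S v : chart01 c s -> om ^+ 3 = 1 ->
  0 < a < 1 -> 0 < b < 1 ->
  is_transport omega (segment (c + s * a%:C) (c + s * b%:C)) S ->
  T (c + s * a%:C) *m v = (om * eigenvalue (cbrt a)%:C) *: v ->
  T (c + s * b%:C) *m (S *m v) = (om * eigenvalue (cbrt b)%:C) *: (S *m v) /\
  complex.Re (quad (S *m v) (H (c + s * b%:C))) =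
    complex.Re (quad v (H (c + s * a%:C))) *
    expR (-4 * complex.Re (tau * (s * om * primitive (cbrt b)%:C - s * om * primitive (cbrt a)%:C))).
Proof.
move=> cs om3 ha hb hS; have [m m0 hp] := radial_path c s ha hb.
have h := transport_lift cs om3 m0 (segment_derive _ _) (fun=> lexx _) hp hS (v := v).
move: h; rewrite segment0 segment1 /radial mul0r addr0 mul1r.
by have -> : a + (b - a) = b by rewrite addrC subrK.
Qed.

Lemma transport_circle c s om (r : R) S v : chart01 c s -> om ^+ 3 = 1 ->
  0 < r < 1 -> is_transport omega (circle c (c + s * r%:C)) S ->
  T (c + s * r%:C) *m v = (om * eigenvalue (cbrt r)%:C) *: v ->
  T (c + s * r%:C) *m (S *m v) = (om * eps * eigenvalue (cbrt r)%:C) *: (S *m v) /\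
  complex.Re (quad (S *m v) (H (c + s * r%:C))) =
    complex.Re (quad v (H (c + s * r%:C))) *
    expR (-4 * complex.Re (tau * (s * om * (eps * primitive (cbrt r)%:C) - s * om * primitive (cbrt r)%:C))).
Proof.
move=> cs om3 hr hS; have [m m0 hp] := third_turn_path c s hr.
pose p1 t := s * (3 * third_turn r t ^+ 2 * third_speed r t).
have dp (t : R) : cder (circle c (c + s * r%:C)) t (p1 t) by have [] := hp t.
have pM (t : R) : cmod (p1 t) <= cmod s * (3 * cbrt r ^+ 3 * (2 * pi / 3)).
  by rewrite /p1; have [_ _ _ -> _] := hp t.
have h4 (t : R) : 0 <= t <= 1 -> [/\ circle c (c + s * r%:C) t = c + s * third_turn r t ^+ 3,
    p1 t = s * (3 * third_turn r t ^+ 2 * third_speed r t),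
    cder (third_turn r) t (third_speed r t) & m <= cmod (third_turn r t) ^+ 3 <= 1 - m].
  by move=> _; have [h1 _ h2 _ h3] := hp t.
have h := transport_lift cs om3 m0 dp pM h4 hS (v := v).
move: h; rewrite circle0 circle1 third_turn0 third_turn1 eigenvalue_rotation.
by rewrite primitive_rotation ?eps_cube ?(cbrt_disc hr).2 // [om * (eps * _)]mulrA.
Qed.

(** The eigenline of the branch [om] is transported to that of the branch [om * eps], and
    the period of the branch point [c] governs the change of norm. *)
Lemma transport_loop c s om (r : R) S v : chart01 c s -> om ^+ 3 = 1 ->
  0 < r < 1 -> is_transport_seq omega (loop c (c + s * r%:C)) S ->
  T (z0 R) *m v = (om * eigenvalue (cbrt (1 / 2))%:C) *: v ->
  T (z0 R) *m (S *m v) = (om * eps * eigenvalue (cbrt (1 / 2))%:C) *: (S *m v) /\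
  complex.Re (quad (S *m v) (H (z0 R))) = complex.Re (quad v (H (z0 R))) *
    expR (-2 * complex.Re (tau * (om * (s * period0)))).
Proof.
move=> cs om3 hr.
have e0 : z0 R = c + s * (1 / 2)%:C :> C.
  rewrite /z0 rmorphM rmorph1 mul1r fmorphV (rmorph_nat (real_complex R)).
  by case: cs => [[-> ->]|[-> ->]]; field.
have hh := half_in01 R; have ome : (om * eps) ^+ 3 = 1 by rewrite exprMn om3 eps_cube mul1r.
rewrite /loop e0 /= => -[S1 [_ [t1 [S2 [_ [t2 [S3 [_ [t3 -> ->]]] ->]]] ->]]] hv.
have [h1 q1] := transport_radial cs om3 hh hr t1 hv.
have [h2 q2] := transport_circle cs om3 hr t2 h1.
have [h3 q3] := transport_radial cs ome hr hh t3 h2.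
rewrite mul1mx -!mulmxA; split=> //.
rewrite q3 q2 q1 period0E primitive_half; exact: loop_exponent.
Qed.

End LoopTransport.

(** * The trace coordinates as sums of three terms *)

Section Monodromies.
Variable R : realType.
Local Notation C := R[i].

Lemma quad_scale n (k : C) (u : 'cV[C]_n) (M : 'M[C]_n) :
  complex.Re (quad (k *: u) M) = cmod k ^+ 2 * complex.Re (quad u M).
Proof.
rewrite /quad adjZ -!scalemxAl -scalemxAr scalerA mxE -cReMr.
by congr (complex.Re (_ * _)); rewrite mulrC cmod_sqr.
Qed.

Lemma quad_gt0 n (u : 'cV[C]_n) (M : 'M[C]_n) : posdef M -> u != 0 ->
  0 < complex.Re (quad u M).
Proof.
move=> pM u0; rewrite lt0r quad_ge0 // andbT; apply: contraNneq u0 => h.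
by apply/eqP/(quad_eq0 pM).
Qed.

(** The unknown ratio [q / q'] of the norms of two eigenvectors is the same for both
    monodromies and drops out of the quotient. *)
Lemma modulus_ratio (c d : C) (q q' a : R) : 0 < q -> 0 < q' ->
  cmod c ^+ 2 * q' = q * expR (-2 * a) -> cmod d ^+ 2 * q' = q * expR (2 * a) ->
  [/\ c != 0, d != 0 & cmod d = cmod c * expR (2 * a)].
Proof.
move=> q0 q0' hc hd.
have nz (z : C) b : cmod z ^+ 2 * q' = q * expR b -> z != 0.
  move=> h; apply: contraTneq (mulr_gt0 q0 (expR_gt0 b)) => e.
  by rewrite -h e cmod0 expr0n mul0r ltxx.
split; [exact: nz hc|exact: nz hd|].
apply/eqP; rewrite -(@eqrXn2 _ 2) ?mulr_ge0 ?cmod_ge0 ?expR_ge0 //; apply/eqP.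
apply: (mulIf (lt0r_neq0 q0')); rewrite hd exprMn mulrAC hc -mulrA -expRM_natl -expRD.
by congr (_ * expR _); ring.
Qed.

Variable E : higgs R.
Hypothesis E_par : strongly_parabolic E.
Hypothesis E_det : forall z : C, z != 0 -> z != 1 ->
  \det (Theta0 E z) = (z ^+ 2 * (z - 1) ^+ 2)^-1.
Variables (tau : C) (H : C -> 'M[C]_3).
Hypotheses (tau0 : tau != 0) (H_harm : harmonic_metric E tau H).

Lemma z0_punctured : punctured (z0 R).
Proof.
have n2 : 2 != 0 :> C by rewrite pnatr_eq0.
rewrite /punctured /z0 /=; split; first by rewrite invr_eq0.
apply/eqP => h; have : 2 = 1 :> C by rewrite -[LHS]invrK h invr1.
by move=> /eqP; rewrite -subr_eq0 -[X in X - _]natr1 addrK oner_eq0.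
Qed.

Lemma theta_trace0 : \tr (Theta0 E (z0 R)) = 0.
Proof. by have [_ _ _ h _] := E_par; rewrite /Theta0 mxtraceZ h mulr0. Qed.

Lemma base_eigenbasis : exists2 V, V \in unitmx &
  forall k, Theta0 E (z0 R) *m col k V =
    (eps ^+ k * eigenvalue (cbrt (1 / 2))%:C) *: col k V.
Proof.
have [l0 l1] := cbrt_disc (half_in01 R).
have l3 := eigenvalue_cube l0 l1.
have e : ((cbrt (1 / 2))%:C) ^+ 3 = z0 R :> C.
  rewrite -rmorphXn /= cbrt_cube ?divr_ge0 // /z0 mul1r fmorphV.
  by rewrite (rmorph_nat (real_complex R)).
rewrite e in l3; apply: cyclic_eigenbasis.
- by apply: contraTneq (cubic_neq0 z0_punctured) => h; rewrite -l3 h expr0n eqxx.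
- by rewrite l3 (higgs_cube E_par E_det tau0 H_harm z0_punctured).
- exact: theta_trace0.
- exact: (trace_square_eq0 E_par z0_punctured).
Qed.

(** The monodromies permute the three eigenlines of [theta] at the base point
    cyclically, and the metric fixes the moduli of their matrix entries. *)
Lemma trace_coordinates_sums r X Y Z : 0 < r < 1 ->
  trace_coordinates (conn_form E tau H) r X Y Z ->
  let a (k : 'I_3) := complex.Re (tau * (eps ^+ k * (period0 - period1))) in
  exists f g h : 'I_3 -> C,
    [/\ X = \sum_k f k /\ (forall k, cmod (f k) = expR (a k)),
        Y = \sum_k g k /\ (forall k, cmod (g k) = expR (- a k))
      & Z = \sum_k h k /\ (forall k, cmod (h k) = expR (a k - a (k + 1)))].
Proof.
move=> hr [A [B [[T0 t0 eA] [T1 t1 eB] eX eY eZ]]] a.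
have [V uV hV] := base_eigenbasis.
have [pH _] := metric_posdef H_harm z0_punctured.
set lam := eigenvalue _ in hV.
have l0 : lam != 0.
  have [l0 l1] := cbrt_disc (half_in01 R).
  by rewrite mulf_neq0 ?branch_neq0 // invr_eq0 expf_neq0.
have inj : injective (fun k : 'I_3 => eps ^+ k * lam).
  by move=> i j /(mulIf l0) /eps_pow_inj.
have v0 k : col k V != 0.
  apply: contraTneq uV => e; rewrite unitmxE unitfE negbK -det_tr.
  apply/det0P; exists (delta_mx 0 k); last first.
    by apply: trmx_inj; rewrite trmx_mul trmxK trmx_delta -colE e trmx0.
  by apply/eqP => /matrixP/(_ 0 k); rewrite !mxE !eqxx; apply/eqP; exact: oner_neq0.
have c0 : chart01 (0 : C) 1 by left.
have c1 : chart01 (1 : C) (-1) by right.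
have e0 : (0 : C) + 1 * r%:C = r%:C by rewrite add0r mul1r.
have e1 : (1 : C) + -1 * r%:C = 1 - r%:C by rewrite mulN1r.
rewrite -e0 in t0; rewrite -e1 in t1.
pose q k := complex.Re (quad (col k V) (H (z0 R))).
have q0 k : 0 < q k by exact: quad_gt0.
pose b k := complex.Re (tau * (eps ^+ k * period0)).
have shift c s (T : 'M[C]_3) (k : 'I_3) : chart01 c s ->
    is_transport_seq (conn_form E tau H) (loop c (c + s * r%:C)) T ->
    exists x, T *m col k V = x *: col (k + 1) V /\
      cmod x ^+ 2 * q (k + 1) = q k * expR (-2 * complex.Re (tau * (eps ^+ k * (s * period0)))).
  move=> cs hT.
  have [h1 h2] := transport_loop E_par E_det tau0 H_harm cs (eps_pow_cube R k) hr hT (hV k).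
  have [x ex] : exists x, T *m col k V = x *: col (k + 1) V.
    apply: (eigenline_1dim (f := fun k : 'I_3 => eps ^+ k * lam) uV inj hV).
    by rewrite h1 eps_shift [eps * _]mulrC.
  by exists x; split=> //; rewrite -h2 ex quad_scale.
have [c hc] := choice (fun k => shift 0 1 T0 k c0 t0).
have [d hd] := choice (fun k => shift 1 (-1) T1 k c1 t1).
have pp : period1 = - period0 :> C by rewrite period1E period0E.
(* the two branch points contribute opposite periods, so [period0 - period1] is twice
   the period of one of them *)
have ab k : a k = 2 * b k.
  rewrite /a /b pp opprK.
  have dbl (z : C) : 2 * complex.Re z = complex.Re (z + z) by case: z => x y /=; ring.
  by rewrite dbl -!mulrDr.
have ratio k : [/\ c k != 0, d k != 0 & cmod (d k) = cmod (c k) * expR (a k)].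
  rewrite ab; apply: (modulus_ratio (q0 k) (q0 (k + 1))).
    by rewrite (hc k).2 mul1r.
  rewrite (hd k).2; congr (_ * expR _).
  by rewrite mulN1r !mulrN /b; case: (tau * _) => x y /=; ring.
have cn k : c k != 0 by have [] := ratio k.
have dn k : d k != 0 by have [] := ratio k.
have rt k : cmod (d k) = cmod (c k) * expR (a k) by have [] := ratio k.
have cp k : cmod (c k) != 0 by rewrite cmod_eq0.
have ep x : expR x != 0 :> R by rewrite gt_eqF // expR_gt0.
have hc1 k : T0 *m col k V = c k *: col (k + 1) V by exact: (hc k).1.
have hd1 k : T1 *m col k V = d k *: col (k + 1) V by exact: (hd k).1.
exists (fun k => d k / c k), (fun k => c k / d k),
  (fun k => d k * c (k + 1) / d (k + 1) / c k); split; split.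
- by rewrite eX eA eB; exact: (trace_X uV hc1 hd1 cn).
- by move=> k; rewrite cmodM cmodV rt mulrC mulKf.
- by rewrite eY eA eB; exact: (trace_Y uV hc1 hd1 dn).
- by move=> k; rewrite cmodM cmodV rt invfM mulrA mulfV // mul1r expRN.
- by rewrite eZ eA eB; exact: (trace_Z uV hc1 hd1 cn dn).
- move=> k; rewrite !cmodM !cmodV !rt expRD expRN.
  move: (cp k) (cp (k + 1)) (ep (a k)) (ep (a (k + 1))).
  move: (cmod _) (cmod _) (expR _) (expR _) => x y z w x0 y0 z0 w0.
  by field; rewrite x0 y0 w0.
Qed.

End Monodromies.

(** * Sums dominated by one term *)
Section Asymptotics.
Variable R : realType.
Local Notation C := R[i].

Lemma dominant_bound (z0 z1 z2 : C) (s a0 a1 a2 e : R) : 0 <= s ->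
  cmod z0 = expR (s * a0) -> cmod z1 = expR (s * a1) -> cmod z2 = expR (s * a2) ->
  a1 <= a0 - e -> a2 <= a0 - e ->
  `|cmod (z0 + z1 + z2) / expR (s * a0) - 1| <= 2 * expR (- e * s).
Proof.
move=> s0 h0 h1 h2 g1 g2; have p := expR_gt0 (s * a0).
have small b : b <= a0 - e -> expR (s * b) <= expR (s * a0) * expR (- e * s).
  move=> hb; rewrite -expRD ler_expR.
  have -> : s * a0 + - e * s = s * (a0 - e) by ring.
  exact: ler_wpM2l.
have k1 := small _ g1; have k2 := small _ g2; rewrite -h1 in k1; rewrite -h2 in k2.
have -> : cmod (z0 + z1 + z2) / expR (s * a0) - 1 =
    (cmod (z0 + z1 + z2) - cmod z0) / expR (s * a0).
  by rewrite mulrBl h0 mulfV // gt_eqF.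
rewrite normrM [`|_^-1|]ger0_norm ?invr_ge0 ?expR_ge0 // ler_pdivrMr //.
have u1 : cmod (z0 + z1 + z2) <= cmod z0 + cmod z1 + cmod z2.
  by apply: le_trans (cmodD _ _) _; rewrite lerD2r; exact: cmodD.
have u2 : cmod z0 <= cmod (z0 + z1 + z2) + cmod z1 + cmod z2.
  have h3 := cmodD (z0 + z1 + z2) (- z1); have h4 := cmodD (z0 + z1 + z2 - z1) (- z2).
  have e0 : z0 + z1 + z2 - z1 - z2 = z0 by ring.
  by rewrite e0 in h4; move: h3 h4; rewrite !cmodN; lra.
move: (expR (- e * s)) k1 k2 => y k1 k2.
rewrite ler_norml; move: u1 u2 k1 k2.
move: (cmod (z0 + z1 + z2)) (cmod z0) (cmod z1) (cmod z2) (expR _) => A B D F G.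
by clear => u1 u2 k1 k2; apply/andP; split; lra.
Qed.

(** A sum of three exponentially growing terms has the size of the one that grows
    fastest. *)
Lemma dominant_asymp (F : R -> C) (f : R -> 'I_3 -> C) (a : 'I_3 -> R) (j : 'I_3) :
  (forall t : R, 0 < t -> F t = \sum_k f t k) ->
  (forall (t : R) k, 0 < t -> cmod (f t k) = expR (t `^ (1 / 3) * a k)) ->
  a (j + 1) < a j -> a (j + 1 + 1) < a j ->
  exp_approx (fun t => cmod (F t)) (fun t => expR (t `^ (1 / 3) * a j)).
Proof.
move=> hF hf g1 g2; pose e := Num.min (a j - a (j + 1)) (a j - a (j + 1 + 1)).
exists e, 2; split; first by rewrite lt_min !subr_gt0 g1.
near=> t; have t0 : 0 < t by near: t; exact: nbhs_pinfty_gt.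
have -> : F t = f t j + f t (j + 1) + f t (j + 1 + 1).
  rewrite hF // !big_ord_recl big_ord0 /= addr0.
  have e0 : ord0 = 0 :> 'I_3 by apply: val_inj.
  have e1 : lift ord0 ord0 = 1 :> 'I_3 by apply: val_inj.
  have e2 : lift ord0 (lift ord0 ord0) = 1 + 1 :> 'I_3 by apply: val_inj.
  rewrite e0 e1 e2; case: j {g1 g2 e} => [[|[|[|//]]] i].
  - have -> : Ordinal i = 0 by apply: val_inj.
    by rewrite add0r addrA.
  - have -> : Ordinal i = 1 by apply: val_inj.
    have -> : 1 + 1 + 1 = 0 :> 'I_3 by apply: val_inj.
    by rewrite [LHS]addrC.
  - have -> : Ordinal i = 1 + 1 by apply: val_inj.
    have -> : 1 + 1 + 1 = 0 :> 'I_3 by apply: val_inj.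
    have -> : 0 + 1 = 1 :> 'I_3 by apply: val_inj.
    by rewrite addrA addrC addrA.
apply: (dominant_bound (powR_ge0 _ _) (hf t j t0) (hf t _ t0) (hf t _ t0)).
  have : e <= a j - a (j + 1) by rewrite ge_min lexx.
  by move: e (a j) (a (j + 1)) => x y z; clear; lra.
have : e <= a j - a (j + 1 + 1) by rewrite ge_min lexx orbT.
by move: e (a j) (a (j + 1 + 1)) => x y z; clear; lra.
Unshelve. all: by end_near. Qed.

End Asymptotics.

(** * Sectors *)

Section Sectors.
Variable R : realType.
Local Notation C := R[i].
Local Notation s3 := (Num.sqrt 3 : R).

(** The signed distance of [a + u / sqrt 3 * 'i] from the line of argument
    [pi k / 6], up to a positive factor that makes it rational. *)
Definition side (k : nat) (a u : R) : R :=
  nth 0 [:: - u; a - u; 3 * a - u; a; 3 * a + u; a + u; u; u - a; u - 3 * a; - a;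
            - (3 * a) - u; - a - u; - u] k.

Lemma cis_quarter k : cis (pi * (k + 3)%:R / 6) = 'i%C * cis (pi * k%:R / 6) :> C.
Proof.
rewrite natrD; have -> : pi * (k%:R + 3) / 6 = pi / 2 + pi * k%:R / 6 :> R by field.
rewrite cisD; congr (_ * _); by rewrite /cis cos_pihalf sin_pihalf.
Qed.

Lemma cis_sixths : [/\ cis (pi * 0%:R / 6) = 1 :> C,
  cis (pi * 1%:R / 6) = (s3 / 2) +i* (1 / 2) :> C &
  cis (pi * 2%:R / 6) = (1 / 2) +i* (s3 / 2) :> C].
Proof.
split.
- by rewrite mulr0 mul0r cis0.
- by rewrite mulr1 cis_pi6.
have -> : pi * 2%:R / 6 = 2%:R * (pi / 6) :> R by field.
have e := sqrt3_sq R; rewrite -cisX cis_pi6.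
by apply: complex_eqP => /=; [move: e; rewrite !expr2; nra|field].
Qed.

Lemma sideE k (x : C) : (k <= 12)%N -> exists2 p, 0 < p &
  side k (complex.Re x) (s3 * complex.Im x) =
  p * complex.Im (cis (pi * k%:R / 6) * x^*%C).
Proof.
have := cis_sixths; have := sqrt3_gt0 R; have := sqrt3_sq R; move: (Num.sqrt 3) => s.
rewrite expr2 => q s0 [h0 h1 h2].
have st k' (w : C) : cis (pi * k'%:R / 6) = w -> cis (pi * (k' + 3)%:R / 6) = 'i%C * w.
  by move=> <-; exact: cis_quarter.
have h3 := st 0%N _ h0; have h4 := st 1%N _ h1; have h5 := st 2%N _ h2.
have h6 := st 3%N _ h3; have h7 := st 4%N _ h4; have h8 := st 5%N _ h5.
have h9 := st 6%N _ h6; have h10 := st 7%N _ h7; have h11 := st 8%N _ h8.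
have h12 := st 9%N _ h9; have s2 : 0 < 2 * s by rewrite mulr_gt0.
case: x => a b; move: k; do 13 ?[case=> [_|]]; last by [].
- by exists s; rewrite // h0 /side /=; ring.
- by exists 2; rewrite // h1 /side /=; field.
- by exists (2 * s); rewrite // h2 /side /= -q; field.
- by exists 1; rewrite // h3 /side /=; ring.
- by exists (2 * s); rewrite // h4 /side /= -q; field.
- by exists 2; rewrite // h5 /side /=; field.
- by exists s; rewrite // h6 /side /=; ring.
- by exists 2; rewrite // h7 /side /=; field.
- by exists (2 * s); rewrite // h8 /side /= -q; field.
- by exists 1; rewrite // h9 /side /=; ring.
- by exists (2 * s); rewrite // h10 /side /= -q; field.
- by exists 2; rewrite // h11 /side /=; field.
- by exists s; rewrite // h12 /side /=; ring.
Qed.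

Lemma sector_side k (x : C) : (k < 12)%N -> sector k.+1 x ->
  side k (complex.Re x) (s3 * complex.Im x) < 0 <
  side k.+1 (complex.Re x) (s3 * complex.Im x).
Proof.
move=> hk [rho [th [r0 /andP[t1 t2] ->]]]; have p0 := pi_gt0 R.
have e m : complex.Im (cis (pi * m%:R / 6) * (rho%:C * cis th)^*%C) =
    rho * sin (pi * m%:R / 6 - th).
  by rewrite sinB /cis /=; ring.
have [p pp ->] := @sideE k (rho%:C * cis th) (ltnW hk).
have [p' pp' ->] := @sideE k.+1 (rho%:C * cis th) hk.
have hn : k.+1%:R = k%:R + 1 :> R by rewrite natr1.
have w : pi * (k%:R + 1) / 6 = pi * k%:R / 6 + pi / 6 :> R by field.
move: t1 t2; rewrite !e hn addrK w; move: (pi * k%:R / 6) => al t1 t2.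
apply/andP; split.
  rewrite pmulr_rlt0 // pmulr_rlt0 // -oppr_gt0 -sinN opprB.
  by apply: sin_gt0_pi; apply/andP; split; move: t1 t2 p0; clear; lra.
rewrite !mulr_gt0 //; apply: sin_gt0_pi; apply/andP; split; move: t1 t2 p0; clear; lra.
Qed.

Lemma period_difference :
  period0 - period1 = (4 * s3 * half_period R)%:C * cis (5 * pi / 6) :> C.
Proof.
rewrite period0E period1E eps_sub1 !rmorphM /= (rmorph_nat (real_complex R)).
ring.
Qed.

(** [period0 - period1] has argument [5 pi / 6], so [phi] in the [k]-th quarter turn puts
    [x] in the sector [k + 6]. *)
Lemma generic_sector (phi : R) : 0 <= phi <= 2 * pi ->
  ~ (exists k : int, phi = k%:~R * (pi / 2)) ->
  in_sectors (iota 1 12) (cis (phi / 3) * (period0 - period1)).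
Proof.
move=> /andP[p0 p1] gen; have pi0 := pi_gt0 R.
have hs := sqrt3_gt0 R; have hh := half_period_gt0 R.
pose rho := 4 * s3 * half_period R.
have r0 : 0 < rho by rewrite !mulr_gt0.
have ne (k : nat) : phi != k%:R * (pi / 2).
  by apply/eqP => e; apply: gen; exists k; rewrite -pmulrn.
have key (k : nat) : (k < 4)%N -> k%:R * (pi / 2) < phi < k.+1%:R * (pi / 2) ->
    in_sectors (iota 1 12) (cis (phi / 3) * (period0 - period1)).
  move=> k4 /andP[l u]; exists (k + 6)%N; first by rewrite mem_iota; case: k k4 l u => [|[|[|[|]]]].
  exists rho, (phi / 3 + 5 * pi / 6); split=> //.
    have hn : k.+1%:R = k%:R + 1 :> R by rewrite natr1.
    move: l u; rewrite natrD hn; move: (k%:R : R) => x l u; apply/andP; split.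
      have -> : pi * (x + 6 - 1) / 6 = x * (pi / 2) / 3 + 5 * pi / 6 by field.
      by move: l; clear; lra.
    have -> : pi * (x + 6) / 6 = (x + 1) * (pi / 2) / 3 + 5 * pi / 6 by field.
    by move: u; clear; lra.
  by rewrite period_difference cisD mulrCA.
have n0 := ne 0; have n1 := ne 1; have n2 := ne 2%N; have n3 := ne 3%N; have n4 := ne 4%N.
have [c1|c1|c1] := ltgtP phi (1%:R * (pi / 2)); last by move: n1; rewrite c1 eqxx.
  by apply: (key 0%N) => //; rewrite c1 andbT lt_neqAle eq_sym n0 mul0r.
have [c2|c2|c2] := ltgtP phi (2%:R * (pi / 2)); last by move: n2; rewrite c2 eqxx.
  by apply: (key 1%N) => //; rewrite c1.
have [c3|c3|c3] := ltgtP phi (3%:R * (pi / 2)); last by move: n3; rewrite c3 eqxx.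
  by apply: (key 2%N) => //; rewrite c2.
apply: (key 3%N) => //; rewrite c3 /= lt_neqAle n4 /=.
by move: p1; clear; lra.
Qed.

Lemma Re_eps (x : C) : [/\ complex.Re (eps ^+ 0 * x) = complex.Re x,
  complex.Re (eps * x) = - (complex.Re x / 2) - s3 * complex.Im x / 2 &
  complex.Re (eps ^+ 2 * x) = - (complex.Re x / 2) + s3 * complex.Im x / 2].
Proof.
have -> : eps ^+ 2 = - 1 - eps :> C.
  by apply/eqP; rewrite -subr_eq0 -(eps_sum R); apply/eqP; ring.
by rewrite expr0 epsE; case: x => a b /=; split; field.
Qed.

Lemma in_sectors4 (P : R -> R -> Prop) i j k l (x : C) :
  all (fun j => (0 < j <= 12)%N) [:: i; j; k; l] ->
  (forall n, n \in [:: i; j; k; l] ->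
    forall a u, side n.-1 a u < 0 -> 0 < side n a u -> P a u) ->
  in_sectors [:: i; j; k; l] x -> P (complex.Re x) (s3 * complex.Im x).
Proof.
move=> /allP bd h [[|n] hn sn]; first by have := bd _ hn.
by have /andP[s1 s2] := sector_side (bd _ hn : (n < 12)%N) sn; exact: (h _ hn).
Qed.

(** The growth rates of the three terms of each trace.  In a fixed sector their order is
    a consequence of the two linear inequalities that bound the sector. *)
Local Notation r0 x := (complex.Re x).
Local Notation r1 x := (complex.Re (eps * x)).
Local Notation r2 x := (complex.Re (eps ^+ 2 * x)).

Lemma order_X (x : C) :
  [/\ in_sectors [:: 11; 12; 1; 2]%N x -> r1 x < r0 x /\ r2 x < r0 x,
      in_sectors [:: 3; 4; 5; 6]%N x -> r0 x < r2 x /\ r1 x < r2 x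
    & in_sectors [:: 7; 8; 9; 10]%N x -> r2 x < r1 x /\ r0 x < r1 x].
Proof.
have [_ e1 e2] := Re_eps x; rewrite e1 e2; split.
- apply: (@in_sectors4 (fun a u => - (a / 2) - u / 2 < a /\ - (a / 2) + u / 2 < a)) => //.
  by move=> n; rewrite !inE => /or4P[]/eqP-> a u; rewrite /side /=; clear; lra.
- apply: (@in_sectors4 (fun a u => a < - (a / 2) + u / 2 /\
    - (a / 2) - u / 2 < - (a / 2) + u / 2)) => //.
  by move=> n; rewrite !inE => /or4P[]/eqP-> a u; rewrite /side /=; clear; lra.
- apply: (@in_sectors4 (fun a u => - (a / 2) + u / 2 < - (a / 2) - u / 2 /\
    a < - (a / 2) - u / 2)) => //.
  by move=> n; rewrite !inE => /or4P[]/eqP-> a u; rewrite /side /=; clear; lra.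
Qed.

Lemma order_Y (x : C) :
  [/\ in_sectors [:: 1; 2; 3; 4]%N x -> r1 x < r2 x /\ r1 x < r0 x,
      in_sectors [:: 5; 6; 7; 8]%N x -> r0 x < r1 x /\ r0 x < r2 x
    & in_sectors [:: 9; 10; 11; 12]%N x -> r2 x < r0 x /\ r2 x < r1 x].
Proof.
have [_ e1 e2] := Re_eps x; rewrite e1 e2; split.
- apply: (@in_sectors4 (fun a u => - (a / 2) - u / 2 < - (a / 2) + u / 2 /\
    - (a / 2) - u / 2 < a)) => //.
  by move=> n; rewrite !inE => /or4P[]/eqP-> a u; rewrite /side /=; clear; lra.
- apply: (@in_sectors4 (fun a u => a < - (a / 2) - u / 2 /\ a < - (a / 2) + u / 2)) => //.
  by move=> n; rewrite !inE => /or4P[]/eqP-> a u; rewrite /side /=; clear; lra.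
- apply: (@in_sectors4 (fun a u => - (a / 2) + u / 2 < a /\
    - (a / 2) + u / 2 < - (a / 2) - u / 2)) => //.
  by move=> n; rewrite !inE => /or4P[]/eqP-> a u; rewrite /side /=; clear; lra.
Qed.

Lemma order_Z (x : C) :
  [/\ in_sectors [:: 12; 1; 2; 3]%N x ->
        r1 x - r2 x < r0 x - r1 x /\ r2 x - r0 x < r0 x - r1 x,
      in_sectors [:: 4; 5; 6; 7]%N x ->
        r0 x - r1 x < r2 x - r0 x /\ r1 x - r2 x < r2 x - r0 x
    & in_sectors [:: 8; 9; 10; 11]%N x ->
        r2 x - r0 x < r1 x - r2 x /\ r0 x - r1 x < r1 x - r2 x].
Proof.
have [_ e1 e2] := Re_eps x; rewrite e1 e2; split.
- apply: (@in_sectors4 (fun a u =>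
    - (a / 2) - u / 2 - (- (a / 2) + u / 2) < a - (- (a / 2) - u / 2) /\
    - (a / 2) + u / 2 - a < a - (- (a / 2) - u / 2))) => //.
  by move=> n; rewrite !inE => /or4P[]/eqP-> a u; rewrite /side /=; clear; lra.
- apply: (@in_sectors4 (fun a u =>
    a - (- (a / 2) - u / 2) < - (a / 2) + u / 2 - a /\
    - (a / 2) - u / 2 - (- (a / 2) + u / 2) < - (a / 2) + u / 2 - a)) => //.
  by move=> n; rewrite !inE => /or4P[]/eqP-> a u; rewrite /side /=; clear; lra.
- apply: (@in_sectors4 (fun a u =>
    - (a / 2) + u / 2 - a < - (a / 2) - u / 2 - (- (a / 2) + u / 2) /\
    a - (- (a / 2) - u / 2) < - (a / 2) - u / 2 - (- (a / 2) + u / 2))) => //.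
  by move=> n; rewrite !inE => /or4P[]/eqP-> a u; rewrite /side /=; clear; lra.
Qed.

End Sectors.

(** * Asymptotics of the trace coordinates *)

Theorem proposition6p11 (R : realType) (E : higgs R)
    (E_par : strongly_parabolic E)
    (E_stable : parabolic_stable E)
    (E_det : forall z : R[i], z != 0 -> z != 1 ->
       \det (Theta0 E z) = (z ^+ 2 * (z - 1) ^+ 2)^-1)
    (phi : R) (phi_range : 0 <= phi <= 2 * pi)
    (phi_gen : ~ exists k : int, phi = k%:~R * (pi / 2))
    (H : R -> R[i] -> 'M[R[i]]_3)
    (H_harm : forall t, 0 < t -> harmonic_metric E (tau_of phi t) (H t))
    (r : R) (r_small : 0 < r < 1 / 2)
    (X Y Z : R -> R[i])
    (XYZ : forall t, 0 < t ->
       trace_coordinates (conn_form E (tau_of phi t) (H t)) r (X t) (Y t) (Z t)) :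
  let x : R[i] := cis (phi / 3) * (period0 - period1) in
  let a : R := complex.Re x in
  let b : R := complex.Im x in
  let s3 : R := Num.sqrt 3 in
  [/\ in_sectors (iota 1 12) x,
      [/\ in_sectors [:: 11; 12; 1; 2]%N x -> mod_asymp X x a,
          in_sectors [:: 3; 4; 5; 6]%N x ->
            mod_asymp X (eps ^+ 2 * x) (- (1 / 2) * a + s3 / 2 * b)
        & in_sectors [:: 7; 8; 9; 10]%N x ->
            mod_asymp X (eps * x) (- (1 / 2) * a - s3 / 2 * b)],
      [/\ in_sectors [:: 1; 2; 3; 4]%N x ->
            mod_asymp Y (- eps * x) (1 / 2 * a + s3 / 2 * b),
          in_sectors [:: 5; 6; 7; 8]%N x -> mod_asymp Y (- x) (- a)
        & in_sectors [:: 9; 10; 11; 12]%N x ->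
            mod_asymp Y (- eps ^+ 2 * x) (1 / 2 * a - s3 / 2 * b)]
    & [/\ in_sectors [:: 12; 1; 2; 3]%N x ->
            mod_asymp Z ((1 - eps) * x) (3 / 2 * a + s3 / 2 * b),
          in_sectors [:: 4; 5; 6; 7]%N x ->
            mod_asymp Z ((1 - eps) * eps ^+ 2 * x) (- (3 / 2) * a + s3 / 2 * b)
        & in_sectors [:: 8; 9; 10; 11]%N x ->
            mod_asymp Z ((1 - eps) * eps * x) (- s3 * b)]].
Proof.
move=> x a b s3.
have cis0' : cis (phi / 3) != 0 :> R[i] by exact: cis_neq0.
have hr : 0 < r < 1 by move: r_small; clear; move=> /andP[h0 h1]; apply/andP; split; lra.
pose A (k : 'I_3) := complex.Re (eps ^+ k * x).
(* the terms exist for [t > 0]; the default values elsewhere make them functions of [t] *)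
have sums t : exists p : ('I_3 -> R[i]) * ('I_3 -> R[i]) * ('I_3 -> R[i]), 0 < t ->
    [/\ X t = \sum_k p.1.1 k /\ (forall k, cmod (p.1.1 k) = expR (t `^ (1 / 3) * A k)),
        Y t = \sum_k p.1.2 k /\ (forall k, cmod (p.1.2 k) = expR (t `^ (1 / 3) * - A k))
      & Z t = \sum_k p.2 k /\
          (forall k, cmod (p.2 k) = expR (t `^ (1 / 3) * (A k - A (k + 1))))].
  have [t0|t0] := ltP 0 t; last by exists (fun=> 0, fun=> 0, fun=> 0).
  have tau0 : tau_of phi t != 0.
    by rewrite mulf_neq0 // (inj_eq (@complexI R)) gt_eqF // powR_gt0.
  have [f [g [h [[eX mX] [eY mY] [eZ mZ]]]]] :=
    trace_coordinates_sums E_par E_det tau0 (H_harm t t0) hr (XYZ t t0).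
  have eA (k : 'I_3) : complex.Re (tau_of phi t * (eps ^+ k * (period0 - period1))) =
      t `^ (1 / 3) * A k.
    by rewrite /A /x -cReMr /tau_of; congr complex.Re; ring.
  exists (f, g, h) => _; split; split=> //= k; first by rewrite mX eA.
    by rewrite mY eA mulrN.
  by rewrite mZ !eA mulrBr.
have [p hp] := choice sums.
have asX (j : 'I_3) : A (j + 1) < A j -> A (j + 1 + 1) < A j ->
    exp_approx (fun t => cmod (X t)) (fun t => expR (t `^ (1 / 3) * A j)).
  apply: (dominant_asymp (f := fun t => (p t).1.1)) => t; first by move=> /hp[[]].
  by move=> k /hp[[_ h] _ _]; exact: h.
have asY (j : 'I_3) : - A (j + 1) < - A j -> - A (j + 1 + 1) < - A j ->
    exp_approx (fun t => cmod (Y t)) (fun t => expR (t `^ (1 / 3) * - A j)).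
  apply: (dominant_asymp (f := fun t => (p t).1.2) (a := fun k => - A k)) => t.
    by move=> /hp[_ []].
  by move=> k /hp[_ [_ h] _]; exact: h.
have asZ (j : 'I_3) : A (j + 1) - A (j + 1 + 1) < A j - A (j + 1) ->
    A (j + 1 + 1) - A (j + 1 + 1 + 1) < A j - A (j + 1) ->
    exp_approx (fun t => cmod (Z t)) (fun t => expR (t `^ (1 / 3) * (A j - A (j + 1)))).
  apply: (dominant_asymp (f := fun t => (p t).2) (a := fun k => A k - A (k + 1))) => t.
    by move=> /hp[_ _ []].
  by move=> k /hp[_ _ [_ h]]; exact: h.
have [eA0 eA1 eA2] := Re_eps x.
have A0 : A 0 = complex.Re x by exact: eA0.
have A1 : A 1 = complex.Re (eps * x) by [].
have A2 : A (1 + 1) = complex.Re (eps ^+ 2 * x) by [].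
have c10 : 0 + 1 = 1 :> 'I_3 by exact: add0r.
have c20 : 1 + 1 + 1 = 0 :> 'I_3 by apply: val_inj.
have neg (z : R[i]) : complex.Re (- z) = - complex.Re z by case: z.
have sub (z w : R[i]) : complex.Re (z - w) = complex.Re z - complex.Re w.
  by case: z => ? ?; case: w.
have [X0 X2 X1] := order_X x; have [Y1 Y0 Y2] := order_Y x.
have [Z0 Z2 Z1] := order_Z x.
have nY0 : complex.Re (- x) = - complex.Re x by exact: neg.
have nY1 : complex.Re (- eps * x) = - complex.Re (eps * x) by rewrite mulNr neg.
have nY2 : complex.Re (- eps ^+ 2 * x) = - complex.Re (eps ^+ 2 * x) by rewrite mulNr neg.
have nZ0 : complex.Re ((1 - eps) * x) = complex.Re x - complex.Re (eps * x).
  by rewrite mulrBl mul1r sub.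
have nZ1 : complex.Re ((1 - eps) * eps * x) = complex.Re (eps * x) - complex.Re (eps ^+ 2 * x).
  by rewrite mulrBl mul1r -expr2 mulrBl sub.
have nZ2 : complex.Re ((1 - eps) * eps ^+ 2 * x) = complex.Re (eps ^+ 2 * x) - complex.Re x.
  by rewrite mulrBl mul1r -exprS eps_cube mulrBl mul1r sub.
have vX1 : complex.Re (eps * x) = - (1 / 2) * a - s3 / 2 * b
  by rewrite eA1 -/a -/b -/s3; move: (a) (b) (s3) => a' b' s'; field.
have vX2 : complex.Re (eps ^+ 2 * x) = - (1 / 2) * a + s3 / 2 * b
  by rewrite eA2 -/a -/b -/s3; move: (a) (b) (s3) => a' b' s'; field.
have aX0 := asX 0; have aX1 := asX 1; have aX2 := asX (1 + 1).
have aY0 := asY 0; have aY1 := asY 1; have aY2 := asY (1 + 1).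
have aZ0 := asZ 0; have aZ1 := asZ 1; have aZ2 := asZ (1 + 1).
move: aX0 aX1 aX2 aY0 aY1 aY2 aZ0 aZ1 aZ2.
rewrite !(c10, c20, A0, A1, A2) !ltrN2 => aX0 aX1 aX2 aY0 aY1 aY2 aZ0 aZ1 aZ2.
split; first exact: generic_sector.
- split.
  + by move=> /X0[h1 h2]; split=> //; exact: aX0.
  + by move=> /X2[h1 h2]; split=> //; exact: aX2.
  + by move=> /X1[h1 h2]; split=> //; exact: aX1.
- split.
  + move=> /Y1[h1 h2]; split; first by rewrite nY1; exact: aY1.
    by rewrite nY1 vX1; move: (a) (b) (s3) => a' b' s'; ring.
  + by move=> /Y0[h1 h2]; split; rewrite nY0 //; exact: aY0.
  + move=> /Y2[h1 h2]; split; first by rewrite nY2; exact: aY2.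
    by rewrite nY2 vX2; move: (a) (b) (s3) => a' b' s'; ring.
- split.
  + move=> /Z0[h1 h2]; split; first by rewrite nZ0; exact: aZ0.
    by rewrite nZ0 vX1 -/a; move: (a) (b) (s3) => a' b' s'; field.
  + move=> /Z2[h1 h2]; split; first by rewrite nZ2; exact: aZ2.
    by rewrite nZ2 vX2 -/a; move: (a) (b) (s3) => a' b' s'; field.
  + move=> /Z1[h1 h2]; split; first by rewrite nZ1; exact: aZ1.
    by rewrite nZ1 vX1 vX2; move: (a) (b) (s3) => a' b' s'; field.
Qed.
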